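(* Let $\phi$ be a subharmonic, non-harmonic function on $\mathbb{C}$ such that $\mu=\Delta\phi$ is a doubling measure. Let $g$ be an entire function such that $\bar g\,k_\lambda\in L^2(e^{-2\phi})$ for every $\lambda\in\mathbb{C}$. Then the Hankel operator $H_{\bar g}$ (densely defined on $\operatorname{Span}\{k_\lambda:\lambda\in\mathbb{C}\}$) extends to a bounded linear operator on $\mathcal{F}^2_\phi$ if and only if the function $|g'|\rho$ is bounded on $\mathbb{C}$.
   Context: A nonnegative Borel measure $\mu$ on $\mathbb{C}$ is doubling if there is $C>0$ with $\mu(D(z,2r))\le C\mu(D(z,r))$ for all $z\in\mathbb{C}$, $r>0$. For $z\in\mathbb{C}$, $\rho(z)>0$ denotes the radius such that $\mu(D(z,\rho(z)))=1$, where $\mu=\Delta\phi$. $dm$ is Lebesgue measure on $\mathbb{C}$. $L^2(e^{-2\phi})$ is the space of measurable $f$ with $\int_{\mathbb{C}}|f|^2e^{-2\phi}\,dm<\infty$, and the generalized Fock space is $\mathcal{F}^2_\phi=\{f \text{ entire}: \int_{\mathbb{C}}|f|^2e^{-2\phi}\,dm<\infty\}$, a closed subspace of $L^2(e^{-2\phi})$; $P$ is the orthogonal projection of $L^2(e^{-2\phi})$ onto $\mathcal{F}^2_\phi$. $K(z,\lambda)$ is the reproducing (Bergman) kernel of $\mathcal{F}^2_\phi$ and $k_\lambda(z)=K(z,\lambda)/K(\lambda,\lambda)^{1/2}$ is the normalized reproducing kernel. For $f\in\operatorname{Span}\{k_\lambda\}$ (a dense subspace of $\mathcal{F}^2_\phi$)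 the big Hankel operator with symbol $\bar g$ is $H_{\bar g}f=(I-P)(\bar g f)$. *)

(* Defs.v *)
From HB Require Import structures.
From mathcomp Require Import all_boot all_order all_algebra.
From mathcomp Require Import all_classical all_reals all_analysis.
From mathcomp Require Export complex.
Import Order.TTheory GRing.Theory Num.Theory.
Import numFieldNormedType.Exports.

Set Implicit Arguments.
Unset Strict Implicit.
Unset Printing Implicit Defensive.

Local Open Scope ring_scope.
Local Open Scope classical_set_scope.

Section Defs.
Context {R : realType}.
Local Notation C := R[i].

Definition toC (p : R * R) : C := (p.1 +i* p.2)%C.

Definition cabs (z : C) : R := Num.sqrt (complex.Re z ^+ 2 + complex.Im z ^+ 2).

Definition leb2 := ((@lebesgue_measure R) \x (@lebesgue_measure R))%E.

Definition disc (z : C) (r : R) : set (R * R) := [set p | cabs (toC p - z) < r].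

Definition doubling (mu : {measure set (R * R) -> \bar R}) :=
  exists c : R, 0 < c /\
    forall (z : C) (r : R), 0 < r -> (mu (disc z (2 * r)) <= c%:E * mu (disc z r))%E.

Definition upper_semicontinuous (phi : C -> R) :=
  forall (z : C) (eps : R), 0 < eps -> exists delta : R, 0 < delta /\
    forall w : C, cabs (w - z) < delta -> phi w < phi z + eps.

Definition subharmonic (phi : C -> R) :=
  upper_semicontinuous phi /\
  forall (z : C) (r : R), 0 < r ->
    ((2 * pi * phi z)%:E <=
     \int[@lebesgue_measure R]_(t in `[0%R, (2 * pi)%R]%classic)
        (phi (z + (r%:C)%C * (cos t +i* sin t)%C))%:E)%E.

Definition e1 : R * R := (1, 0).
Definition e2 : R * R := (0, 1).
Definition pd (v : R * R) (f : R * R -> R) : R * R -> R := fun p => 'D_v f p.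

Definition C2 (f : R * R -> R) :=
  [/\ (forall p, differentiable f p),
      (forall p, differentiable (pd e1 f) p),
      (forall p, differentiable (pd e2 f) p),
      continuous (pd e1 (pd e1 f)) /\ continuous (pd e2 (pd e1 f)) &
      continuous (pd e1 (pd e2 f)) /\ continuous (pd e2 (pd e2 f))].

Definition lap (f : R * R -> R) : R * R -> R :=
  fun p => pd e1 (pd e1 f) p + pd e2 (pd e2 f) p.

Definition is_harmonic (phi : C -> R) :=
  C2 (phi \o toC) /\ forall p, lap (phi \o toC) p = 0.

Definition test_fun (psi : R * R -> R) :=
  C2 psi /\ exists M : R, forall p : R * R, M < `|p| -> psi p = 0.

(** mu = Delta phi (in the sense of distributions), mu a Radon measure. *)
Definition riesz_measure (phi : C -> R) (mu : {measure set (R * R) -> \bar R}) :=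
  (forall (z : C) (r : R), (mu (disc z r) < +oo)%E) /\
  forall psi, test_fun psi ->
    Rintegral leb2 setT (fun p => phi (toC p) * lap psi p) = Rintegral mu setT psi.

Definition has_cderiv (f : C -> C) (z d : C) :=
  forall eps : R, 0 < eps -> exists delta : R, 0 < delta /\
    forall h : C, 0 < cabs h < delta -> cabs ((f (z + h) - f z) / h - d) <= eps.

Definition entire (f : C -> C) := forall z, exists d, has_cderiv f z d.

Definition weight (phi : C -> R) (p : R * R) : R := expR (- (2 * phi (toC p))).

Definition L2 (phi : C -> R) (h : C -> C) :=
  [/\ measurable_fun setT (fun p : R * R => complex.Re (h (toC p))),
      measurable_fun setT (fun p : R * R => complex.Im (h (toC p))) &
      (\int[leb2]_p ((cabs (h (toC p))) ^+ 2 * weight phi p)%:E < +oo)%E].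

Definition L2norm (phi : C -> R) (h : C -> C) : R :=
  Num.sqrt (Rintegral leb2 setT (fun p => cabs (h (toC p)) ^+ 2 * weight phi p)).

Definition cintegral (F : R * R -> C) : C :=
  (Rintegral leb2 setT (fun p => complex.Re (F p))
   +i* Rintegral leb2 setT (fun p => complex.Im (F p)))%C.

Definition inner (phi : C -> R) (h v : C -> C) : C :=
  cintegral (fun p => h (toC p) * (v (toC p))^*%C * (weight phi p)%:C%C).

Definition Fock (phi : C -> R) (f : C -> C) := entire f /\ L2 phi f.

Definition reproducing_kernel (phi : C -> R) (K : C -> C -> C) :=
  forall lam : C, Fock phi (fun z => K z lam) /\
    forall f, Fock phi f -> f lam = inner phi f (fun z => K z lam).

Definition nkernel (K : C -> C -> C) (lam : C) : C -> C :=
  fun z => K z lam / sqrtC (K lam lam).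

Definition in_kernel_span (K : C -> C -> C) (f : C -> C) :=
  exists (n : nat) (c lam : 'I_n -> C),
    f = fun z => \sum_(i < n) c i * nkernel K (lam i) z.

Definition is_Fock_projection (phi : C -> R) (h u : C -> C) :=
  Fock phi u /\ forall v, Fock phi v -> inner phi (fun z => h z - u z) v = 0.

(** H_{bar g} f = (I - P)(bar g f) for f in Span{k_lam}; it extends to a bounded
    operator on F^2_phi iff ||H_{bar g} f|| <= M ||f|| on that dense subspace. *)
Definition hankel_bounded (phi : C -> R) (K : C -> C -> C) (g : C -> C) :=
  exists M : R, forall f, in_kernel_span K f ->
    forall u, is_Fock_projection phi (fun z => (g z)^*%C * f z) u ->
      L2norm phi (fun z => (g z)^*%C * f z - u z) <= M * L2norm phi f.

End Defs.

(* Main.v *)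
(* A holomorphic function is handled as a pair (P, Q) = (real part, imaginary part) of functions on R * R.

   The weight. Averaging phi at a small scale and adding logarithmic potentials of mu at scale rho gives a C^2
   function psi with phi <= psi <= phi + C and Laplacian >= c rho^-2.  For such psi, integration by parts gives
     1/2 int (Lap psi) |b|^2 e^(2 psi) <= int |d b / dz|^2 e^(2 psi)  for b of compact support,
   and by duality (Riesz representation on the graph) every dbar u = h has a weak solution with
     int |u|^2 e^(-2 phi) <= C int |h|^2 rho^2 e^(-2 phi).

   Sufficiency. Solving dbar u = conj(g') f, the function conj(g) f - u is holomorphic (Weyl), and it is at least
   as far from conj(g) f as the projection is.

   Necessity. The projection of conj(g) k_l is conj(g(l)) k_l, so that q = (g - g(l)) K_l satisfies
   ||q||^2 <= M^2 K(l, l).  Then q = (z - l) f with f entire and f(l) = g'(l) K(l, l).  The basic inequality, applied to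
   a cut-off of conj f near l, gives ||f||^2 <= C rho(l)^-2 ||q||^2, and |f(l)|^2 <= ||f||^2 K(l, l) concludes; K(l, l) <> 0
   because the dbar-equation with a logarithmic pole at l produces a Fock function that does not vanish at l. *)
Require Import Defs.
From HB Require Import structures.
From mathcomp Require Import all_boot all_order all_algebra.
From mathcomp Require Import all_classical all_reals all_analysis.
From mathcomp Require Import complex measurable_realfun.
From mathcomp Require Import ring lra.
Import Order.TTheory GRing.Theory Num.Theory.
Import numFieldNormedType.Exports.
Set Implicit Arguments.
Unset Strict Implicit.
Unset Printing Implicit Defensive.
Local Open Scope classical_set_scope.
Local Open Scope ring_scope.

(** Doubling is used in two ways. Tripling a radius multiplies the mass by a factor larger than 1
    (reverse doubling), so the logarithmic potential of [mu] over a disc of mass 1 is bounded by a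
    geometric series; this keeps the smoothed weight within a constant of [phi]. Doubling itself
    bounds from below the mass of discs of radius [rho / 8], hence the Laplacian once [mu] is spread
    out at scale [rho]. One family of radial kernels, [al r], does the smoothing. The difference of
    two of them is the Laplacian of a compactly supported [Ek], and testing against [Ek] yields both
    the mean value property of weakly harmonic functions and the comparison of averages of [phi] at
    different scales. In the lower bound no decay of the kernel enters: one factor [K(l, l)] comes
    from the norm of [K_l], another from evaluation at [l], and they cancel the [K(l, l)^2] in
    [|f(l)|^2]. The sign of the weight is the obstacle there: the basic inequality is wanted for
    [-phi], which is superharmonic. A quadratic term restores positivity on the disc of radius
    [rho(l)], hence the cut-off. *)

(* Sealed, as otherwise conversion tests between integrals unfold to suprema. *)
HB.lock Definition I (R : realType) d (T : measurableType d) (nu : {measure set T -> \bar R})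
  (f : T -> R) : R := Rintegral nu setT f.

(** * Real-valued integrals and dominated convergence *)

Section RealIntegral.
Context {R : realType} d {T : measurableType d} (nu : {measure set T -> \bar R}).
Implicit Types f g : T -> R.

Definition intg f := nu.-integrable setT (EFin \o f).
Local Notation I := (I nu).
Definition meas f := measurable_fun setT f.

Lemma intg_meas f : intg f -> meas f.
Proof. by move=> /measurable_int /measurable_EFinP. Qed.

Lemma intgD f g : intg f -> intg g -> intg (fun p => f p + g p).
Proof. by move=> hf hg; have := integrableD measurableT hf hg; apply: eq_integrable. Qed.

Lemma intgZ (c : R) f : intg f -> intg (fun p => c * f p).
Proof. by move=> hf; have := integrableZl measurableT c hf; apply: eq_integrable. Qed.

Lemma intgN f : intg f -> intg (fun p => - f p).
Proof. by move=> hf; have := integrableN hf; apply: eq_integrable. Qed.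

Lemma intgB f g : intg f -> intg g -> intg (fun p => f p - g p).
Proof. by move=> hf /intgN; exact: intgD. Qed.

Lemma intg0 : intg (fun=> 0).
Proof. exact: integrable0. Qed.

Lemma intg_le f g : meas f -> (forall p, `|f p| <= g p) -> intg g -> intg f.
Proof.
move=> mf fg ig; apply: (le_integrable measurableT _ _ ig).
  exact/measurable_EFinP.
move=> p _ /=; rewrite lee_fin (le_trans (fg p))// ler_norm//.
Qed.

Lemma intg_abs f : intg f -> intg (fun p => `|f p|).
Proof. by move=> hf; have := integrable_abse hf; apply: eq_integrable. Qed.

Lemma ID f g : intg f -> intg g -> I (fun p => f p + g p) = I f + I g.
Proof. by move=> hf hg; rewrite I.unlock RintegralD. Qed.

Lemma IB f g : intg f -> intg g -> I (fun p => f p - g p) = I f - I g.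
Proof. by move=> hf hg; rewrite I.unlock RintegralB. Qed.

Lemma IZ (c : R) f : intg f -> I (fun p => c * f p) = c * I f.
Proof. by move=> hf; rewrite I.unlock RintegralZl. Qed.

Lemma IN f : intg f -> I (fun p => - f p) = - I f.
Proof.
move=> hf; rewrite -[RHS]mulN1r -IZ//; congr I; apply/funext => p.
by rewrite mulN1r.
Qed.

Lemma I0 : I (fun=> 0) = 0.
Proof. by rewrite I.unlock /Rintegral integral0. Qed.

Lemma I_le f g : intg f -> intg g -> (forall p, f p <= g p) -> I f <= I g.
Proof. by move=> hf hg fg; rewrite !I.unlock; apply: le_Rintegral. Qed.

Lemma I_ge0 f : (forall p, 0 <= f p) -> 0 <= I f.
Proof. by move=> f0; rewrite !I.unlock; apply: Rintegral_ge0. Qed.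

Lemma I_abs f : intg f -> `|I f| <= I (fun p => `|f p|).
Proof. by move=> hf; rewrite !I.unlock; apply: le_normr_Rintegral. Qed.

Lemma I_fin f : intg f -> (\int[nu]_p (f p)%:E)%E = (I f)%:E.
Proof. by move=> hf; rewrite I.unlock /Rintegral fineK//; exact: integrable_fin_num. Qed.

Lemma intg_ge0P f : meas f -> (forall p, 0 <= f p) ->
  intg f <-> (\int[nu]_p (f p)%:E < +oo)%E.
Proof.
move=> mf f0; split.
  by move=> /I_fin ->; rewrite ltry.
move=> h; apply/integrableP; split; first exact/measurable_EFinP.
by under eq_integral do rewrite /= ger0_norm//.
Qed.

Lemma intg_indic (A : set T) (M : R) f : measurable A -> (nu A < +oo)%E -> meas f ->
  (forall p, A p -> `|f p| <= M) -> (forall p, ~ A p -> f p = 0) -> intg f.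
Proof.
move=> mA Afin mf fM f0.
apply: (@intg_le _ (fun p => `|M| * \1_A p)) => //.
  move=> p; rewrite indicE; case: (boolP (p \in A)) => [/set_mem pA|/negP pA].
    by rewrite mulr1 (le_trans (fM _ pA))// ler_norm.
  by rewrite mulr0 f0 ?normr0// => /mem_set.
apply: intgZ; apply/intg_ge0P => //; first exact: measurable_indic.
by rewrite integral_indic// setIT.
Qed.

Lemma I_indic (A : set T) : measurable A -> I (\1_A) = fine (nu A).
Proof. by move=> mA; rewrite I.unlock /Rintegral integral_indic// setIT. Qed.

Lemma I_dct (f_ : nat -> T -> R) f g : (forall n, meas (f_ n)) ->
  (forall p, (f_ n p) @[n --> \oo] --> f p) -> intg g ->
  (forall n p, `|f_ n p| <= g p) ->
  intg f /\ (I (f_ n)) @[n --> \oo] --> I f.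
Proof.
move=> mf cf ig fg.
have mfl : meas f by apply: (measurable_fun_cvg mf) => p _; exact: cf.
have [|||||h1 _ h3] := @dominated_convergence _ _ _ nu _ measurableT
  (fun n => EFin \o f_ n) (EFin \o f) (EFin \o g).
- by move=> n; apply/measurable_EFinP; exact: mf.
- exact/measurable_EFinP.
- by apply: aeW => p _; apply: cvg_EFin; [exact: nearW|exact: cf].
- exact: ig.
- by apply: aeW => p n _; rewrite /= lee_fin.
split => //.
rewrite I.unlock /Rintegral; apply: fine_cvg.
by rewrite fineK//; exact: (@integrable_fin_num _ _ _ nu).
Qed.

Lemma I_ae_eq f g : {ae nu, forall p, f p = g p} -> meas f -> meas g -> I f = I g.
Proof.
move=> h mf mg; rewrite I.unlock /Rintegral; congr fine.
apply: ae_eq_integral => //; [exact/measurable_EFinP|exact/measurable_EFinP|].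
by apply: filterS h => p /= ->.
Qed.

Lemma intg_ae_eq f g : {ae nu, forall p, f p = g p} -> meas g -> intg f -> intg g.
Proof.
move=> h mg hf; have mf := intg_meas hf.
apply/integrableP; split; first exact/measurable_EFinP.
have /integrableP[_] := hf.
rewrite (@ae_eq_integral _ _ _ nu setT (fun p => `|(g p)%:E|%E) (fun p => `|(f p)%:E|%E))//=.
- by apply/measurable_EFinP; apply: measurableT_comp.
- by apply/measurable_EFinP; apply: measurableT_comp.
- by apply: filterS h => p /= ->.
Qed.

End RealIntegral.

(** * Lebesgue measure on the plane *)

(* [leb2] lives on [measurableTypeR R * measurableTypeR R]; [Leb] is its image on the canonical [R * R]. *)
Section Plane.
Context {R : realType}.
Local Notation P2 := (R * R)%type.
Implicit Types (p q z w : P2) (r t e : R).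

Definition lebid (p : measurableTypeR R * measurableTypeR R) : P2 := p.

Lemma meas_lebid : measurable_fun setT lebid.
Proof. by move=> _ Y mY; rewrite setTI; exact: mY. Qed.

Definition Leb : {measure set P2 -> \bar R}.
Proof. by refine [the measure _ _ of pushforward (@leb2 R) lebid]; exact: meas_lebid. Defined.

Lemma ge0_Leb (f : P2 -> \bar R) : measurable_fun setT f -> (forall p, 0 <= f p)%E ->
  (\int[Leb]_p f p = \int[leb2]_p f p)%E.
Proof.
move=> mf f0; rewrite /Leb/= ge0_integral_pushforward//; exact: meas_lebid.
Qed.

Lemma int_Leb (f : P2 -> \bar R) : measurable_fun setT f ->
  (\int[Leb]_p f p = \int[leb2]_p f p)%E.
Proof.
move=> mf; rewrite [LHS]integralE [RHS]integralE; congr (_ - _)%E.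
  by apply: ge0_Leb => //; exact: measurable_funepos.
by apply: ge0_Leb => //; exact: measurable_funeneg.
Qed.

Lemma Leb_I (f : P2 -> R) : meas f -> Rintegral (@leb2 R) setT f = I Leb f.
Proof. by move=> mf; rewrite I.unlock /Rintegral int_Leb//; exact/measurable_EFinP. Qed.

Lemma intg_Leb (f : P2 -> R) : meas f ->
  intg Leb f <-> intg (@leb2 R) (f : measurableTypeR R * measurableTypeR R -> R).
Proof.
move=> mf; split => /integrableP[_ h]; apply/integrableP; split.
- exact/measurable_EFinP.
- rewrite -int_Leb//; apply/measurable_EFinP; exact: measurableT_comp.
- exact/measurable_EFinP.
- rewrite int_Leb//; apply/measurable_EFinP; exact: measurableT_comp.
Qed.

Lemma tonelli_Leb (f : P2 -> \bar R) : measurable_fun setT f -> (forall p, 0 <= f p)%E ->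
  (\int[Leb]_p f p = \int[lebesgue_measure]_x \int[lebesgue_measure]_y f (x, y))%E.
Proof.
move=> mf f0; rewrite ge0_Leb//.
by rewrite /leb2 (fubini_tonelli1 (f : measurableTypeR R * measurableTypeR R -> \bar R)).
Qed.

Lemma tonelli_Leb2 (f : P2 -> \bar R) : measurable_fun setT f -> (forall p, 0 <= f p)%E ->
  (\int[Leb]_p f p = \int[lebesgue_measure]_y \int[lebesgue_measure]_x f (x, y))%E.
Proof.
move=> mf f0; rewrite ge0_Leb//.
rewrite /leb2 (fubini_tonelli1 (f : measurableTypeR R * measurableTypeR R -> \bar R))//.
by rewrite (fubini_tonelli (f : measurableTypeR R * measurableTypeR R -> \bar R)).
Qed.

Lemma fubini_Leb (f : P2 -> R) : intg Leb f ->
  (\int[Leb]_p (f p)%:E = \int[lebesgue_measure]_x \int[lebesgue_measure]_y (f (x, y))%:E)%E.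
Proof.
move=> hf; have mf := intg_meas hf; rewrite int_Leb//; last exact/measurable_EFinP.
have h2 := proj1 (intg_Leb mf) hf.
by rewrite -(integral12_prod_meas1 h2).
Qed.

Lemma fubini_Leb2 (f : P2 -> R) : intg Leb f ->
  (\int[Leb]_p (f p)%:E = \int[lebesgue_measure]_y \int[lebesgue_measure]_x (f (x, y))%:E)%E.
Proof.
move=> hf; have mf := intg_meas hf; rewrite int_Leb//; last exact/measurable_EFinP.
have h2 := proj1 (intg_Leb mf) hf.
by rewrite -(integral21_prod_meas1 h2).
Qed.

Lemma open_box (A : set P2) p : open A -> A p ->
  exists n : nat, forall q, `|q - p| < n.+1%:R^-1 -> A q.
Proof.
move=> oA Ap.
have /nbhs_ballP[e /= e0 he] := open_nbhs_nbhs (conj oA Ap).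
have [n _ hn] := near_infty_natSinv_lt (PosNum e0).
exists n => q hq; apply: he; rewrite -ball_normE /ball_ /=.
by rewrite distrC (lt_trans hq)// (hn n)//=.
Qed.

Lemma norm_lt2 p (e : R) : (`|p| < e) = (`|p.1| < e) && (`|p.2| < e).
Proof. by rewrite prod_normE gt_max. Qed.

Lemma norm_le2 p (e : R) : (`|p| <= e) = (`|p.1| <= e) && (`|p.2| <= e).
Proof. by rewrite prod_normE ge_max. Qed.

(** The sigma-algebra of [R * R] is the product one, so an open set is written as the union of the
    countably many squares [Q u], with rational centre and radius [1/(n+1)], that it contains. *)
Lemma open_measP (A : set P2) : open A -> measurable A.
Proof.
move=> oA.
pose Q (u : rat * rat * nat) : set P2 :=
  `](ratr u.1.1 - u.2.+1%:R^-1), (ratr u.1.1 + u.2.+1%:R^-1)[%classic `*`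
  `](ratr u.1.2 - u.2.+1%:R^-1), (ratr u.1.2 + u.2.+1%:R^-1)[%classic.
have mQ u : measurable (Q u) by apply: measurableX; exact: measurable_itv.
have -> : A = \bigcup_u (if `[< Q u `<=` A >] then Q u else set0).
  apply/seteqP; split => [p Ap|p [u _]]; last by case: asboolP => // h; exact: h.
  have [n hn] := open_box oA Ap.
  (* Half the radius: since [m.+1] is twice [n.+1], a square of radius [1/(m+1)] containing [p]
     stays within distance [1/(n+1)] of [p]. *)
  pose m := n.*2.+1.
  have m0 : (0 : R) < m.+1%:R^-1 by rewrite invr_gt0 ltr0n.
  have mn : m.+1%:R^-1 + m.+1%:R^-1 = n.+1%:R^-1 :> R.
    have -> : m.+1%:R = 2 * n.+1%:R :> R by rewrite -natrM mul2n.
    by have : n.+1%:R != 0 :> R; [rewrite pnatr_eq0|move=> ?; field].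
  have lt2 (x : R) : x - m.+1%:R^-1 < x + m.+1%:R^-1.
    by rewrite ltrBlDr -addrA ltrDl addr_gt0.
  have [a] := rat_in_itvoo (lt2 p.1); rewrite in_itv/= => /andP[a1 a2].
  have [b] := rat_in_itvoo (lt2 p.2); rewrite in_itv/= => /andP[b1 b2].
  exists ((a, b), m) => //; rewrite /Q/= in mQ *; clear mQ Q; move: m0 mn a1 a2 b1 b2 hn.
  move: (m.+1%:R^-1 : R) (n.+1%:R^-1 : R) (ratr a : R) (ratr b : R) => c d u v m0 mn a1 a2 b1 b2 hn.
  case: asboolP => [_|]; first by split; rewrite /= in_itv/=; apply/andP; split; lra.
  case => q [] /=; rewrite !in_itv/= => /andP[q1 q2] /andP[q3 q4].
  by apply: hn; rewrite norm_lt2 !ltr_norml/=; apply/andP; split; apply/andP; split; lra.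
apply: countable_bigcupT_measurable; first exact: countableP.
by move=> u; case: asboolP.
Qed.

Lemma cont_meas (f : P2 -> R) : continuous f -> meas f.
Proof.
move=> /continuousP cf; apply: (measurability _ (RGenOpens.measurableE R)).
move=> _ [_ [a [b ->] <-]]; rewrite setTI; apply: open_measP.
by apply: cf; exact: interval_open.
Qed.
End Plane.

(** * Compact supports and local integrability *)

Section LocalIntegrability.
Context {R : realType}.
Local Notation P2 := (R * R)%type.
Implicit Types (p q z w : P2) (f g : P2 -> R).

(** The norm of [R * R] is the maximum norm, so [bbox M] is a closed square, and compact support
    means vanishing outside some square. *)
Definition csupp f := exists M : R, forall p, M < `|p| -> f p = 0.
Definition bbox (M : R) : set P2 := [set p | `|p| <= M].
Definition lfin (nu : {measure set P2 -> \bar R}) := forall M, (nu (bbox M) < +oo)%E.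
(** Measurable and bounded on bounded sets. The weight [phi], which is not known to be continuous,
    is shown to belong to this class in [phi_lbd]; it is stable under products and makes products
    with test functions integrable. *)
Definition lbd f := meas f /\ forall M, exists C, forall p, `|p| <= M -> `|f p| <= C.
Definition lint (nu : {measure set P2 -> \bar R}) f :=
  meas f /\ forall M, intg nu (fun p => f p * \1_(bbox M) p).

Lemma bbox_itv (M : R) : bbox M = `[- M, M]%classic `*` `[- M, M]%classic.
Proof.
apply/seteqP; split => p; rewrite /bbox/= norm_le2 !ler_norml !in_itv/=.
  by move=> /andP[].
by move=> [-> ->].
Qed.

Lemma bbox_meas (M : R) : measurable (bbox M).
Proof. by rewrite bbox_itv; apply: measurableX; exact: measurable_itv. Qed.

Lemma bbox_compact (M : R) : compact (bbox M).
Proof. by rewrite bbox_itv; apply: compact_setX; exact: segment_compact. Qed.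

Lemma cont_bounded f (M : R) : continuous f -> exists C, forall p, `|p| <= M -> `|f p| <= C.
Proof.
move=> cf.
have /compact_bounded[C [_ hC]] : compact (f @` bbox M).
  apply: continuous_compact; last exact: bbox_compact.
  exact: continuous_subspaceT.
exists (C + 1) => p pM; apply: (hC (C + 1)); first by rewrite ltrDl.
by exists p.
Qed.

Lemma cont_lbd f : continuous f -> lbd f.
Proof. by move=> cf; split; [exact: cont_meas|move=> M; exact: cont_bounded]. Qed.

Lemma csuppM f g : csupp g -> csupp (fun p => f p * g p).
Proof. by move=> [M h]; exists M => p /h ->; rewrite mulr0. Qed.

Lemma csuppMl f g : csupp f -> csupp (fun p => f p * g p).
Proof. by move=> [M h]; exists M => p /h ->; rewrite mul0r. Qed.

Lemma csuppD f g : csupp f -> csupp g -> csupp (fun p => f p + g p).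
Proof.
move=> [M h] [N k]; exists (Num.max M N) => p; rewrite gt_max => /andP[/h -> /k ->].
by rewrite addr0.
Qed.

Lemma csuppN f : csupp f -> csupp (fun p => - f p).
Proof. by move=> [M h]; exists M => p /h ->; rewrite oppr0. Qed.

Lemma lbdM f g : lbd f -> lbd g -> lbd (fun p => f p * g p).
Proof.
move=> [mf hf] [mg hg]; split; first exact: measurable_funM.
move=> M; have [C hC] := hf M; have [D hD] := hg M; exists (C * D) => p pM.
by rewrite normrM ler_pM// ?hC ?hD.
Qed.

Lemma lbdD f g : lbd f -> lbd g -> lbd (fun p => f p + g p).
Proof.
move=> [mf hf] [mg hg]; split; first exact: measurable_funD.
move=> M; have [C hC] := hf M; have [D hD] := hg M; exists (C + D) => p pM.
by rewrite (le_trans (ler_normD _ _))// lerD// ?hC ?hD.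
Qed.

Lemma lbdN f : lbd f -> lbd (fun p => - f p).
Proof.
move=> [mf hf]; split; first exact: measurableT_comp.
by move=> M; have [C hC] := hf M; exists C => p /hC; rewrite normrN.
Qed.

Lemma lbd_csupp f : lbd f -> csupp f -> exists C, forall p, `|f p| <= C.
Proof.
move=> [mf hf] [M h]; have [C hC] := hf M; exists (Num.max C 0) => p.
have [pM|pM] := leP `|p| M; first by rewrite le_max hC.
by rewrite h// normr0 le_max lexx orbT.
Qed.

Variable nu : {measure set P2 -> \bar R}.

Lemma lint_mul f g : lint nu f -> lbd g -> csupp g -> intg nu (fun p => f p * g p).
Proof.
move=> [mf hf] bg cg; have [C hC] := lbd_csupp bg cg; have [M hM] := cg.
apply: (@intg_le _ _ _ _ _ (fun p => `|C| * `|f p * \1_(bbox M) p|)).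
- by apply: measurable_funM => //; case: bg.
- move=> p; have [pM|pM] := leP `|p| M.
    rewrite indicE mem_set// mulr1 normrM mulrC ler_wpM2r// (le_trans (hC p))// ler_norm//.
  by rewrite hM// mulr0 normr0 mulr_ge0.
- by apply: intgZ; apply: intg_abs.
Qed.

Lemma lbd_lint f : lfin nu -> lbd f -> lint nu f.
Proof.
move=> fin [mf hf]; split => // M; have [C hC] := hf M.
apply: (@intg_indic _ _ _ _ (bbox M) C); [exact: bbox_meas|exact: fin| | | ].
- by apply: measurable_funM => //; apply: measurable_indic; exact: bbox_meas.
- by move=> p pM; rewrite indicE mem_set// mulr1 hC.
- by move=> p pM; rewrite indicE memNset// mulr0.
Qed.

Lemma lbd_intg f : lfin nu -> lbd f -> csupp f -> intg nu f.
Proof.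
move=> fin bf cf; have : intg nu (fun p => f p * 1).
  have h1 : lint nu (fun=> 1).
    by apply: lbd_lint => //; apply: cont_lbd => ?; exact: cvg_cst.
  by have := lint_mul h1 bf cf; congr intg; apply/funext => p; rewrite mulrC.
by congr intg; apply/funext => p; rewrite mulr1.
Qed.

Lemma cont_intg f : lfin nu -> continuous f -> csupp f -> intg nu f.
Proof. by move=> fin /cont_lbd; exact: lbd_intg. Qed.

Lemma lintD f g : lint nu f -> lint nu g -> lint nu (fun p => f p + g p).
Proof.
move=> [mf hf] [mg hg]; split; first exact: measurable_funD.
move=> M; have := intgD (hf M) (hg M); congr intg; apply/funext => p; by rewrite mulrDl.
Qed.

Lemma lintN f : lint nu f -> lint nu (fun p => - f p).
Proof.
move=> [mf hf]; split; first exact: measurableT_comp.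
move=> M; have := intgN (hf M); congr intg; apply/funext => p; by rewrite mulNr.
Qed.
End LocalIntegrability.

(** * Translations and shears *)

Section LebPlane.
Context {R : realType}.
Local Notation P2 := (R * R)%type.
Implicit Types (p q z w : P2) (f g : P2 -> R).

Lemma Leb_lfin : lfin (@Leb R).
Proof.
move=> M; rewrite bbox_itv.
have -> : Leb (`[- M, M]%classic `*` `[- M, M]%classic) =
  (@leb2 R) (`[- M, M]%classic `*` `[- M, M]%classic) by [].
rewrite /leb2 product_measure1E//=.
rewrite lebesgue_measure_itv/=; case: ifP => _; rewrite -?EFinD -?EFinM ?mule0 ?ltry//.
Qed.

Definition lebsh (a : R) (t : measurableTypeR R) : measurableTypeR R := t + a.
Lemma meas_lebsh a : measurable_fun setT (lebsh a).
Proof. exact: (@measurable_funD _ _ _ setT (fun t : measurableTypeR R => t : R) (cst a)). Qed.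
Definition leb_shm (a : R) : {measure set (measurableTypeR R) -> \bar R}.
Proof. by refine [the measure _ _ of pushforward (@lebesgue_measure R) (lebsh a)]; exact: meas_lebsh. Defined.

(** By uniqueness of Lebesgue measure it suffices to compare both measures on half-open
    intervals. *)
Lemma leb_shift (a : R) (A : set (measurableTypeR R)) : measurable A ->
  lebesgue_measure A = leb_shm a A.
Proof.
move=> mA; apply: lebesgue_measure_unique => // X [[u v] _ <-]/=.
rewrite /pushforward.
have -> : lebsh a @^-1` `]u, v] = `](u - a), (v - a)]%classic.
  apply/seteqP; split => t; rewrite /lebsh/= !in_itv/= => /andP[h1 h2]; apply/andP; split; lra.
rewrite !lebesgue_measure_itv/= !lte_fin ltrD2r; case: ifP => // _.
by rewrite -!EFinB; congr EFin; ring.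
Qed.

Lemma ge0_leb_shift (a : R) (f : R -> \bar R) : measurable_fun setT f ->
  (forall t, 0 <= f t)%E ->
  (\int[lebesgue_measure]_t f (t + a)%R = \int[lebesgue_measure]_t f t)%E.
Proof.
move=> mf f0.
transitivity (\int[leb_shm a]_t f t)%E.
  by rewrite ge0_integral_pushforward//; exact: meas_lebsh.
by apply: eq_measure_integral => A mA _; rewrite -leb_shift.
Qed.

Lemma meas_sectx (f : P2 -> \bar R) (y : R) : measurable_fun setT f ->
  measurable_fun setT (fun x => f (x, y)).
Proof.
move=> mf; apply: measurableT_comp => //; apply: measurable_fun_pair => //.
Qed.

Lemma meas_secty (f : P2 -> \bar R) (x : R) : measurable_fun setT f ->
  measurable_fun setT (fun y => f (x, y)).
Proof.
move=> mf; apply: measurableT_comp => //; apply: measurable_fun_pair => //.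
Qed.

(** Tonelli, with the first coordinate as inner variable, turns the shear into a translation of each
    horizontal line. Shears generate the translations of the plane and, later, the rotations. *)
Lemma ge0_shearx (h : R -> R) (f : P2 -> \bar R) : meas h -> measurable_fun setT f ->
  (forall p, 0 <= f p)%E ->
  (\int[Leb]_p f (p.1 + h p.2, p.2)%R = \int[Leb]_p f p)%E.
Proof.
move=> mh mf f0; rewrite !tonelli_Leb2//; last first.
  apply: measurableT_comp => //; apply: measurable_fun_pair => //.
  apply: measurable_funD => //; apply: measurableT_comp => //.
apply: eq_integral => y _ /=.
by apply: (@ge0_leb_shift (h y) (fun x => f (x, y))) => //; exact: meas_sectx.
Qed.

Lemma ge0_sheary (h : R -> R) (f : P2 -> \bar R) : meas h -> measurable_fun setT f ->
  (forall p, 0 <= f p)%E ->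
  (\int[Leb]_p f (p.1, p.2 + h p.1)%R = \int[Leb]_p f p)%E.
Proof.
move=> mh mf f0; rewrite !tonelli_Leb//; last first.
  apply: measurableT_comp => //; apply: measurable_fun_pair => //.
  apply: measurable_funD => //; apply: measurableT_comp => //.
apply: eq_integral => x _ /=.
by apply: (@ge0_leb_shift (h x) (fun y => f (x, y))) => //; exact: meas_secty.
Qed.

Lemma meas_shift (v : P2) (f : P2 -> \bar R) : measurable_fun setT f ->
  measurable_fun setT (fun p => f (p + v)).
Proof.
move=> mf; apply: measurableT_comp => //; apply: measurable_fun_pair => //;
  apply: measurable_funD => //.
Qed.

Lemma ge0_shift (v : P2) (f : P2 -> \bar R) : measurable_fun setT f ->
  (forall p, 0 <= f p)%E -> (\int[Leb]_p f (p + v)%R = \int[Leb]_p f p)%E.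
Proof.
move=> mf f0.
pose g p := f (p.1 + v.1, p.2)%R.
have mg : measurable_fun setT g.
  apply: measurableT_comp => //; apply: measurable_fun_pair => //; exact: measurable_funD.
transitivity (\int[Leb]_p g p)%E; last by rewrite -[RHS](@ge0_shearx (cst v.1))//; exact: measurable_cst.
have mc : meas (cst v.2 : R -> R) by exact: measurable_cst.
by rewrite -(@ge0_sheary (cst v.2) g mc mg (fun p => f0 _)).
Qed.

Lemma int_shift (v : P2) (f : P2 -> \bar R) : measurable_fun setT f ->
  (\int[Leb]_p f (p + v)%R = \int[Leb]_p f p)%E.
Proof.
move=> mf; rewrite [LHS]integralE [RHS]integralE; congr (_ - _)%E.
  apply: eq_trans (@ge0_shift v (f^\+)%E (measurable_funepos mf) (fun p => funepos_ge0 f p)).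
  by apply: eq_integral => x _; rewrite !funeposE.
apply: eq_trans (@ge0_shift v (f^\-)%E (measurable_funeneg mf) (fun p => funeneg_ge0 f p)).
by apply: eq_integral => x _; rewrite !funenegE.
Qed.

Lemma I_shift (v : P2) (f : P2 -> R) : meas f -> I Leb (fun p => f (p + v)) = I Leb f.
Proof.
move=> mf; rewrite I.unlock /Rintegral -(@int_shift v (EFin \o f))//.
by apply/measurable_EFinP.
Qed.

Lemma intg_shift (v : P2) (f : P2 -> R) : intg Leb f -> intg Leb (fun p => f (p + v)).
Proof.
move=> hf; have mf := intg_meas hf; have /integrableP[m1 h] := hf.
apply/integrableP; split; first exact: (@meas_shift v (EFin \o f)).
rewrite (@int_shift v (fun p => `|(f p)%:E|%E))//.
by apply: measurableT_comp.
Qed.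

End LebPlane.

(** * Differential calculus on the plane *)

(** Partial derivatives are taken along one-variable slices, so that the chain rule, the mean value
    theorem and the fundamental theorem of calculus on the line apply directly. *)
HB.lock Definition dx (R : realType) (f : R * R -> R) (p : R * R) : R :=
  derive1 (fun t => f (t, p.2)) p.1.
HB.lock Definition dy (R : realType) (f : R * R -> R) (p : R * R) : R :=
  derive1 (fun t => f (p.1, t)) p.2.

Section Smooth.
Context {R : realType}.
Local Notation P2 := (R * R)%type.
Implicit Types (p q z w : P2) (f g : P2 -> R) (F G : R -> R).

(** The class C^n, by recursion on partial derivatives; total differentiability is a consequence
    ([tangent_diff]). [Dk] is the analogue on the line. *)
Fixpoint Ck (n : nat) f : Prop :=
  continuous f /\ match n with
  | 0%N => True
  | m.+1 => [/\ forall p, derivable (fun t => f (t, p.2)) p.1 1,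
                forall p, derivable (fun t => f (p.1, t)) p.2 1,
                Ck m (dx f) & Ck m (dy f)]
  end.

Fixpoint Dk (n : nat) F : Prop :=
  continuous F /\ match n with
  | 0%N => True
  | m.+1 => (forall t, derivable F t 1) /\ Dk m (derive1 F)
  end.

Lemma Ck_cont n f : Ck n f -> continuous f.
Proof. by case: n => [|n] []. Qed.

Lemma Dk_cont n F : Dk n F -> continuous F.
Proof. by case: n => [|n] []. Qed.

Lemma CkS n f : Ck n.+1 f -> Ck n f.
Proof.
elim: n f => [|n IH] f /= [cf [h1 h2 h3 h4]]; split => //.
by split => //; apply: IH; [exact: h3|exact: h4].
Qed.

Lemma DkS n F : Dk n.+1 F -> Dk n F.
Proof. by elim: n F => [|n IH] F /= [cf [h1 h3]]; split => //; split => //; exact: IH. Qed.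

Lemma Ck_le m n f : (m <= n)%N -> Ck n f -> Ck m f.
Proof.
elim: n => [|n IH]; first by rewrite leqn0 => /eqP ->.
by rewrite leq_eqVlt => /predU1P[->//|/IH h] /CkS.
Qed.

Lemma derivx n f p : Ck n.+1 f -> is_derive (p.1 : R) (1 : R) (fun t => f (t, p.2)) (dx f p).
Proof. by case=> _ [h _ _ _]; rewrite dx.unlock derive1E; exact/derivableP. Qed.

Lemma derivy n f p : Ck n.+1 f -> is_derive (p.2 : R) (1 : R) (fun t => f (p.1, t)) (dy f p).
Proof. by case=> _ [_ h _ _]; rewrite dy.unlock derive1E; exact/derivableP. Qed.

Lemma deriv1 n F t : Dk n.+1 F -> is_derive (t : R) (1 : R) F (derive1 F t).
Proof. by case=> _ [h _]; rewrite derive1E; exact/derivableP. Qed.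

Lemma Ck_dx n f : Ck n.+1 f -> Ck n (dx f). Proof. by case=> _ []. Qed.
Lemma Ck_dy n f : Ck n.+1 f -> Ck n (dy f). Proof. by case=> _ []. Qed.
Lemma Dk_d n F : Dk n.+1 F -> Dk n (derive1 F). Proof. by case=> _ []. Qed.

Lemma isd_eq F (x d d' : R) : is_derive x (1 : R) F d -> d = d' -> is_derive x (1 : R) F d'.
Proof. by move=> h <-. Qed.

Lemma dxE f g : (forall p, is_derive (p.1 : R) (1 : R) (fun t => f (t, p.2)) (g p)) -> dx f = g.
Proof. by move=> h; apply/funext => p; rewrite dx.unlock derive1E; case: (h p). Qed.

Lemma dyE f g : (forall p, is_derive (p.2 : R) (1 : R) (fun t => f (p.1, t)) (g p)) -> dy f = g.
Proof. by move=> h; apply/funext => p; rewrite dy.unlock derive1E; case: (h p). Qed.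

Lemma d1E F G : (forall t : R, is_derive t (1 : R) F (G t)) -> derive1 F = G.
Proof. by move=> h; apply/funext => p; rewrite derive1E; case: (h p). Qed.

Lemma CkP n f gx gy : continuous f ->
  (forall p, is_derive (p.1 : R) (1 : R) (fun t => f (t, p.2)) (gx p)) ->
  (forall p, is_derive (p.2 : R) (1 : R) (fun t => f (p.1, t)) (gy p)) ->
  Ck n gx -> Ck n gy -> Ck n.+1 f.
Proof.
move=> cf hx hy cx cy; split => //; split.
- by move=> p; case: (hx p).
- by move=> p; case: (hy p).
- by rewrite (dxE hx).
- by rewrite (dyE hy).
Qed.

Lemma DkP n F G : (forall t : R, is_derive t (1 : R) F (G t)) -> Dk n G -> Dk n.+1 F.
Proof.
move=> h dG; split; last first.
  by split; [move=> t; case: (h t)|rewrite (d1E h)].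
move=> t; apply: differentiable_continuous; apply/derivable1_diffP.
by case: (h t).
Qed.

Lemma Ck_cst n (c : R) : Ck n (fun=> c).
Proof.
elim: n c => [|n IH] c; first by split => // p; exact: cvg_cst.
apply: (@CkP _ _ (fun=> 0) (fun=> 0)) => //; first by move=> p; exact: cvg_cst.
- by move=> p; exact: is_derive_cst.
- by move=> p; exact: is_derive_cst.
Qed.

Lemma Dk_cst n (c : R) : Dk n (fun=> c).
Proof.
elim: n c => [|n IH] c; first by split => // p; exact: cvg_cst.
by apply: (@DkP _ _ (fun=> 0)) => // p; exact: is_derive_cst.
Qed.

Lemma Ck_fst n : Ck n (fun p => p.1).
Proof.
have c : continuous (fun p : P2 => p.1) by move=> p; exact: cvg_fst.
case: n => [|n]; first by split.
apply: (@CkP _ _ (fun=> 1) (fun=> 0)) => //; try exact: Ck_cst.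
by move=> p; exact: is_derive_cst.
Qed.

Lemma Ck_snd n : Ck n (fun p => p.2).
Proof.
have c : continuous (fun p : P2 => p.2) by move=> p; exact: cvg_snd.
case: n => [|n]; first by split.
apply: (@CkP _ _ (fun=> 0) (fun=> 1)) => //; try exact: Ck_cst.
by move=> p; exact: is_derive_cst.
Qed.

Lemma CkD n f g : Ck n f -> Ck n g -> Ck n (fun p => f p + g p).
Proof.
elim: n f g => [|n IH] f g hf hg.
  by split => // p; apply: cvgD; [exact: (Ck_cont hf)|exact: (Ck_cont hg)].
apply: (@CkP _ _ (fun p => dx f p + dx g p) (fun p => dy f p + dy g p)).
- by move=> p; apply: cvgD; [exact: (Ck_cont hf)|exact: (Ck_cont hg)].
- by move=> p; apply: is_deriveD; [exact: (derivx p hf)|exact: (derivx p hg)].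
- by move=> p; apply: is_deriveD; [exact: (derivy p hf)|exact: (derivy p hg)].
- by apply: IH; exact: Ck_dx.
- by apply: IH; exact: Ck_dy.
Qed.

Lemma CkM n f g : Ck n f -> Ck n g -> Ck n (fun p => f p * g p).
Proof.
elim: n f g => [|n IH] f g hf hg.
  by split => // p; apply: cvgM; [exact: (Ck_cont hf)|exact: (Ck_cont hg)].
have hf' := CkS hf; have hg' := CkS hg.
apply: (@CkP _ _ (fun p => f p * dx g p + g p * dx f p) (fun p => f p * dy g p + g p * dy f p)).
- by move=> p; apply: cvgM; [exact: (Ck_cont hf)|exact: (Ck_cont hg)].
- move=> p; apply: (isd_eq (is_deriveM (derivx p hf) (derivx p hg))).
  by rewrite -surjective_pairing.
- move=> p; apply: (isd_eq (is_deriveM (derivy p hf) (derivy p hg))).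
  by rewrite -surjective_pairing.
- by apply: CkD; apply: IH => //; exact: Ck_dx.
- by apply: CkD; apply: IH => //; exact: Ck_dy.
Qed.

Lemma CkN n f : Ck n f -> Ck n (fun p => - f p).
Proof.
move=> hf; have := CkM (Ck_cst n (-1)) hf; congr Ck.
by apply/funext => p; rewrite mulN1r.
Qed.

Lemma CkB n f g : Ck n f -> Ck n g -> Ck n (fun p => f p - g p).
Proof. by move=> hf hg; apply: CkD => //; exact: CkN. Qed.

Lemma CkZ n (c : R) f : Ck n f -> Ck n (fun p => c * f p).
Proof. by move=> hf; apply: CkM => //; exact: Ck_cst. Qed.

Lemma DkD n F G : Dk n F -> Dk n G -> Dk n (fun t => F t + G t).
Proof.
elim: n F G => [|n IH] F G hF hG.
  by split => // p; apply: cvgD; [exact: (Dk_cont hF)|exact: (Dk_cont hG)].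
apply: (@DkP _ _ (fun t => derive1 F t + derive1 G t)).
  by move=> p; apply: is_deriveD; [exact: (deriv1 p hF)|exact: (deriv1 p hG)].
by apply: IH; exact: Dk_d.
Qed.

Lemma DkM n F G : Dk n F -> Dk n G -> Dk n (fun t => F t * G t).
Proof.
elim: n F G => [|n IH] F G hF hG.
  by split => // p; apply: cvgM; [exact: (Dk_cont hF)|exact: (Dk_cont hG)].
have hF' := DkS hF; have hG' := DkS hG.
apply: (@DkP _ _ (fun t => F t * derive1 G t + G t * derive1 F t)).
  by move=> p; exact: (is_deriveM (deriv1 p hF) (deriv1 p hG)).
by apply: DkD; apply: IH => //; exact: Dk_d.
Qed.

Lemma is_derive_comp1 (F G : R -> R) (x : R) dF dG :
  is_derive x (1 : R) G dG -> is_derive (G x) (1 : R) F dF ->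
  is_derive x (1 : R) (fun t => F (G t)) (dF * dG).
Proof. by move=> h1 h2; exact: (@is_derive1_comp R F G x dF dG h2 h1). Qed.

Lemma Ck_comp n F f : Dk n F -> Ck n f -> Ck n (fun p => F (f p)).
Proof.
elim: n F f => [|n IH] F f hF hf.
  split => // p; apply: continuous_comp; [exact: (Ck_cont hf)|exact: (Dk_cont hF)].
have hf' := CkS hf; have hF' := DkS hF.
apply: (@CkP _ _ (fun p => derive1 F (f p) * dx f p) (fun p => derive1 F (f p) * dy f p)).
- by move=> p; apply: continuous_comp; [exact: (Ck_cont hf)|exact: (Dk_cont hF)].
- move=> p; apply: is_derive_comp1; first exact: (derivx p hf).
  by rewrite -surjective_pairing; exact: (deriv1 _ hF).
- move=> p; apply: is_derive_comp1; first exact: (derivy p hf).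
  by rewrite -surjective_pairing; exact: (deriv1 _ hF).
- by apply: CkM; [apply: IH => //; exact: Dk_d|exact: Ck_dx].
- by apply: CkM; [apply: IH => //; exact: Dk_d|exact: Ck_dy].
Qed.

Lemma Dk_exp n : Dk n (@expR R).
Proof.
have e : derive1 (@expR R) = @expR R by apply: d1E => t; exact: is_derive_expR.
elim: n => [|n IH]; first by split => // t; exact: continuous_expR.
by apply: (@DkP _ _ (@expR R)) => // t; exact: is_derive_expR.
Qed.

Lemma Ck_shift n f (v : P2) : Ck n f -> Ck n (fun p => f (p + v)).
Proof.
have cs : continuous (fun p : P2 => p + v).
  by move=> p; apply: cvgD; [exact: cvg_id|exact: cvg_cst].
elim: n f => [|n IH] f hf.
  by split => // p; apply: continuous_comp; [exact: cs|exact: (Ck_cont hf)].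
have sh (a t : R) : is_derive t (1 : R) (fun t => t + a) 1.
  by apply: (isd_eq (is_deriveD (is_derive_id t (1 : R)) (is_derive_cst a t (1 : R)))); rewrite addr0.
apply: (@CkP _ _ (fun p => dx f (p + v)) (fun p => dy f (p + v))).
- by move=> p; apply: continuous_comp; [exact: cs|exact: (Ck_cont hf)].
- by move=> p; apply: (isd_eq (is_derive_comp1 (sh v.1 p.1) (derivx (p + v) hf))); rewrite mulr1.
- by move=> p; apply: (isd_eq (is_derive_comp1 (sh v.2 p.2) (derivy (p + v) hf))); rewrite mulr1.
- by apply: IH; exact: Ck_dx.
- by apply: IH; exact: Ck_dy.
Qed.

Lemma locdx0 f p (e : R) : 0 < e -> (forall t, `|t - p.1| < e -> f (t, p.2) = 0) -> dx f p = 0.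
Proof.
move=> e0 h; rewrite dx.unlock derive1E.
have -> : 'D_1 (fun t => f (t, p.2)) p.1 = 'D_1 (fun=> 0 : R) p.1.
  apply: near_eq_derive; rewrite ?oner_neq0//.
  near=> t; apply: h; rewrite distrC; near: t; exact: cvgr_dist_lt.
by rewrite derive_cst.
Unshelve. all: by end_near. Qed.

Lemma locdy0 f p (e : R) : 0 < e -> (forall t, `|t - p.2| < e -> f (p.1, t) = 0) -> dy f p = 0.
Proof.
move=> e0 h; rewrite dy.unlock derive1E.
have -> : 'D_1 (fun t => f (p.1, t)) p.2 = 'D_1 (fun=> 0 : R) p.2.
  apply: near_eq_derive; rewrite ?oner_neq0//.
  near=> t; apply: h; rewrite distrC; near: t; exact: cvgr_dist_lt.
by rewrite derive_cst.
Unshelve. all: by end_near. Qed.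

Lemma norm_near p (M : R) : M < `|p| -> exists2 e : R, 0 < e &
  (forall t, `|t - p.1| < e -> M < `|(t, p.2)|) /\ (forall t, `|t - p.2| < e -> M < `|(p.1, t)|).
Proof.
move=> h; exists (`|p| - M); first by rewrite subr_gt0.
split => t ht.
  have E : p = (t, p.2) + (p.1 - t, 0).
    by rewrite [LHS]surjective_pairing; congr pair; rewrite /= ?addr0// addrC subrK.
  have := ler_normD (t, p.2) (p.1 - t, 0 : R); rewrite -E.
  have : `|(p.1 - t, 0 : R)| = `|t - p.1|.
    by rewrite prod_normE/= normr0 distrC; apply/max_idPl.
  lra.
have E : p = (p.1, t) + (0, p.2 - t).
  by rewrite [LHS]surjective_pairing; congr pair; rewrite /= ?addr0// addrC subrK.
have := ler_normD (p.1, t) (0 : R, p.2 - t); rewrite -E.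
have : `|(0 : R, p.2 - t)| = `|t - p.2|.
  by rewrite prod_normE/= normr0 distrC; apply/max_idPr.
lra.
Qed.

Lemma csupp_dx f : csupp f -> csupp (dx f).
Proof.
move=> [M h]; exists M => p pM; have [e e0 [h1 _]] := norm_near pM.
by apply: (locdx0 e0) => t /h1; exact: h.
Qed.

Lemma csupp_dy f : csupp f -> csupp (dy f).
Proof.
move=> [M h]; exists M => p pM; have [e e0 [_ h1]] := norm_near pM.
by apply: (locdy0 e0) => t /h1; exact: h.
Qed.

Lemma integral_supp (f : R -> R) (M : R) : (forall t, M < `|t| -> f t = 0) ->
  (\int[lebesgue_measure]_t (f t)%:E = \int[lebesgue_measure]_(t in `[(- M)%R, M]%classic) (f t)%:E)%E.
Proof.
move=> h; rewrite [RHS]integral_mkcond; apply: eq_integral => t _.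
rewrite patchE; case: ifPn => // /negP; rewrite inE/= in_itv/= -ler_norml => tM.
by rewrite h// ltNge; apply/negP.
Qed.

Lemma ftc_supp (F f : R -> R) (M : R) : 0 < M -> continuous f ->
  (forall t : R, is_derive t (1 : R) F (f t)) -> (forall t, M <= `|t| -> F t = 0) ->
  (\int[lebesgue_measure]_(t in `[(- M)%R, M]%classic) (f t)%:E = 0)%E.
Proof.
move=> M0 cf hF FM.
have cF : continuous F.
  by move=> t; apply: differentiable_continuous; apply/derivable1_diffP; case: (hF t).
rewrite (@continuous_FTC2 R f F (- M) M).
- by rewrite !FM ?subee// ?normrN ger0_norm// ltW.
- by rewrite -subr_gt0 opprK addr_gt0.
- exact: continuous_subspaceT.
- split.
  + by move=> t _; case: (hF t).
  + by apply: cvg_at_right_filter; exact: cF.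
  + by apply: cvg_at_left_filter; exact: cF.
- by move=> t _; rewrite derive1E; case: (hF t).
Qed.

Lemma cont_pairx (y : R) : continuous (fun t : R => (t, y)).
Proof. by move=> t; apply: (@cvg_pair _ _ _ (nbhs t) (nbhs t) (nbhs y)); [exact: cvg_id|exact: cvg_cst]. Qed.

Lemma cont_pairy (x : R) : continuous (fun t : R => (x, t)).
Proof. by move=> t; apply: (@cvg_pair _ _ _ (nbhs t) (nbhs x) (nbhs t)); [exact: cvg_cst|exact: cvg_id]. Qed.

(** Fubini reduces the integral to horizontal lines, on each of which it vanishes by the fundamental
    theorem of calculus. *)
Lemma I_dx0 f : Ck 1 f -> csupp f -> I Leb (dx f) = 0.
Proof.
(* Strictly beyond [M0], because the primitive has to vanish at the end points [-M] and [M]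
   themselves. *)
move=> cf sf; have [M0 hM0] := sf; pose M := `|M0| + 1.
have M0M : M0 < M by rewrite (le_lt_trans (ler_norm _))// ltrDl.
have Mpos : 0 < M by rewrite ltr_wpDl.
have cd := Ck_cont (Ck_dx cf).
rewrite I.unlock /Rintegral fubini_Leb2; last by apply: cont_intg => //; [exact: Leb_lfin|exact: csupp_dx].
rewrite (eq_integral (fun=> 0%E)) ?integral0// => y _.
have nx (t : R) : `|t| <= `|(t, y : R)| by rewrite prod_normE le_max lexx.
rewrite (@integral_supp _ M); last first.
  move=> t tM; have [M1 hM1] := csupp_dx sf.
  have [e e0 [h1 _]] := @norm_near (t, y) M0 (lt_le_trans (lt_trans M0M tM) (nx t)).
  by apply: (locdx0 e0) => s /h1; exact: hM0.
apply: (@ftc_supp (fun t => f (t, y))) => //.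
- move=> t; apply: (@continuous_comp _ _ _ (fun t => (t, y)) (dx f)); last exact: cd.
  exact: cont_pairx.
- by move=> t; exact: (derivx (t, y) cf).
- by move=> t tM; apply: hM0; rewrite (lt_le_trans M0M)// (le_trans tM).
Qed.

Lemma I_dy0 f : Ck 1 f -> csupp f -> I Leb (dy f) = 0.
Proof.
move=> cf sf; have [M0 hM0] := sf; pose M := `|M0| + 1.
have M0M : M0 < M by rewrite (le_lt_trans (ler_norm _))// ltrDl.
have Mpos : 0 < M by rewrite ltr_wpDl.
have cd := Ck_cont (Ck_dy cf).
rewrite I.unlock /Rintegral fubini_Leb; last by apply: cont_intg => //; [exact: Leb_lfin|exact: csupp_dy].
rewrite (eq_integral (fun=> 0%E)) ?integral0// => x _.
have nx (t : R) : `|t| <= `|(x : R, t)| by rewrite prod_normE le_max lexx orbT.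
rewrite (@integral_supp _ M); last first.
  move=> t tM.
  have [e e0 [_ h1]] := @norm_near (x, t) M0 (lt_le_trans (lt_trans M0M tM) (nx t)).
  by apply: (locdy0 e0) => s /h1; exact: hM0.
apply: (@ftc_supp (fun t => f (x, t))) => //.
- move=> t; apply: (@continuous_comp _ _ _ (fun t => (x, t)) (dy f)); last exact: cd.
  exact: cont_pairy.
- by move=> t; exact: (derivy (x, t) cf).
- by move=> t tM; apply: hM0; rewrite (lt_le_trans M0M)// (le_trans tM).
Qed.

Lemma dxM f g n m : Ck n.+1 f -> Ck m.+1 g ->
  dx (fun p => f p * g p) = (fun p => f p * dx g p + g p * dx f p).
Proof.
move=> hf hg; apply: dxE => p; apply: (isd_eq (is_deriveM (derivx p hf) (derivx p hg))).
by rewrite -surjective_pairing.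
Qed.

Lemma dyM f g n m : Ck n.+1 f -> Ck m.+1 g ->
  dy (fun p => f p * g p) = (fun p => f p * dy g p + g p * dy f p).
Proof.
move=> hf hg; apply: dyE => p; apply: (isd_eq (is_deriveM (derivy p hf) (derivy p hg))).
by rewrite -surjective_pairing.
Qed.

Lemma dxD f g n m : Ck n.+1 f -> Ck m.+1 g -> dx (fun p => f p + g p) = (fun p => dx f p + dx g p).
Proof. by move=> hf hg; apply: dxE => p; exact: (is_deriveD (derivx p hf) (derivx p hg)). Qed.

Lemma dyD f g n m : Ck n.+1 f -> Ck m.+1 g -> dy (fun p => f p + g p) = (fun p => dy f p + dy g p).
Proof. by move=> hf hg; apply: dyE => p; exact: (is_deriveD (derivy p hf) (derivy p hg)). Qed.

Lemma dxZ (c : R) f n : Ck n.+1 f -> dx (fun p => c * f p) = (fun p => c * dx f p).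
Proof.
move=> hf; apply: dxE => p; apply: (isd_eq (is_deriveM (is_derive_cst c p.1 (1 : R)) (derivx p hf))).
by rewrite scaler0 addr0.
Qed.

Lemma dyZ (c : R) f n : Ck n.+1 f -> dy (fun p => c * f p) = (fun p => c * dy f p).
Proof.
move=> hf; apply: dyE => p; apply: (isd_eq (is_deriveM (is_derive_cst c p.2 (1 : R)) (derivy p hf))).
by rewrite scaler0 addr0.
Qed.

Lemma dx_comp F f n m : Dk n.+1 F -> Ck m.+1 f -> dx (fun p => F (f p)) = (fun p => derive1 F (f p) * dx f p).
Proof.
move=> hF hf; apply: dxE => p; apply: is_derive_comp1; first exact: (derivx p hf).
by rewrite -surjective_pairing; exact: (deriv1 _ hF).
Qed.

Lemma dy_comp F f n m : Dk n.+1 F -> Ck m.+1 f -> dy (fun p => F (f p)) = (fun p => derive1 F (f p) * dy f p).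
Proof.
move=> hF hf; apply: dyE => p; apply: is_derive_comp1; first exact: (derivy p hf).
by rewrite -surjective_pairing; exact: (deriv1 _ hF).
Qed.

Lemma dx_fst : dx (fun p => p.1) = (fun=> 1).
Proof. by apply: dxE => p; exact: is_derive_id. Qed.
Lemma dy_snd : dy (fun p => p.2) = (fun=> 1).
Proof. by apply: dyE => p; exact: is_derive_id. Qed.
Lemma dx_cst (c : R) : dx (fun=> c) = (fun=> 0).
Proof. by apply: dxE => p; exact: is_derive_cst. Qed.
Lemma dy_cst (c : R) : dy (fun=> c) = (fun=> 0).
Proof. by apply: dyE => p; exact: is_derive_cst. Qed.

Lemma ibp_x f g : Ck 1 f -> Ck 1 g -> csupp g ->
  I Leb (fun p => f p * dx g p) = - I Leb (fun p => dx f p * g p).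
Proof.
move=> hf hg sg; apply/eqP; rewrite -subr_eq0 opprK -ID.
- rewrite -(I_dx0 (CkM hf hg)); last exact: csuppM.
  by apply/eqP; congr I; rewrite (dxM hf hg); apply/funext => p; rewrite [dx f p * _]mulrC.
- apply: cont_intg; [exact: Leb_lfin| |by apply: csuppM; exact: csupp_dx].
  by move=> p; apply: cvgM; [exact: (Ck_cont hf)|exact: (Ck_cont (Ck_dx hg))].
- apply: cont_intg; [exact: Leb_lfin| |exact: csuppM].
  by move=> p; apply: cvgM; [exact: (Ck_cont (Ck_dx hf))|exact: (Ck_cont hg)].
Qed.

Lemma ibp_y f g : Ck 1 f -> Ck 1 g -> csupp g ->
  I Leb (fun p => f p * dy g p) = - I Leb (fun p => dy f p * g p).
Proof.
move=> hf hg sg; apply/eqP; rewrite -subr_eq0 opprK -ID.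
- rewrite -(I_dy0 (CkM hf hg)); last exact: csuppM.
  by apply/eqP; congr I; rewrite (dyM hf hg); apply/funext => p; rewrite [dy f p * _]mulrC.
- apply: cont_intg; [exact: Leb_lfin| |by apply: csuppM; exact: csupp_dy].
  by move=> p; apply: cvgM; [exact: (Ck_cont hf)|exact: (Ck_cont (Ck_dy hg))].
- apply: cont_intg; [exact: Leb_lfin| |exact: csuppM].
  by move=> p; apply: cvgM; [exact: (Ck_cont (Ck_dy hf))|exact: (Ck_cont hg)].
Qed.

End Smooth.

(** * Mean value theorem, first-order expansion, mixed derivatives *)

Section Taylor.
Context {R : realType}.
Local Notation P2 := (R * R)%type.
Implicit Types (p q z w h : P2) (f g : P2 -> R) (F G : R -> R).

Lemma cont_eps f p (e : R) : continuous f -> 0 < e ->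
  exists2 d : R, 0 < d & forall q, `|q - p| < d -> `|f q - f p| < e.
Proof.
move=> /(_ p)/cvgrPdist_lt cf e0.
have /nbhs_ballP[d /= d0 hd] := cf _ e0.
exists d => // q hq; rewrite distrC; apply: hd.
by rewrite -ball_normE /ball_/= distrC.
Qed.

Lemma eps_cont f p : (forall e : R, 0 < e -> exists2 d : R, 0 < d &
   forall q, `|q - p| < d -> `|f q - f p| < e) -> {for p, continuous f}.
Proof.
move=> hf; apply/cvgrPdist_lt => e e0; have [d d0 hd] := hf e e0.
suff : nbhs p [set q | `|f p - f q| < e] by [].
apply/nbhs_ballP; exists d => //= q; rewrite -ball_normE /ball_/= => hq.
by rewrite distrC; apply: hd; rewrite distrC.
Qed.

Lemma derive_cont F G : (forall t : R, is_derive t (1 : R) F (G t)) -> continuous F.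
Proof.
move=> h t; apply: differentiable_continuous; apply/derivable1_diffP; by case: (h t).
Qed.

(** Stated without an order between [a] and [b], the point [c] being located by its distance to [a]
    only: this covers increments of either sign. *)
Lemma mvt F G (a b : R) : (forall t : R, is_derive t (1 : R) F (G t)) ->
  exists2 c : R, `|c - a| <= `|b - a| & F b - F a = G c * (b - a).
Proof.
move=> hF; have cF := derive_cont hF.
have [ab|ba|<-] := ltgtP a b; last first.
- by exists a => //; rewrite !subrr mulr0.
- have [c] := @MVT R F G b a ba (fun t _ => hF t) (continuous_subspaceT cF).
  rewrite in_itv/= => /andP[c1 c2] e; exists c.
    by rewrite !ler0_norm ?subr_le0 ?ltW//; lra.
  by rewrite -opprB e; ring.
- have [c] := @MVT R F G a b ab (fun t _ => hF t) (continuous_subspaceT cF).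
  rewrite in_itv/= => /andP[c1 c2] e; exists c => //.
  by rewrite !ger0_norm ?subr_ge0 ?ltW//; lra.
Qed.

(** The increment is split into a vertical and a horizontal one; the mean value theorem applies to
    each, and continuity compares the partial derivatives at the intermediate points with those at
    [p]. *)
Lemma C1_rem f p (e : R) : Ck 1 f -> 0 < e -> exists2 d : R, 0 < d & forall h, `|h| < d ->
  `|f (p + h) - f p - (dx f p * h.1 + dy f p * h.2)| <= e * (`|h.1| + `|h.2|).
Proof.
move=> cf e0.
have [d1 d10 h1] := cont_eps p (Ck_cont (Ck_dx cf)) e0.
have [d2 d20 h2] := cont_eps p (Ck_cont (Ck_dy cf)) e0.
exists (Num.min d1 d2); first by rewrite lt_min d10 d20.
move=> h; rewrite lt_min => /andP[hd1 hd2].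
have [c c1 ce] := @mvt (fun t => f (t, p.2 + h.2)) (fun t => dx f (t, p.2 + h.2)) p.1 (p.1 + h.1)
  (fun t => derivx (t, p.2 + h.2) cf).
have [c' c1' ce'] := @mvt (fun t => f (p.1, t)) (fun t => dy f (p.1, t)) p.2 (p.2 + h.2)
  (fun t => derivy (p.1, t) cf).
rewrite [p.1 + h.1 - _]addrAC subrr add0r in c1 ce.
rewrite [p.2 + h.2 - _]addrAC subrr add0r in c1' ce'.
have -> : f (p + h) - f p - (dx f p * h.1 + dy f p * h.2) =
  (dx f (c, p.2 + h.2) - dx f p) * h.1 + (dy f (p.1, c') - dy f p) * h.2.
  have -> : f (p + h) = f (p.1 + h.1, p.2 + h.2) by [].
  have -> : f p = f (p.1, p.2) by rewrite -surjective_pairing.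
  rewrite -[f (p.1 + h.1, _)](subrK (f (p.1, p.2 + h.2))) ce.
  rewrite -[f (p.1, p.2 + h.2)](subrK (f (p.1, p.2))) ce'; ring.
rewrite (le_trans (ler_normD _ _))// mulrDr !normrM lerD// ler_wpM2r//; apply/ltW.
  apply: h1; apply: le_lt_trans hd1; rewrite norm_le2/= (le_trans c1)/=.
    by rewrite [p.2 + h.2 - _]addrAC subrr add0r; have := lexx `|h|; rewrite norm_le2 => /andP[].
  by have := lexx `|h|; rewrite norm_le2 => /andP[].
apply: h2; apply: le_lt_trans hd2; rewrite norm_le2/= subrr normr0 normr_ge0/= (le_trans c1')//.
by have := lexx `|h|; rewrite norm_le2 => /andP[].
Qed.

Lemma two_close (X A B : R) : `|X - A| < `|A - B| / 2 -> `|X - B| < `|A - B| / 2 -> False.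
Proof.
have := ler_normB (X - B) (X - A).
rewrite (_ : X - B - (X - A) = A - B); last by ring.
lra.
Qed.

(** The second difference [S] over a small square, evaluated by the mean value theorem in both
    orders, equals [d^2] times a nearby value of either mixed derivative. Were these different at
    [p], continuity would keep the two equal values apart. *)
Lemma schwarz f : Ck 2 f -> dx (dy f) = dy (dx f).
Proof.
move=> cf; apply/funext => p; apply/eqP; rewrite -subr_eq0; apply/negPn/negP => ne.
have cx := Ck_dx cf; have cy := Ck_dy cf.
set A := dx (dy f) p in ne; set B := dy (dx f) p in ne.
have e0 : 0 < `|A - B| / 2 by rewrite divr_gt0// normr_gt0.
have [d1 d10 h1] := cont_eps p (Ck_cont (Ck_dx cy)) e0.
have [d2 d20 h2] := cont_eps p (Ck_cont (Ck_dy cx)) e0.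
pose d := Num.min d1 d2 / 2.
have d0 : 0 < d by rewrite divr_gt0// lt_min d10 d20.
have dd1 : d < d1 by rewrite ltr_pdivrMr// (le_lt_trans (y := d1))// ?ge_min ?lexx// ltr_pMr// ltr1n.
have dd2 : d < d2 by rewrite ltr_pdivrMr// (le_lt_trans (y := d2))// ?ge_min ?lexx ?orbT// ltr_pMr// ltr1n.
have cf1 := CkS cf.
pose S := f (p.1 + d, p.2 + d) - f (p.1 + d, p.2) - (f (p.1, p.2 + d) - f (p.1, p.2)).
have near (u v : R) : `|u - p.1| <= `|p.1 + d - p.1| -> `|v - p.2| <= `|p.2 + d - p.2| -> `|(u, v) - p| <= d.
  rewrite ![_ + d - _]addrAC !subrr !add0r (gtr0_norm d0) => hu hv.
  by rewrite norm_le2/= hu hv.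
have [c c1 ce] := @mvt (fun t => f (t, p.2 + d) - f (t, p.2))
  (fun t => dx f (t, p.2 + d) - dx f (t, p.2)) p.1 (p.1 + d)
  (fun t => is_deriveB (derivx (t, p.2 + d) cf1) (derivx (t, p.2) cf1)).
have [c' c1' ce'] := @mvt (fun t => dx f (c, t)) (fun t => dy (dx f) (c, t)) p.2 (p.2 + d)
  (fun t => derivy (c, t) cx).
have [b b1 be] := @mvt (fun t => f (p.1 + d, t) - f (p.1, t))
  (fun t => dy f (p.1 + d, t) - dy f (p.1, t)) p.2 (p.2 + d)
  (fun t => is_deriveB (derivy (p.1 + d, t) cf1) (derivy (p.1, t) cf1)).
have [b' b1' be'] := @mvt (fun t => dy f (t, b)) (fun t => dx (dy f) (t, b)) p.1 (p.1 + d)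
  (fun t => derivx (t, b) cy).
have E : dy (dx f) (c, c') = dx (dy f) (b', b).
  have dd : d * d != 0 by rewrite mulf_neq0// gt_eqF.
  apply: (mulIf dd).
  have e1 : S = dy (dx f) (c, c') * (d * d).
    rewrite (_ : d * d = (p.2 + d - p.2) * (p.1 + d - p.1)); last by ring.
    by rewrite mulrA -ce' -ce /S; ring.
  have e2 : S = dx (dy f) (b', b) * (d * d).
    rewrite (_ : d * d = (p.1 + d - p.1) * (p.2 + d - p.2)); last by ring.
    by rewrite mulrA -be' -be /S; ring.
  exact: (etrans (esym e1) e2).
have k1 := h1 _ (le_lt_trans (near b' b b1' b1) dd1).
have k2 := h2 _ (le_lt_trans (near c c' c1 c1') dd2).
rewrite -/A in k1; rewrite -/B in k2.
rewrite -E in k1.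
exact: (two_close k1 k2).
Qed.

End Taylor.

(** * Integrals depending on a parameter *)

Section UnderIntegral.
Context {R : realType} d {T : measurableType d} (nu : {measure set T -> \bar R}).
Local Notation P2 := (R * R)%type.
Implicit Types (k : P2 -> T -> R).

(** An integrand [k z u] of class C^n in [z], such that it and its derivatives up to order [n] have
    integrable majorants uniform for [z] in bounded sets. The recursion mirrors that of [Ck]. *)
Fixpoint Kk (n : nat) k : Prop :=
  [/\ (forall z, meas (k z)), (forall u, continuous (fun z => k z u)),
      (forall M : R, exists2 G : T -> R, intg nu G & forall z u, `|z| <= M -> `|k z u| <= G u) &
  match n with
  | 0%N => True
  | m.+1 => [/\ (forall u, Ck 1 (fun z => k z u)),
                Kk m (fun z u => dx (fun z => k z u) z) &
                Kk m (fun z u => dy (fun z => k z u) z)]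
  end].

Lemma Kk_intg n k z : Kk n k -> intg nu (k z).
Proof.
case: n => [|n] [mk _ hG _]; have [G iG kG] := hG `|z|;
 by apply: (intg_le (mk z) _ iG) => u; exact: kG.
Qed.

(** Dominated convergence along a sequence: a failure of continuity at [z] would provide points at
    distance less than [1/(n+1)] from [z] along which the integrals stay away from the one at
    [z]. *)
Lemma Kk_cont n k : Kk n k -> continuous (fun z => I nu (k z)).
Proof.
move=> hk z; have [mk ck hG] : [/\ (forall z, meas (k z)), (forall u, continuous (fun z => k z u)) &
      (forall M : R, exists2 G : T -> R, intg nu G & forall z u, `|z| <= M -> `|k z u| <= G u)].
  by case: n hk => [|n] [].
have [G iG kG] := hG (`|z| + 1).
apply: eps_cont => e e0; apply: contrapT => /forall2NP hn.
have hn' (m : nat) : exists q, `|q - z| < m.+1%:R^-1 /\ e <= `|I nu (k q) - I nu (k z)|.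
  have := hn (m.+1%:R^-1); case=> [|]; first by rewrite invr_gt0 ltr0n.
  by move=> /existsNP[q /not_implyP[h1 /negP]]; rewrite -leNgt => h2; exists q.
have /choice[q hq] := hn'.
have qz : (q m) @[m --> \oo] --> z.
  apply/cvgrPdist_lt => eps eps0; have [N _ hN] := near_infty_natSinv_lt (PosNum eps0).
  exists N => //= m Nm; rewrite distrC (lt_trans (hq m).1)//; exact: hN.
have bd (m : nat) u : `|k (q m) u| <= G u.
  apply: kG; rewrite -[q m](subrKC z) (le_trans (ler_normD _ _))// lerD2l ltW//.
  apply: lt_le_trans (hq m).1 _; by rewrite invf_le1 ?ltr0n// ler1n.
have [||||_ ci] := @I_dct _ _ _ nu (fun m => k (q m)) (k z) G.
- by move=> m; exact: mk.
- by move=> u; exact: (@cvg_comp _ _ _ q (fun z => k z u) _ _ _ qz (ck u z)).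
- exact: iG.
- exact: bd.
move/cvgrPdist_lt : ci => /(_ _ e0).
move=> [N _ /(_ N (leqnn N))] /=; rewrite distrC ltNge => /negP; apply; exact: (hq N).2.
Qed.

Lemma deriv_under (g g' : R -> T -> R) (a : R) (G : T -> R) :
  (forall t, `|t - a| < 1 -> intg nu (g t)) ->
  (forall t u, `|t - a| < 1 -> is_derive t (1 : R) (fun s => g s u) (g' t u)) ->
  (forall t u, `|t - a| < 1 -> `|g' t u| <= G u) -> intg nu G ->
  is_derive a (1 : R) (fun t => I nu (g t)) (I nu (g' a)).
Proof.
move=> ig dg gG iG.
have Ia : `](a - 1), (a + 1)[%classic a by rewrite /= in_itv/= gtrBl ltrDl ltr01.
have ball t : `](a - 1), (a + 1)[%classic t -> `|t - a| < 1.
  by rewrite /= in_itv/= => /andP[h1 h2]; rewrite ltr_norml; apply/andP; split; lra.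
have gE t u : `|t - a| < 1 -> partial1of2 g t u = g' t u.
  by move=> ta; rewrite /partial1of2 derive1E; case: (dg t u ta).
have H : h^-1 *: (I nu (g (h + a)) - I nu (g a)) @[h --> 0^'] --> I nu (partial1of2 g a).
  rewrite !I.unlock; apply: (@cvg_differentiation_under_integral R d T nu g setT measurableT a (a - 1) (a + 1)
     Ia _ _ (fun u => `|G u|) (fun u => normr_ge0 _) (intg_abs iG)).
  - by move=> t /ball; exact: ig.
  - by move=> t u /ball ta _; case: (dg t u ta).
  - by move=> t u /ball ta _; rewrite gE// (le_trans (gG _ _ ta))// ler_norm.
have E : I nu (g' a) = I nu (partial1of2 g a).
  by congr I; apply/funext => u; rewrite gE// subrr normr0.
rewrite E; apply: DeriveDef.
  apply/cvg_ex; exists (I nu (partial1of2 g a)).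
  by apply: cvg_trans H; apply: near_eq_cvg; near=> h; rewrite /= scaler1.
apply/cvg_lim => //.
by apply: cvg_trans H; apply: near_eq_cvg; near=> h; rewrite /= scaler1.
Unshelve. all: by end_near. Qed.

Lemma norm_fst_le (z : P2) (t : R) : `|t - z.1| < 1 -> `|(t, z.2)| <= `|z| + 1.
Proof.
move=> h; rewrite norm_le2/=; have := lexx `|z|; rewrite norm_le2 => /andP[z1 z2].
have : `|t| <= `|z.1| + `|t - z.1| by rewrite -[in leLHS](subrKC z.1 t) ler_normD.
by move=> ?; apply/andP; split; lra.
Qed.

Lemma norm_snd_le (z : P2) (t : R) : `|t - z.2| < 1 -> `|(z.1, t)| <= `|z| + 1.
Proof.
move=> h; rewrite norm_le2/=; have := lexx `|z|; rewrite norm_le2 => /andP[z1 z2].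
have : `|t| <= `|z.2| + `|t - z.2| by rewrite -[in leLHS](subrKC z.2 t) ler_normD.
by move=> ?; apply/andP; split; lra.
Qed.

Lemma Kk_dx n k z : Kk n.+1 k ->
  is_derive (z.1 : R) (1 : R) (fun t => I nu (k (t, z.2))) (I nu (fun u => dx (fun z => k z u) z)).
Proof.
move=> hk; have [_ _ _ [hC hx _]] := hk.
have [G iG kG] : exists2 G : T -> R, intg nu G & forall z' u, `|z'| <= `|z| + 1 ->
    `|dx (fun z => k z u) z'| <= G u.
  by case: n hx {hk} => [|n] [_ _ /(_ (`|z| + 1))].
have := @deriv_under (fun t => k (t, z.2)) (fun t u => dx (fun z => k z u) (t, z.2)) z.1 G.
rewrite -surjective_pairing; apply => //.
- by move=> t _; exact: Kk_intg hk.
- by move=> t u _; exact: (derivx (t, z.2) (hC u)).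
- by move=> t u ht; apply: kG; exact: norm_fst_le.
Qed.

Lemma Kk_dy n k z : Kk n.+1 k ->
  is_derive (z.2 : R) (1 : R) (fun t => I nu (k (z.1, t))) (I nu (fun u => dy (fun z => k z u) z)).
Proof.
move=> hk; have [_ _ _ [hC _ hy]] := hk.
have [G iG kG] : exists2 G : T -> R, intg nu G & forall z' u, `|z'| <= `|z| + 1 ->
    `|dy (fun z => k z u) z'| <= G u.
  by case: n hy {hk} => [|n] [_ _ /(_ (`|z| + 1))].
have := @deriv_under (fun t => k (z.1, t)) (fun t u => dy (fun z => k z u) (z.1, t)) z.2 G.
rewrite -surjective_pairing; apply => //.
- by move=> t _; exact: Kk_intg hk.
- by move=> t u _; exact: (derivy (z.1, t) (hC u)).
- by move=> t u ht; apply: kG; exact: norm_snd_le.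
Qed.

Lemma Kk_Ck n k : Kk n k -> Ck n (fun z => I nu (k z)).
Proof.
elim: n k => [|n IH] k hk; first by split => //; exact: Kk_cont hk.
have [_ _ _ [_ hx hy]] := hk.
apply: (@CkP _ _ _ (fun z => I nu (fun u => dx (fun z => k z u) z))
                   (fun z => I nu (fun u => dy (fun z => k z u) z))).
- exact: Kk_cont hk.
- by move=> z; exact: Kk_dx hk.
- by move=> z; exact: Kk_dy hk.
- exact: IH.
- exact: IH.
Qed.

Lemma dx_I n k : Kk n.+1 k -> dx (fun z => I nu (k z)) = fun z => I nu (fun u => dx (fun z => k z u) z).
Proof. by move=> hk; apply: dxE => z; exact: Kk_dx hk. Qed.

Lemma dy_I n k : Kk n.+1 k -> dy (fun z => I nu (k z)) = fun z => I nu (fun u => dy (fun z => k z u) z).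
Proof. by move=> hk; apply: dyE => z; exact: Kk_dy hk. Qed.
End UnderIntegral.

(** * Convolution with a test function *)

Section Convolution.
Context {R : realType} (nu : {measure set (R * R) -> \bar R}).
Local Notation P2 := (R * R)%type.
Implicit Types (a f : P2 -> R).

(** The kernel is taken at [w - z], hence a minus sign with each derivative, which cancels in the
    Laplacian. The measure is arbitrary: Lebesgue measure for averages, [mu] for potentials. *)
Definition conv a f : P2 -> R := fun z => I nu (fun w => f w * a (w - z)).

Lemma refl_cont a (u : P2) : continuous a -> continuous (fun z : P2 => a (u - z)).
Proof.
move=> ca z; apply: continuous_comp; last exact: ca.
by apply: cvgB; [exact: cvg_cst|exact: cvg_id].
Qed.

Lemma is_derive_refl (F : R -> R) (b t dF : R) : is_derive (b - t) (1 : R) F dF ->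
  is_derive t (1 : R) (fun s => F (b - s)) (- dF).
Proof.
move=> h; have h1 : is_derive t (1 : R) (fun s => b - s) (-1).
  by apply: (isd_eq (is_deriveB (is_derive_cst b t (1 : R)) (is_derive_id t (1 : R)))); rewrite sub0r.
by apply: (isd_eq (is_derive_comp1 h1 h)); rewrite mulrN1.
Qed.

Lemma dx_refl n a (u : P2) : Ck n.+1 a -> dx (fun z => a (u - z)) = (fun z => - dx a (u - z)).
Proof.
move=> ca; apply: dxE => z.
by apply: (@is_derive_refl (fun t => a (t, u.2 - z.2))); exact: (derivx (u - z) ca).
Qed.

Lemma dy_refl n a (u : P2) : Ck n.+1 a -> dy (fun z => a (u - z)) = (fun z => - dy a (u - z)).
Proof.
move=> ca; apply: dyE => z.
by apply: (@is_derive_refl (fun t => a (u.1 - z.1, t))); exact: (derivy (u - z) ca).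
Qed.

Lemma Ck_refl n a (u : P2) : Ck n a -> Ck n (fun z => a (u - z)).
Proof.
elim: n a => [|n IH] a ca; first by split => //; apply: refl_cont; exact: Ck_cont ca.
apply: (@CkP _ _ _ (fun z => - dx a (u - z)) (fun z => - dy a (u - z))).
- by apply: refl_cont; exact: Ck_cont ca.
- by move=> z; apply: (@is_derive_refl (fun t => a (t, u.2 - z.2))); exact: (derivx (u - z) ca).
- by move=> z; apply: (@is_derive_refl (fun t => a (u.1 - z.1, t))); exact: (derivy (u - z) ca).
- by apply: CkN; apply: IH; exact: Ck_dx.
- by apply: CkN; apply: IH; exact: Ck_dy.
Qed.

Lemma Kk_conv n a f : Ck n a -> csupp a -> lint nu f -> Kk nu n (fun (z w : P2) => f w * a (w - z)).
Proof.
move=> ca sa lf; elim: n a ca sa => [|n IH] a ca sa.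
all: have [mf hf] := lf.
all: have h1 : forall z : P2, meas (fun w => f w * a (w - z)).
1,3: move=> z; apply: measurable_funM => //; apply: cont_meas => w;
  apply: (@continuous_comp _ _ _ (fun w : P2 => w - z) a); [by apply: cvgB; [exact: cvg_id|exact: cvg_cst]|exact: (Ck_cont ca)].
all: have h2 : forall u : P2, continuous (fun z : P2 => f u * a (u - z)).
1,3: by move=> u z; apply: cvgM; [exact: cvg_cst|apply: refl_cont; exact: Ck_cont ca].
(* For [|z| <= M] and [a] supported in the square of radius [N], only points [u] of the square of
   radius [N + M] contribute; there [f] is integrable and [a] is bounded. *)
all: have h3 : forall M : R, exists2 G : P2 -> R, intg nu G & forall (z u : P2), `|z| <= M -> `|f u * a (u - z)| <= G u.
1,3: move=> M; have [N hN] := sa; have [C hC] := lbd_csupp (cont_lbd (Ck_cont ca)) sa;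
  exists (fun u => `|C| * `|f u * \1_(bbox (N + M)) u|); [by apply: intgZ; apply: intg_abs|move=> z u zM;
  rewrite normrM; have [uN|uN] := leP `|u| (N + M); [rewrite indicE mem_set// mulr1 mulrC ler_wpM2r// (le_trans (hC _))// ler_norm//|
  rewrite hN ?normr0 ?mulr0 ?mulr_ge0//; have : `|u| <= `|u - z| + `|z| by rewrite -[in leLHS](subrK z u) ler_normD]; lra].
- by split.
- split => //; split.
  + by move=> u; apply: (CkZ (f u)); apply: Ck_refl; apply: Ck_le ca.
  + have := IH (fun w => - dx a w) (CkN (Ck_dx ca)) (csuppN (csupp_dx sa)).
    congr (Kk nu n); apply/funext => z; apply/funext => u.
    by rewrite (dxZ (f u) (Ck_refl u ca)) (dx_refl u ca).
  + have := IH (fun w => - dy a w) (CkN (Ck_dy ca)) (csuppN (csupp_dy sa)).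
    congr (Kk nu n); apply/funext => z; apply/funext => u.
    by rewrite (dyZ (f u) (Ck_refl u ca)) (dy_refl u ca).
Qed.

Lemma conv_Ck n a f : Ck n a -> csupp a -> lint nu f -> Ck n (conv a f).
Proof. by move=> ca sa lf; apply: Kk_Ck; exact: Kk_conv. Qed.

Lemma conv_dx n a f : Ck n.+1 a -> csupp a -> lint nu f ->
  dx (conv a f) = (fun z => - conv (dx a) f z).
Proof.
move=> ca sa lf; rewrite /conv (dx_I (Kk_conv ca sa lf)); apply/funext => z.
rewrite -IN; last exact: (Kk_intg _ (Kk_conv (Ck_dx ca) (csupp_dx sa) lf)).
by congr I; apply/funext => u; rewrite (dxZ (f u) (Ck_refl u ca)) (dx_refl u ca) mulrN.
Qed.

Lemma conv_dy n a f : Ck n.+1 a -> csupp a -> lint nu f ->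
  dy (conv a f) = (fun z => - conv (dy a) f z).
Proof.
move=> ca sa lf; rewrite /conv (dy_I (Kk_conv ca sa lf)); apply/funext => z.
rewrite -IN; last exact: (Kk_intg _ (Kk_conv (Ck_dy ca) (csupp_dy sa) lf)).
by congr I; apply/funext => u; rewrite (dyZ (f u) (Ck_refl u ca)) (dy_refl u ca) mulrN.
Qed.

Lemma conv_intg a f z : continuous a -> csupp a -> lint nu f -> intg nu (fun w => f w * a (w - z)).
Proof. by move=> ca sa lf; apply: (Kk_intg z (@Kk_conv 0 a f _ sa lf)); split. Qed.

End Convolution.

(** * Gluing differentiable functions at a point *)

Section Glue.
Context {R : realType}.
Implicit Types (F G f g : R -> R).

Lemma is_derive_epsP F (x d : R) : is_derive x (1 : R) F d <->
  (forall e : R, 0 < e -> \forall h \near 0^', `|d - h^-1 * (F (h + x) - F x)| < e).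
Proof.
have E : (fun h : R => h^-1 *: (F (h *: (1 : R) + x) - F x)) = (fun h => h^-1 * (F (h + x) - F x)).
  by apply/funext => h; rewrite scaler1.
split.
  move=> [h1 h2]; have : (fun h : R => h^-1 *: (F (h *: (1 : R) + x) - F x)) @ 0^' --> d.
    by rewrite -h2; exact: h1.
  by rewrite E => /cvgrPdist_lt.
move=> h; have H : (fun h : R => h^-1 *: (F (h *: (1 : R) + x) - F x)) @ 0^' --> d.
  by rewrite E; apply/cvgrPdist_lt.
apply: DeriveDef; first by apply/cvg_ex; exists d.
exact/cvg_lim.
Qed.

Lemma is_derive_near F G (x d : R) : (\forall t \near x, F t = G t) ->
  is_derive x (1 : R) F d -> is_derive x (1 : R) G d.
Proof.
move=> FG [h1 h2]; have v1 : (1 : R) != 0 by rewrite oner_neq0.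
apply: DeriveDef; first by apply: near_eq_derivable h1.
by rewrite -h2; symmetry; apply: near_eq_derive.
Qed.

(** Both pieces are differentiable on a neighbourhood of 1, [g] possibly only on positive reals as
    the logarithm is. At the junction each difference quotient is that of one of two functions with
    the same value and the same derivative. *)
Lemma glue f g f' g' : (forall t : R, is_derive t (1 : R) f (f' t)) ->
  (forall t : R, 0 < t -> is_derive t (1 : R) g (g' t)) -> f 1 = g 1 -> f' 1 = g' 1 ->
  forall t : R, is_derive t (1 : R) (fun t => if t <= 1 then f t else g t)
     (if t <= 1 then f' t else g' t).
Proof.
move=> hf hg e e' t; have [t1|t1|t1] := ltgtP t 1.
- apply: (is_derive_near _ (hf t)).
  by near=> u; rewrite ifT// ltW//; near: u; exact: lt_nbhsl.
- apply: (is_derive_near _ (hg t (lt_trans ltr01 t1))).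
  by near=> u; rewrite ifF//; apply/negbTE; rewrite -ltNge; near: u; exact: lt_nbhsr.
- rewrite t1; apply/is_derive_epsP => eps eps0.
  have [h1 h2] := (hf 1, hg 1 ltr01).
  move/is_derive_epsP : h1 => /(_ _ eps0) h1; move/is_derive_epsP : h2 => /(_ _ eps0) h2.
  near=> h; have k1 : `|f' 1 - h^-1 * (f (h + 1) - f 1)| < eps by near: h.
  have k2 : `|g' 1 - h^-1 * (g (h + 1) - g 1)| < eps by near: h.
  by rewrite lexx; case: ifP => // _; rewrite e' e.
Unshelve. all: by end_near. Qed.
End Glue.

(** * Radial kernels *)

Section RadialProfile.
Context {R : realType}.
Implicit Types (t : R).

(** The truncated power [(1 - t)_+^k], of class C^(k-1) for [k >= 1]; differentiation lowers the
    exponent by one. *)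
Definition pw (k : nat) t : R := if t <= 1 then (1 - t) ^+ k else 0.

Lemma is_derive_pow (F : R -> R) (d : R) (k : nat) t : is_derive t (1 : R) F d ->
  is_derive t (1 : R) (fun t => F t ^+ k.+1) (k.+1%:R * F t ^+ k * d).
Proof.
move=> h; elim: k => [|k IH]; first by apply: (isd_eq h); rewrite expr0; ring.
have -> : (fun t => F t ^+ k.+2) = (fun t => F t * F t ^+ k.+1).
  by apply/funext => u; rewrite exprS.
apply: (isd_eq (is_deriveM h IH)); rewrite /= /GRing.scale/= -[k.+2%:R]natr1 exprS; ring.
Qed.

Lemma is_derive_inv1 (F : R -> R) (d : R) t : F t != 0 -> is_derive t (1 : R) F d ->
  is_derive t (1 : R) (fun t => (F t)^-1) (- (F t) ^- 2 * d).
Proof. by move=> Fn h; exact: is_deriveV. Qed.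

Lemma is_derive_1mX (k : nat) t : is_derive t (1 : R) (fun t => (1 - t) ^+ k.+1) (- (k.+1%:R * (1 - t) ^+ k)).
Proof.
have h : is_derive t (1 : R) (fun t => 1 - t) (-1).
  by apply: (isd_eq (is_deriveB (is_derive_cst (1 : R) t (1 : R)) (is_derive_id t (1 : R)))); rewrite sub0r.
by apply: (isd_eq (is_derive_pow k h)); ring.
Qed.

Lemma pw_derive (k : nat) t : is_derive t (1 : R) (pw k.+2) (- (k.+2%:R * pw k.+1 t)).
Proof.
have := @glue R _ (fun=> 0) _ (fun=> 0) (is_derive_1mX k.+1) (fun t _ => is_derive_cst (0:R) t (1:R)).
rewrite !subrr !exprS !mul0r mulr0 oppr0 => /(_ erefl erefl t).
by rewrite /pw; case: ifP => //; rewrite mulr0 oppr0.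
Qed.

Lemma pw_ge0 k t : 0 <= pw k t.
Proof. by rewrite /pw; case: ifP => // t1; rewrite exprn_ge0// subr_ge0. Qed.

Lemma pw_le1 k t : 0 <= t -> pw k t <= 1.
Proof. by move=> t0; rewrite /pw; case: ifP => // t1; rewrite exprn_ile1 ?subr_ge0//; lra. Qed.

Lemma pw_0 k t : 1 <= t -> pw k.+1 t = 0.
Proof.
by move=> t1; rewrite /pw; case: ifP => // t2; rewrite (_ : t = 1) ?subrr ?exprS ?mul0r//; lra.
Qed.

Lemma Dk_ext n (F G : R -> R) : F =1 G -> Dk n F -> Dk n G.
Proof. by move=> /funext ->. Qed.

Lemma DkZ n (c : R) (F : R -> R) : Dk n F -> Dk n (fun t => c * F t).
Proof. by move=> h; apply: DkM => //; exact: Dk_cst. Qed.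

Lemma pw_Dk n : Dk n (pw n.+1).
Proof.
elim: n => [|n IH].
  split => //; have -> : pw 1 = fun t => (`|1 - t| + (1 - t)) / 2.
    apply/funext => t; rewrite /pw; case: ifPn => t1.
      by rewrite expr1 ger0_norm ?subr_ge0//; field.
    by rewrite ltr0_norm ?addNr ?mul0r// subr_lt0 ltNge.
  have c : continuous (fun t : R => 1 - t) by move=> t; apply: cvgB; [exact: cvg_cst|exact: cvg_id].
  move=> t; apply: cvgM; last exact: cvg_cst.
  by apply: cvgD; [apply: cvg_norm; exact: c|exact: c].
apply: (DkP (pw_derive n)).
by have := DkZ (- n.+2%:R) IH; apply: Dk_ext => t; rewrite mulNr.
Qed.

(* [N0] is [ln t / 2] with the part [t < 1] replaced by its Taylor polynomial at 1, so that
   [4 (N0' + t N0'')], the Laplacian of [N0 |w|^2], is a multiple of [(1 - t)^4] for [t <= 1] and 0 beyond. *)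
Definition N0 t : R := if t <= 1 then
  - 2^-1 * ((1 - t) + 2^-1 * (1 - t) ^+ 2 + 3^-1 * (1 - t) ^+ 3 + 4^-1 * (1 - t) ^+ 4 + 5^-1 * (1 - t) ^+ 5)
  else 2^-1 * ln t.
Definition N1 t : R := if t <= 1 then
  2^-1 * (1 + (1 - t) + (1 - t) ^+ 2 + (1 - t) ^+ 3 + (1 - t) ^+ 4) else 2^-1 * t^-1.
Definition N2 t : R := if t <= 1 then
  - 2^-1 * (1 + 2 * (1 - t) + 3 * (1 - t) ^+ 2 + 4 * (1 - t) ^+ 3) else - 2^-1 * t ^- 2.
Definition N3 t : R := if t <= 1 then
  2^-1 * (2 + 6 * (1 - t) + 12 * (1 - t) ^+ 2) else t ^- 3.
Definition N4 t : R := if t <= 1 then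
  - 2^-1 * (6 + 24 * (1 - t)) else - 3 * t ^- 4.

Let dm (c : R) (f : R -> R) (d : R) t : is_derive t (1 : R) f d -> is_derive t (1 : R) (fun t => c * f t) (c * d).
Proof.
move=> h; apply: (isd_eq (is_deriveM (is_derive_cst c t (1 : R)) h)).
by rewrite scaler0 addr0.
Qed.

Let d1m t : is_derive t (1 : R) (fun t => 1 - t) (-1).
Proof. by apply: (isd_eq (is_deriveB (is_derive_cst (1 : R) t (1 : R)) (is_derive_id t (1 : R)))); rewrite sub0r. Qed.

Let dX (k : nat) t : 0 < t -> is_derive t (1 : R) (fun t => t ^- k.+1) (- k.+1%:R * t ^- k.+2).
Proof.
move=> t0; have tn : t != 0 by rewrite gt_eqF.
have h := is_derive_pow k (is_derive_id t (1 : R)).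
have tk : t ^+ k.+1 != 0 by rewrite expf_neq0.
apply: (isd_eq (@is_derive_inv1 (fun t => t ^+ k.+1) _ t tk h)).
rewrite [t ^+ k.+2]exprS [t ^+ k.+1]exprS.
have : t ^+ k != 0 by rewrite expf_neq0.
by move: (t ^+ k) (k.+1%:R : R) => x c x0; field; rewrite x0 tn.
Qed.

Lemma N0_derive t : is_derive t (1 : R) N0 (N1 t).
Proof.
move: t; rewrite /N0 /N1; apply: glue.
- by move=> u; apply: isd_eq; rewrite /GRing.scale/=; field.
- by move=> u u0; apply: dm; exact: is_derive1_ln.
- by rewrite subrr ln1; field.
- by rewrite subrr invr1; field.
Qed.

Lemma N1_derive t : is_derive t (1 : R) N1 (N2 t).
Proof.
move: t; rewrite /N1 /N2; apply: glue.
- by move=> u; apply: isd_eq; rewrite /GRing.scale/=; field.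
- move=> u u0; apply: isd_eq; first by apply: dm; exact: dX 0 u u0.
  by ring.
- by rewrite subrr invr1; field.
- by rewrite subrr expr1n invr1; field.
Qed.

Lemma N2_derive t : is_derive t (1 : R) N2 (N3 t).
Proof.
move: t; rewrite /N2 /N3; apply: glue.
- by move=> u; apply: isd_eq; rewrite /GRing.scale/=; field.
- move=> u u0; apply: isd_eq; first by apply: dm; exact: dX 1 u u0.
  by field; rewrite gt_eqF.
- by rewrite subrr expr1n invr1; field.
- by rewrite subrr expr1n invr1; field.
Qed.

Lemma N3_derive t : is_derive t (1 : R) N3 (N4 t).
Proof.
move: t; rewrite /N3 /N4; apply: glue.
- by move=> u; apply: isd_eq; rewrite /GRing.scale/=; field.
- by move=> u u0; exact: dX 2 u u0.
- by rewrite subrr expr1n invr1; field.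
- by rewrite subrr expr1n invr1; field.
Qed.

Lemma N0_Dk : Dk 3 N0.
Proof.
apply: (DkP N0_derive); apply: (DkP N1_derive); apply: (DkP N2_derive); split => //.
exact: derive_cont N3_derive.
Qed.

Lemma N0_ln t : 1 <= t -> N0 t = 2^-1 * ln t.
Proof.
move=> t1; rewrite /N0; case: ifP => // t2; have -> : t = 1 by lra.
by rewrite subrr ln1; ring.
Qed.

(** For [t <= 1] the bracket in [N1] is a geometric sum in [1 - t], and multiplication by
    [t = 1 - (1 - t)] makes it telescope. The formula gives the sign of the derivative in
    [Lr_derive]. *)
Lemma N1_pw t : 2 * (t * N1 t) = 1 - pw 5 t.
Proof.
rewrite /N1 /pw; case: ifPn => t1; first by field.
have : t != 0 by rewrite gt_eqF// (lt_trans ltr01)// ltNge.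
by move=> ?; field.
Qed.

Lemma N12_pw t : 4 * (N1 t + t * N2 t) = 10 * pw 4 t.
Proof.
rewrite /N1 /N2 /pw; case: ifPn => t1; first by field.
have : t != 0 by rewrite gt_eqF// (lt_trans ltr01)// ltNge.
by move=> ?; field.
Qed.

End RadialProfile.

(** * Averaging kernels and truncated logarithms *)

Section RadialKernels.
Context {R : realType}.
Local Notation P2 := (R * R)%type.
Implicit Types (w z p : P2) (r e : R).

Definition sq w : R := w.1 ^+ 2 + w.2 ^+ 2.

Lemma sq_ge0 w : 0 <= sq w. Proof. by rewrite addr_ge0// sqr_ge0. Qed.

Lemma sq_Ck n : Ck n sq.
Proof. by apply: CkD; (have h : forall f : P2 -> R, (fun w => f w ^+ 2) = (fun w => f w * f w) by move=> f; apply/funext => w; rewrite expr2);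
  rewrite h; apply: CkM; (exact: Ck_fst || exact: Ck_snd). Qed.

Lemma dx_sq : dx sq = (fun w => 2 * w.1).
Proof. by apply: dxE => p; rewrite /sq/=; apply: isd_eq; rewrite /GRing.scale/=; ring. Qed.

Lemma dy_sq : dy sq = (fun w => 2 * w.2).
Proof. by apply: dyE => p; rewrite /sq/=; apply: isd_eq; rewrite /GRing.scale/=; ring. Qed.

(** The profile takes [|w|^2] as its argument, which keeps radial functions smooth at the origin. *)
Definition rad (F : R -> R) (c : R) w := F (sq w * c).

Lemma rad_Ck n F c : Dk n F -> Ck n (rad F c).
Proof.
move=> hF; apply: (Ck_comp hF); apply: CkM; [exact: sq_Ck|exact: Ck_cst].
Qed.

Lemma dx_rad n F c : Dk n.+1 F -> dx (rad F c) = (fun w => 2 * c * w.1 * rad (derive1 F) c w).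
Proof.
move=> hF; rewrite (dx_comp hF (CkM (sq_Ck 1) (Ck_cst 1 c))) (dxM (sq_Ck 1) (Ck_cst 1 c)).
by rewrite dx_sq dx_cst; apply/funext => w; rewrite /rad; ring.
Qed.

Lemma dy_rad n F c : Dk n.+1 F -> dy (rad F c) = (fun w => 2 * c * w.2 * rad (derive1 F) c w).
Proof.
move=> hF; rewrite (dy_comp hF (CkM (sq_Ck 1) (Ck_cst 1 c))) (dyM (sq_Ck 1) (Ck_cst 1 c)).
by rewrite dy_sq dy_cst; apply/funext => w; rewrite /rad; ring.
Qed.

Lemma lap_rad n F c : Dk n.+2 F ->
  (fun w => dx (dx (rad F c)) w + dy (dy (rad F c)) w) =
  rad (fun t => 4 * c * (derive1 F t + t * derive1 (derive1 F) t)) c.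
Proof.
move=> hF; have h1 := Dk_d hF; have h2 := rad_Ck c h1.
rewrite (dx_rad _ hF) (dy_rad _ hF).
rewrite (dxM (CkM (Ck_cst 1 (2 * c)) (Ck_fst 1)) h2) (dyM (CkM (Ck_cst 1 (2 * c)) (Ck_snd 1)) h2).
rewrite (dxZ (2 * c) (Ck_fst 1)) (dyZ (2 * c) (Ck_snd 1)) dx_fst dy_snd (dx_rad _ h1) (dy_rad _ h1).
by apply/funext => w; rewrite /rad /sq; ring.
Qed.

Lemma d1_N0 : derive1 N0 = N1 :> (R -> R). Proof. by apply: d1E; exact: N0_derive. Qed.
Lemma d1_N1 : derive1 N1 = N2 :> (R -> R). Proof. by apply: d1E; exact: N1_derive. Qed.

(* A smoothing of [log^+ (r / |w|) - log^+ (e / |w|)], with Laplacian [al r - al e]. *)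
Definition Ek e r w := ln r - ln e + N0 (sq w * r^-2) - N0 (sq w * e^-2).
Definition al r w := 10 * r^-2 * pw 4 (sq w * r^-2).

Lemma Ek_Ck e r : Ck 3 (Ek e r).
Proof.
apply: CkB; last exact: (rad_Ck _ N0_Dk).
by apply: CkD; [exact: Ck_cst|exact: (rad_Ck _ N0_Dk)].
Qed.

Lemma al_Ck r : Ck 3 (al r).
Proof. by apply: CkZ; exact: (rad_Ck _ (pw_Dk 3)). Qed.

Lemma lap_N0 (c : R) w : dx (dx (rad N0 c)) w + dy (dy (rad N0 c)) w = 10 * c * pw 4 (sq w * c).
Proof.
have /(congr1 (fun f => f w)) := lap_rad c N0_Dk.
rewrite d1_N0 d1_N1 /rad /= => ->.
have := N12_pw (sq w * c); move: (N1 _) (N2 _) (pw _ _) => a b d h.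
by rewrite [RHS]mulrAC -h; ring.
Qed.

Lemma lap_Ek e r : (fun w => dx (dx (Ek e r)) w + dy (dy (Ek e r)) w) = (fun w => al r w - al e w).
Proof.
have cr := rad_Ck (r^-2) N0_Dk; have ce := CkN (rad_Ck (e^-2) N0_Dk).
have c0 : Ck 3 (fun w : P2 => ln r - ln e) by exact: Ck_cst.
have EE : Ek e r = (fun w => (ln r - ln e + rad N0 (r^-2) w) + -1 * rad N0 (e^-2) w).
  by apply/funext => w; rewrite mulN1r.
have c1 := CkD c0 cr; have c2 := CkZ (-1) (rad_Ck (e^-2) N0_Dk).
rewrite EE (dxD c1 c2) (dyD c1 c2) (dxD c0 cr) (dyD c0 cr) dx_cst dy_cst.
rewrite (dxZ _ (rad_Ck (e^-2) N0_Dk)) (dyZ _ (rad_Ck (e^-2) N0_Dk)).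
have z0 : Ck 2 (fun _ : P2 => 0 : R) by exact: Ck_cst.
rewrite (dxD (CkD z0 (Ck_dx cr)) (CkZ (-1) (Ck_dx (rad_Ck (e^-2) N0_Dk)))).
rewrite (dyD (CkD z0 (Ck_dy cr)) (CkZ (-1) (Ck_dy (rad_Ck (e^-2) N0_Dk)))).
rewrite (dxD z0 (Ck_dx cr)) (dyD z0 (Ck_dy cr)) dx_cst dy_cst.
rewrite (dxZ _ (Ck_dx (rad_Ck (e^-2) N0_Dk))) (dyZ _ (Ck_dy (rad_Ck (e^-2) N0_Dk))).
apply/funext => w; rewrite /al -(lap_N0 (r^-2) w) -(lap_N0 (e^-2) w).
move: (dx _ w) (dx _ w) (dy _ w) (dy _ w) => a b c d; ring.
Qed.

Lemma sq_norm w : `|w| ^+ 2 <= sq w <= 2 * `|w| ^+ 2.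
Proof.
rewrite prod_normE /sq -[w.1 ^+ 2]real_normK ?num_real// -[w.2 ^+ 2]real_normK ?num_real//.
rewrite /Order.max; have := sqr_ge0 `|w.1|; have := sqr_ge0 `|w.2|.
case: ltP => h.
  have : `|w.1| ^+ 2 <= `|w.2| ^+ 2 by rewrite ler_pXn2r ?nnegrE// ltW.
  by move: (`|w.1| ^+ 2) (`|w.2| ^+ 2) => a b; lra.
have : `|w.2| ^+ 2 <= `|w.1| ^+ 2 by rewrite ler_pXn2r ?nnegrE.
by move: (`|w.1| ^+ 2) (`|w.2| ^+ 2) => a b; lra.
Qed.

(** Beyond radius [r] both [N0] terms are in their logarithmic range and everything cancels; each of
    the two potentials alone is unbounded. *)
Lemma Ek_supp e r w : 0 < e -> e <= r -> r ^+ 2 <= sq w -> Ek e r w = 0.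
Proof.
move=> e0 er rs; have r0 : 0 < r by rewrite (lt_le_trans e0).
have s0 : 0 < sq w by rewrite (lt_le_trans _ rs)// exprn_gt0.
have h (a : R) : 0 < a -> a ^+ 2 <= sq w -> N0 (sq w * a^-2) = 2^-1 * ln (sq w) - ln a.
  move=> a0 aw; rewrite N0_ln; last by rewrite ler_pdivlMr ?mul1r// exprn_gt0.
  by rewrite lnM ?posrE ?invr_gt0 ?exprn_gt0// lnV ?posrE ?exprn_gt0// lnXn// -mulr_natl; field.
rewrite /Ek !h//; first by ring.
by rewrite (le_trans _ rs)// ler_pXn2r ?nnegrE ?(ltW e0) ?(ltW r0).
Qed.

Lemma Lr_derive (s r : R) : 0 < r ->
  is_derive r (1 : R) (fun r => ln r + N0 (s * r^-2)) (r^-1 * pw 5 (s * r^-2)).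
Proof.
move=> r0; have rn : r != 0 by rewrite gt_eqF.
have h1 : is_derive r (1 : R) (fun r => s * r^-2) (- 2 * s * r ^- 3).
  have h := is_derive_pow 1 (is_derive_id r (1 : R)).
  have tk : r ^+ 2 != 0 by rewrite expf_neq0.
  have h2 := @is_derive_inv1 R (fun t => t ^+ 2) _ r tk h.
  apply: (isd_eq (is_deriveM (is_derive_cst s r (1 : R)) h2)).
  by rewrite /GRing.scale/=; field.
have h3 := is_derive_comp1 h1 (N0_derive (s * r^-2)).
apply: (isd_eq (is_deriveD (is_derive1_ln r0) h3)).
rewrite (_ : pw 5 _ = 1 - 2 * (s * r^-2 * N1 (s * r^-2))); last by rewrite N1_pw subKr.
by field.
Qed.

Lemma Lr_mvt (s a b : R) : 0 < a -> a < b -> exists2 c : R, a < c < b &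
  ln b + N0 (s * b^-2) - (ln a + N0 (s * a^-2)) = c^-1 * pw 5 (s * c^-2) * (b - a).
Proof.
move=> a0 ab.
have d c : c \in `]a, b[ -> is_derive c (1 : R) (fun r => ln r + N0 (s * r^-2)) (c^-1 * pw 5 (s * c^-2)).
  by rewrite in_itv/= => /andP[ac _]; apply: Lr_derive; rewrite (lt_trans a0).
have [|c] := @MVT R (fun r => ln r + N0 (s * r^-2)) (fun c => c^-1 * pw 5 (s * c^-2)) a b ab d; last first.
  by rewrite in_itv/=; exists c.
apply: derivable_within_continuous => r; rewrite in_itv/= => /andP[ar _].
by case: (Lr_derive s (lt_le_trans a0 ar)).
Qed.

Lemma Lr_le (s a b : R) : 0 < a -> a <= b -> ln a + N0 (s * a^-2) <= ln b + N0 (s * b^-2).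
Proof.
move=> a0; rewrite le_eqVlt => /predU1P[->//|ab]; rewrite -subr_ge0.
have [c /andP[ac cb] ->] := Lr_mvt s a0 ab.
rewrite mulr_ge0 ?subr_ge0 ?(ltW ab)// mulr_ge0 ?pw_ge0// invr_ge0 ltW// (lt_trans a0)//.
Qed.

Lemma Ek_ge0 e r w : 0 < e -> e <= r -> 0 <= Ek e r w.
Proof. by move=> e0 er; have := Lr_le (sq w) e0 er; rewrite /Ek; lra. Qed.

Lemma Ek_le e r r' w : 0 < r -> r <= r' -> Ek e r w <= Ek e r' w.
Proof. by move=> r0 rr'; have := Lr_le (sq w) r0 rr'; rewrite /Ek; lra. Qed.

Lemma Ek_add e r r' w : Ek e r' w = Ek e r w + Ek r r' w.
Proof. by rewrite /Ek; ring. Qed.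

(** The derivative in the radius is at most [1/c] with [c > r], over an interval of length [2 r]. *)
Lemma Ek3_le r w : 0 < r -> Ek r (3 * r) w <= 2.
Proof.
move=> r0; have r3 : r < 3 * r by lra.
have [c /andP[ac cb] h] := Lr_mvt (sq w) r0 r3.
have -> : Ek r (3 * r) w = c^-1 * pw 5 (sq w * c^-2) * (3 * r - r) by rewrite -h /Ek; ring.
have c0 : 0 < c by rewrite (lt_trans r0).
have h1 : pw 5 (sq w * c^-2) <= 1 by apply: pw_le1; rewrite mulr_ge0 ?sq_ge0// invr_ge0 exprn_ge0// ltW.
rewrite (_ : 3 * r - r = 2 * r); last by ring.
have h2 : c^-1 * (2 * r) <= 2 by rewrite mulrC ler_pdivrMr//; lra.
rewrite mulrAC (le_trans _ h2)// ler_piMr// mulr_ge0 ?invr_ge0 ?ltW// mulr_gt0//.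
Qed.

Lemma al_ge0 r w : 0 <= al r w.
Proof. by rewrite /al mulr_ge0 ?pw_ge0// mulr_ge0// invr_ge0 exprn_even_ge0. Qed.

Lemma al_le r w : al r w <= 10 * r^-2.
Proof.
have r2 : 0 <= r^-2 by rewrite invr_ge0 exprn_even_ge0.
by rewrite /al ler_piMr ?pw_le1// mulr_ge0// ?sq_ge0.
Qed.

Lemma al_supp r w : 0 < r -> r ^+ 2 <= sq w -> al r w = 0.
Proof. by move=> r0 h; rewrite /al pw_0 ?mulr0// ler_pdivlMr ?mul1r// exprn_gt0. Qed.

(** There [1 - |w|^2 / r^2] is at least [1/2], and [10 * (1/2)^4 = 10/16]. *)
Lemma al_low r w : 0 < r -> sq w <= r ^+ 2 / 2 -> 10 / 16 * r^-2 <= al r w.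
Proof.
move=> r0 h; have r2 : 0 < r ^+ 2 by rewrite exprn_gt0.
have t2 : sq w * r^-2 <= 2^-1 by rewrite ler_pdivrMr// mulrC.
have t0 : 0 <= sq w * r^-2 by rewrite mulr_ge0 ?sq_ge0// invr_ge0 ltW.
rewrite /al /pw ifT; last by lra.
have : (2^-1) ^+ 4 <= (1 - sq w * r^-2) ^+ 4 by rewrite ler_pXn2r// ?nnegrE; lra.
have : 0 < r^-2 by rewrite invr_gt0.
set x := (1 - _) ^+ 4; move: x (r^-2) => x y y0 hx.
have : 10 * y * (2^-1) ^+ 4 <= 10 * y * x by rewrite ler_pM2l ?mulr_gt0.
by apply: le_trans; rewrite le_eqVlt; apply/orP; left; apply/eqP; field.
Qed.

Lemma norm_sq r w : 0 < r -> r < `|w| -> r ^+ 2 <= sq w.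
Proof.
move=> r0 h; have /andP[h1 _] := sq_norm w; apply: le_trans h1.
by rewrite ler_pXn2r ?nnegrE ?(ltW r0)// ltW.
Qed.

Lemma Ek_csupp e r : 0 < e -> e <= r -> csupp (Ek e r).
Proof.
move=> e0 er; exists r => w h; apply: Ek_supp => //.
by apply: norm_sq => //; rewrite (lt_le_trans e0).
Qed.

Lemma al_csupp r : 0 < r -> csupp (al r).
Proof. by move=> r0; exists r => w h; apply: al_supp => //; exact: norm_sq. Qed.

Lemma al_intg nu r : lfin nu -> 0 < r -> intg nu (al r).
Proof. by move=> fin r0; apply: cont_intg => //; [exact: Ck_cont (al_Ck r)|exact: al_csupp]. Qed.

(** The difference of the two kernels is the Laplacian of the compactly supported [Ek e r], which
    integrates to 0. *)
Lemma al_mass_le e r : 0 < e -> e <= r -> I Leb (al r) = I Leb (al e).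
Proof.
move=> e0 er; apply/eqP; rewrite -subr_eq0 -IB; try by apply: al_intg; [exact: Leb_lfin|rewrite ?(lt_le_trans e0)].
rewrite -lap_Ek.
have cE := Ek_Ck e r; have sE := Ek_csupp e0 er.
rewrite ID.
- have hx := I_dx0 (CkS (Ck_dx cE)) (csupp_dx sE).
  have hy := I_dy0 (CkS (Ck_dy cE)) (csupp_dy sE).
  apply/eqP.
  apply: (etrans (f_equal2 +%R hx hy)).
  exact: addr0.
- apply: cont_intg; [exact: Leb_lfin|exact: Ck_cont (Ck_dx (Ck_dx cE))|do 2 apply: csupp_dx; exact: sE].
- apply: cont_intg; [exact: Leb_lfin|exact: Ck_cont (Ck_dy (Ck_dy cE))|do 2 apply: csupp_dy; exact: sE].
Qed.

(** The common mass of all [al r]. Its value is [2 pi]; keeping it symbolic avoids an integration in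
    polar coordinates. *)
Definition c0 : R := I Leb (al 1).

Lemma al_mass r : 0 < r -> I Leb (al r) = c0.
Proof.
move=> r0; have [h|h] := leP r 1; first by rewrite /c0 (al_mass_le r0 h).
by rewrite (al_mass_le ltr01 (ltW h)).
Qed.

Lemma Leb_bbox (M : R) : 0 < M -> Leb (bbox M) = ((2 * M) ^+ 2)%:E.
Proof.
move=> M0; rewrite bbox_itv.
have -> : Leb (`[- M, M]%classic `*` `[- M, M]%classic) =
  (@leb2 R) (`[- M, M]%classic `*` `[- M, M]%classic) by [].
rewrite /leb2 product_measure1E//= lebesgue_measure_itv/= lte_fin ifT; last by lra.
by rewrite -EFinB -EFinM; congr EFin; ring.
Qed.

Lemma c0_gt0 : 0 < c0.
Proof.
have mb := bbox_meas (2^-1 : R).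
have i1 : intg Leb (\1_(bbox (2^-1)) : P2 -> R).
  apply: (@intg_indic _ _ _ _ _ 1 _ mb (Leb_lfin _)); first exact: measurable_indic.
  by move=> p hp; rewrite indicE mem_set// normr1.
  by move=> p hp; rewrite indicE memNset.
apply: (@lt_le_trans _ _ (I Leb (fun w : P2 => 10 / 16 * \1_(bbox (2^-1)) w))).
  rewrite IZ// I_indic// Leb_bbox ?invr_gt0//= mulr_gt0// exprn_gt0// divff//.
apply: I_le; [exact: intgZ|by apply: al_intg => //; exact: Leb_lfin|].
move=> w; rewrite indicE; case: (boolP (w \in _)) => [/set_mem hw|_]; last by rewrite mulr0 al_ge0.
have := @al_low 1 w ltr01; rewrite expr1n invr1 !mulr1; apply.
have /andP[_ h2] := sq_norm w; apply: le_trans h2 _.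
have : `|w| ^+ 2 <= (2^-1) ^+ 2 by rewrite ler_pXn2r ?nnegrE.
by move: (`|w| ^+ 2) => x; rewrite expr2; lra.
Qed.

End RadialKernels.

(** * Weakly harmonic and weakly holomorphic functions *)

Section DuBoisReymond.
Context {R : realType}.
Local Notation P2 := (R * R)%type.
Implicit Types (p q z w : P2) (H : P2 -> R).

(** Open boxes given by their end points. Empty ones are allowed, so that the family is closed under
    intersection. *)
Definition obx (u : R * R * (R * R)) : set P2 := `]u.1.1, u.1.2[%classic `*` `]u.2.1, u.2.2[%classic.
Definition obxs : set (set P2) := [set A | exists u, A = obx u].

Lemma obx_meas u : measurable (obx u).
Proof. by apply: measurableX; exact: measurable_itv. Qed.

Lemma obxI : setI_closed obxs.
Proof.
move=> _ _ [u ->] [v ->].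
exists ((Num.max u.1.1 v.1.1, Num.min u.1.2 v.1.2), (Num.max u.2.1 v.2.1, Num.min u.2.2 v.2.2)).
by apply/seteqP; split => p; rewrite /obx/= !in_itv/= !gt_max !lt_min;
  [move=> [[/andP[-> ->] /andP[-> ->]] [/andP[-> ->] /andP[-> ->]]]
  |move=> [/andP[/andP[-> ->] /andP[-> ->]] /andP[/andP[-> ->] /andP[-> ->]]]].
Qed.

Local Notation BT := (g_sigma_algebraType obxs).

Lemma nat_bound (x y : R) : exists n : nat, `|x| < n%:R /\ `|y| < n%:R.
Proof.
exists (maxn (Num.bound `|x|) (Num.bound `|y|)).
split; [apply: lt_le_trans (archi_boundP (normr_ge0 x)) _|apply: lt_le_trans (archi_boundP (normr_ge0 y)) _];
  by rewrite ler_nat ?leq_maxl ?leq_maxr.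
Qed.

Lemma obx_fst_meas : measurable_fun setT (fun p : BT => p.1 : R).
Proof.
apply: (measurability _ (RGenOpens.measurableE R)) => _ [_ [a [b ->] <-]]; rewrite setTI.
have -> : (fun p : BT => p.1) @^-1` `]a, b[ = \bigcup_n obx ((a, b), (- n%:R, n%:R)).
  apply/seteqP; split => [p/= pab|p [n _ []]//].
  have [n [_ hn]] := nat_bound p.2 p.2.
  by exists n => //; split => //=; rewrite in_itv/= -ltr_norml.
apply: bigcupT_measurable => n; apply: sub_sigma_algebra; by eexists.
Qed.

Lemma obx_snd_meas : measurable_fun setT (fun p : BT => p.2 : R).
Proof.
apply: (measurability _ (RGenOpens.measurableE R)) => _ [_ [a [b ->] <-]]; rewrite setTI.
have -> : (fun p : BT => p.2) @^-1` `]a, b[ = \bigcup_n obx ((- n%:R, n%:R), (a, b)).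
  apply/seteqP; split => [p/= pab|p [n _ []]//].
  have [n [_ hn]] := nat_bound p.1 p.1.
  by exists n => //; split => //=; rewrite in_itv/= -ltr_norml.
apply: bigcupT_measurable => n; apply: sub_sigma_algebra; by eexists.
Qed.

(** For the nontrivial inclusion, both coordinates are measurable with respect to the sigma-algebra
    generated by boxes, hence so is the identity, being the pair of them. *)
Lemma measurable_obxs : @measurable _ P2 = <<s obxs >>.
Proof.
apply/seteqP; split; last first.
  apply: smallest_sub; last by move=> _ [u ->]; exact: obx_meas.
  exact: sigma_algebra_measurable.
move=> Y mY; have := measurable_fun_pair obx_fst_meas obx_snd_meas.
move=> /(_ measurableT Y mY); rewrite setTI.
have -> // : (fun x : BT => (x.1, x.2)) @^-1` Y = Y.
by apply/seteqP; split => p; rewrite /= -surjective_pairing.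
Qed.

(** A trapezoid that vanishes off []a, b[], has slopes of size [n] and tends to the indicator of
    []a, b[] as [n] grows. *)
Definition tent (n : nat) (a b t : R) : R :=
  Num.min 1 (n%:R * Num.max 0 ((b - a) / 2 - `|t - (a + b) / 2|)).

Lemma tent_gt0 (a b t : R) : (0 < (b - a) / 2 - `|t - (a + b) / 2|) = (a < t < b).
Proof.
rewrite subr_gt0 ltr_norml; apply/andP/andP => -[h1 h2]; split; lra.
Qed.

Lemma lip_min1 (x y : R) : `|Num.min 1 x - Num.min 1 y| <= `|x - y|.
Proof.
rewrite /Order.min; case: ltP => hx; case: ltP => hy; rewrite ?subrr ?normr0//.
- by rewrite !ger0_norm ?subr_ge0; lra.
- by rewrite !ler0_norm ?subr_le0; lra.
Qed.

Lemma lip_max0 (x y : R) : `|Num.max 0 x - Num.max 0 y| <= `|x - y|.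
Proof.
rewrite /Order.max; case: ltP => hx; case: ltP => hy; rewrite ?subrr ?normr0//.
- by rewrite !ger0_norm ?subr_ge0; lra.
- by rewrite !ler0_norm ?subr_le0; lra.
Qed.

Lemma tent_lip n a b s t : `|tent n a b s - tent n a b t| <= n%:R * `|s - t|.
Proof.
apply: le_trans (lip_min1 _ _) _; rewrite -mulrBr normrM normr_nat ler_wpM2l//.
apply: le_trans (lip_max0 _ _) _.
rewrite (_ : _ - _ - _ = `|t - (a + b) / 2| - `|s - (a + b) / 2|); last by ring.
by apply: le_trans (ler_dist_dist _ _) _; rewrite distrC (_ : _ - _ = s - t)//; ring.
Qed.

Lemma tent_bound n a b t : 0 <= tent n a b t <= 1.
Proof.
rewrite /tent le_min ler01 ge_min lexx/= andbT mulr_ge0// le_max lexx//.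
Qed.

Lemma tent_out n a b t : ~~ (a < t < b) -> tent n a b t = 0.
Proof.
rewrite -tent_gt0 -leNgt => h; rewrite /tent (max_idPl h) mulr0.
by apply/min_idPr; exact: ler01.
Qed.

Lemma tent_cvg a b t : (tent n a b t) @[n --> \oo] --> (\1_(`]a, b[%classic) t : R).
Proof.
rewrite indicE; case: (boolP (t \in _)) => [|h].
  rewrite inE/= in_itv/= -tent_gt0 => m0.
  apply: cvg_near_cst; near=> n; rewrite /tent; apply/min_idPl.
  rewrite (max_idPr (ltW m0)) -ler_pdivrMr//.
  by near: n; exact: nbhs_infty_ger.
apply: cvg_near_cst; apply: nearW => n; apply: tent_out.
by move: h; rewrite notin_setE/= in_itv/= => /negP.
Unshelve. all: by end_near. Qed.

Definition lipschitz2 (g : P2 -> R) := exists2 K : R, 0 <= K & forall u w, `|g u - g w| <= K * `|u - w|.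

Lemma lip_cont g : lipschitz2 g -> continuous g.
Proof.
move=> [K K0 hK] p; apply: eps_cont => e e0; exists (e / (K + 1)); first by rewrite divr_gt0// ltr_wpDl.
move=> q; rewrite ltr_pdivlMr; last by rewrite ltr_wpDl.
by move=> h; apply: le_lt_trans (hK _ _) _; apply: le_lt_trans h; rewrite mulrC ler_wpM2l// lerDl.
Qed.

Lemma indic_obx u p : \1_(obx u) p = \1_(`]u.1.1, u.1.2[%classic) p.1 * \1_(`]u.2.1, u.2.2[%classic) p.2 :> R.
Proof.
rewrite !indicE -natrM; congr (_%:R); rewrite mulnb; congr nat_of_bool.
apply/idP/andP; first by rewrite inE => -[h1 h2]; rewrite !inE.
by rewrite !inE => -[h1 h2].
Qed.

Lemma csupp_in (f : P2 -> R) (a b c d : R) :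
  (forall p, ~~ ((a < p.1 < b) && (c < p.2 < d)) -> f p = 0) -> csupp f.
Proof.
move=> h; exists (Num.max (Num.max `|a| `|b|) (Num.max `|c| `|d|)) => p hp; apply: h.
apply/negP => /andP[/andP[h1 h2] /andP[h3 h4]]; move: hp; rewrite ltNge => /negP; apply.
rewrite prod_normE ge_max; apply/andP; split; rewrite !le_max.
  have : (`|p.1| <= `|a|) || (`|p.1| <= `|b|).
    case: (leP 0 p.1) => p0; apply/orP; [right|left].
      by rewrite (ger0_norm p0) ger0_norm ?(ltW h2)// (le_trans p0)// ltW.
    by rewrite !ltr0_norm ?lerN2 ?(ltW h1)// (lt_trans h1).
  by case/orP => ->; rewrite ?orbT.
have : (`|p.2| <= `|c|) || (`|p.2| <= `|d|).
  case: (leP 0 p.2) => p0; apply/orP; [right|left].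
    by rewrite (ger0_norm p0) ger0_norm ?(ltW h4)// (le_trans p0)// ltW.
  by rewrite !ltr0_norm ?lerN2 ?(ltW h3)// (lt_trans h3).
by case/orP => ->; rewrite ?orbT.
Qed.

(** Products of two tents are Lipschitz, vanish off the box and converge to its indicator; dominated
    convergence gives the claim. *)
Lemma dubois_obx H u : lint Leb H ->
  (forall g, lipschitz2 g -> csupp g -> I Leb (fun p => H p * g p) = 0) ->
  I Leb (fun p => H p * \1_(obx u) p) = 0.
Proof.
move=> lH h0; pose g n p : R := tent n u.1.1 u.1.2 p.1 * tent n u.2.1 u.2.2 p.2.
have cg n : lipschitz2 (g n).
  exists (n%:R + n%:R); first by rewrite addr_ge0.
  move=> p q; rewrite /g.
  rewrite (_ : _ - _ = tent n u.1.1 u.1.2 p.1 * (tent n u.2.1 u.2.2 p.2 - tent n u.2.1 u.2.2 q.2)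
    + tent n u.2.1 u.2.2 q.2 * (tent n u.1.1 u.1.2 p.1 - tent n u.1.1 u.1.2 q.1)); last by ring.
  have /andP[a0 a1] := tent_bound n u.1.1 u.1.2 p.1.
  have /andP[c0 c1] := tent_bound n u.2.1 u.2.2 q.2.
  have h (x y z : R) : 0 <= x -> x <= 1 -> `|y| <= n%:R * `|z| -> `|z| <= `|p - q| -> `|x * y| <= n%:R * `|p - q|.
    move=> x0 x1 yz zp; rewrite normrM (ger0_norm x0).
    apply: (@le_trans _ _ `|y|); first by rewrite ler_piMl.
    by apply: le_trans yz _; rewrite ler_wpM2l.
  rewrite (le_trans (ler_normD _ _))// mulrDl lerD//.
    by apply: h a0 a1 (tent_lip _ _ _ _ _) _; rewrite prod_normE/= le_max lexx orbT.
  by apply: h c0 c1 (tent_lip _ _ _ _ _) _; rewrite prod_normE/= le_max lexx.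
have out n p : ~~ ((u.1.1 < p.1 < u.1.2) && (u.2.1 < p.2 < u.2.2)) -> g n p = 0.
  by rewrite negb_and => /orP[h|h]; rewrite /g (tent_out _ h) ?mul0r ?mulr0.
have [M hM] : csupp (fun p => \1_(obx u) p : R).
  apply: (@csupp_in _ u.1.1 u.1.2 u.2.1 u.2.2) => p hp; rewrite indicE memNset//= => -[]/=.
  by rewrite !in_itv/= => h1 h2; move: hp; rewrite h1 h2.
have b1 : lbd (fun p => \1_(obx u) p : R).
  split; first by apply: measurable_indic; exact: obx_meas.
  by move=> N; exists 1 => p _; rewrite indicE; case: (_ \in _); rewrite ?normr1 ?normr0.
have iG := intg_abs (lint_mul lH b1 (ex_intro _ M hM)).
have [|||| _] := @I_dct _ _ _ (@Leb R) (fun n p => H p * g n p) (fun p => H p * \1_(obx u) p)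
  (fun p => `|H p * \1_(obx u) p|).
- by move=> n; apply: measurable_funM; [case: lH|apply: cont_meas; apply: lip_cont; exact: cg].
- by move=> p; apply: cvgM; [exact: cvg_cst|rewrite indic_obx; apply: cvgM; exact: tent_cvg].
- exact: iG.
- move=> n p; rewrite !normrM ler_wpM2l// indicE.
  case: (boolP ((u.1.1 < p.1 < u.1.2) && (u.2.1 < p.2 < u.2.2))) => [/andP[h1 h2]|hp]; last first.
    by rewrite -normrM -/(g n p) (out _ _ hp) normr0.
  rewrite mem_set; last by split; rewrite /= in_itv.
  have /andP[a0 a1] := tent_bound n u.1.1 u.1.2 p.1.
  have /andP[c0 c1] := tent_bound n u.2.1 u.2.2 p.2.
  by rewrite /= normr1 !ger0_norm// mulr_ile1.
move=> /cvg_lim <-//.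
rewrite [X in lim (X @ _)](_ : _ = fun=> 0) ?lim_cst//.
apply/funext => n; apply: h0; [exact: cg|exact: csupp_in (out n)].
Qed.

(** The integral of [H] vanishes over open boxes. Dynkin induction extends this to all Borel subsets
    of a fixed box, which forces [H = 0] almost everywhere there; countably many boxes cover the
    plane. *)
Lemma dubois H : lint Leb H ->
  (forall g, lipschitz2 g -> csupp g -> I Leb (fun p => H p * g p) = 0) ->
  {ae Leb, forall p, H p = 0}.
Proof.
move=> lH h0; have mH : meas H by case: lH.
have main (M : R) : {ae Leb, forall p, H p * \1_(obx ((- M, M), (- M, M))) p = 0}.
  set B := obx _; pose H' p := H p * \1_B p.
  have csB : csupp (fun p => \1_B p : R).
    apply: (@csupp_in _ (- M) M (- M) M) => p hp; rewrite indicE memNset//= => -[]/=.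
    by rewrite !in_itv/= => h1 h2; move: hp; rewrite h1 h2.
  have b1 A : measurable A -> lbd (fun p => \1_A p : R).
    move=> mA; split; first exact: measurable_indic.
    by move=> N; exists 1 => p _; rewrite indicE; case: (_ \in _); rewrite ?normr1 ?normr0.
  have mB : measurable B by exact: obx_meas.
  have iH' : intg Leb H' by exact: (lint_mul lH (b1 _ mB) csB).
  have iHA A : measurable A -> intg Leb (fun p => H' p * \1_A p).
    move=> mA; apply: (intg_le _ _ (intg_abs iH')).
      by apply: measurable_funM; [exact: intg_meas iH'|exact: measurable_indic].
    move=> p; rewrite normrM ler_piMr// indicE; case: (_ \in _); rewrite ?normr1 ?normr0//.
  pose Pr (A : set P2) := I Leb (fun p => H' p * \1_A p) = 0.
  have PT : Pr setT.
    rewrite /Pr -(dubois_obx ((- M, M), (- M, M)) lH h0).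
    by congr I; apply/funext => p; rewrite indicT mulr1.
  have PC A : measurable A -> Pr A -> Pr (~` A).
    move=> mA PA; rewrite /Pr.
    have -> : (fun p => H' p * \1_(~` A) p) = (fun p => H' p * \1_setT p - H' p * \1_A p).
      apply/funext => p; by rewrite -mulrBr indicT/= !indicE in_setC; case: (p \in A); rewrite ?subrr ?subr0.
    by rewrite IB ?PT ?PA ?subr0//; apply: iHA.
  have PU (F : (set P2)^nat) : (forall n, measurable (F n)) -> trivIset setT F ->
      (forall n, Pr (F n)) -> Pr (\bigcup_k F k).
    move=> mF tF PF.
    have PS n : Pr (\big[setU/set0]_(k < n) F k) .
      elim: n => [|n IH]; first by rewrite big_ord0 /Pr -[RHS](I0 Leb); congr I; apply/funext => p; rewrite indic0 mulr0.
      rewrite big_ord_recr /Pr /=.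
      have mS : measurable (\big[setU/set0]_(k < n) F k) by apply: bigsetU_measurable.
      have -> : (fun p => H' p * \1_(\big[setU/set0]_(k < n) F k `|` F n) p) =
         (fun p => H' p * \1_(\big[setU/set0]_(k < n) F k) p + H' p * \1_(F n) p).
        apply/funext => p; rewrite -mulrDr; congr (_ * _); rewrite !indicE in_setU.
        have [pS|] := boolP (p \in _); last by rewrite add0r.
        rewrite memNset ?addr0// => Fp; move: pS; rewrite inE -bigcup_mkord => -[k/= kn Fk].
        move/trivIsetP : tF => /(_ k n Logic.I Logic.I (negbT (ltn_eqF kn))); apply/eqP/set0P; by exists p.
      by rewrite ID ?IH ?PF ?addr0//; apply: iHA.
    have [||||_] := @I_dct _ _ _ (@Leb R) (fun n p => H' p * \1_(\big[setU/set0]_(k < n) F k) p)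
       (fun p => H' p * \1_(\bigcup_k F k) p) (fun p => `|H' p|).
    - move=> n; apply: measurable_funM; first exact: intg_meas iH'.
      by apply: measurable_indic; apply: bigsetU_measurable.
    - move=> p; apply: cvgM; first exact: cvg_cst.
      apply: cvg_near_cst; rewrite !indicE; case: (boolP (p \in \bigcup_k F k)) => [|pF].
        rewrite inE => -[k _ Fk]; exists k.+1 => // n /= kn.
        by rewrite !indicE mem_set// -bigcup_mkord; exists k.
      apply: nearW => n; rewrite indicE memNset// -bigcup_mkord => -[k _ Fk].
      by move: pF; rewrite notin_setE; apply; exists k.
    - exact: intg_abs iH'.
    - by move=> n p; rewrite normrM ler_piMr// indicE; case: (_ \in _); rewrite ?normr1 ?normr0.
    move=> /cvg_lim h; rewrite /Pr -h//.
    rewrite [X in lim (X @ _)](_ : _ = fun=> 0) ?lim_cst//.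
    by apply/funext => n; exact: PS.
  (* [H'] carries the indicator of [B], and the intersection of [B] with a box is again a box. *)
  have PG : obxs `<=` Pr.
    move=> _ [u ->]; rewrite /Pr.
    have [v hv] := obxI (ex_intro _ ((- M, M), (- M, M)) erefl) (ex_intro _ u erefl).
    rewrite -(dubois_obx v lH h0); congr I; apply/funext => p.
    by rewrite /H' -mulrA -hv indicI.
  have PA := dynkin_induction measurable_obxs obxI PT PG PC PU.
  have := @integral_ae_eq _ _ _ (@Leb R) setT measurableT (cst 0%E) (EFin \o H') iH' (measurable_cst _).
  have hE (E : set P2) : E `<=` setT -> measurable E ->
      (\int[Leb]_(x in E) (EFin \o H') x = \int[Leb]_(x in E) cst 0 x)%E.
    move=> _ mE; rewrite integral_cst// mul0e integral_mkcond.
    have E2 : (EFin \o H') \_ E = EFin \o (fun p => H' p * \1_E p).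
      by apply/funext => p; rewrite patchE /= indicE; case: (p \in E); rewrite ?mulr1 ?mulr0.
    rewrite E2 (I_fin (iHA _ mE)) PA// -measurable_obxs//.
  move=> /(_ hE); apply: filterS => p /(_ Logic.I)/= [].
  by rewrite -/B /H' => ->.
have : {ae Leb, forall p, forall n : nat, H p * \1_(obx ((- n%:R, n%:R), (- n%:R, n%:R))) p = 0}.
  by apply/ae_foralln => n; exact: main.
apply: filterS => p hp; have [n [h1 h2]] := nat_bound p.1 p.2.
have := hp n; rewrite indicE mem_set ?mulr1//.
by split; rewrite /= in_itv/= -ltr_norml.
Qed.

End DuBoisReymond.

(** * Fubini's theorem for convolutions *)

Section ConvFubini.
Context {R : realType}.
Local Notation P2 := (R * R)%type.
Implicit Types (p q z w : P2) (f g a : P2 -> R).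

Lemma Leb_sf : sigma_finite setT (@Leb R).
Proof.
exists (fun n => bbox n%:R).
  apply/esym; rewrite -subTset => p _.
  exists (Num.bound `|p|) => //; rewrite /bbox/=; apply/ltW; exact: archi_boundP.
by move=> n; split; [exact: bbox_meas|exact: Leb_lfin].
Qed.

(** A copy of [Leb] to which sigma-finiteness is attached, as used by Fubini's theorem on
    [P2 * P2]. *)
Definition LebF : set P2 -> \bar R := @Leb R.
HB.instance Definition _ := Measure.copy LebF (@Leb R).
HB.instance Definition _ := Measure_isSigmaFinite.Build _ _ _ LebF Leb_sf.
Definition LebS : {sigma_finite_measure set P2 -> \bar R} := LebF.

Lemma al_sym r w : al r (- w) = al r w :> R.
Proof. by rewrite /al /sq /= !sqrrN. Qed.

Lemma csupp_conv a f : csupp a -> csupp f -> csupp (conv Leb a f).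
Proof.
move=> [M hM] [N hN]; exists (M + N) => z hz; rewrite /conv.
rewrite -[RHS](I0 Leb); congr I; apply/funext => w.
have [wN|/hN ->] := leP `|w| N; last by rewrite mul0r.
rewrite hM ?mulr0//; have : `|z| <= `|w| + `|w - z|.
  by rewrite -[in leLHS](subKr w z) ler_normB.
lra.
Qed.

(** Convolution by an even kernel is self-adjoint. The double integrand is absolutely integrable
    because the convolution of [|P|] by [|a|] is continuous and [|g|] has compact support. *)
Lemma conv_fubini a P g : (forall w, a (- w) = a w) -> continuous a -> csupp a -> lint Leb P ->
  continuous g -> csupp g ->
  I Leb (fun z => conv Leb a P z * g z) = I Leb (fun w => P w * conv Leb a g w).
Proof.
move=> asym ca sa lP cg sg.
have mP : meas P by case: lP.
have Ca : Ck 0 a by [].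
have lg : lint Leb g by apply: lbd_lint; [exact: Leb_lfin|exact: cont_lbd].
have ccP := Ck_cont (conv_Ck Ca sa lP).
have ccg := Ck_cont (conv_Ck Ca sa lg).
pose F (x : P2 * P2) : \bar R := (P x.2 * a (x.2 - x.1) * g x.1)%:E.
have ma : meas a by exact: cont_meas. have mg : meas g by exact: cont_meas.
have mF : measurable_fun setT F.
  apply/measurable_EFinP; apply: measurable_funM; last first.
    by apply: (measurableT_comp mg); exact: measurable_fst.
  apply: measurable_funM; first by apply: (measurableT_comp mP); exact: measurable_snd.
  apply: (measurableT_comp ma); apply: measurable_fun_pair; apply: measurable_funB.
  - by apply: (measurableT_comp (@measurable_fst _ _ R R)).
  - by apply: (measurableT_comp (@measurable_fst _ _ R R)).
  - by apply: (measurableT_comp (@measurable_snd _ _ R R)).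
  - by apply: (measurableT_comp (@measurable_snd _ _ R R)).
have lPn : lint Leb (fun w => `|P w|).
  split; first exact: measurableT_comp.
  move=> M; have := intg_abs (lP.2 M); congr intg; apply/funext => w.
  by rewrite normrM (@ger0_norm _ (\1_ _ _)).
have can : continuous (fun w => `|a w|) by move=> w; apply: cvg_norm; exact: ca.
have san : csupp (fun w => `|a w|) by have [M h] := sa; exists M => w /h ->; rewrite normr0.
have iz z : intg Leb (fun w => P w * a (w - z) * g z).
  have := intgZ (g z) (conv_intg z ca sa lP); congr intg; apply/funext => w; by rewrite mulrC.
have izn z : intg Leb (fun w => `|P w * a (w - z) * g z|) by exact: intg_abs.
have iF : (LebS \x LebS)%E.-integrable setT F.
  apply: (proj2 (integrable12ltyP LebS LebS mF)).
  have E z : (\int[LebS]_y `|F (z, y)| = (conv Leb (fun w => `|a w|) (fun w => `|P w|) z * `|g z|)%:E)%E.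
    rewrite /F /= (I_fin (izn z)); congr EFin; rewrite mulrC /conv -IZ; last first.
      exact: (conv_intg z can san lPn).
    by congr I; apply/funext => w; rewrite !normrM mulrC.
  under eq_integral do rewrite E.
  have cc : continuous (fun z => conv Leb (fun w => `|a w|) (fun w => `|P w|) z * `|g z|).
    move=> z; apply: cvgM; last by apply: cvg_norm; exact: cg.
    by apply: Ck_cont; exact: (@conv_Ck _ _ 0).
  have sgn : csupp (fun w => `|g w|) by have [M h] := sg; exists M => w /h ->; rewrite normr0.
  by rewrite (I_fin (cont_intg (@Leb_lfin R) cc (csuppM _ sgn))) ltry.
have := Fubini iF.
have E1 z : (\int[LebS]_y F (z, y) = (conv Leb a P z * g z)%:E)%E.
  rewrite /F /= (I_fin (iz z)); congr EFin; rewrite mulrC /conv -IZ; last first.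
    exact: (conv_intg z ca sa lP).
  by congr I; apply/funext => w; rewrite mulrC.
have iw w : intg Leb (fun z => P w * a (w - z) * g z).
  have := intgZ (P w) (conv_intg w ca sa lg); congr intg; apply/funext => z.
  by rewrite -asym opprB; ring.
have E2 w : (\int[LebS]_x F (x, w) = (P w * conv Leb a g w)%:E)%E.
  rewrite /F /= (I_fin (iw w)); congr EFin; rewrite /conv -IZ; last first.
    exact: (conv_intg w ca sa lg).
  by congr I; apply/funext => z; rewrite -asym opprB; ring.
under eq_integral do rewrite E1.
under [RHS]eq_integral do rewrite E2.
by move=> h; rewrite I.unlock /Rintegral h.
Qed.
End ConvFubini.
Global Opaque al Ek.

(** * Averages and the mean value property *)

Section Averages.
Context {R : realType}.
Local Notation P2 := (R * R)%type.
Implicit Types (p q z w : P2) (f g a P Q : P2 -> R) (r e : R).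
Local Notation L := (@Leb R).

Definition Av r f z : R := c0^-1 * conv L (al r) f z.

Lemma Av_Ck r f : 0 < r -> lint L f -> Ck 3 (Av r f).
Proof. by move=> r0 lf; apply: CkZ; exact: (conv_Ck (al_Ck r) (al_csupp r0) lf). Qed.

Lemma al_shift_mass r z : 0 < r -> I L (fun w => al r (w - z)) = c0.
Proof.
move=> r0; rewrite (@I_shift R (- z) (al r)); first exact: al_mass.
by apply: cont_meas; exact: Ck_cont (al_Ck r).
Qed.

Lemma al_shift_intg nu r z : lfin nu -> 0 < r -> intg nu (fun w => al r (w - z)).
Proof.
move=> fin r0; apply: cont_intg => //.
  by move=> w; apply: (@continuous_comp _ _ _ (fun w : P2 => w - z) (al r));
    [apply: cvgB; [exact: cvg_id|exact: cvg_cst]|exact: (Ck_cont (al_Ck r))].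
have [M hM] := al_csupp r0; exists (M + `|z|) => w hw; apply: hM.
have : `|w| <= `|w - z| + `|z| by rewrite -[in leLHS](subrK z w) ler_normD.
lra.
Qed.

Lemma Av_near r f z c eta : 0 < r -> lint L f ->
  (forall w, `|w - z| <= r -> `|f w - c| <= eta) -> `|Av r f z - c| <= eta.
Proof.
move=> r0 lf hf; have c00 := @c0_gt0 R.
have ic := al_shift_intg z (@Leb_lfin R) r0.
have ifc := conv_intg z (Ck_cont (al_Ck r)) (al_csupp r0) lf.
have -> : Av r f z - c = c0^-1 * I L (fun w => (f w - c) * al r (w - z)).
  have -> : (fun w => (f w - c) * al r (w - z)) = (fun w => f w * al r (w - z) - c * al r (w - z)).
    by apply/funext => w; rewrite mulrBl.
  rewrite (IB ifc (intgZ c ic)) (IZ c ic).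
  rewrite al_shift_mass// /Av /conv; move: (I _ _) => x; field; exact: lt0r_neq0.
rewrite normrM gtr0_norm ?invr_gt0// mulrC ler_pdivrMr// -(al_shift_mass z r0) -IZ//.
have i1 : intg L (fun w => (f w - c) * al r (w - z)).
  have := intgB ifc (intgZ c ic); congr intg; by apply/funext => w; rewrite mulrBl.
apply: (le_trans (I_abs i1)); apply: I_le; [exact: intg_abs|exact: intgZ|].
move=> w; rewrite normrM (ger0_norm (al_ge0 _ _)).
have [h|h] := leP `|w - z| r; first by rewrite ler_wpM2r ?al_ge0// hf.
by rewrite al_supp ?mulr0// norm_sq.
Qed.

Lemma Av_cvg f z : lint L f -> {for z, continuous f} ->
  forall eta, 0 < eta -> exists2 d : R, 0 < d & forall r, 0 < r -> r < d -> `|Av r f z - f z| <= eta.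
Proof.
move=> lf /cvgrPdist_lt cf eta eta0; have /nbhs_ballP[d /= d0 hd] := cf _ eta0.
exists d => // r r0 rd; apply: Av_near => // w hw; rewrite distrC ltW//; apply: hd.
by rewrite -ball_normE /ball_/= distrC (le_lt_trans hw).
Qed.

(** Harmonicity in the sense of distributions; C^3 is the regularity of the test functions [Ek]. *)
Definition wharm P := forall tau, Ck 3 tau -> csupp tau ->
  I L (fun p => P p * (dx (dx tau) p + dy (dy tau) p)) = 0.

Lemma dx_shift n f (v : P2) : Ck n.+1 f -> dx (fun p => f (p + v)) = (fun p => dx f (p + v)).
Proof.
move=> hf; apply: dxE => p.
have sh : is_derive (p.1 : R) (1 : R) (fun t => t + v.1) 1.
  by apply: (isd_eq (is_deriveD (is_derive_id p.1 (1 : R)) (is_derive_cst v.1 p.1 (1 : R)))); rewrite addr0.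
by apply: (isd_eq (is_derive_comp1 sh (derivx (p + v) hf))); rewrite mulr1.
Qed.

Lemma dy_shift n f (v : P2) : Ck n.+1 f -> dy (fun p => f (p + v)) = (fun p => dy f (p + v)).
Proof.
move=> hf; apply: dyE => p.
have sh : is_derive (p.2 : R) (1 : R) (fun t => t + v.2) 1.
  by apply: (isd_eq (is_deriveD (is_derive_id p.2 (1 : R)) (is_derive_cst v.2 p.2 (1 : R)))); rewrite addr0.
by apply: (isd_eq (is_derive_comp1 sh (derivy (p + v) hf))); rewrite mulr1.
Qed.

Lemma csupp_shift f (v : P2) : csupp f -> csupp (fun p => f (p + v)).
Proof.
move=> [M h]; exists (M + `|v|) => p hp; apply: h.
have : `|p| <= `|p + v| + `|v| by rewrite -[in leLHS](addrK v p) ler_normB.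
lra.
Qed.

(* [al r - al e] is the Laplacian of the test function [Ek e r]. *)
Lemma wharm_Av P e r z : lint L P -> wharm P -> 0 < e -> e <= r -> Av r P z = Av e P z.
Proof.
move=> lP hP e0 er; have r0 : 0 < r by rewrite (lt_le_trans e0).
have cE := Ek_Ck e r.
have := hP _ (Ck_shift (- z) cE) (csupp_shift (- z) (Ek_csupp e0 er)).
rewrite (dx_shift _ cE) (dx_shift _ (Ck_dx cE)) (dy_shift _ cE) (dy_shift _ (Ck_dy cE)).
have E : (fun p => P p * (dx (dx (Ek e r)) (p - z) + dy (dy (Ek e r)) (p - z))) =
   (fun p => P p * al r (p - z) - P p * al e (p - z)).
  apply/funext => p; have := lap_Ek e r => /(congr1 (fun f => f (p - z))) /= ->.
  by rewrite mulrBr.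
rewrite E IB; last 2 first.
- exact: (conv_intg z (Ck_cont (al_Ck r)) (al_csupp r0) lP).
- exact: (conv_intg z (Ck_cont (al_Ck e)) (al_csupp e0) lP).
by rewrite /Av /conv => /eqP; rewrite subr_eq0 => /eqP ->.
Qed.

(** Weyl's lemma. Since [Av r P] does not depend on [r], the pairing of [Av 1 P] with [g] is that of
    [P] with [Av r g] for every small [r], and [Av r g] tends to [g] uniformly. So [P - Av 1 P] is
    orthogonal to all test functions and [dubois] applies. *)
Lemma wharm_ae P : lint L P -> wharm P -> {ae L, forall p, P p = Av 1 P p}.
Proof.
move=> lP hP; have c00 := @c0_gt0 R.
have cA := Ck_cont (Av_Ck ltr01 lP).
have lA : lint L (Av 1 P) by apply: lbd_lint; [exact: Leb_lfin|exact: cont_lbd].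
have lH : lint L (fun p => P p - Av 1 P p) by apply: lintD => //; exact: lintN.
suff : {ae L, forall p, P p - Av 1 P p = 0}.
  by apply: filterS => p /eqP; rewrite subr_eq0 => /eqP.
apply: (dubois lH) => g lipg sg; have cg := lip_cont lipg.
have bg := cont_lbd cg.
have lg : lint L g by apply: lbd_lint => //; exact: Leb_lfin.
have iPg := lint_mul lP bg sg; have iAg := lint_mul lA bg sg.
have -> : (fun p => (P p - Av 1 P p) * g p) = (fun p => P p * g p - Av 1 P p * g p).
  by apply/funext => p; rewrite mulrBl.
rewrite IB//; apply/eqP; rewrite subr_eq0; apply/eqP.
have [M hM] := sg.
have lPn : intg L (fun w => `|P w * \1_(bbox (M + 1)) w|) by apply: intg_abs; exact: lP.2.
pose K := I L (fun w => `|P w * \1_(bbox (M + 1)) w|).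
have K0 : 0 <= K by apply: I_ge0.
(* For [r <= 1] both [g] and [Av r g] vanish outside the square of radius [M + 1], so [K] controls
   the error. *)
have key r eta : 0 < r -> r <= 1 -> (forall w, `|Av r g w - g w| <= eta) ->
   `|I L (fun p => P p * g p) - I L (fun p => Av 1 P p * g p)| <= eta * K.
  move=> r0 r1 hr.
  have -> : I L (fun p => Av 1 P p * g p) = I L (fun p => P p * Av r g p).
    have -> : (fun p => Av 1 P p * g p) = (fun p => c0^-1 * (conv L (al r) P p * g p)).
      by apply/funext => p; rewrite (wharm_Av p lP hP r0 r1) /Av mulrA.
    have ccP := Ck_cont (conv_Ck (al_Ck r) (al_csupp r0) lP).
    rewrite IZ; last first.
      by apply: cont_intg; [exact: Leb_lfin|move=> p; apply: cvgM; [exact: ccP|exact: cg]|exact: csuppM].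
    rewrite (conv_fubini (al_sym r) (Ck_cont (al_Ck r)) (al_csupp r0) lP cg sg) -IZ.
      by congr I; apply/funext => p; rewrite /Av; ring.
    apply: (lint_mul lP); last by apply: csupp_conv => //; exact: al_csupp.
    by apply: cont_lbd; exact: Ck_cont (conv_Ck (al_Ck r) (al_csupp r0) lg).
  have bA : lbd (Av r g) by apply: cont_lbd; exact: Ck_cont (Av_Ck r0 lg).
  have sA : csupp (Av r g) by apply: csuppM; apply: csupp_conv => //; exact: al_csupp.
  have out w : M + 1 < `|w| -> Av r g w - g w = 0.
    move=> hw; rewrite (hM w) ?subr0; last by lra.
    rewrite /Av /conv (_ : (fun _ => _) = fun=> 0) ?I0 ?mulr0//.
    apply/funext => u; have [uM|/hM ->] := leP `|u| M; last by rewrite mul0r.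
    rewrite al_supp ?mulr0// norm_sq//.
    have : `|w| <= `|u| + `|u - w| by rewrite -[in leLHS](subKr u w) ler_normB.
    lra.
  have iPA := lint_mul lP bA sA.
  rewrite -IB//.
  apply: (le_trans (I_abs (intgB iPg iPA))); rewrite /K -IZ//.
  apply: I_le; [exact: intg_abs (intgB iPg iPA)|exact: intgZ|].
  move=> w; rewrite -mulrBr normrM; have [h|h] := leP `|w| (M + 1).
    by rewrite indicE mem_set// mulr1 mulrC ler_wpM2r// distrC.
  rewrite -[g w - _]opprB out// oppr0 normr0 mulr0 mulr_ge0// (le_trans (normr_ge0 _) (hr w))//.
apply/eqP; rewrite -subr_eq0 -normr_le0; apply/ler_addgt0Pr => eps eps0; rewrite add0r.
pose eta := eps / (K + 1).
have eta0 : 0 < eta by rewrite divr_gt0// ltr_wpDl.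
suff [r [r0 r1 hr]] : exists r, [/\ 0 < r, r <= 1 & forall w, `|Av r g w - g w| <= eta].
  apply: (le_trans (key r eta r0 r1 hr)); rewrite /eta -mulrA ler_piMr ?(ltW eps0)// mulrC.
  by rewrite ler_pdivrMr ?mul1r ?lerDl// ltr_wpDl.
apply: contrapT => /forallNP hn.
have hn' (n : nat) : exists w, eta < `|Av n.+1%:R^-1 g w - g w| /\ `|w| <= M + 1.
  have n0 : (0 : R) < n.+1%:R^-1 by rewrite invr_gt0 ltr0n.
  have n1 : (n.+1%:R^-1 : R) <= 1 by rewrite invf_le1 ?ltr0n// ler1n.
  have := hn n.+1%:R^-1 => /not_and3P[//|//|/existsNP[w /negP]]; rewrite -ltNge => hw.
  exists w; split => //; rewrite leNgt; apply/negP => wM; move: hw.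
  rewrite (hM w) ?subr0; last by lra.
  rewrite /Av /conv (_ : (fun _ => _) = fun=> 0) ?I0 ?mulr0 ?normr0; first by rewrite ltNge ltW.
  apply/funext => u; have [uM|/hM ->] := leP `|u| M; last by rewrite mul0r.
  rewrite al_supp ?mulr0// norm_sq//.
  have : `|w| <= `|u| + `|u - w| by rewrite -[in leLHS](subKr u w) ler_normB.
  move: n1; move: (n.+1%:R^-1) => t; lra.
have [Kg Kg0 hKg] := lipg.
have [del del0 hdel] : exists2 d : R, 0 < d & forall w u, `|w| <= M + 1 -> `|u - w| < d -> `|g u - g w| <= eta.
  exists (eta / (Kg + 1)); first by rewrite divr_gt0// ltr_wpDl.
  move=> w u _; rewrite ltr_pdivlMr; last by rewrite ltr_wpDl.
  by move=> h; apply: le_trans (hKg _ _) _; apply/ltW/(le_lt_trans _ h); rewrite mulrC ler_wpM2l// lerDl.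
have [n _ hnn] := near_infty_natSinv_lt (PosNum del0).
have [w [hw wM]] := hn' n.
have n0 : (0 : R) < n.+1%:R^-1 by rewrite invr_gt0 ltr0n.
move: hw; rewrite ltNge => /negP; apply; apply: Av_near => // u hu.
by apply: hdel => //; apply: le_lt_trans hu _; apply: (hnn n) => /=.
Qed.
End Averages.

(** * Cauchy-Riemann equations, classical and weak *)

Section WeakHolomorphy.
Context {R : realType}.
Local Notation P2 := (R * R)%type.
Implicit Types (p q z w h : P2) (f g a P Q : P2 -> R) (r e : R).
Local Notation L := (@Leb R).

(* The integral of [(P + iQ) * (g_x + i g_y)] vanishes. *)
Definition annih P Q g :=
  I L (fun p => P p * dx g p - Q p * dy g p) = 0 /\
  I L (fun p => P p * dy g p + Q p * dx g p) = 0.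

(** Real test functions suffice, the pairing being complex linear in the test function. *)
Definition whol P Q := forall g, Ck 2 g -> csupp g -> annih P Q g.

Lemma test_intg n P g : lint L P -> Ck n g -> csupp g -> intg L (fun p => P p * g p).
Proof. by move=> lP cg sg; apply: lint_mul => //; apply: cont_lbd; exact: Ck_cont cg. Qed.

(** The tests [dx tau] and [dy tau] are combined so that the mixed derivatives cancel and the
    Laplacian remains; this is the factorization of the Laplacian through dbar. *)
Lemma whol_harm P Q : lint L P -> lint L Q -> whol P Q -> wharm P /\ wharm Q.
Proof.
move=> lP lQ h; split => tau ct st.
- have cx := Ck_dx ct; have cy := Ck_dy ct; have sx := csupp_dx st; have sy := csupp_dy st.
  have [h1 _] := h _ cx sx; have [_ h2] := h _ cy sy.
  have i1 := test_intg lP (Ck_dx cx) (csupp_dx sx); have i2 := test_intg lQ (Ck_dy cx) (csupp_dy sx).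
  have i3 := test_intg lP (Ck_dy cy) (csupp_dy sy); have i4 := test_intg lQ (Ck_dx cy) (csupp_dx sy).
  rewrite -[RHS](addr0 0) -{1}h1 -h2 -(ID (intgB i1 i2) (intgD i3 i4)); congr I; apply/funext => p.
  rewrite (schwarz (CkS ct)).
  by move: (P p) (Q p) (dx (dx tau) p) (dy (dy tau) p) (dy (dx tau) p) => *; ring.
- have cx := Ck_dx ct; have cy := Ck_dy ct; have sx := csupp_dx st; have sy := csupp_dy st.
  have [_ h1] := h _ cx sx; have [h2 _] := h _ cy sy.
  have i1 := test_intg lP (Ck_dy cx) (csupp_dy sx); have i2 := test_intg lQ (Ck_dx cx) (csupp_dx sx).
  have i3 := test_intg lP (Ck_dx cy) (csupp_dx sy); have i4 := test_intg lQ (Ck_dy cy) (csupp_dy sy).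
  rewrite -[RHS](subr0 0) -{1}h1 -h2 -(IB (intgD i1 i2) (intgB i3 i4)); congr I; apply/funext => p.
  rewrite (schwarz (CkS ct)).
  by move: (P p) (Q p) (dx (dx tau) p) (dy (dy tau) p) (dy (dx tau) p) => *; ring.
Qed.

(** Derivatives of a convolution fall on the kernel, so the Cauchy-Riemann equations at [z] say
    precisely that the translate of [a] by [z] is annihilated. *)
Lemma annih_conv a P Q z : Ck 1 a -> csupp a -> lint L P -> lint L Q ->
  annih P Q (fun w => a (w - z)) ->
  dx (conv L a P) z = dy (conv L a Q) z /\ dy (conv L a P) z = - dx (conv L a Q) z.
Proof.
move=> ca sa lP lQ [h1 h2].
rewrite (conv_dx ca sa lP) (conv_dy ca sa lP) (conv_dx ca sa lQ) (conv_dy ca sa lQ).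
move: h1 h2; rewrite (dx_shift _ ca) (dy_shift _ ca).
have i1 := conv_intg z (Ck_cont (Ck_dx ca)) (csupp_dx sa) lP.
have i2 := conv_intg z (Ck_cont (Ck_dy ca)) (csupp_dy sa) lP.
have i3 := conv_intg z (Ck_cont (Ck_dx ca)) (csupp_dx sa) lQ.
have i4 := conv_intg z (Ck_cont (Ck_dy ca)) (csupp_dy sa) lQ.
rewrite (IB i1 i4) (ID i2 i3) => /eqP; rewrite subr_eq0 => /eqP e1 /eqP; rewrite addr_eq0 => /eqP e2.
have c a1 (f : P2 -> R) : conv L a1 f z = I L (fun w => f w * a1 (w - z)) by [].
split; first by rewrite (c (dx a) P) (c (dy a) Q) e1.
by rewrite (c (dy a) P) (c (dx a) Q) e2.
Qed.

(** Holomorphy in the C^1 sense. More regularity follows from the mean value property ([CR_C3]), and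
    [goursat] reaches this notion from mere complex differentiability. *)
Definition CR P Q := [/\ Ck 1 P, Ck 1 Q & forall z, dx P z = dy Q z /\ dy P z = - dx Q z].

Lemma CR_annih P Q g : CR P Q -> Ck 1 g -> csupp g -> annih P Q g.
Proof.
move=> [cP cQ h] cg sg; rewrite /annih.
have sgx := csupp_dx sg; have sgy := csupp_dy sg.
have lP : lint L P by apply: lbd_lint; [exact: Leb_lfin|exact/cont_lbd/Ck_cont/cP].
have lQ : lint L Q by apply: lbd_lint; [exact: Leb_lfin|exact/cont_lbd/Ck_cont/cQ].
have i1 := test_intg lP (Ck_dx cg) sgx; have i2 := test_intg lP (Ck_dy cg) sgy.
have i3 := test_intg lQ (Ck_dx cg) sgx; have i4 := test_intg lQ (Ck_dy cg) sgy.
rewrite (IB i1 i4) (ID i2 i3) !ibp_x// !ibp_y//.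
have -> : (fun p => dx P p * g p) = (fun p => dy Q p * g p) by apply/funext => p; rewrite (h p).1.
have -> : (fun p => dy P p * g p) = (fun p => - (dx Q p * g p)) by apply/funext => p; rewrite (h p).2 mulNr.
have j : intg L (fun p => dx Q p * g p).
  apply: (@test_intg 1 (dx Q) g) => //.
  by apply: lbd_lint; [exact: Leb_lfin|exact/cont_lbd/(Ck_cont (Ck_dx cQ))].
rewrite (IN j) !opprK.
by split; [rewrite addNr|rewrite subrr].
Qed.

Lemma CR_whol P Q : CR P Q -> whol P Q.
Proof. by move=> h g /CkS cg sg; exact: CR_annih. Qed.

Lemma annih_conv_CR a P Q : Ck 1 a -> csupp a -> lint L P -> lint L Q ->
  (forall z, annih P Q (fun w => a (w - z))) -> CR (conv L a P) (conv L a Q).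
Proof.
move=> ca sa lP lQ h; split; [exact: conv_Ck ca sa lP|exact: conv_Ck ca sa lQ|].
by move=> z; exact: annih_conv.
Qed.

Lemma whol_conv_CR a P Q : Ck 2 a -> csupp a -> lint L P -> lint L Q -> whol P Q ->
  CR (conv L a P) (conv L a Q).
Proof.
move=> ca sa lP lQ h; apply: annih_conv_CR => //; first exact: CkS ca.
by move=> z; apply: h; [exact: Ck_shift|exact: csupp_shift].
Qed.

Lemma CRZ P Q c : CR P Q -> CR (fun p => c * P p) (fun p => c * Q p).
Proof.
move=> [cP cQ h]; split; [exact: CkZ|exact: CkZ|move=> z].
by rewrite (dxZ c cP) (dxZ c cQ) (dyZ c cP) (dyZ c cQ) (h z).1 (h z).2 mulrN.
Qed.

Lemma whol_Av P Q : lint L P -> lint L Q -> whol P Q -> CR (Av 1 P) (Av 1 Q).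
Proof.
move=> lP lQ h; apply: CRZ; apply: whol_conv_CR => //; [exact: CkS (al_Ck 1)|exact: al_csupp].
Qed.

Lemma CR_harm P Q : CR P Q -> wharm P /\ wharm Q.
Proof.
move=> h; have [cP cQ _] := h.
apply: whol_harm; last exact: CR_whol.
  by apply: lbd_lint; [exact: Leb_lfin|exact/cont_lbd/Ck_cont/cP].
by apply: lbd_lint; [exact: Leb_lfin|exact/cont_lbd/Ck_cont/cQ].
Qed.

(** [Av r P] does not depend on [r] and tends to [P] at each point as [r] tends to 0. *)
Lemma wharm_fix P r : 0 < r -> continuous P -> wharm P -> Av r P = P.
Proof.
move=> r0 cP hP; apply/funext => z.
have lP : lint L P by apply: lbd_lint; [exact: Leb_lfin|exact: cont_lbd].
apply/eqP; rewrite -subr_eq0 -normr_le0; apply/ler_addgt0Pr => eps eps0; rewrite add0r.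
have [d d0 hd] := Av_cvg lP (cP z) eps0.
pose t := Num.min r (d / 2).
have t0 : 0 < t by rewrite lt_min r0 divr_gt0.
rewrite (wharm_Av z lP hP t0); last by rewrite ge_min lexx.
apply: hd => //; apply: (@le_lt_trans _ _ (d / 2)); first by rewrite ge_min lexx orbT.
by rewrite ltr_pdivrMr// ltr_pMr// ltr1n.
Qed.

Lemma CR_fix P Q r : 0 < r -> CR P Q -> Av r P = P /\ Av r Q = Q.
Proof.
move=> r0 h; have [cP cQ _] := h; have [hP hQ] := CR_harm h.
by split; apply: wharm_fix => //; exact: Ck_cont (_ : Ck 1 _).
Qed.

(** A holomorphic pair equals its own averages, which are of class C^3. *)
Lemma CR_C3 P Q : CR P Q -> Ck 3 P /\ Ck 3 Q.
Proof.
move=> h; have [e1 e2] := CR_fix ltr01 h; have [cP cQ _] := h.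
by rewrite -e1 -e2; split; apply: Av_Ck => //; (apply: lbd_lint; [exact: Leb_lfin|exact/cont_lbd/Ck_cont/(_ : Ck 1 _)]).
Qed.

Lemma CR_deriv P Q : CR P Q -> CR (dx P) (dx Q).
Proof.
move=> h; have [cP cQ] := CR_C3 h; have [_ _ hz] := h.
split; [exact: CkS (Ck_dx cP)|exact: CkS (Ck_dx cQ)|move=> z].
have e1 : dx P = dy Q by apply/funext => p; rewrite (hz p).1.
have e2 : dy P = (fun p => -1 * dx Q p) by apply/funext => p; rewrite (hz p).2 mulN1r.
split.
  by rewrite {1}e1 (schwarz (CkS cQ)).
by rewrite -(schwarz (CkS cP)) e2 (dxZ _ (Ck_dx cQ)) mulN1r.
Qed.

End WeakHolomorphy.

(** * Goursat's theorem *)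

Section Goursat.
Context {R : realType}.
Local Notation P2 := (R * R)%type.
Local Notation L := (@Leb R).
Implicit Types (t s : R) (k l : nat) (p q z : P2).

(* Quadratic B-spline with knots 0, 1, 2, 3. *)
Definition tp t : R := if 0 <= t then t ^+ 2 else 0.
Definition bs t : R := tp t - 3 * tp (t - 1) + 3 * tp (t - 2) - tp (t - 3).

Lemma tpZ t : tp (2 * t) = 4 * tp t.
Proof. by rewrite /tp pmulr_rge0//; case: ifP => _; rewrite ?mulr0//; ring. Qed.

(** The two-scale relation of the quadratic B-spline, with binomial weights 1, 3, 3, 1. It comes
    from the homogeneity of [tp]. *)
Lemma bs_refine t : bs t = 4^-1 * (bs (2 * t) + 3 * bs (2 * t - 1) + 3 * bs (2 * t - 2) + bs (2 * t - 3)).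
Proof.
rewrite /bs.
have e (x y : R) : 2 * x = y -> tp y = 4 * tp x by move=> <-; exact: tpZ.
have e0 := tpZ t.
have e2 : tp (2 * t - 2) = 4 * tp (t - 1) by apply: e; ring.
have e2' : tp (2 * t - 1 - 1) = 4 * tp (t - 1) by apply: e; ring.
have e4 : tp (2 * t - 1 - 3) = 4 * tp (t - 2) by apply: e; ring.
have e4' : tp (2 * t - 2 - 2) = 4 * tp (t - 2) by apply: e; ring.
have e4'' : tp (2 * t - 3 - 1) = 4 * tp (t - 2) by apply: e; ring.
have e6 : tp (2 * t - 3 - 3) = 4 * tp (t - 3) by apply: e; ring.
rewrite e0 e2 e2' e4 e4' e4'' e6.
have -> : 2 * t - 1 - 2 = 2 * t - 3 by ring.
have -> : 2 * t - 2 - 1 = 2 * t - 3 by ring.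
have -> : 2 * t - 2 - 3 = 2 * t - 5 by ring.
have -> : 2 * t - 3 - 2 = 2 * t - 5 by ring.
by field.
Qed.

Lemma tp_derive t : is_derive t (1 : R) tp (2 * Num.max 0 t).
Proof.
have E : tp = fun s => if 1 - s <= 1 then (1 - (1 - s)) ^+ 2 else 0.
  apply/funext => s; rewrite /tp; have -> : (1 - s <= 1) = (0 <= s) by apply/idP/idP; lra.
  by rewrite subKr.
have h := pw_derive 0 (1 - t).
have h1 : is_derive t (1 : R) (fun s => 1 - s) (-1).
  by apply: (isd_eq (is_deriveB (is_derive_cst (1 : R) t (1 : R)) (is_derive_id t (1 : R)))); rewrite sub0r.
rewrite E; apply: (isd_eq (is_derive_comp1 h1 h)).
rewrite /pw expr1; case: ifPn => h2; first by rewrite (max_idPr _); [ring|lra].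
by rewrite (max_idPl _) ?mulr0 ?mul0r ?oppr0//; rewrite -ltNge in h2; lra.
Qed.

Lemma bs_out t : ~~ (0 < t < 3) -> bs t = 0.
Proof.
rewrite negb_and -!leNgt => /orP[h|h]; rewrite /bs /tp.
  have -> : (0 <= t) = (t == 0) by rewrite eq_le h.
  rewrite (ifF _ _ (_ : (0 <= t - 1) = false)) ?(ifF _ _ (_ : (0 <= t - 2) = false)) ?(ifF _ _ (_ : (0 <= t - 3) = false)).
  all: try by apply/negbTE; rewrite -ltNge; lra.
  by case: (boolP (t == 0)) => [/eqP ->|_]; ring.
by rewrite !ifT; try lra; ring.
Qed.

Definition bs1 t : R :=
  2 * (Num.max 0 t - 3 * Num.max 0 (t - 1) + 3 * Num.max 0 (t - 2) - Num.max 0 (t - 3)).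

Lemma bs_derive t : is_derive t (1 : R) bs (bs1 t).
Proof.
have h (c : R) : is_derive t (1 : R) (fun t => tp (t - c)) (2 * Num.max 0 (t - c)).
  have h1 : is_derive t (1 : R) (fun t => t - c) 1.
    by apply: isd_eq; rewrite /GRing.scale/=; ring.
  by apply: (isd_eq (is_derive_comp1 h1 (tp_derive (t - c)))); rewrite mulr1.
have h0 := tp_derive t; have h1 := h 1; have h2 := h 2; have h3 := h 3.
apply: isd_eq; rewrite /bs1 /GRing.scale/=.
by move: (Num.max 0 _) (Num.max 0 _) (Num.max 0 _) (Num.max 0 _) => *; ring.
Qed.

Lemma bs1_cont : continuous bs1.
Proof.
have ci (c : R) : continuous (fun t : R => Num.max 0 (t - c)).
  move=> t; apply: (@continuous_max _ _ (fun=> 0 : R) (fun t : R => t - c)); first exact: cvg_cst.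
  by apply: cvgB; [exact: cvg_id|exact: cvg_cst].
have c0 : continuous (fun t : R => Num.max 0 t).
  by move=> t; have := ci 0 t; under eq_fun do rewrite subr0.
move=> t; apply: cvgM; first exact: cvg_cst.
apply: cvgB; last exact: ci.
apply: cvgD; last by apply: cvgM; [exact: cvg_cst|exact: ci].
by apply: cvgB; [exact: c0|apply: cvgM; [exact: cvg_cst|exact: ci]].
Qed.

Lemma bs_Dk : Dk 1 bs.
Proof. by apply: (DkP bs_derive); split => //; exact: bs1_cont. Qed.

Lemma bs1_out t : ~~ (0 < t < 3) -> bs1 t = 0.
Proof.
rewrite negb_and -!leNgt => /orP[h|h]; rewrite /bs1.
  by rewrite !(max_idPl _); [ring|lra..].
by rewrite !(max_idPr _); [ring|lra..].
Qed.

Lemma bs_ge0 t : 0 <= bs t.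
Proof.
have [h|] := boolP (0 < t < 3); last by move=> /bs_out ->.
rewrite /bs /tp; case: (lerP 0 t) => h0; case: (lerP 0 (t - 1)) => h1;
  case: (lerP 0 (t - 2)) => h2; case: (lerP 0 (t - 3)) => h3; nra.
Qed.

Lemma bs_low t : 1 <= t <= 2 -> 1 <= bs t.
Proof.
move=> h; rewrite /bs /tp; case: (lerP 0 t) => h0; case: (lerP 0 (t - 1)) => h1;
  case: (lerP 0 (t - 2)) => h2; case: (lerP 0 (t - 3)) => h3; nra.
Qed.

Lemma bs_bound : exists2 M : R, 0 < M & forall t, `|bs t| <= M /\ `|bs1 t| <= M.
Proof.
have c2 : continuous (fun p : P2 => bs p.1).
  by move=> p; apply: continuous_comp; [exact: cvg_fst|exact: Dk_cont bs_Dk _].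
have c1 : continuous (fun p : P2 => bs1 p.1).
  by move=> p; apply: continuous_comp; [exact: cvg_fst|exact: bs1_cont].
have [C hC] := cont_bounded 3 c2; have [C' hC'] := cont_bounded 3 c1.
have M0 : 0 < 1 + `|C| + `|C'| by rewrite -addrA ltr_pwDl// addr_ge0.
exists (1 + `|C| + `|C'|) => // t.
have [ht|ht] := boolP (0 < t < 3); last by rewrite bs_out// bs1_out// normr0 (ltW M0).
have h : `|(t, t)| <= 3 by rewrite norm_le2/= ger0_norm; lra.
have := hC _ h; have := hC' _ h; have := ler_norm C; have := ler_norm C' => /=.
have := normr_ge0 C; have := normr_ge0 C'.
by move: (`|C|) (`|C'|) (`|bs t|) (`|bs1 t|) => x y z w *; split; lra.
Qed.

End Goursat.

(** * Bisection of spline squares *)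

Section Squares.
Context {R : realType}.
Local Notation P2 := (R * R)%type.
Local Notation L := (@Leb R).
Implicit Types (t s : R) (n k : nat) (p q z w : P2) (f g F : P2 -> R).

(** A tensor product of splines supported in the rectangle with lower left corner [z] and sides
    [3 s] and [3 u]. Two separate sizes are kept because the sides are halved one at a time. *)
Definition bsq z (s u : R) p : R := bs ((p.1 - z.1) * s^-1) * bs ((p.2 - z.2) * u^-1).

Lemma bsq_out z s u p : 0 < s -> 0 < u ->
  ~~ ((z.1 < p.1 < z.1 + 3 * s) && (z.2 < p.2 < z.2 + 3 * u)) ->
  [/\ bsq z s u p = 0, bs1 ((p.1 - z.1) * s^-1) * bs ((p.2 - z.2) * u^-1) = 0 &
      bs ((p.1 - z.1) * s^-1) * bs1 ((p.2 - z.2) * u^-1) = 0].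
Proof.
move=> s0 u0; rewrite /bsq.
have e (a b c : R) : 0 < c -> (0 < (a - b) * c^-1 < 3) = (b < a < b + 3 * c).
  by move=> c0; rewrite pmulr_lgt0 ?invr_gt0// subr_gt0 ltr_pdivrMr// ltrBlDl.
rewrite negb_and -(e _ _ _ s0) -(e _ _ _ u0) => /orP[h|h]; rewrite (bs_out h) (bs1_out h).
  by rewrite !mul0r.
by rewrite !mulr0.
Qed.

Lemma bsq_csupp z s u : 0 < s -> 0 < u -> csupp (bsq z s u).
Proof.
move=> s0 u0; apply: (@csupp_in _ _ z.1 (z.1 + 3 * s) z.2 (z.2 + 3 * u)) => p h.
by case: (bsq_out s0 u0 h).
Qed.

Lemma Ck_afx n (c d : R) : Ck n (fun p => (p.1 - c) * d).
Proof. by apply: CkM; [apply: CkB; [exact: Ck_fst|exact: Ck_cst]|exact: Ck_cst]. Qed.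

Lemma Ck_afy n (c d : R) : Ck n (fun p => (p.2 - c) * d).
Proof. by apply: CkM; [apply: CkB; [exact: Ck_snd|exact: Ck_cst]|exact: Ck_cst]. Qed.

Lemma bsq_Ck z s u : Ck 1 (bsq z s u).
Proof. by apply: CkM; apply: (Ck_comp bs_Dk); [exact: Ck_afx|exact: Ck_afy]. Qed.

Lemma dx_bsq z s u : dx (bsq z s u) =
  fun p => s^-1 * (bs1 ((p.1 - z.1) * s^-1) * bs ((p.2 - z.2) * u^-1)).
Proof.
apply: dxE => p.
have h1 : is_derive (p.1 : R) (1 : R) (fun t : R => (t - z.1) * s^-1) s^-1.
  by apply: isd_eq; rewrite /GRing.scale/=; ring.
have h2 := is_derive_comp1 h1 (bs_derive ((p.1 - z.1) * s^-1)).
rewrite /bsq /=; apply: isd_eq; rewrite /GRing.scale/=.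
by move: (bs _) (bs _) (bs1 _) => *; ring.
Qed.

Lemma dy_bsq z s u : dy (bsq z s u) =
  fun p => u^-1 * (bs ((p.1 - z.1) * s^-1) * bs1 ((p.2 - z.2) * u^-1)).
Proof.
apply: dyE => p.
have h1 : is_derive (p.2 : R) (1 : R) (fun t : R => (t - z.2) * u^-1) u^-1.
  by apply: isd_eq; rewrite /GRing.scale/=; ring.
have h2 := is_derive_comp1 h1 (bs_derive ((p.2 - z.2) * u^-1)).
rewrite /bsq /=; apply: isd_eq; rewrite /GRing.scale/=.
by move: (bs _) (bs1 _) => *; ring.
Qed.

Lemma bsq_splitx z s u p : 0 < s -> bsq z s u p = 4^-1 * (bsq z (s / 2) u p +
  3 * bsq (z.1 + s / 2, z.2) (s / 2) u p + 3 * bsq (z.1 + 2 * (s / 2), z.2) (s / 2) u p +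
  bsq (z.1 + 3 * (s / 2), z.2) (s / 2) u p).
Proof.
move=> s0; have s1 : s != 0 by exact: lt0r_neq0.
rewrite /bsq /= bs_refine.
have e1 : 2 * ((p.1 - z.1) * s^-1) = (p.1 - z.1) * (s / 2)^-1 by field.
have e2 : 2 * ((p.1 - z.1) * s^-1) - 1 = (p.1 - (z.1 + s / 2)) * (s / 2)^-1 by field.
have e3 : 2 * ((p.1 - z.1) * s^-1) - 2 = (p.1 - (z.1 + 2 * (s / 2))) * (s / 2)^-1 by field.
have e4 : 2 * ((p.1 - z.1) * s^-1) - 3 = (p.1 - (z.1 + 3 * (s / 2))) * (s / 2)^-1 by field.
rewrite e2 e3 e4 e1; move: (bs _) (bs _) (bs _) (bs _) (bs _) => *; ring.
Qed.

Lemma bsq_splity z s u p : 0 < u -> bsq z s u p = 4^-1 * (bsq z s (u / 2) p +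
  3 * bsq (z.1, z.2 + u / 2) s (u / 2) p + 3 * bsq (z.1, z.2 + 2 * (u / 2)) s (u / 2) p +
  bsq (z.1, z.2 + 3 * (u / 2)) s (u / 2) p).
Proof.
move=> u0; have u1 : u != 0 by exact: lt0r_neq0.
rewrite /bsq /= (bs_refine ((p.2 - z.2) * u^-1)).
have e1 : 2 * ((p.2 - z.2) * u^-1) = (p.2 - z.2) * (u / 2)^-1 by field.
have e2 : 2 * ((p.2 - z.2) * u^-1) - 1 = (p.2 - (z.2 + u / 2)) * (u / 2)^-1 by field.
have e3 : 2 * ((p.2 - z.2) * u^-1) - 2 = (p.2 - (z.2 + 2 * (u / 2))) * (u / 2)^-1 by field.
have e4 : 2 * ((p.2 - z.2) * u^-1) - 3 = (p.2 - (z.2 + 3 * (u / 2))) * (u / 2)^-1 by field.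
rewrite e2 e3 e4 e1; move: (bs _) (bs _) (bs _) (bs _) (bs _) => *; ring.
Qed.

Variables f1 f2 : P2 -> R.
Hypotheses (c1 : continuous f1) (c2 : continuous f2).

Let l1 : lint L f1. Proof. by apply: lbd_lint; [exact: Leb_lfin|exact: cont_lbd]. Qed.
Let l2 : lint L f2. Proof. by apply: lbd_lint; [exact: Leb_lfin|exact: cont_lbd]. Qed.

(* A B-spline is a combination of half-size ones, hence the [defect] of a square is at most 4 times that of some
   half-size square: this replaces the bisection of triangles. *)
Definition defect1 g := I L (fun p => f1 p * dx g p - f2 p * dy g p).
Definition defect2 g := I L (fun p => f1 p * dy g p + f2 p * dx g p).
Definition defect g := `|defect1 g| + `|defect2 g|.

Lemma defectD g g' : Ck 1 g -> csupp g -> Ck 1 g' -> csupp g' ->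
  defect (fun p => g p + g' p) <= defect g + defect g'.
Proof.
move=> cg sg cg' sg'.
have i1 := test_intg l1 (Ck_dx cg) (csupp_dx sg); have i2 := test_intg l1 (Ck_dy cg) (csupp_dy sg).
have i3 := test_intg l2 (Ck_dx cg) (csupp_dx sg); have i4 := test_intg l2 (Ck_dy cg) (csupp_dy sg).
have j1 := test_intg l1 (Ck_dx cg') (csupp_dx sg'); have j2 := test_intg l1 (Ck_dy cg') (csupp_dy sg').
have j3 := test_intg l2 (Ck_dx cg') (csupp_dx sg'); have j4 := test_intg l2 (Ck_dy cg') (csupp_dy sg').
have e1 : defect1 (fun p => g p + g' p) = defect1 g + defect1 g'.
  rewrite /defect1 -(ID (intgB i1 i4) (intgB j1 j4)) (dxD cg cg') (dyD cg cg'); congr I; apply/funext => p.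
  by move: (f1 p) (f2 p) (dx g p) (dy g p) (dx g' p) (dy g' p) => *; ring.
have e2 : defect2 (fun p => g p + g' p) = defect2 g + defect2 g'.
  rewrite /defect2 -(ID (intgD i2 i3) (intgD j2 j3)) (dxD cg cg') (dyD cg cg'); congr I; apply/funext => p.
  by move: (f1 p) (f2 p) (dx g p) (dy g p) (dx g' p) (dy g' p) => *; ring.
rewrite /defect e1 e2 addrACA; apply: lerD; exact: ler_normD.
Qed.

Lemma defectZ (c : R) g : Ck 1 g -> csupp g -> defect (fun p => c * g p) = `|c| * defect g.
Proof.
move=> cg sg.
have i1 := test_intg l1 (Ck_dx cg) (csupp_dx sg); have i2 := test_intg l1 (Ck_dy cg) (csupp_dy sg).
have i3 := test_intg l2 (Ck_dx cg) (csupp_dx sg); have i4 := test_intg l2 (Ck_dy cg) (csupp_dy sg).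
have e1 : defect1 (fun p => c * g p) = c * defect1 g.
  rewrite /defect1 -(IZ c (intgB i1 i4)) (dxZ c cg) (dyZ c cg); congr I; apply/funext => p.
  by move: (f1 p) (f2 p) (dx g p) (dy g p) => *; ring.
have e2 : defect2 (fun p => c * g p) = c * defect2 g.
  rewrite /defect2 -(IZ c (intgD i2 i3)) (dxZ c cg) (dyZ c cg); congr I; apply/funext => p.
  by move: (f1 p) (f2 p) (dx g p) (dy g p) => *; ring.
by rewrite /defect e1 e2 !normrM mulrDr.
Qed.

Lemma defect4 g0 g1 g2 g3 : Ck 1 g0 -> csupp g0 -> Ck 1 g1 -> csupp g1 ->
  Ck 1 g2 -> csupp g2 -> Ck 1 g3 -> csupp g3 ->
  4 * defect (fun p => 4^-1 * (g0 p + 3 * g1 p + 3 * g2 p + g3 p)) <=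
  defect g0 + 3 * defect g1 + 3 * defect g2 + defect g3.
Proof.
move=> k0 s0 k1 s1 k2 s2 k3 s3.
have kz (c : R) g : Ck 1 g -> Ck 1 (fun p => c * g p) by exact: CkZ.
have sz (c : R) g : csupp g -> csupp (fun p => c * g p) by move=> h; exact: csuppM.
have k01 := CkD k0 (kz 3 _ k1); have s01 := csuppD s0 (sz 3 _ s1).
have k012 := CkD k01 (kz 3 _ k2); have s012 := csuppD s01 (sz 3 _ s2).
rewrite (defectZ _ (CkD k012 k3) (csuppD s012 s3)) ger0_norm// mulrA divff// mul1r.
apply: le_trans (defectD k012 s012 k3 s3) _; rewrite lerD2r.
apply: le_trans (defectD k01 s01 (kz 3 _ k2) (sz 3 _ s2)) _.
apply: lerD; last by rewrite defectZ// ger0_norm.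
apply: le_trans (defectD k0 s0 (kz 3 _ k1) (sz 3 _ s1)) _.
by rewrite lerD2l defectZ// ger0_norm.
Qed.

(** The weights 1, 3, 3, 1 add up to 8, so one of the four values is at least [x / 2]. *)
Lemma pick4 (a b c d x : R) : 4 * x <= a + 3 * b + 3 * c + d ->
  [\/ x <= 2 * a, x <= 2 * b, x <= 2 * c | x <= 2 * d].
Proof.
move=> h; have [|ha] := lerP x (2 * a); first by constructor 1.
have [|hb] := lerP x (2 * b); first by constructor 2.
have [|hc] := lerP x (2 * c); first by constructor 3.
by constructor 4; lra.
Qed.

Lemma defect_splitx z s u : 0 < s -> 0 < u -> exists z',
  [/\ z.1 <= z'.1 <= z.1 + 3 * (s / 2), z'.2 = z.2 &
      defect (bsq z s u) <= 2 * defect (bsq z' (s / 2) u)].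
Proof.
move=> s0 u0; have s20 : 0 < s / 2 by rewrite divr_gt0.
have := defect4 (bsq_Ck z (s/2) u) (bsq_csupp z s20 u0)
  (bsq_Ck (z.1 + s / 2, z.2) (s/2) u) (bsq_csupp (z.1 + s / 2, z.2) s20 u0)
  (bsq_Ck (z.1 + 2 * (s / 2), z.2) (s/2) u) (bsq_csupp (z.1 + 2 * (s / 2), z.2) s20 u0)
  (bsq_Ck (z.1 + 3 * (s / 2), z.2) (s/2) u) (bsq_csupp (z.1 + 3 * (s / 2), z.2) s20 u0).
have <- : bsq z s u = (fun p => 4^-1 * (bsq z (s / 2) u p +
  3 * bsq (z.1 + s / 2, z.2) (s / 2) u p + 3 * bsq (z.1 + 2 * (s / 2), z.2) (s / 2) u p +
  bsq (z.1 + 3 * (s / 2), z.2) (s / 2) u p)) by apply/funext => p; exact: bsq_splitx.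
case/pick4 => h; [exists z|exists (z.1 + s / 2, z.2)|exists (z.1 + 2 * (s / 2), z.2)|
  exists (z.1 + 3 * (s / 2), z.2)]; split => //=; by apply/andP; split; lra.
Qed.

Lemma defect_splity z s u : 0 < s -> 0 < u -> exists z',
  [/\ z.2 <= z'.2 <= z.2 + 3 * (u / 2), z'.1 = z.1 &
      defect (bsq z s u) <= 2 * defect (bsq z' s (u / 2))].
Proof.
move=> s0 u0; have s20 : 0 < u / 2 by rewrite divr_gt0.
have := defect4 (bsq_Ck z s (u/2)) (bsq_csupp z s0 s20)
  (bsq_Ck (z.1, z.2 + u / 2) s (u/2)) (bsq_csupp (z.1, z.2 + u / 2) s0 s20)
  (bsq_Ck (z.1, z.2 + 2 * (u / 2)) s (u/2)) (bsq_csupp (z.1, z.2 + 2 * (u / 2)) s0 s20)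
  (bsq_Ck (z.1, z.2 + 3 * (u / 2)) s (u/2)) (bsq_csupp (z.1, z.2 + 3 * (u / 2)) s0 s20).
have <- : bsq z s u = (fun p => 4^-1 * (bsq z s (u / 2) p +
  3 * bsq (z.1, z.2 + u / 2) s (u / 2) p + 3 * bsq (z.1, z.2 + 2 * (u / 2)) s (u / 2) p +
  bsq (z.1, z.2 + 3 * (u / 2)) s (u / 2) p)) by apply/funext => p; exact: bsq_splity.
case/pick4 => h; [exists z|exists (z.1, z.2 + u / 2)|exists (z.1, z.2 + 2 * (u / 2))|
  exists (z.1, z.2 + 3 * (u / 2))]; split => //=; by apply/andP; split; lra.
Qed.

Lemma defect_step z s : 0 < s -> exists z',
  [/\ z.1 <= z'.1 <= z.1 + 3 * (s / 2), z.2 <= z'.2 <= z.2 + 3 * (s / 2) &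
      defect (bsq z s s) <= 4 * defect (bsq z' (s / 2) (s / 2))].
Proof.
move=> s0; have s20 : 0 < s / 2 by rewrite divr_gt0.
have [z' [h1 h2 h3]] := defect_splitx z s0 s0.
have [z'' [h4 h5 h6]] := defect_splity z' s20 s0.
exists z''; split; [by rewrite h5|by rewrite -h2|].
by apply: le_trans h3 _; lra.
Qed.

(** The supports are nested squares with corners [u n] and sides [3 s / 2^n]; each halving of both
    sides costs a factor 4 in the defect. *)
Lemma defect_chain z s : 0 < s -> exists2 u : nat -> P2, u 0%N = z & forall n,
  [/\ (u n).1 <= (u n.+1).1 <= (u n).1 + 3 * (s / 2 ^+ n.+1),
      (u n).2 <= (u n.+1).2 <= (u n).2 + 3 * (s / 2 ^+ n.+1) &
      defect (bsq z s s) <= 4 ^+ n * defect (bsq (u n) (s / 2 ^+ n) (s / 2 ^+ n))].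
Proof.
move=> s0.
have sn n : 0 < s / 2 ^+ n by rewrite divr_gt0// exprn_gt0.
have /choice[G hG] : forall nz : nat * P2, exists z', 
  [/\ nz.2.1 <= z'.1 <= nz.2.1 + 3 * (s / 2 ^+ nz.1 / 2), nz.2.2 <= z'.2 <= nz.2.2 + 3 * (s / 2 ^+ nz.1 / 2) &
      defect (bsq nz.2 (s / 2 ^+ nz.1) (s / 2 ^+ nz.1)) <= 4 * defect (bsq z' (s / 2 ^+ nz.1 / 2) (s / 2 ^+ nz.1 / 2))].
  by move=> [n z']; exact: defect_step.
pose u := fix u n := if n is m.+1 then G (m, u m) else z.
have e n : s / 2 ^+ n.+1 = s / 2 ^+ n / 2.
  by rewrite exprSr invfM mulrA.
exists u => // n; have [h1 h2 h3] := hG (n, u n).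
split; [by rewrite e|by rewrite e|].
elim: n {h1 h2 h3} => [|n IH]; first by rewrite expr0 mul1r divr1.
apply: le_trans IH _; rewrite exprSr -mulrA ler_pM2l ?exprn_gt0// e.
by have [_ _] := hG (n, u n).
Qed.

Lemma nested_point (a r : nat -> R) : (forall n, a n <= a n.+1 /\ a n.+1 + r n.+1 <= a n + r n) ->
  (forall n, 0 <= r n) -> exists p : R, forall n, a n <= p <= a n + r n.
Proof.
move=> h r0.
have mono m n : (m <= n)%N -> a m <= a n /\ a n + r n <= a m + r m.
  elim: n => [|n IH]; first by rewrite leqn0 => /eqP ->.
  rewrite leq_eqVlt => /predU1P[->//|]; rewrite ltnS => /IH [h1 h2].
  by have [h3 h4] := h n; split; [exact: le_trans h3|exact: le_trans h4 h2].
have ub m n : a m <= a n + r n.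
  have [mn|/ltnW nm] := leqP m n.
    by have [h1 _] := mono _ _ mn; apply: le_trans h1 _; rewrite lerDl.
  by have [_ h1] := mono _ _ nm; apply: le_trans h1; rewrite lerDl.
have hs : has_sup (range a).
  by split; [exists (a 0%N); exists 0%N|exists (a 0%N + r 0%N) => _ [m _ <-]].
exists (sup (range a)) => n; apply/andP; split.
  by apply: sup_upper_bound => //; exists n.
by apply: ge_sup => [|_ [m _ <-]//]; case: hs.
Qed.

(* [f1 + i f2] has the complex derivative [a + i b] at [p]. *)
Definition cdiff p := exists a b : R, forall e : R, 0 < e -> exists2 d : R, 0 < d & forall q, `|q - p| < d ->
  `|f1 q - (f1 p + (a * (q.1 - p.1) - b * (q.2 - p.2)))| <= e * `|q - p| /\
  `|f2 q - (f2 p + (b * (q.1 - p.1) + a * (q.2 - p.2)))| <= e * `|q - p|.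

Lemma I_small F p (r K : R) : 0 < r -> meas F -> (forall q, `|F q| <= K) ->
  (forall q, r < `|q - p| -> F q = 0) -> `|I L F| <= K * (2 * r) ^+ 2.
Proof.
move=> r0 mF hK h0.
have fb : (L (bbox r) < +oo)%E by exact: Leb_lfin.
have mb := bbox_meas r.
have z q : ~ bbox r q -> F (q + p) = 0 by move=> /negP; rewrite -ltNge => hq; apply: h0; rewrite addrK.
have iF : intg L (fun q => F (q + p)).
  apply: (@intg_indic _ _ _ L (bbox r) K) => //.
    by apply/measurable_EFinP; apply: (@meas_shift _ p (EFin \o F)); exact/measurable_EFinP.
rewrite -(I_shift p mF); apply: le_trans (I_abs iF) _.
have i1 : intg L (\1_(bbox r) : P2 -> R).
  apply: (@intg_indic _ _ _ L (bbox r) 1) => // [|q hq|q hq]; first exact: measurable_indic.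
    by rewrite indicE mem_set// normr1.
  by rewrite indicE memNset.
have := I_le (intg_abs iF) (intgZ K i1); rewrite (IZ K i1) (I_indic L mb) Leb_bbox//=; apply => q.
have [hq|hq] := pselect (bbox r q); first by rewrite indicE mem_set// mulr1.
by rewrite z// normr0 indicE memNset// mulr0.
Qed.

Lemma is_derive_aff1 (A B r : R) : is_derive r (1 : R) (fun r => A + B * r) B.
Proof. by apply: isd_eq; rewrite /GRing.scale/=; ring. Qed.

Lemma is_derive_ext (F G : R -> R) (r D : R) : is_derive r (1 : R) F D -> F =1 G -> is_derive r (1 : R) G D.
Proof. by move=> h /funext <-. Qed.

Lemma affine_CR p (a b : R) :
  CR (fun q => f1 p + (a * (q.1 - p.1) - b * (q.2 - p.2)))
     (fun q => f2 p + (b * (q.1 - p.1) + a * (q.2 - p.2))).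
Proof.
move: (f1 p) (f2 p) p.1 p.2 => u v s t.
have k1 (c : R) n : Ck n (fun q => c * (q.1 - s)) by apply: CkZ; apply: CkB; [exact: Ck_fst|exact: Ck_cst].
have k2 (c : R) n : Ck n (fun q => c * (q.2 - t)) by apply: CkZ; apply: CkB; [exact: Ck_snd|exact: Ck_cst].
split; first by apply: CkD; [exact: Ck_cst|apply: CkB].
  by apply: CkD; [exact: Ck_cst|apply: CkD].
have e1 : dx (fun q => u + (a * (q.1 - s) - b * (q.2 - t))) = fun=> a.
  apply: dxE => q; have h := is_derive_aff1 (u - a * s - b * (q.2 - t)) a.
  apply: (is_derive_ext (h _)) => r /=; ring.
have e2 : dy (fun q => u + (a * (q.1 - s) - b * (q.2 - t))) = fun=> - b.
  apply: dyE => q; have h := is_derive_aff1 (u + a * (q.1 - s) + b * t) (- b).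
  apply: (is_derive_ext (h _)) => r /=; ring.
have e3 : dx (fun q => v + (b * (q.1 - s) + a * (q.2 - t))) = fun=> b.
  apply: dxE => q; have h := is_derive_aff1 (v - b * s + a * (q.2 - t)) b.
  apply: (is_derive_ext (h _)) => r /=; ring.
have e4 : dy (fun q => v + (b * (q.1 - s) + a * (q.2 - t))) = fun=> a.
  apply: dyE => q; have h := is_derive_aff1 (v + b * (q.1 - s) - a * t) a.
  apply: (is_derive_ext (h _)) => r /=; ring.
by move=> q; rewrite e1 e2 e3 e4.
Qed.

(** The affine part of [f1 + i f2] at [p] is holomorphic and has defect 0. On the support the
    remainder is at most [3 s e], the derivatives of the spline are at most [M^2 / s], and the
    domain of integration lies in a square of area [36 s^2]; with two terms in each of two integrals
    this gives [432 = 2 * 2 * 3 * 36]. *)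
Lemma defect_small p z (s d e M : R) : 0 < s -> 3 * s < d -> 0 < e -> 0 < M ->
  (forall t : R, `|bs t| <= M /\ `|bs1 t| <= M) ->
  z.1 <= p.1 <= z.1 + 3 * s -> z.2 <= p.2 <= z.2 + 3 * s ->
  (exists a b : R, forall q, `|q - p| < d ->
  `|f1 q - (f1 p + (a * (q.1 - p.1) - b * (q.2 - p.2)))| <= e * `|q - p| /\
  `|f2 q - (f2 p + (b * (q.1 - p.1) + a * (q.2 - p.2)))| <= e * `|q - p|) ->
  defect (bsq z s s) <= e * (432 * M ^+ 2 * s ^+ 2).
Proof.
move=> s0 sd e0 M0 hM p1 p2 [a [b hd]].
have [A1 A2] := CR_annih (affine_CR p a b) (bsq_Ck z s s) (bsq_csupp z s0 s0).
have [kA1 kA2 _] := affine_CR p a b.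
set h1 := (fun q => f1 p + _) in A1 A2 kA1 hd; set h2 := (fun q => f2 p + _) in A1 A2 kA2 hd.
have B0 := bsq_csupp z s0 s0; have B1 := bsq_Ck z s s.
have lh1 : lint L h1 by apply: lbd_lint; [exact: Leb_lfin|exact/cont_lbd/(Ck_cont kA1)].
have lh2 : lint L h2 by apply: lbd_lint; [exact: Leb_lfin|exact/cont_lbd/(Ck_cont kA2)].
have i1 := test_intg l1 (Ck_dx B1) (csupp_dx B0); have i2 := test_intg l1 (Ck_dy B1) (csupp_dy B0).
have i3 := test_intg l2 (Ck_dx B1) (csupp_dx B0); have i4 := test_intg l2 (Ck_dy B1) (csupp_dy B0).
have j1 := test_intg lh1 (Ck_dx B1) (csupp_dx B0); have j2 := test_intg lh1 (Ck_dy B1) (csupp_dy B0).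
have j3 := test_intg lh2 (Ck_dx B1) (csupp_dx B0); have j4 := test_intg lh2 (Ck_dy B1) (csupp_dy B0).
have bx q : `|dx (bsq z s s) q| <= M ^+ 2 / s.
  rewrite dx_bsq normrM gtr0_norm ?invr_gt0// mulrC ler_pM2r ?invr_gt0// normrM expr2.
  by apply: ler_pM => //; [exact: (hM _).2|exact: (hM _).1].
have by_ q : `|dy (bsq z s s) q| <= M ^+ 2 / s.
  rewrite dy_bsq normrM gtr0_norm ?invr_gt0// mulrC ler_pM2r ?invr_gt0// normrM expr2.
  by apply: ler_pM => //; [exact: (hM _).1|exact: (hM _).2].
have out q : 3 * s < `|q - p| -> dx (bsq z s s) q = 0 /\ dy (bsq z s s) q = 0.
  move=> hq; rewrite dx_bsq dy_bsq; have [|_ -> ->] := @bsq_out z s s q s0 s0; last by rewrite !mulr0.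
  apply/negP => /andP[h3 h4]; move: hq; rewrite ltNge => /negP; apply; rewrite norm_le2/=.
  by rewrite !ler_norml; move: h3 h4 p1 p2; clear; case: q => q1 q2; case: p => a b; case: z => c d /=;
     move=> *; apply/andP; split; apply/andP; split; lra.
have K0 : 0 <= M ^+ 2 / s by rewrite divr_ge0// ?sqr_ge0// ltW.
have bnd (u v : P2 -> R) (X Y : P2 -> R) q :
    (`|q - p| < d -> `|u q| <= e * `|q - p| /\ `|v q| <= e * `|q - p|) ->
    `|X q| <= M ^+ 2 / s -> `|Y q| <= M ^+ 2 / s ->
    (3 * s < `|q - p| -> X q = 0 /\ Y q = 0) ->
    `|u q * X q| <= e * (3 * M ^+ 2) /\ `|v q * Y q| <= e * (3 * M ^+ 2).
  move=> huv hX hY hout; have [hq|hq] := lerP `|q - p| (3 * s); last first.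
    by have [-> ->] := hout hq; rewrite !mulr0 normr0 mulr_ge0// ?mulr_ge0 ?sqr_ge0 ?ltW.
  have [h3 h4] := huv (le_lt_trans hq sd).
  have h5 : e * `|q - p| <= e * (3 * s) by rewrite ler_pM2l.
  have -> : e * (3 * M ^+ 2) = (e * (3 * s)) * (M ^+ 2 / s).
    by move: s0 {hq sd p1 p2 hX hY hM K0} => s0; field; exact: lt0r_neq0.
  by split; rewrite normrM; apply: ler_pM => //; [exact: le_trans h3 h5|exact: le_trans h4 h5].
have m u q : `|u q| <= e * (3 * M ^+ 2) -> True by [].
have E (F : P2 -> R) : intg L F -> (forall q, `|F q| <= e * (3 * M ^+ 2) + e * (3 * M ^+ 2)) ->
    (forall q, 3 * s < `|q - p| -> F q = 0) -> `|I L F| <= e * (216 * M ^+ 2 * s ^+ 2).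
  move=> iF hF oF; have := I_small (mulr_gt0 (ltr0n _ 3) s0) (intg_meas iF) hF oF.
  by move=> h; apply: le_trans h _; rewrite le_eqVlt; apply/orP; left; apply/eqP; ring.
have D1 : defect1 (bsq z s s) = I L (fun q => (f1 q - h1 q) * dx (bsq z s s) q - (f2 q - h2 q) * dy (bsq z s s) q).
  rewrite /defect1 -[LHS]subr0 -A1 -(IB (intgB i1 i4) (intgB j1 j4)); congr I; apply/funext => q.
  by move: (f1 q) (f2 q) (h1 q) (h2 q) (dx (bsq z s s) q) (dy (bsq z s s) q) => *; ring.
have D2 : defect2 (bsq z s s) = I L (fun q => (f1 q - h1 q) * dy (bsq z s s) q + (f2 q - h2 q) * dx (bsq z s s) q).
  rewrite /defect2 -[LHS]subr0 -A2 -(IB (intgD i2 i3) (intgD j2 j3)); congr I; apply/funext => q.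
  by move: (f1 q) (f2 q) (h1 q) (h2 q) (dx (bsq z s s) q) (dy (bsq z s s) q) => *; ring.
have -> : e * (432 * M ^+ 2 * s ^+ 2) = e * (216 * M ^+ 2 * s ^+ 2) + e * (216 * M ^+ 2 * s ^+ 2) by ring.
rewrite /defect D1 D2; apply: lerD; apply: E.
- have := intgB (intgB i1 i4) (intgB j1 j4); congr (intg L _); apply/funext => q.
  by move: (f1 q) (f2 q) (h1 q) (h2 q) (dx (bsq z s s) q) (dy (bsq z s s) q) => *; ring.
- move=> q; have [h3 h4] := bnd (fun q => f1 q - h1 q) (fun q => f2 q - h2 q) _ _ q (hd q) (bx q) (by_ q) (out q).
  by apply: le_trans (ler_normB _ _) _; exact: lerD.
- by move=> q /out[-> ->]; rewrite !mulr0 subr0.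
- have := intgB (intgD i2 i3) (intgD j2 j3); congr (intg L _); apply/funext => q.
  by move: (f1 q) (f2 q) (h1 q) (h2 q) (dx (bsq z s s) q) (dy (bsq z s s) q) => *; ring.
- move=> q; have [h3 h4] := bnd (fun q => f1 q - h1 q) (fun q => f2 q - h2 q) (dy (bsq z s s)) (dx (bsq z s s)) q (hd q) (by_ q) (bx q) (fun h => conj (out q h).2 (out q h).1).
  by apply: le_trans (ler_normD _ _) _; exact: lerD.
- by move=> q /out[-> ->]; rewrite !mulr0 addr0.
Qed.

(** The nested squares shrink to a point where the complex derivative exists. The factor [4^n] lost
    in the bisection cancels against the square of the size [s / 2^n] in [defect_small], and [eta]
    is arbitrary. *)
Lemma defect0 z s : (forall p, cdiff p) -> 0 < s -> defect (bsq z s s) = 0.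
Proof.
move=> hf s0; have [M M0 hM] := @bs_bound R.
have [u u0 hu] := defect_chain z s0.
have sn n : 0 < s / 2 ^+ n by rewrite divr_gt0// exprn_gt0.
have e n : s / 2 ^+ n = 2 * (s / 2 ^+ n.+1).
  by rewrite exprS; field; rewrite expf_neq0.
have [p1 hp1] : exists p : R, forall n, (u n).1 <= p <= (u n).1 + 3 * (s / 2 ^+ n).
  apply: nested_point => n; last by rewrite mulr_ge0// ltW.
  by have [/andP[h1 h2] _ _] := hu n; split => //; rewrite (e n); move: h2; move: (s / _) => *; lra.
have [p2 hp2] : exists p : R, forall n, (u n).2 <= p <= (u n).2 + 3 * (s / 2 ^+ n).
  apply: nested_point => n; last by rewrite mulr_ge0// ltW.
  by have [_ /andP[h1 h2] _] := hu n; split => //; rewrite (e n); move: h2; move: (s / _) => *; lra.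
have [a [b hd]] := hf (p1, p2).
apply/eqP; rewrite eq_le; apply/andP; split; last by rewrite /defect addr_ge0.
apply/ler_addgt0Pr => eps eps0; rewrite add0r.
have C0 : 0 < 432 * M ^+ 2 * s ^+ 2.
  by apply: mulr_gt0; [apply: mulr_gt0; [rewrite ltr0n|exact: exprn_gt0]|exact: exprn_gt0].
pose eta := eps / (432 * M ^+ 2 * s ^+ 2).
have eta0 : 0 < eta by rewrite divr_gt0.
have [d d0 hd'] := hd _ eta0.
have [n hn] : exists n, 3 * (s / 2 ^+ n) < d.
  have [n _ hn] := near_infty_natSinv_lt (PosNum (divr_gt0 d0 (mulr_gt0 (ltr0n R 3) s0))).
  exists n.+1; have := hn n (leqnn n) => /=; rewrite ltr_pdivlMr ?mulr_gt0// => h.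
  apply: le_lt_trans h; rewrite mulrA mulrC ler_pM2r ?mulr_gt0// lef_pV2 ?posrE ?exprn_gt0 ?ltr0n//.
  by rewrite -natrX ler_nat ltnW// ltn_expl.
have [_ _ h] := hu n; apply: le_trans h _.
have := @defect_small (p1, p2) (u n) (s / 2 ^+ n) d eta M (sn n) hn eta0 M0 hM (hp1 n) (hp2 n) (ex_intro _ a (ex_intro _ b hd')).
move=> h; have p0 : 0 < 2 ^+ n :> R by rewrite exprn_gt0.
rewrite -(ler_pM2l (exprn_gt0 n (ltr0n R 4))) in h; apply: le_trans h _.
rewrite le_eqVlt; apply/orP; left; apply/eqP; rewrite /eta.
have -> : 4 ^+ n = 2 ^+ n * 2 ^+ n :> R by rewrite -exprMn -natrM.
by field; rewrite !lt0r_neq0.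
Qed.
End Squares.

(** * From vanishing defects to holomorphy *)

Section GoursatTheorem.
Context {R : realType}.
Local Notation P2 := (R * R)%type.
Local Notation L := (@Leb R).
Implicit Types (s r : R) (n : nat) (p q z w : P2) (f g a : P2 -> R).

Lemma moll_near a f z (r m c eta : R) : continuous a -> csupp a -> (forall w, 0 <= a w) ->
  (forall w, r < `|w| -> a w = 0) -> I L a = m -> 0 < m -> lint L f ->
  (forall w, `|w - z| <= r -> `|f w - c| <= eta) -> `|m^-1 * conv L a f z - c| <= eta.
Proof.
move=> ca sa a0 ar Ia m0 lf hf.
have ia : intg L a by apply: cont_intg => //; exact: Leb_lfin.
have ic : intg L (fun w => a (w - z)) by exact: (intg_shift (- z) ia).
have ifc := conv_intg z ca sa lf.
have Iz : I L (fun w => a (w - z)) = m by rewrite (I_shift (- z) (intg_meas ia)).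
have E : I L (fun w => (f w - c) * a (w - z)) = conv L a f z - c * m.
  rewrite -Iz -(IZ c ic) -(IB ifc (intgZ c ic)); congr I; apply/funext => w.
  by rewrite mulrBl.
have -> : m^-1 * conv L a f z - c = m^-1 * I L (fun w => (f w - c) * a (w - z)).
  by rewrite E; move: (conv _ _ _ _) => x; field; exact: lt0r_neq0.
rewrite normrM gtr0_norm ?invr_gt0// mulrC ler_pdivrMr// -Iz -(IZ eta ic).
have i1 : intg L (fun w => (f w - c) * a (w - z)).
  have := intgB ifc (intgZ c ic); congr (intg L _); apply/funext => w; by rewrite mulrBl.
apply: le_trans (I_abs i1) _; apply: I_le => [||w]; [exact: intg_abs|exact: intgZ|].
have [wz|wz] := lerP `|w - z| r; last by rewrite ar// !mulr0 normr0.
by rewrite normrM (ger0_norm (a0 _)); apply: ler_wpM2r; [exact: a0|exact: hf].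
Qed.

Lemma bsq_shift z s w : bsq (0 : P2) s s (w - z) = bsq z s s w.
Proof. by rewrite /bsq /= !subr0. Qed.

Lemma bsq_ge0 z s w : 0 <= bsq z s s w.
Proof. by rewrite /bsq mulr_ge0// bs_ge0. Qed.

Lemma bsq_far s w : 0 < s -> 3 * s < `|w| -> bsq (0 : P2) s s w = 0.
Proof.
move=> s0 h; have [|-> //] := @bsq_out _ 0 s s w s0 s0.
apply/negP => /= h1; move: h; rewrite ltNge => /negP; apply; rewrite norm_le2 !ler_norml.
by move: h1; rewrite !add0r; move: w.1 w.2 => x y h1; apply/andP; split; apply/andP; split; lra.
Qed.

Lemma bsq_mass s : 0 < s -> 0 < I L (bsq 0 s s).
Proof.
move=> s0; pose c : P2 := (3 / 2 * s, 3 / 2 * s).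
have mb := bbox_meas (s / 2); have s20 : 0 < s / 2 by rewrite divr_gt0.
have i1 : intg L (\1_(bbox (s / 2)) : P2 -> R).
  apply: (@intg_indic _ _ _ L (bbox (s / 2)) 1) => // [|||q hq]; [exact: Leb_lfin|exact: measurable_indic| |].
    by move=> q hq; rewrite indicE mem_set// normr1.
  by rewrite indicE memNset.
have i2 := intg_shift (- c) i1.
have ia : intg L (bsq 0 s s).
  by apply: cont_intg; [exact: Leb_lfin|exact: (Ck_cont (bsq_Ck _ _ _))|exact: bsq_csupp].
have : I L (fun w => \1_(bbox (s / 2)) (w - c)) <= I L (bsq 0 s s).
  apply: I_le => // w; rewrite indicE; have [/set_mem|_] := boolP (_ \in _); last exact: bsq_ge0.
  rewrite /bbox/= norm_le2 /= => /andP[h1 h2].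
  have b t : `|t - 3 / 2 * s| <= s / 2 -> 1 <= bs ((t - 0) * s^-1).
    rewrite subr0 ler_norml => /andP[h3 h4]; apply: bs_low; rewrite ler_pdivlMr// ler_pdivrMr//.
    by apply/andP; split; lra.
  by rewrite /bsq -[leLHS]mulr1; apply: ler_pM => //; exact: b.
rewrite (I_shift (- c) (intg_meas i1)) (I_indic L mb) Leb_bbox//=; apply: lt_le_trans.
by rewrite exprn_gt0// mulr_gt0.
Qed.

Lemma harmonic_lt (d : R) : 0 < d -> exists N, forall n, (N <= n)%N -> 3 * n.+1%:R^-1 < d.
Proof.
move=> d0; have [N _ hN] := near_infty_natSinv_lt (PosNum (divr_gt0 d0 (ltr0n R 3))).
exists N => n Nn; have := hN n Nn => /=; move: (n.+1%:R^-1) => x; rewrite ltr_pdivlMr// => h; lra.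
Qed.

(** The splines, whose defects vanish, serve as mollifiers in place of [al]. The mean is over a
    square of side [3/(n+1)] having [z] as a corner, not as its centre. *)
Definition moll n f z := (I L (bsq 0 n.+1%:R^-1 n.+1%:R^-1))^-1 * conv L (bsq 0 n.+1%:R^-1 n.+1%:R^-1) f z.

Lemma moll_close n f z (c eta : R) : continuous f ->
  (forall w, `|w - z| <= 3 * n.+1%:R^-1 -> `|f w - c| <= eta) -> `|moll n f z - c| <= eta.
Proof.
move=> cf h; have s0 : 0 < n.+1%:R^-1 :> R by rewrite invr_gt0 ltr0n.
apply: (@moll_near _ _ _ (3 * n.+1%:R^-1)) => //.
- exact: (Ck_cont (bsq_Ck _ _ _)).
- exact: bsq_csupp.
- by move=> w; exact: bsq_ge0.
- by move=> w; exact: bsq_far.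
- exact: bsq_mass.
- by apply: lbd_lint; [exact: Leb_lfin|exact: cont_lbd].
Qed.

Lemma moll_cvg f z : continuous f -> (moll n f z) @[n --> \oo] --> f z.
Proof.
move=> cf; apply/cvgrPdist_le => e e0; have [d d0 hd] := cont_eps z cf e0.
have [N hN] := harmonic_lt d0; exists N => //= n Nn.
rewrite distrC; apply: moll_close => // w hw; apply/ltW/hd/(le_lt_trans hw)/hN => //.
Qed.

Lemma moll_bound f (M : R) : continuous f -> exists2 C : R, 0 <= C & forall n z, `|z| <= M -> `|moll n f z| <= C.
Proof.
move=> cf; have [C hC] := cont_bounded (M + 3) cf; exists `|C| => // n z zM.
rewrite -[moll n f z]subr0; apply: moll_close => // w hw; rewrite subr0.
apply: le_trans (hC w _) (ler_norm _); rewrite -[w](subrK z).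
apply: le_trans (ler_normD _ _) _; rewrite addrC; apply: lerD => //; apply: le_trans hw _.
by rewrite ler_piMr// invf_le1 ?ltr0n// ler1n.
Qed.

Lemma moll_Ck n f : continuous f -> Ck 1 (moll n f).
Proof.
move=> cf; apply: CkZ; apply: conv_Ck; first exact: bsq_Ck.
  by apply: bsq_csupp; rewrite invr_gt0 ltr0n.
by apply: lbd_lint; [exact: Leb_lfin|exact: cont_lbd].
Qed.

(** Vanishing defects make all mollifications satisfy the Cauchy-Riemann equations. In the limit
    [f1 + i f2] is weakly holomorphic; being continuous, it equals its averages, which are
    holomorphic. *)
Lemma goursat f1 f2 : continuous f1 -> continuous f2 -> (forall p, cdiff f1 f2 p) -> CR f1 f2.
Proof.
move=> c1 c2 hf.
have l1 : lint L f1 by apply: lbd_lint; [exact: Leb_lfin|exact: cont_lbd].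
have l2 : lint L f2 by apply: lbd_lint; [exact: Leb_lfin|exact: cont_lbd].
have hn n : CR (moll n f1) (moll n f2).
  have s0 : 0 < n.+1%:R^-1 :> R by rewrite invr_gt0 ltr0n.
  apply: CRZ; apply: annih_conv_CR => //; [exact: bsq_Ck|exact: bsq_csupp|].
  move=> z; have -> : (fun w => bsq (0 : P2) n.+1%:R^-1 n.+1%:R^-1 (w - z)) = bsq z n.+1%:R^-1 n.+1%:R^-1.
    by apply/funext => w; exact: bsq_shift.
  have /eqP := defect0 c1 c2 z hf s0; rewrite paddr_eq0// => /andP[].
  by rewrite !normr_eq0 => /eqP h1 /eqP h2; split.
have lim (g1 g2 : P2 -> R) : continuous g1 -> continuous g2 -> csupp g1 -> csupp g2 ->
    (forall n, I L (fun p => moll n f1 p * g1 p + moll n f2 p * g2 p) = 0) ->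
    I L (fun p => f1 p * g1 p + f2 p * g2 p) = 0.
  move=> k1 k2 [M1 s1] [M2 s2] h.
  have [C1 C10 hC1] := moll_bound M1 c1; have [C2 C20 hC2] := moll_bound M2 c2.
  have mc n (f g : P2 -> R) : continuous f -> continuous g -> continuous (fun p => moll n f p * g p).
    by move=> kf kg p; apply: cvgM; [exact: (Ck_cont (moll_Ck n kf))|exact: kg].
  have G : intg L (fun p => C1 * `|g1 p| + C2 * `|g2 p|).
    by apply: intgD; apply: intgZ; apply: intg_abs; apply: cont_intg => //;
      try exact: Leb_lfin; [exists M1|exists M2].
  have [|||_ hlim] := @I_dct _ _ _ L (fun n p => moll n f1 p * g1 p + moll n f2 p * g2 p)
     (fun p => f1 p * g1 p + f2 p * g2 p) _ _ _ G.
  - by move=> n; apply: cont_meas => p; apply: cvgD; exact: mc.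
  - by move=> p; apply: cvgD; apply: cvgM; [exact: moll_cvg|exact: cvg_cst|exact: moll_cvg|exact: cvg_cst].
  - move=> n p; apply: le_trans (ler_normD _ _) _; apply: lerD; rewrite normrM.
      have [hp|/s1 ->] := lerP `|p| M1; last by rewrite normr0 !mulr0.
      by apply: ler_wpM2r => //; exact: hC1.
    have [hp|/s2 ->] := lerP `|p| M2; last by rewrite normr0 !mulr0.
    by apply: ler_wpM2r => //; exact: hC2.
  move: hlim; under eq_fun do rewrite h.
  by move=> /(cvg_lim (@Rhausdorff R)); rewrite (cvg_lim (@Rhausdorff R) (cvg_cst _)) => <-.
have w : whol f1 f2.
  move=> g cg sg; have cx := Ck_cont (Ck_dx cg); have cy := Ck_cont (Ck_dy cg).
  have sx := csupp_dx sg; have sy := csupp_dy sg.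
  have cny : continuous (fun p => - dy g p) by move=> p; apply: cvgN; exact: cy.
  have sny := csuppN sy.
  split.
    have -> : (fun p => f1 p * dx g p - f2 p * dy g p) = (fun p => f1 p * dx g p + f2 p * - dy g p).
      by apply/funext => p; rewrite mulrN.
    apply: lim => // n; have [h _] := CR_whol (hn n) cg sg; rewrite -[RHS]h; congr I.
    by apply/funext => p; rewrite mulrN.
  by apply: lim => // n; have [_ h] := CR_whol (hn n) cg sg; rewrite -[RHS]h.
have [w1 w2] := whol_harm l1 l2 w.
have e1 := wharm_fix ltr01 c1 w1; have e2 := wharm_fix ltr01 c2 w2.
by rewrite -e1 -e2; exact: whol_Av.
Qed.

(** The expansion of [C1_rem] for both components, with the derivatives in [y] eliminated by the
    Cauchy-Riemann equations. *)
Lemma CR_cdiff f1 f2 p : CR f1 f2 -> forall e : R, 0 < e -> exists2 d : R, 0 < d & forall q, `|q - p| < d ->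
  `|f1 q - (f1 p + (dx f1 p * (q.1 - p.1) - dx f2 p * (q.2 - p.2)))| <= e * `|q - p| /\
  `|f2 q - (f2 p + (dx f2 p * (q.1 - p.1) + dx f1 p * (q.2 - p.2)))| <= e * `|q - p|.
Proof.
move=> [k1 k2 h] e e0; have e20 : 0 < e / 2 by rewrite divr_gt0.
have [d1 d10 h1] := C1_rem p k1 e20; have [d2 d20 h2] := C1_rem p k2 e20.
exists (Num.min d1 d2) => [|q]; first by rewrite lt_min d10.
rewrite lt_min => /andP[q1 q2].
have nn : e / 2 * (`|q.1 - p.1| + `|q.2 - p.2|) <= e * `|q - p|.
  have : `|q - p| <= `|q - p| by []. 
  rewrite [in X in X -> _]norm_le2/= => /andP[u v].
  have -> : e * `|q - p| = e / 2 * (`|q - p| + `|q - p|) by move: `|q - p| => x; field.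
  by rewrite ler_pM2l//; exact: lerD.
have := h1 _ q1; have := h2 _ q2; rewrite (subrKC p q) /= -(h p).1 (h p).2 => r2 r1.
split.
  apply: le_trans nn; apply: le_trans r1; rewrite le_eqVlt; apply/orP; left; apply/eqP; congr `|_|.
  by move: (f1 q) (f1 p) (dx f1 p) (dx f2 p) => *; ring.
apply: le_trans nn; apply: le_trans r2; rewrite le_eqVlt; apply/orP; left; apply/eqP; congr `|_|.
by move: (f2 q) (f2 p) (dx f1 p) (dx f2 p) => *; ring.
Qed.
End GoursatTheorem.

(** * Euclidean norm and discs *)

Section Euclid.
Context {R : realType}.
Local Notation P2 := (R * R)%type.
Implicit Types (p q w z : P2) (r s : R).

(** The Euclidean norm, the ambient norm of [R * R] being the maximum norm; discs are taken with
    respect to it. *)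
Definition en p : R := Num.sqrt (sq p).

Lemma en_ge0 p : 0 <= en p. Proof. exact: sqrtr_ge0. Qed.

Lemma en_sq p : en p ^+ 2 = sq p. Proof. by rewrite sqr_sqrtr// sq_ge0. Qed.

Lemma en_lt p r : 0 < r -> (en p < r) = (sq p < r ^+ 2).
Proof. by move=> r0; rewrite -en_sq ltr_pXn2r// nnegrE ?en_ge0// ltW. Qed.

Lemma en_le p r : 0 <= r -> (en p <= r) = (sq p <= r ^+ 2).
Proof. by move=> r0; rewrite -en_sq ler_pXn2r// nnegrE en_ge0. Qed.

Lemma en0 : en 0 = 0.
Proof. by rewrite /en /sq /= expr0n /= addr0 sqrtr0. Qed.

Lemma enN p : en (- p) = en p.
Proof. by rewrite /en /sq /= !sqrrN. Qed.

Lemma en_normr t : en (t, 0) = `|t|.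
Proof. by rewrite /en /sq /= expr0n /= addr0 sqrtr_sqr. Qed.

Lemma en_norm p : `|p| <= en p <= 2 * `|p|.
Proof.
have /andP[h1 h2] := sq_norm p; have h0 := normr_ge0 p; apply/andP; split.
  by rewrite -(@ler_pXn2r _ 2) ?nnegrE ?en_ge0// en_sq.
by rewrite en_le ?mulr_ge0//; move: (sq p) (`|p|) h0 h1 h2 => a b *; nra.
Qed.

Lemma cs2 (a b c d x y : R) : 0 <= x -> 0 <= y -> x ^+ 2 = a ^+ 2 + b ^+ 2 -> y ^+ 2 = c ^+ 2 + d ^+ 2 ->
  a * c + b * d <= x * y.
Proof.
move=> x0 y0 hx hy; have [h|h] := lerP (a * c + b * d) 0; first by rewrite (le_trans h)// mulr_ge0.
rewrite -(@ler_pXn2r _ 2) ?nnegrE ?mulr_ge0//; last by rewrite ltW.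
rewrite exprMn hx hy; have := sqr_ge0 (a * d - b * c).
by rewrite -subr_ge0 => h2; rewrite -subr_ge0 (le_trans h2)// le_eqVlt; apply/orP; left; apply/eqP; ring.
Qed.

Lemma enD p q : en (p + q) <= en p + en q.
Proof.
rewrite en_le ?addr_ge0 ?en_ge0//.
have := cs2 (en_ge0 p) (en_ge0 q) (en_sq p) (en_sq q).
rewrite sqrrD !en_sq /sq /=; move: (en p * en q) p.1 p.2 q.1 q.2 => x a b c d h.
by rewrite mulr2n; nra.
Qed.

Lemma en_cont : continuous en.
Proof.
move=> p; apply: continuous_comp; first exact: (Ck_cont (sq_Ck 0)).
exact: sqrt_continuous.
Qed.

Lemma Ek_out e r w : 0 < e -> e <= r -> r <= en w -> Ek e r w = 0.
Proof.
move=> e0 er h; have r0 := lt_le_trans e0 er; apply: Ek_supp => //.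
by rewrite -en_sq ler_pXn2r// nnegrE ?en_ge0// ltW.
Qed.

Lemma al_out r w : 0 < r -> r <= en w -> al r w = 0.
Proof. by move=> r0 h; apply: al_supp => //; rewrite -en_sq ler_pXn2r// nnegrE ?en_ge0// ltW. Qed.

Definition D p r : set P2 := [set q | en (q - p) < r].

Lemma D_meas p r : measurable (D p r).
Proof.
have c : continuous (fun q => en (q - p)).
  by move=> q; apply: continuous_comp; [apply: cvgB; [exact: cvg_id|exact: cvg_cst]|exact: en_cont].
have := cont_meas c measurableT (measurable_itv `]-oo, r[); rewrite setTI.
by congr measurable; apply/seteqP; split => q; rewrite /D /= in_itv.
Qed.

Lemma D_sub p q r s : en (p - q) + r <= s -> D p r `<=` D q s.
Proof.
move=> h w; rewrite /D /= => hw; apply: lt_le_trans h; rewrite -[w](subrK p) -addrA addrC.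
by apply: le_lt_trans (enD _ _) _; rewrite ltrD2l.
Qed.

Lemma D_disj p q r s : r + s <= en (p - q) -> [disjoint D p r & D q s].
Proof.
move=> h; apply/disj_setPS => w [/=]; rewrite /D /= => h1 h2.
have : en (p - q) <= en (w - p) + en (w - q).
  by rewrite -(enN (w - p)) opprB; apply: le_trans (enD _ _); rewrite addrA subrK.
by move=> ?; lra.
Qed.

Lemma bbox_D M : bbox M `<=` D (0 : P2) (2 * M + 1).
Proof.
move=> p; rewrite /bbox /D /= subr0 => h; have /andP[_ h2] := en_norm p; lra.
Qed.
End Euclid.

(** * Doubling measures *)

Section DoublingMeasure.
Context {R : realType}.
Local Notation P2 := (R * R)%type.
Implicit Types (p q w z : P2) (r s e : R).
Variable mu : {measure set P2 -> \bar R}.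
Hypothesis mu_fin : forall p r, (mu (D p r) < +oo)%E.
Variable cd : R.
Hypothesis cd0 : 0 < cd.
Hypothesis mu_dbl : forall p r, 0 < r -> (mu (D p (2 * r)) <= cd%:E * mu (D p r))%E.
Variable rho : P2 -> R.
Hypothesis rho0 : forall p, 0 < rho p.
Hypothesis mu_rho : forall p, mu (D p (rho p)) = 1%:E.

Definition m p r : R := fine (mu (D p r)).

Lemma m_fin p r : mu (D p r) = (m p r)%:E.
Proof. by rewrite fineK// ge0_fin_numE. Qed.

Lemma m_ge0 p r : 0 <= m p r. Proof. by rewrite fine_ge0. Qed.

Lemma m_le p q r s : en (p - q) + r <= s -> m p r <= m q s.
Proof.
move=> h; rewrite -lee_fin -!m_fin; apply: le_measure; rewrite ?inE; try exact: D_meas.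
exact: D_sub.
Qed.

Lemma m_mono p r s : r <= s -> m p r <= m p s.
Proof. by move=> h; apply: m_le; rewrite subrr en0 add0r. Qed.

Lemma m_dbl p r : 0 < r -> m p (2 * r) <= cd * m p r.
Proof. by move=> r0; rewrite -lee_fin EFinM -!m_fin; exact: mu_dbl. Qed.

Lemma m_dbln p r n : 0 < r -> m p (2 ^+ n * r) <= cd ^+ n * m p r.
Proof.
move=> r0; elim: n => [|n IH]; first by rewrite !expr0 !mul1r.
rewrite !exprS -!mulrA; apply: le_trans (m_dbl _ _) _; first by rewrite mulr_gt0// exprn_gt0.
by rewrite ler_pM2l.
Qed.

Lemma m_rho p : m p (rho p) = 1. Proof. by rewrite /m mu_rho. Qed.

(** Some [2^n r] exceeds [rho p], and the disc of that radius has mass at least 1. *)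
Lemma m_gt0 p r : 0 < r -> 0 < m p r.
Proof.
move=> r0; have [n hn] : exists n, rho p <= 2 ^+ n * r.
  have [n hn] : exists n : nat, rho p / r <= n%:R.
    by have [n [h _]] := nat_bound (rho p / r) 0; exists n; apply: le_trans (ler_norm _) (ltW h).
  exists n; rewrite -ler_pdivrMr//; apply: le_trans hn _.
  by rewrite -natrX ler_nat ltnW// ltn_expl.
have h := m_dbln p n r0; have h1 := m_mono p hn; rewrite m_rho in h1.
have : 0 < cd ^+ n * m p r by lra.
by rewrite pmulr_rgt0// exprn_gt0.
Qed.

Lemma m_add p q1 q2 r r1 r2 : en (q1 - p) + r1 <= r -> en (q2 - p) + r2 <= r ->
  r1 + r2 <= en (q1 - q2) -> m q1 r1 + m q2 r2 <= m p r.
Proof.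
move=> h1 h2 h3; rewrite -lee_fin EFinD -!m_fin -measureU; try exact: D_meas.
  apply: le_measure; rewrite ?inE; [by apply: measurableU; exact: D_meas|exact: D_meas|].
  by rewrite subUset; split; exact: D_sub.
by have := D_disj h3 => /disj_set2P.
Qed.

Lemma point_at p r : 0 <= r -> exists q, en (q - p) = r.
Proof.
move=> r0; exists (p.1 + r, p.2); have -> : (p.1 + r, p.2) - p = (r, 0).
  by apply/pair_equal_spec; split => /=; [rewrite addrC addKr|rewrite subrr].
by rewrite en_normr ger0_norm.
Qed.

(** The annulus between both circles contains a disc of radius [(s - r) / 2], which has positive
    mass. Strictness is what determines [rho] from the mass. *)
Lemma m_lt p r s : 0 < r -> r < s -> m p r < m p s.
Proof.
move=> r0 rs; have [|q hq] := @point_at p ((r + s) / 2); first by rewrite divr_ge0//; lra.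
have d0 : 0 < (s - r) / 2 by rewrite divr_gt0//; lra.
have : m p r + m q ((s - r) / 2) <= m p s.
  apply: m_add; rewrite ?subrr ?en0 ?hq ?add0r; [lra|lra|].
  by rewrite -enN opprB hq; lra.
by have := m_gt0 q d0; lra.
Qed.

Lemma rho_le p r : 0 < r -> 1 <= m p r -> rho p <= r.
Proof. by move=> r0 h; rewrite leNgt; apply/negP => /(m_lt p r0); rewrite m_rho; lra. Qed.

(** The disc about [p] of this radius contains the disc of mass 1 about [q]. *)
Lemma rho_lip p q : rho p <= rho q + en (p - q).
Proof.
apply: rho_le; first by rewrite ltr_pwDl ?en_ge0.
by rewrite -(m_rho q); apply: m_le; rewrite -enN opprB addrC.
Qed.

Lemma rho_cont : continuous rho.
Proof.
move=> p; apply: eps_cont => e e0; exists (e / 2); first by rewrite divr_gt0.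
move=> q hq; have /andP[_ h] := en_norm (q - p).
have h1 := rho_lip p q; have h2 := rho_lip q p; rewrite -enN opprB in h1.
by rewrite ltr_norml; apply/andP; split; lra.
Qed.

Lemma rho_low (M : R) : exists2 e : R, 0 < e & forall p, `|p| <= M -> e <= rho p.
Proof.
have c : continuous (fun p => (rho p)^-1).
  by move=> p; apply: cvgV; [exact: lt0r_neq0|exact: rho_cont].
have [C hC] := cont_bounded M c; have C0 : 0 < `|C| + 1 by rewrite ltr_pwDr.
exists ((`|C| + 1)^-1); first by rewrite invr_gt0.
move=> p /hC; rewrite ger0_norm ?invr_ge0 ?(ltW (rho0 p))// => h.
rewrite -[leRHS]invrK lef_pV2 ?posrE ?invr_gt0//.
by have := ler_norm C; lra.
Qed.

Definition rd : R := 1 + cd ^- 2.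

Lemma cd2_gt0 : 0 < cd ^- 2. Proof. by rewrite invr_gt0 exprn_gt0. Qed.

Lemma m_quarter p r : 0 < r -> cd ^- 2 * m p r <= m p (4^-1 * r).
Proof.
move=> r0; rewrite mulrC ler_pdivrMr ?exprn_gt0// mulrC.
have := m_dbln p 2 (_ : 0 < 4^-1 * r); rewrite mulrA -natrX mulfV ?mul1r//; apply.
by rewrite mulr_gt0// invr_gt0.
Qed.

(** Reverse doubling. The tripled disc also contains a disjoint disc of radius [r] centred at
    distance [2 r]; the disc of radius [4 r] with that centre contains the original one, so doubling
    twice bounds the additional mass from below. *)
Lemma m_reverse p r : 0 < r -> rd * m p r <= m p (3 * r).
Proof.
move=> r0; have [|q hq] := @point_at p (2 * r); first by rewrite mulr_ge0// ltW.
have h : m p r + m q r <= m p (3 * r).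
  by apply: m_add; rewrite ?subrr ?en0 ?hq ?add0r -?[en (p - q)]enN ?opprB ?hq; lra.
have h4 : 0 < 4 * r by rewrite mulr_gt0.
have := m_quarter q h4; rewrite mulrA mulVf ?mul1r// => h1.
have h2 : m p r <= m q (4 * r) by apply: m_le; rewrite -enN opprB hq; lra.
have := cd2_gt0; rewrite /rd; move: (cd ^- 2) (m p r) (m q (4 * r)) (m q r) (m p (3 * r)) h h1 h2 => a b c d e.
by move=> *; nra.
Qed.

Lemma m_infty p (A : R) : exists2 r, 0 < r & A <= m p r.
Proof.
have h n : 1 + n%:R * cd ^- 2 <= m p (3 ^+ n * rho p).
  elim: n => [|n IH]; first by rewrite mul0r addr0 expr0 mul1r m_rho.
  have h3 : 0 < 3 ^+ n * rho p by rewrite mulr_gt0// exprn_gt0.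
  rewrite (exprS 3 n) -mulrA; apply: le_trans (m_reverse p h3).
  rewrite /rd -natr1; have := cd2_gt0; have : (0:R) <= n%:R by [].
  by move: IH; move: (cd ^- 2) (m p _) (n%:R) => a b k *; nra.
have [k [hk _]] := nat_bound (A * cd ^+ 2) 0.
exists (3 ^+ k * rho p); first by rewrite mulr_gt0// exprn_gt0.
apply: le_trans (h k); apply: le_trans (_ : k%:R * cd ^- 2 <= _); last by rewrite lerDr.
by rewrite ler_pdivlMr ?exprn_gt0//; exact: le_trans (ler_norm _) (ltW hk).
Qed.

Lemma mu_lfin : lfin mu.
Proof.
move=> M; apply: le_lt_trans (mu_fin 0 (2 * M + 1)).
by apply: le_measure; rewrite ?inE; [exact: bbox_meas|exact: D_meas|exact: bbox_D].
Qed.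

Lemma I_D p r : intg mu (\1_(D p r) : P2 -> R) /\ I mu (\1_(D p r)) = m p r.
Proof.
split; last by rewrite (I_indic mu (D_meas p r)).
apply: (@intg_indic _ _ _ mu (D p r) 1) => //.
- exact: D_meas.
- by have mD := D_meas p r; exact: measurable_indic.
- by move=> q hq; rewrite indicE mem_set// normr1.
- by move=> q hq; rewrite indicE memNset.
Qed.

Lemma Ek_shift_intg e r z : 0 < e -> e <= r -> intg mu (fun w => Ek e r (w - z)).
Proof.
move=> e0 er; apply: cont_intg; first exact: mu_lfin.
  exact: (Ck_cont (Ck_shift (- z) (Ek_Ck e r))).
exact: (csupp_shift (- z) (Ek_csupp e0 er)).
Qed.

(** The sum of the series of terms [2 rd^-j]: on cutting [Ek] at the radii [r / 3^j], each piece is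
    at most 2 and lives on a disc whose mass has decreased by a factor [rd^j]. *)
Definition KE : R := 2 * rd / (rd - 1).

Lemma KE_gt0 : 0 < KE.
Proof. by have := cd2_gt0; rewrite /KE /rd => h; rewrite divr_gt0 ?mulr_gt0//; lra. Qed.

Lemma Ek3_mass r z : 0 < r -> I mu (fun w => Ek r (3 * r) (w - z)) <= 2 * m z (3 * r).
Proof.
move=> r0; have [i1 <-] := I_D z (3 * r); have r3 : r <= 3 * r by lra.
rewrite -(IZ 2 i1); apply: I_le => [||w]; [exact: Ek_shift_intg|exact: intgZ|].
rewrite indicE; have [/set_mem _|/negP h] := boolP (w \in _); first by rewrite mulr1 Ek3_le.
by rewrite mulr0 Ek_out// leNgt; apply/negP => hh; apply: h; rewrite inE.
Qed.

Lemma Ek_massn n r z : 0 < r -> I mu (fun w => Ek (r / 3 ^+ n) r (w - z)) <= KE * m z r.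
Proof.
elim: n r => [|n IH] r r0.
  have -> : (fun w => Ek (r / 3 ^+ 0) r (w - z)) = fun=> 0.
    apply/funext => w; rewrite expr0 divr1; have := Ek_add r r r (w - z).
    by move/eqP; rewrite -subr_eq subrr => /eqP <-.
  by rewrite I0 mulr_ge0 ?m_ge0// ltW// KE_gt0.
have s0 : 0 < r / 3 by rewrite divr_gt0.
have p0 : 0 < r / 3 / 3 ^+ n by rewrite divr_gt0// exprn_gt0.
have pr : r / 3 / 3 ^+ n <= r / 3.
  by rewrite ler_pdivrMr ?exprn_gt0// ler_pMr// exprn_ege1// ler1n.
have e : r / 3 ^+ n.+1 = r / 3 / 3 ^+ n by rewrite exprS invfM mulrA.
have r3 : 3 * (r / 3) = r by field.
have -> : (fun w => Ek (r / 3 ^+ n.+1) r (w - z)) =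
    (fun w => Ek (r / 3 / 3 ^+ n) (r / 3) (w - z) + Ek (r / 3) r (w - z)).
  by apply/funext => w; rewrite e (Ek_add (r / 3 / 3 ^+ n) (r / 3) r).
rewrite ID; [|exact: Ek_shift_intg|apply: Ek_shift_intg => //; lra].
have h1 := IH _ s0; have h2 := Ek3_mass z s0; have h3 := m_reverse z s0; rewrite r3 in h2 h3.
apply: le_trans (lerD h1 h2) _.
have k0 := cd2_gt0; have kr : rd - 1 = cd ^- 2 by rewrite /rd; ring.
have rd0 : 0 < rd by rewrite /rd; lra.
rewrite /KE kr -(mulrA 2) -!mulrA; have := m_ge0 z r; move: h3; rewrite /rd.
move: k0; move: (cd ^- 2) (m z (r / 3)) (m z r) => a b c a0 h c0'.
rewrite (_ : 2 * ((1 + a) * (a^-1 * b)) = 2 * a^-1 * ((1 + a) * b)); last by ring.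
rewrite (_ : 2 * ((1 + a) * (a^-1 * c)) = 2 * a^-1 * c + 2 * c); last by field; exact: lt0r_neq0.
by rewrite lerD2r ler_pM2l// mulr_gt0// invr_gt0.
Qed.

(** The bound is uniform in the inner radius [e], since reverse doubling excludes a concentration of
    mass at the centre. It is first proved for radii [r / 3^n], below [e] for large [n]. *)
Lemma Ek_mass e r z : 0 < e -> e <= r -> I mu (fun w => Ek e r (w - z)) <= KE * m z r.
Proof.
move=> e0 er; have r0 := lt_le_trans e0 er.
have [n [hn _]] := nat_bound (r / e) 0.
have p0 : 0 < r / 3 ^+ n by rewrite divr_gt0// exprn_gt0.
have pr : r / 3 ^+ n <= r.
  by rewrite ler_pdivrMr ?exprn_gt0// ler_pMr// exprn_ege1// ler1n.
have pe : r / 3 ^+ n <= e.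
  rewrite ler_pdivrMr ?exprn_gt0// mulrC -ler_pdivrMr//; apply: le_trans (ler_norm _) _.
  by apply/ltW/(lt_le_trans hn); rewrite -natrX ler_nat ltnW// ltn_expl.
apply: le_trans (Ek_massn n z r0); apply: I_le => [||w]; [exact: Ek_shift_intg|exact: Ek_shift_intg|].
by rewrite (Ek_add (r / 3 ^+ n) e r) lerDr Ek_ge0.
Qed.
End DoublingMeasure.

(** * Subharmonic functions and potentials *)

Section Rotation.
Context {R : realType}.
Local Notation P2 := (R * R)%type.
Local Notation L := (@Leb R).
Local Notation lam := (@lebesgue_measure R).
Implicit Types (p q w z : P2) (r s t c : R).

Definition rot c s w : P2 := (c * w.1 - s * w.2, s * w.1 + c * w.2).

Lemma rot_meas c s : measurable_fun setT (rot c s : P2 -> P2).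
Proof.
apply: measurable_fun_pair.
  by apply: measurable_funB; apply: measurable_funM => //; exact: measurable_cst.
by apply: measurable_funD; apply: measurable_funM => //; exact: measurable_cst.
Qed.

(* A rotation with nonzero sine is a product of three shears. *)
Lemma rot_shear c s (f : P2 -> \bar R) : s != 0 -> c ^+ 2 + s ^+ 2 = 1 ->
  measurable_fun setT f -> (forall p, 0 <= f p)%E ->
  (\int[L]_p f (rot c s p) = \int[L]_p f p)%E.
Proof.
move=> s0 cs mf f0; pose a := (c - 1) / s.
have ma : meas (fun y : R => a * y) by apply: measurable_funM => //; exact: measurable_cst.
have ms : meas (fun y : R => s * y) by apply: measurable_funM => //; exact: measurable_cst.
have sx : measurable_fun setT (fun p : P2 => (p.1 + a * p.2, p.2)).
  apply: measurable_fun_pair => //; apply: measurable_funD => //.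
  by apply: measurable_funM => //; exact: measurable_cst.
have sy : measurable_fun setT (fun p : P2 => (p.1, p.2 + s * p.1)).
  apply: measurable_fun_pair => //; apply: measurable_funD => //.
  by apply: measurable_funM => //; exact: measurable_cst.
pose f1 p := f (p.1 + a * p.2, p.2); pose f2 p := f1 (p.1, p.2 + s * p.1).
have m1 : measurable_fun setT f1 by exact: measurableT_comp.
have m2 : measurable_fun setT f2 by exact: (measurableT_comp m1).
rewrite -(ge0_shearx ma mf f0) -(@ge0_sheary _ (fun y => s * y) f1 ms m1 (fun p => f0 _)).
rewrite -(@ge0_shearx _ (fun y => a * y) f2 ma m2 (fun p => f0 _)).
apply: eq_integral => -[x y] _; rewrite /f2 /f1 /rot /=; congr f; rewrite /a.
have cs' : c ^+ 2 = 1 - s ^+ 2 by rewrite -cs addrK.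
have E1 : x + (c - 1) / s * y + (c - 1) / s * (y + s * (x + (c - 1) / s * y)) =
   c * x + (c ^+ 2 - 1) / s * y by field.
have E2 : y + s * (x + (c - 1) / s * y) = s * x + c * y by field.
by rewrite E1 E2 cs'; congr pair; field.
Qed.

Lemma ge0_rot c s (f : P2 -> \bar R) : c ^+ 2 + s ^+ 2 = 1 ->
  measurable_fun setT f -> (forall p, 0 <= f p)%E ->
  (\int[L]_p f (rot c s p) = \int[L]_p f p)%E.
Proof.
move=> cs mf f0; have [s0|] := eqVneq s 0; last by move=> s0; exact: rot_shear.
have : (c - 1) * (c + 1) == 0 by rewrite -subr_sqr expr1n -cs s0 expr0n /= addr0 subrr.
rewrite mulf_eq0 => /orP[|].
  rewrite subr_eq0 => /eqP ->; rewrite s0; apply: eq_integral => -[x y] _; congr f.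
  by rewrite /rot /= !mul0r !mul1r subr0 add0r.
(* The half-turn has sine 0 and is not reached by shears; it is the square of the quarter turn. *)
rewrite addr_eq0 => /eqP ->; rewrite s0.
have n1 : (1 : R) != 0 by exact: oner_neq0.
have e1 : (0 : R) ^+ 2 + 1 ^+ 2 = 1 by rewrite expr0n expr1n add0r.
have mg : measurable_fun setT (fun p => f (rot 0 1 p)) by apply: measurableT_comp => //; exact: rot_meas.
rewrite -(rot_shear n1 e1 mf f0) -(@rot_shear 0 1 (fun p => f (rot 0 1 p)) n1 e1 mg (fun p => f0 _)).
by apply: eq_integral => -[x y] _; congr f; rewrite /rot /=; congr pair; ring.
Qed.

Lemma polar w : exists t : R, 0 <= t <= 2 * pi /\ w = (en w * cos t, en w * sin t).
Proof.
have [w0|w0] := eqVneq (en w) 0.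
  exists 0; rewrite lexx mulr_ge0 ?pi_ge0//; split => //.
  have /andP[h _] := en_norm w; rewrite w0 normr_le0 in h; rewrite (eqP h) en0 !mul0r.
  by [].
have r0 : 0 < en w by rewrite lt0r w0 en_ge0.
set r := en w in w0 r0 *.
have e : (w.1 / r) ^+ 2 + (w.2 / r) ^+ 2 = 1.
  by rewrite !exprMn -mulrDl -/(sq w) -en_sq -/r -exprMn mulfV// expr1n.
have b : -1 <= w.1 / r <= 1.
  by rewrite -ler_norml -(@ler_pXn2r _ 2)// ?nnegrE// expr1n real_normK ?num_real// -e lerDl sqr_ge0.
have c1 : cos (acos (w.1 / r)) = w.1 / r by apply: acosK; rewrite in_itv.
have s1 : sin (acos (w.1 / r)) = `|w.2 / r|.
  by rewrite sin_acos// -e addrC addKr sqrtr_sqr.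
have a0 := acos_ge0 b; have a1 := acos_lepi b.
have fin (t : R) : cos t = w.1 / r -> sin t = w.2 / r -> w = (r * cos t, r * sin t).
  by move=> -> ->; rewrite ![r * _]mulrC !divfK//; case: (w).
have [h|h] := lerP 0 (w.2 / r).
  exists (acos (w.1 / r)); rewrite ger0_norm// in s1; split; last exact: fin.
  by apply/andP; split => //; have := pi_ge0 R; lra.
rewrite ltr0_norm// in s1; exists (- acos (w.1 / r) + pi *+ 2); split.
  by rewrite mulr2n; apply/andP; split; lra.
by apply: fin; rewrite ?cosD2pi ?sinD2pi ?cosN ?sinN ?s1 ?opprK.
Qed.

Local Notation TT := (2 * pi : R).

(** The shifted period [[th, TT + th[] is cut at [TT], and periodicity moves the piece beyond [TT]
    back to [[0, th[]. *)
Lemma periodic_shift (F : R -> \bar R) (th : R) : 0 <= th <= TT -> measurable_fun setT F ->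
  (forall t, 0 <= F t)%E -> (forall t, F (t + TT)%R = F t) ->
  (\int[lam]_(t in `[0%R, TT]%classic) F (t + th)%R = \int[lam]_(t in `[0%R, TT]%classic) F t)%E.
Proof.
move=> /andP[th0 th1] mF F0 per.
have ind (a b : R) (G : R -> \bar R) : (\int[lam]_(t in `[a, b[%classic) G t = \int[lam]_t (G t * (\1_(`[a, b[%classic) t)%:E))%E.
  by rewrite integral_mkcond; apply: eq_integral => t _; rewrite patchE indicE; case: ifP => _; rewrite ?mule1 ?mule0.
have mi (a b : R) : measurable_fun setT (fun t : R => (\1_(`[a, b[%classic) t : R)%:E).
  by apply/measurable_EFinP; apply: measurable_indic; exact: measurable_itv.
have mm (a b : R) : measurable_fun setT (fun t => F t * (\1_(`[a, b[%classic) t)%:E)%E.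
  by apply: emeasurable_funM => //; exact: mi.
have nn (a b : R) t : (0 <= F t * (\1_(`[a, b[%classic) t : R)%:E)%E.
  by rewrite mule_ge0// lee_fin.
have sh (a b c : R) : (forall t, F (t + c)%R = F t) ->
    (\int[lam]_t (F t * (\1_(`[(a + c)%R, (b + c)%R[%classic) t)%:E) = \int[lam]_t (F t * (\1_(`[a, b[%classic) t)%:E))%E.
  move=> pc; rewrite -(@ge0_leb_shift _ c (fun t => F t * (\1_(`[(a + c)%R, (b + c)%R[%classic) t)%:E)%E (mm _ _) (nn _ _)).
  apply: eq_integral => t _; rewrite pc; congr (_ * (_)%:E)%E; rewrite !indicE; congr (_%:R).
  by congr nat_of_bool; apply/idP/idP; rewrite !inE /= !in_itv/= => /andP[h1 h2]; apply/andP; split; lra.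
have mFt : measurable_fun setT (fun t => F (t + th)).
  by apply: measurableT_comp => //; apply: measurable_funD => //; exact: measurable_cst.
have e1 (G : R -> \bar R) : measurable_fun setT G ->
   (\int[lam]_(t in `[0%R, TT]%classic) G t = \int[lam]_(t in `[0%R, TT[%classic) G t)%E.
  by move=> mG; rewrite -integral_itv_bndo_bndc//; exact: measurable_funS mG.
rewrite (e1 _ mFt) (e1 _ mF) !ind.
have -> : (\int[lam]_t (F (t + th)%R * (\1_(`[0%R, TT[%classic) t)%:E) =
    \int[lam]_t (F t * (\1_(`[th, (TT + th)%R[%classic) t)%:E))%E.
  rewrite -(@ge0_leb_shift _ th (fun t => F t * (\1_(`[th, (TT + th)%R[%classic) t)%:E)%E (mm _ _) (nn _ _)).
  apply: eq_integral => t _; congr (_ * (_)%:E)%E; rewrite !indicE; congr (_%:R).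
  by congr nat_of_bool; apply/idP/idP; rewrite !inE /= !in_itv/= => /andP[h1 h2]; apply/andP; split; lra.
have spl (a b c : R) : a <= b -> b <= c -> (\int[lam]_t (F t * (\1_(`[a, c[%classic) t)%:E) =
   \int[lam]_t (F t * (\1_(`[a, b[%classic) t)%:E) + \int[lam]_t (F t * (\1_(`[b, c[%classic) t)%:E))%E.
  move=> ab bc; have := @ge0_integralD _ _ _ lam setT measurableT _ _ (fun t _ => nn a b t) (mm a b) (fun t _ => nn b c t) (mm b c).
  move=> <-.
  apply: eq_integral => t _; rewrite !indicE !mem_setE !in_itv/=.
  case: (leP a t) => at_; case: (leP b t) => bt /=; case: (ltP t c) => tc /=;
    case: (ltP t b) => tb /=; rewrite ?mule1 ?mule0 ?adde0 ?add0e//; exfalso; lra.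
rewrite (spl th TT (TT + th)) ?lerDl// (spl 0 th TT)// addeC; congr (_ + _)%E.
by have := sh 0 th TT per; rewrite add0r (addrC th TT).
Qed.
End Rotation.

(** * The sub-mean value property over discs *)

Section Subharmonic.
Context {R : realType}.
Local Notation P2 := (R * R)%type.
Local Notation L := (@Leb R).
Local Notation lam := (@lebesgue_measure R).
Local Notation TT := (2 * pi : R).
Implicit Types (p q w z : P2) (r s t c e : R).

Lemma TT_gt0 : 0 < TT. Proof. by rewrite mulr_gt0// pi_gt0. Qed.

Lemma lam_TT : lam (`[0%R, TT]%classic : set R) = TT%:E.
Proof. by rewrite lebesgue_measure_itv /= lte_fin TT_gt0 oppr0 adde0. Qed.

(** Passage to the nonnegative function [N - f], to which Tonelli applies. The lower bound excludes
    the value [-oo] of the integral, so [f] is integrable over the period. *)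
Lemma circle_flip (f : R -> R) (N c : R) : meas f -> (forall t, f t <= N) ->
  ((TT * c)%:E <= \int[lam]_(t in `[0%R, TT]%classic) (f t)%:E)%E ->
  (\int[lam]_(t in `[0%R, TT]%classic) (N - f t)%:E <= (TT * (N - c))%:E)%E.
Proof.
move=> mf fN h; set A := `[0%R, TT]%classic.
have mA : measurable (A : set (measurableTypeR R)) by exact: measurable_itv.
have mE : measurable_fun (A : set (measurableTypeR R)) (EFin \o f).
  by apply: measurable_funTS; exact/measurable_EFinP.
have ct k : (\int[lam]_(t in A) (k%:E) = (k * TT)%:E)%E.
  by apply: etrans (integral_cst lam mA k%:E) _; rewrite EFinM; congr (_ * _)%E; exact: lam_TT.
have fp : (\int[lam]_(t in A) (EFin \o f)^\+ t < +oo)%E.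
  apply: (@le_lt_trans _ _ (\int[lam]_(t in A) (`|N|%:E))%E); last by rewrite ct ltry.
  apply: ge0_le_integral => //.
  - exact: measurable_funepos.
  - move=> t _; rewrite funeposE /= -EFin_max lee_fin; case: (leP (f t) 0) => // _.
    by apply: le_trans (fN t) (ler_norm _).
have fm : (\int[lam]_(t in A) (EFin \o f)^\- t < +oo)%E.
  rewrite ltey; apply/eqP => ninf; move: h.
  rewrite (_ : (\int[lam]_(t in A) (f t)%:E = -oo)%E) ?leNgt ?ltNyr//.
  rewrite integralE /= ninf; move: fp; rewrite -ge0_fin_numE; last first.
    by apply: integral_ge0 => t _; exact: funepos_ge0.
  by move=> /fineK <-.
have int_f : lam.-integrable A (EFin \o f).
  apply/integrableP; split => //.
  rewrite (_ : (fun x => _) = abse \o (EFin \o f))// fune_abse ge0_integralD//; first exact: lte_add_pinfty.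
  - exact: measurable_funepos.
  - exact: measurable_funeneg.
have int_N : lam.-integrable A (EFin \o cst N).
  apply/integrableP; split; first by apply/measurable_EFinP; exact: measurable_cst.
  by rewrite (_ : (fun x => _) = fun=> `|N|%:E)// ct ltry.
have := integralB_EFin mA int_N int_f; rewrite ct => E.
have -> : (\int[lam]_(t in A) (N - f t)%:E = (N * TT)%:E - \int[lam]_(t in A) (f t)%:E)%E by exact: E.
by rewrite mulrBr (mulrC TT N) EFinB; apply: leeB.
Qed.

Transparent al.
Lemma al_rad r w w' : sq w = sq w' -> al r w = al r w'.
Proof. by rewrite /al => ->. Qed.
Opaque al.

Variable phi : P2 -> R.
Hypothesis usc : forall z e, 0 < e -> exists2 d : R, 0 < d & forall w, en (w - z) < d -> phi w < phi z + e.
Hypothesis smv : forall z r, 0 < r ->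
  ((TT * phi z)%:E <= \int[lam]_(t in `[0%R, TT]%classic) (phi (z.1 + r * cos t, z.2 + r * sin t))%:E)%E.

Lemma usc_nbhs z e : 0 < e -> exists2 d : R, 0 < d & forall w, `|w - z| < d -> phi w < phi z + e.
Proof.
move=> /(usc z)[d d0 hd]; exists (d / 2); first by rewrite divr_gt0.
move=> w hw; apply: hd; have /andP[_ h] := en_norm (w - z); lra.
Qed.

(** Strict sublevel sets of an upper semicontinuous function are open. *)
Lemma phi_meas : meas phi.
Proof.
apply: (measurability _ (RGenInftyO.measurableE R)) => // _ [_ [a ->] <-]; rewrite setTI.
apply: open_measP; rewrite openE => z /=; rewrite in_itv /= => ha.
have e0 : 0 < a - phi z by rewrite subr_gt0.
have [d d0 hd] := usc_nbhs z e0; apply/nbhs_ballP; exists d => //= w.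
rewrite -ball_normE /ball_/= distrC => /hd; rewrite in_itv /=; lra.
Qed.

Lemma phi_ub (M : R) : exists N, forall p, `|p| <= M -> phi p <= N.
Proof.
apply: contrapT => hn.
have /choice[u hu] : forall n : nat, exists p, `|p| <= M /\ n%:R < phi p.
  move=> n; apply: contrapT => h; apply: hn; exists n%:R => p pM; rewrite leNgt.
  by apply/negP => hp; apply: h; exists p.
have : (nbhs (u @ \oo) (bbox M)) by exists 0%N => // n _; exact: (hu n).1.
move=> /(bbox_compact _)[p [_ cl]].
have [d d0 hd] := usc_nbhs p ltr01.
have [k [hk _]] := nat_bound (phi p + 1) 0.
have t1 : nbhs (u @ \oo) [set q | exists2 n, (k <= n)%N & q = u n] by exists k => // n /= kn; exists n.
have t2 : nbhs p [set w | `|w - p| < d].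
  by apply/nbhs_ballP; exists d => //= w; rewrite -ball_normE /ball_/= distrC.
have [_ [[n kn ->] /hd h]] := cl _ _ t1 t2.
have h1 := (hu n).2; have h2 : k%:R <= n%:R :> R by rewrite ler_nat.
by have := ler_norm (phi p + 1); lra.
Qed.

Lemma circ_meas z r : meas (fun t : R => phi (z.1 + r * cos t, z.2 + r * sin t)).
Proof.
have mc : meas (@cos R) by apply: continuous_measurable_fun; exact: continuous_cos.
have ms : meas (@sin R) by apply: continuous_measurable_fun; exact: continuous_sin.
apply: (measurableT_comp phi_meas); apply: measurable_fun_pair; apply: measurable_funD;
  try exact: measurable_cst; apply: measurable_funM => //; exact: measurable_cst.
Qed.

Section OnDisc.
Variables (z : P2) (r N : R).
Hypothesis r0 : 0 < r.
Hypothesis phiN : forall w, en w < r -> phi (z + w) <= N.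

(** Truncated so as to be nonnegative everywhere; on the disc, where [phi <= N], it is [N - phi]. *)
Let U w := Num.max 0 (N - phi (z + w)).

Let U_meas : meas U.
Proof.
apply: measurable_maxr; first exact: measurable_cst.
apply: measurable_funB; first exact: measurable_cst.
apply: (measurableT_comp phi_meas); apply: measurable_fun_pair; apply: measurable_funD => //; exact: measurable_cst.
Qed.

(** In polar coordinates the rotations of [w] run over its circle, starting at the angle of [w].
    Periodicity removes this angle, and the sub-mean value inequality applies with reversed sign. *)
Lemma circle_mean w : (\int[lam]_(t in `[0%R, TT]%classic) (U (rot (cos t) (sin t) w) * al r w)%:E <=
  (TT * (N - phi z) * al r w)%:E)%E.
Proof.
have [wr|wr] := lerP r (en w).
  by rewrite (al_out r0 wr) mulr0; under eq_integral do rewrite mulr0; rewrite integral0.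
have a0 := al_ge0 r w.
have pz : phi z <= N by have := phiN (w := 0); rewrite en0 addr0; apply.
have -> : (\int[lam]_(t in `[0%R, TT]%classic) (U (rot (cos t) (sin t) w) * al r w)%:E =
   (\int[lam]_(t in `[0%R, TT]%classic) (U (rot (cos t) (sin t) w))%:E) * (al r w)%:E)%E.
  rewrite -ge0_integralZr//.
  - apply/measurable_EFinP; apply: measurable_funTS; apply: (measurableT_comp U_meas).
    have mc : meas (@cos R) by apply: continuous_measurable_fun; exact: continuous_cos.
    have ms : meas (@sin R) by apply: continuous_measurable_fun; exact: continuous_sin.
    by apply: measurable_fun_pair; [apply: measurable_funB|apply: measurable_funD]; apply: measurable_funM => //; exact: measurable_cst.
  - by move=> t _; rewrite lee_fin /U le_max lexx.
suff H : (\int[lam]_(t in `[0%R, TT]%classic) (U (rot (cos t) (sin t) w))%:E <= (TT * (N - phi z))%:E)%E.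
  by rewrite (EFinM _ (al r w)); have := @lee_wpmul2r _ (al r w)%:E _ _ _ H; apply; rewrite lee_fin.
have [th [hth hw]] := polar w.
set s := en w in hw wr.
have rotE t : rot (cos t) (sin t) w = (s * cos (t + th), s * sin (t + th)).
  rewrite hw /rot /= cosD sinD; congr pair; ring.
under eq_integral do rewrite rotE.
have s0 : 0 <= s by exact: en_ge0.
have EU t : U (s * cos t, s * sin t) = N - phi (z.1 + s * cos t, z.2 + s * sin t).
  rewrite /U; apply/max_idPr; rewrite subr_ge0; apply: (phiN (w := (s * cos t, s * sin t))).
  by apply: le_lt_trans wr; rewrite en_le// /sq /= !exprMn -mulrDr cos2Dsin2 mulr1.
have mH : measurable_fun setT (fun t : R => (N - phi (z.1 + s * cos t, z.2 + s * sin t))%:E).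
  by apply/measurable_EFinP; apply: measurable_funB; [exact: measurable_cst|exact: circ_meas].
under eq_integral do rewrite EU.
have /= -> := periodic_shift hth mH; last 2 first.
- by move=> t; rewrite -EU lee_fin /U le_max lexx.
- move=> t; have e : t + TT = t + pi *+ 2 by rewrite mulr2n; ring.
  by rewrite e cosD2pi sinD2pi.
have [s00|s00] := eqVneq s 0.
  rewrite s00; under eq_integral do rewrite !mul0r !addr0 -surjective_pairing.
  have mA : measurable (`[0%R, TT]%classic : set (measurableTypeR R)) by exact: measurable_itv.
  by apply: le_trans (_ : _ <= (N - phi z)%:E * TT%:E)%E _; [rewrite le_eqVlt; apply/orP; left; apply/eqP; apply: etrans (integral_cst lam mA (N - phi z)%:E) _; congr (_ * _)%E; exact: lam_TT|rewrite -EFinM mulrC].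
apply: circle_flip; first exact: circ_meas.
  by move=> t; have := EU t; rewrite -subr_ge0 => <-; rewrite /U le_max lexx.
by apply: smv; rewrite lt0r s00.
Qed.

(** Polar integration is replaced by averaging over rotations: the integral over the plane is
    invariant under each of them, and Tonelli exchanges the average with the integral, which reduces
    the claim to [circle_mean]. *)
Lemma disc_mean : (\int[L]_w (U w * al r w)%:E <= (c0 * (N - phi z))%:E)%E.
Proof.
have mal : meas (al r) by apply: cont_meas; exact: (Ck_cont (al_Ck r)).
have mF : measurable_fun setT (fun w => (U w * al r w)%:E).
  by apply/measurable_EFinP; exact: measurable_funM.
have F0 w : (0 <= (U w * al r w)%:E)%E by rewrite lee_fin mulr_ge0 ?al_ge0// /U le_max lexx.
have mc : meas (@cos R) by apply: continuous_measurable_fun; exact: continuous_cos.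
have ms : meas (@sin R) by apply: continuous_measurable_fun; exact: continuous_sin.
pose G (x : R * P2) : \bar R := ((\1_(`[0%R, TT]%classic) x.1)%:E * (U (rot (cos x.1) (sin x.1) x.2) * al r x.2)%:E)%E.
have mrot : measurable_fun setT (fun x : measurableTypeR R * P2 => rot (cos x.1) (sin x.1) x.2).
  have c1 : measurable_fun setT (fun x : measurableTypeR R * P2 => cos x.1) by exact: (measurableT_comp mc).
  have s1 : measurable_fun setT (fun x : measurableTypeR R * P2 => sin x.1) by exact: (measurableT_comp ms).
  have x1 : measurable_fun setT (fun x : measurableTypeR R * P2 => x.2.1) by exact: (measurableT_comp (@measurable_fst _ _ R R)).
  have x2 : measurable_fun setT (fun x : measurableTypeR R * P2 => x.2.2) by exact: (measurableT_comp (@measurable_snd _ _ R R)).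
  by apply: measurable_fun_pair; [apply: measurable_funB|apply: measurable_funD]; exact: measurable_funM.
have mA : measurable (`[0%R, TT]%classic : set (measurableTypeR R)) by exact: measurable_itv.
have mG : measurable_fun setT (G : measurableTypeR R * P2 -> \bar R).
  apply: emeasurable_funM.
    apply/measurable_EFinP; apply: (@measurableT_comp _ _ _ _ _ _ (\1_(`[0%R, TT]%classic) : measurableTypeR R -> R)) => //.
  apply/measurable_EFinP; apply: measurable_funM; first exact: (measurableT_comp U_meas).
  by apply: (measurableT_comp mal).
have G0 x : (0 <= G x)%E by rewrite /G mule_ge0// ?lee_fin// mulr_ge0 ?al_ge0// /U le_max lexx.
have := @fubini_tonelli _ _ (measurableTypeR R) P2 R lam (@LebS R) G mG G0.
have EL t : (\int[@LebS R]_y G (t, y) = (\1_(`[0%R, TT]%classic) t)%:E * \int[L]_w (U w * al r w)%:E)%E.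
  rewrite /G /= -(@ge0_rot _ (cos t) (sin t) (fun w => (U w * al r w)%:E))//; last by exact: cos2Dsin2.
  rewrite ge0_integralZl//.
  - congr (_ * _)%E; apply: eq_integral => w _; congr ((_ * _)%:E).
    by apply: al_rad; rewrite /sq /rot /= -[LHS]mul1r -(cos2Dsin2 t); ring.
  - apply/measurable_EFinP; apply: measurable_funM => //; apply: (measurableT_comp U_meas); exact: rot_meas.
  - by move=> w _; rewrite lee_fin mulr_ge0 ?al_ge0// /U le_max lexx.
under eq_integral do rewrite EL.
have -> : (\int[lam]_t ((\1_(`[0%R, TT]%classic) t)%:E * \int[L]_w (U w * al r w)%:E) = TT%:E * \int[L]_w (U w * al r w)%:E)%E.
  rewrite ge0_integralZr//; last 2 first.
  - exact/measurable_EFinP/measurable_indic.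
  - by apply: integral_ge0.
  congr (_ * _)%E; apply: etrans (integral_indic lam measurableT mA) _; rewrite setIT; exact: lam_TT.
move=> E.
have : (TT%:E * \int[L]_w (U w * al r w)%:E <= (TT * (c0 * (N - phi z)))%:E)%E.
  rewrite E.
  have ic : intg L (fun w => TT * (N - phi z) * al r w) by apply: intgZ; apply: al_intg => //; exact: Leb_lfin.
  have <- : I L (fun w => TT * (N - phi z) * al r w) = TT * (c0 * (N - phi z)).
    by rewrite IZ ?al_mass//; [ring|apply: al_intg => //; exact: Leb_lfin].
  rewrite -(I_fin ic); apply: ge0_le_integral => //.
  - by move=> w _; apply: integral_ge0 => t _; exact: G0.
  - by have := @measurable_fun_fubini_tonelli_G _ _ (measurableTypeR R) P2 R lam G mG G0.
  - by have := intg_meas ic; move=> /measurable_EFinP.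
  - move=> w _; apply: le_trans (circle_mean w); rewrite [leRHS]integral_mkcond le_eqVlt; apply/orP; left; apply/eqP.
    apply: eq_integral => t _; rewrite /G /= patchE indicE; case: ifP => _; rewrite ?mul1e ?mul0e//.
by rewrite (EFinM TT) lee_pmul2l// lte_fin TT_gt0.
Qed.
End OnDisc.
End Subharmonic.

(** * Test functions for the Riesz measure *)

Section TestFunctions.
Context {R : realType}.
Local Notation P2 := (R * R)%type.
Implicit Types (p q w z h : P2) (r s t c e : R) (f : P2 -> R).

Section Differential.
Variables (f : P2 -> R) (p : P2).

Definition tangent (h : P2) : R := dx f p * h.1 + dy f p * h.2.

Lemma tangent_linear : linear tangent.
Proof.
by move=> k u v; rewrite /tangent /= /GRing.scale /=; move: (dx f p) (dy f p) => *; ring.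
Qed.

HB.instance Definition _ := GRing.isLinear.Build R P2 R _ tangent tangent_linear.

Lemma tangent_cont : continuous tangent.
Proof.
by move=> h; apply: cvgD; apply: cvgM; try exact: cvg_cst; [exact: cvg_fst|exact: cvg_snd].
Qed.

(** The Riesz measure is tested by means of differentials and directional derivatives; [C1_rem]
    identifies these with [dx] and [dy]. *)
Lemma tangent_diff : Ck 1 f -> differentiable f p /\ 'd f p = tangent :> (P2 -> R).
Proof.
move=> cf.
have e : f \o shift p = cst (f p) + tangent +o_ (0 : P2) id.
  apply/eqaddoP => eps eps0; have e20 : 0 < eps / 2 by rewrite divr_gt0.
  have [d d0 hd] := C1_rem p cf e20.
  apply/nbhs_ballP; exists d => //= h; rewrite -ball_normE /ball_/= sub0r normrN => /hd.
  rewrite (addrC p) /tangent /= => h1.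
  have -> : (f \o shift p - (cst (f p) + tangent)) h = f (h + p) - f p - (dx f p * h.1 + dy f p * h.2).
    by rewrite /= !fctE /= /tangent opprD addrA.
  apply: le_trans h1 _.
  have : `|h| <= `|h| by []. 
  rewrite [in X in X -> _]norm_le2/= => /andP[u v].
  have -> : eps * `|h| = eps / 2 * (`|h| + `|h|) by move: `|h| => x; field.
  by rewrite ler_pM2l//; exact: lerD.
have E := diff_unique tangent_cont e.
by split => //; apply/diff_locallyP; rewrite E; split => //; exact: tangent_cont.
Qed.
End Differential.

Lemma pd_e1 f : Ck 1 f -> pd e1 f = dx f.
Proof.
move=> cf; apply/funext => p; have [h1 h2] := tangent_diff p cf.
by rewrite /pd (deriveE _ h1) h2 /tangent /e1 /= mulr1 mulr0 addr0.
Qed.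

Lemma pd_e2 f : Ck 1 f -> pd e2 f = dy f.
Proof.
move=> cf; apply/funext => p; have [h1 h2] := tangent_diff p cf.
by rewrite /pd (deriveE _ h1) h2 /tangent /e2 /= mulr1 mulr0 add0r.
Qed.

Lemma Ck_test f : Ck 2 f -> csupp f -> test_fun f.
Proof.
move=> cf sf; split; last exact: sf.
have c1 := CkS cf; have cx := Ck_dx cf; have cy := Ck_dy cf.
split.
- by move=> p; have [] := tangent_diff p c1.
- by move=> p; rewrite (pd_e1 c1); have [] := tangent_diff p cx.
- by move=> p; rewrite (pd_e2 c1); have [] := tangent_diff p cy.
- by rewrite (pd_e1 c1) (pd_e1 cx) (pd_e2 cx); split; [exact: (Ck_cont (Ck_dx cx))|exact: (Ck_cont (Ck_dy cx))].
- by rewrite (pd_e2 c1) (pd_e1 cy) (pd_e2 cy); split; [exact: (Ck_cont (Ck_dx cy))|exact: (Ck_cont (Ck_dy cy))].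
Qed.

Lemma lapE f : Ck 2 f -> lap f = fun p => dx (dx f) p + dy (dy f) p.
Proof.
move=> cf; apply/funext => p; rewrite /lap (pd_e1 (CkS cf)) (pd_e2 (CkS cf)).
by rewrite (pd_e1 (Ck_dx cf)) (pd_e2 (Ck_dy cf)).
Qed.
End TestFunctions.

(** * Averages of the weight and its Riesz measure *)

Section Potential.
Context {R : realType}.
Local Notation P2 := (R * R)%type.
Local Notation L := (@Leb R).
Local Notation lam := (@lebesgue_measure R).
Local Notation TT := (2 * pi : R).
Implicit Types (p q w z : P2) (r s t c e : R).
Variable phi : P2 -> R.
Hypothesis usc : forall z e, 0 < e -> exists2 d : R, 0 < d & forall w, en (w - z) < d -> phi w < phi z + e.
Hypothesis smv : forall z r, 0 < r ->
  ((TT * phi z)%:E <= \int[lam]_(t in `[0%R, TT]%classic) (phi (z.1 + r * cos t, z.2 + r * sin t))%:E)%E.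

Let pm := phi_meas usc.

(** [phi] is bounded above by some [N] on the disc, and [disc_mean] bounds the integral of the
    nonnegative [(N - phi) al r]. This gives integrability and the inequality together. *)
Lemma phi_al_intg r z : 0 < r -> intg L (fun w => phi w * al r (w - z)) /\ phi z <= Av r phi z.
Proof.
move=> r0; have [N hN] := phi_ub usc (`|z| + r).
have phiN w : en w < r -> phi (z + w) <= N.
  move=> h; apply: hN; apply: le_trans (ler_normD _ _) _; rewrite lerD2l.
  by have /andP[h1 _] := en_norm w; lra.
have := disc_mean usc smv r0 phiN.
set U := (fun w => Num.max 0 (N - phi (z + w))).
have U0 w : 0 <= U w by rewrite /U le_max lexx.
have mz : meas (fun w => phi (z + w)).
  apply: (measurableT_comp pm); apply: measurable_fun_pair; apply: measurable_funD => //; exact: measurable_cst.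
have mal : meas (al r) by apply: cont_meas; exact: (Ck_cont (al_Ck r)).
have mU : meas U.
  by apply: measurable_maxr; [exact: measurable_cst|apply: measurable_funB => //; exact: measurable_cst].
have mUa : meas (fun w => U w * al r w) by exact: measurable_funM.
move=> hU.
have iU : intg L (fun w => U w * al r w).
  apply/intg_ge0P => //; first by move=> w; rewrite mulr_ge0// al_ge0.
  by apply: le_lt_trans hU _; rewrite ltry.
rewrite (I_fin iU) lee_fin in hU.
have ia : intg L (al r) by apply: al_intg => //; exact: Leb_lfin.
have E : (fun w => phi (z + w) * al r w) = (fun w => N * al r w - U w * al r w).
  apply/funext => w; have [h|h] := ltrP (en w) r; last by rewrite (al_out r0 h) !mulr0 subrr.
  by rewrite /U (max_idPr _) ?subr_ge0 ?phiN//; ring.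
have i1 : intg L (fun w => phi (z + w) * al r w).
  by rewrite E; apply: intgB => //; exact: intgZ.
have E2 : (fun w => phi w * al r (w - z)) = (fun p => (fun w => phi (z + w) * al r w) (p + - z)).
  by apply/funext => w; rewrite /= subrKC.
split; first by rewrite E2; exact: (intg_shift (- z) i1).
have -> : Av r phi z = c0^-1 * I L (fun w => phi w * al r (w - z)) by [].
rewrite E2 (I_shift (- z) (intg_meas i1)) E (IB (intgZ N ia) iU) (IZ N ia) al_mass//.
have c00 := @c0_gt0 R; rewrite mulrC ler_pdivlMr//; move: hU; rewrite mulrBr.
by move: (I _ _) (phi z) c0 => a b c; rewrite (mulrC c) (mulrC c) => ?; lra.
Qed.

Lemma Av_ge r z : 0 < r -> phi z <= Av r phi z.
Proof. by move=> /(phi_al_intg z)[]. Qed.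

(** For [r] large compared with [M], the kernel [al r] is bounded below on the square of radius [M],
    so integrability against it is enough. *)
Lemma phi_lint : lint L phi.
Proof.
split => // M; pose r := 2 * (`|M| + 1) : R.
have r0 : 0 < r by rewrite mulr_gt0// ltr_wpDl.
have [i1 _] := phi_al_intg 0 r0.
pose k := 10 / 16 * r^-2 : R.
have k0 : 0 < k by rewrite mulr_gt0// ?divr_gt0// invr_gt0 exprn_gt0.
apply: (intg_le _ _ (intgZ k^-1 (intg_abs i1))).
  by apply: measurable_funM => //; have := bbox_meas M => mb; exact: measurable_indic.
move=> p; rewrite indicE; have [/set_mem hp|_] := boolP (p \in _); last first.
  by rewrite mulr0 normr0 mulr_ge0// invr_ge0 ltW.
rewrite mulr1 subr0 normrM (ger0_norm (al_ge0 _ _)) mulrCA ler_peMr//.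
rewrite ler_pdivlMl// mulr1; apply: al_low => //.
have /andP[_ h] := sq_norm p; apply: le_trans h _; rewrite /bbox /= in hp.
have h0 := normr_ge0 p; have h2 := ler_norm M; rewrite /r.
have : `|p| <= `|M| by lra.
by move: (`|p|) (`|M|) h0 => a b a0 ab; nra.
Qed.

Lemma Av_phi_le z (eps : R) : 0 < eps -> exists2 d : R, 0 < d & forall e, 0 < e -> e < d -> Av e phi z <= phi z + eps.
Proof.
move=> eps0; have [d d0 hd] := usc z eps0; exists d => // e e0 ed.
have [i1 _] := phi_al_intg z e0.
have i2 : intg L (fun w => (phi z + eps) * al e (w - z)).
  by apply: intgZ; apply: al_shift_intg => //; exact: Leb_lfin.
have : I L (fun w => phi w * al e (w - z)) <= I L (fun w => (phi z + eps) * al e (w - z)).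
  apply: I_le => // w; have [h|h] := ltrP (en (w - z)) e.
    by apply: ler_wpM2r; [exact: al_ge0|apply/ltW/hd/(lt_trans h)].
  by rewrite (al_out e0 h) !mulr0.
rewrite IZ ?al_shift_mass//; last by apply: al_shift_intg => //; exact: Leb_lfin.
have -> : Av e phi z = c0^-1 * I L (fun w => phi w * al e (w - z)) by [].
by rewrite ler_pdivrMl ?c0_gt0// mulrC.
Qed.

Variable mu : {measure set P2 -> \bar R}.
Hypothesis riesz : forall psi, test_fun psi ->
  Rintegral (@leb2 R) setT (fun p => phi p * lap psi p) = Rintegral mu setT psi.

Lemma riesz_Ck f : Ck 2 f -> csupp f ->
  I L (fun p => phi p * (dx (dx f) p + dy (dy f) p)) = I mu f.
Proof.
move=> cf sf; have h := riesz (Ck_test cf sf); rewrite (lapE cf) in h.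
rewrite -Leb_I; first by rewrite h I.unlock.
apply: measurable_funM => //; apply: cont_meas => p.
by apply: cvgD; [exact: (Ck_cont (Ck_dx (Ck_dx cf)))|exact: (Ck_cont (Ck_dy (Ck_dy cf)))].
Qed.

Lemma lap_shift f z p : Ck 2 f -> dx (dx (fun q => f (q + - z))) p + dy (dy (fun q => f (q + - z))) p =
  dx (dx f) (p - z) + dy (dy f) (p - z).
Proof.
move=> cf; rewrite (dx_shift (- z) (CkS cf)) (dy_shift (- z) (CkS cf)).
by rewrite (dx_shift (- z) (Ck_dx cf)) (dy_shift (- z) (Ck_dy cf)).
Qed.

(** A smoothed Jensen formula: the Riesz measure is tested on the translate of [Ek e r], whose
    Laplacian is the difference of the two averaging kernels. *)
Lemma Av_diff e r z : 0 < e -> e <= r -> Av r phi z - Av e phi z = c0^-1 * I mu (fun w => Ek e r (w - z)).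
Proof.
move=> e0 er; have r0 := lt_le_trans e0 er.
have cE := CkS (Ek_Ck e r).
rewrite -(riesz_Ck (Ck_shift (- z) cE) (csupp_shift (- z) (Ek_csupp e0 er))).
have lE w : dx (dx (Ek e r)) w + dy (dy (Ek e r)) w = al r w - al e w.
  by have := lap_Ek e r => /(congr1 (fun f => f w)).
have [i1 _] := phi_al_intg z r0; have [i2 _] := phi_al_intg z e0.
have -> : (fun p => phi p * (dx (dx (fun q => Ek e r (q + - z))) p + dy (dy (fun q => Ek e r (q + - z))) p)) =
    (fun p => phi p * al r (p - z) - phi p * al e (p - z)).
  by apply/funext => p; rewrite (lap_shift _ _ cE) lE mulrBr.
by rewrite (IB i1 i2) mulrBr.
Qed.

(** Both derivatives fall on the kernel, and the distributional Laplacian of [phi] turns the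
    integral into one against [mu]. *)
Lemma lap_Av e : 0 < e -> (fun z => dx (dx (Av e phi)) z + dy (dy (Av e phi)) z) =
  fun z => c0^-1 * I mu (fun w => al e (w - z)).
Proof.
move=> e0; apply/funext => z.
have ca := al_Ck e : Ck 3 (al e); have sa := al_csupp e0.
have pl := phi_lint.
have cc := conv_Ck ca sa pl.
have -> : Av e phi = (fun z => c0^-1 * conv L (al e) phi z) by [].
rewrite (dxZ _ cc) (dyZ _ cc) (dxZ _ (Ck_dx cc)) (dyZ _ (Ck_dy cc)) -mulrDr; congr (_ * _).
have NN (f : P2 -> R) : (fun z => - f z) = (fun z => -1 * f z) by apply/funext => w; rewrite mulN1r.
rewrite (conv_dx ca sa pl) (conv_dy ca sa pl).
have cx := conv_Ck (Ck_dx ca) (csupp_dx sa) pl; have cy := conv_Ck (Ck_dy ca) (csupp_dy sa) pl.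
rewrite (NN (conv L (dx (al e)) phi)) (NN (conv L (dy (al e)) phi)) (dxZ _ cx) (dyZ _ cy).
rewrite (conv_dx (Ck_dx ca) (csupp_dx sa) pl) (conv_dy (Ck_dy ca) (csupp_dy sa) pl) !mulN1r !opprK.
rewrite -(riesz_Ck (Ck_shift (- z) (CkS ca)) (csupp_shift (- z) sa)).
have i1 := conv_intg z (Ck_cont (Ck_dx (Ck_dx ca))) (csupp_dx (csupp_dx sa)) pl.
have i2 := conv_intg z (Ck_cont (Ck_dy (Ck_dy ca))) (csupp_dy (csupp_dy sa)) pl.
have -> : (fun p => phi p * (dx (dx (fun q => al e (q + - z))) p + dy (dy (fun q => al e (q + - z))) p)) =
  (fun p => phi p * dx (dx (al e)) (p - z) + phi p * dy (dy (al e)) (p - z)).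
  by apply/funext => p; rewrite (lap_shift _ _ (CkS ca)) mulrDr.
by rewrite (ID i1 i2).
Qed.

Hypothesis mu_fin : forall p r, (mu (D p r) < +oo)%E.
Variable cd : R.
Hypothesis cd0 : 0 < cd.
Hypothesis mu_dbl : forall p r, 0 < r -> (mu (D p (2 * r)) <= cd%:E * mu (D p r))%E.
Variable rho : P2 -> R.
Hypothesis rho0 : forall p, 0 < rho p.
Hypothesis mu_rho : forall p, mu (D p (rho p)) = 1%:E.

Definition Kav : R := c0^-1 * KE cd.

Lemma Kav_gt0 : 0 < Kav.
Proof. by rewrite mulr_gt0 ?invr_gt0 ?c0_gt0// KE_gt0. Qed.

(** Comparison with a radius [t] tending to 0: there upper semicontinuity bounds the average by
    [phi z + eps], and [Ek_mass] bounds the difference uniformly in [t]. *)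
Lemma Av_le e z : 0 < e -> Av e phi z <= phi z + Kav * m mu z e.
Proof.
move=> e0; apply/ler_addgt0Pr => eps eps0.
have [d d0 hd] := Av_phi_le z eps0.
pose t := Num.min e (d / 2); have t0 : 0 < t by rewrite lt_min e0 divr_gt0.
have te : t <= e by rewrite ge_min lexx.
have td : t < d by apply: (@le_lt_trans _ _ (d / 2)); rewrite ?ge_min ?lexx ?orbT//; lra.
have h1 := hd t t0 td; have h2 := Av_diff z t0 te.
have h3 := Ek_mass mu_fin cd0 mu_dbl z t0 te.
have c0i : 0 < c0^-1 :> R by rewrite invr_gt0 c0_gt0.
rewrite -(ler_pM2l c0i) mulrA -h2 -/Kav in h3.
by move: h1 h3; move: (Kav * _) => a; lra.
Qed.

Lemma Av_le_rho e z : 0 < e -> e <= rho z -> Av e phi z <= phi z + Kav.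
Proof.
move=> e0 er; apply: le_trans (Av_le z e0) _; rewrite lerD2l ler_piMr ?(ltW Kav_gt0)//.
by rewrite -(m_rho mu_rho z); apply: m_mono.
Qed.

(** For [e] below the minimum of [rho] on the square, the continuous function [Av e phi] stays
    within [Kav] of [phi]. So doubling makes the upper semicontinuous [phi] bounded below on bounded
    sets as well. *)
Lemma phi_lbd : lbd phi.
Proof.
split => // M; have [e e0 he] := rho_low mu_fin cd0 mu_dbl rho0 mu_rho M.
have [C hC] := cont_bounded M (Ck_cont (Av_Ck e0 phi_lint)).
exists (C + Kav) => p hp; have h1 := Av_le_rho e0 (he p hp); have h2 := Av_ge p e0.
have := hC p hp; rewrite !ler_norml => /andP[h3 h4]; have k0 := Kav_gt0.
by apply/andP; split; lra.
Qed.
End Potential.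

(** * The weighted estimate *)

Section BasicInequality.
Context {R : realType}.
Local Notation P2 := (R * R)%type.
Local Notation L := (@Leb R).
Implicit Types (p q w z : P2) (psi a b : P2 -> R).

(* |d(a + ib)/dz|^2 *)
Definition dz2 a b p : R := 4^-1 * ((dx a p + dy b p) ^+ 2 + (dx b p - dy a p) ^+ 2).

Definition mod2 a b p : R := a p ^+ 2 + b p ^+ 2.

(** Used with either sign: the weight of the Fock space is [ex] of [- phi], the dual estimates carry
    [ex] of [phi]. *)
Definition ex psi p : R := expR (2 * psi p).

Lemma ex_gt0 psi p : 0 < ex psi p. Proof. exact: expR_gt0. Qed.

Lemma ex_Ck n psi : Ck n psi -> Ck n (ex psi).
Proof. by move=> h; apply: Ck_comp; [exact: Dk_exp|exact: CkZ]. Qed.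

Lemma dx_ex n psi : Ck n.+1 psi -> dx (ex psi) = fun p => 2 * dx psi p * ex psi p.
Proof.
move=> h; apply: dxE => p; have h1 := derivx p h.
have h2 : is_derive (p.1 : R) (1 : R) (fun t => 2 * psi (t, p.2)) (2 * dx psi p).
  by apply: isd_eq.
have e := is_derive_expR (2 * psi (p.1, p.2)).
by apply: (isd_eq (is_derive_comp1 h2 e)); rewrite /ex mulrC -surjective_pairing.
Qed.

Lemma dy_ex n psi : Ck n.+1 psi -> dy (ex psi) = fun p => 2 * dy psi p * ex psi p.
Proof.
move=> h; apply: dyE => p; have h1 := derivy p h.
have h2 : is_derive (p.2 : R) (1 : R) (fun t => 2 * psi (p.1, t)) (2 * dy psi p).
  by apply: isd_eq.
have e := is_derive_expR (2 * psi (p.1, p.2)).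
by apply: (isd_eq (is_derive_comp1 h2 e)); rewrite /ex mulrC -surjective_pairing.
Qed.

Section Fields.
Variables psi a b : P2 -> R.
Hypotheses (cpsi : Ck 2 psi) (ca : Ck 2 a) (cb : Ck 2 b) (sa : csupp a) (sb : csupp b).
Local Notation e := (ex psi).

(** [X1] and [X2] are the components of a compactly supported vector field collecting the boundary
    terms of the integrations by parts; its divergence integrates to 0. *)
Let X1 p := 2^-1 * ((a p * dy b p - b p * dy a p) * e p) - 2^-1 * (dx psi p * mod2 a b p * e p).
Let X2 p := - 2^-1 * ((a p * dx b p - b p * dx a p) * e p) - 2^-1 * (dy psi p * mod2 a b p * e p).

Let ce : Ck 2 e. Proof. exact: ex_Ck. Qed.

Lemma mod2_Ck n : Ck n a -> Ck n b -> Ck n (mod2 a b).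
Proof. by move=> ka kb; apply: CkD; apply: CkM. Qed.

Lemma mod2_csupp : csupp (mod2 a b).
Proof. by apply: csuppD; apply: csuppM. Qed.

Let X1_Ck : Ck 1 X1.
Proof.
have m := CkS (mod2_Ck ca cb); have e1 := CkS ce; have a1 := CkS ca; have b1 := CkS cb.
apply: CkB; apply: CkZ; apply: CkM => //.
  by apply: CkB; apply: CkM => //; exact: Ck_dy.
by apply: CkM => //; exact: Ck_dx.
Qed.

Let X2_Ck : Ck 1 X2.
Proof.
have m := CkS (mod2_Ck ca cb); have e1 := CkS ce; have a1 := CkS ca; have b1 := CkS cb.
apply: CkB; apply: CkZ; apply: CkM => //.
  by apply: CkB; apply: CkM => //; exact: Ck_dx.
by apply: CkM => //; exact: Ck_dy.
Qed.

Let X1_csupp : csupp X1.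
Proof.
apply: csuppD; last by apply: csuppN; apply: csuppM; apply: csuppMl; apply: csuppM; exact: mod2_csupp.
by apply: csuppM; apply: csuppMl; apply: csuppD; [exact: csuppMl|apply: csuppN; exact: csuppMl].
Qed.

Let X2_csupp : csupp X2.
Proof.
apply: csuppD; last by apply: csuppN; apply: csuppM; apply: csuppMl; apply: csuppM; exact: mod2_csupp.
by apply: csuppM; apply: csuppMl; apply: csuppD; [exact: csuppMl|apply: csuppN; exact: csuppMl].
Qed.

Let dX1 : dx X1 = fun p => 2^-1 * ((a p * dx (dy b) p + dx a p * dy b p - (b p * dx (dy a) p + dx b p * dy a p)) * e p
   + (a p * dy b p - b p * dy a p) * (2 * dx psi p * e p))
   - 2^-1 * (dx (dx psi) p * mod2 a b p * e p + dx psi p * (2 * (a p * dx a p + b p * dx b p)) * e p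
      + dx psi p * mod2 a b p * (2 * dx psi p * e p)).
Proof.
apply: dxE => p.
have h1 := derivx p ca; have h2 := derivx p cb; have h3 := derivx p (Ck_dy ca); have h4 := derivx p (Ck_dy cb).
have h5 := derivx p ce; rewrite (dx_ex cpsi) in h5; have h6 := derivx p (Ck_dx cpsi).
rewrite /X1 /mod2; apply: isd_eq; rewrite -?surjective_pairing /GRing.scale/=.
move: (a p) (b p) (dx a p) (dx b p) (dy a p) (dy b p) (dx (dy a) p) (dx (dy b) p) (ex psi p) (dx psi p) (dx (dx psi) p).
by move=> *; field.
Qed.

Let dX2 : dy X2 = fun p => - 2^-1 * ((a p * dx (dy b) p + dy a p * dx b p - (b p * dx (dy a) p + dy b p * dx a p)) * e p
   + (a p * dx b p - b p * dx a p) * (2 * dy psi p * e p))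
   - 2^-1 * (dy (dy psi) p * mod2 a b p * e p + dy psi p * (2 * (a p * dy a p + b p * dy b p)) * e p
      + dy psi p * mod2 a b p * (2 * dy psi p * e p)).
Proof.
apply: dyE => p.
have h1 := derivy p ca; have h2 := derivy p cb; have h3 := derivy p (Ck_dx ca); have h4 := derivy p (Ck_dx cb).
rewrite -(schwarz ca) in h3; rewrite -(schwarz cb) in h4.
have h5 := derivy p ce; rewrite (dy_ex cpsi) in h5; have h6 := derivy p (Ck_dy cpsi).
rewrite /X2 /mod2; apply: isd_eq; rewrite -?surjective_pairing /GRing.scale/=.
move: (a p) (b p) (dx a p) (dx b p) (dy a p) (dy b p) (dx (dy a) p) (dx (dy b) p) (ex psi p) (dy psi p) (dy (dy psi) p).
by move=> *; field.
Qed.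

(* The difference of both sides is the square of |db/dz + 2 (d psi/dz) b| times the weight. *)
Lemma divergence_le p : 2^-1 * (dx (dx psi) p + dy (dy psi) p) * mod2 a b p * e p + (dx X1 p + dy X2 p)
  <= dz2 a b p * e p.
Proof.
rewrite dX1 dX2 /dz2 /mod2 -subr_ge0.
have e0 := ex_gt0 psi p.
move: (a p) (b p) (dx a p) (dx b p) (dy a p) (dy b p) (dx (dy a) p) (dx (dy b) p) (ex psi p)
  (dx psi p) (dx (dx psi) p) (dy psi p) (dy (dy psi) p) e0.
move=> A B ax bx ay b_y axy bxy E px pxx py pyy E0.
have -> : forall x, x = 4^-1 * E * ((ax - b_y + 2 * (px * A - py * B)) ^+ 2 + (bx + ay + 2 * (px * B + py * A)) ^+ 2) -> 0 <= x.
- by move=> x ->; rewrite mulr_ge0 ?addr_ge0 ?sqr_ge0// mulr_ge0// ltW.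
- by [].
- by field.
Qed.

Lemma basic_inequality :
  I L (fun p => 2^-1 * (dx (dx psi) p + dy (dy psi) p) * mod2 a b p * e p) <= I L (fun p => dz2 a b p * e p).
Proof.
have i0 : I L (fun p => dx X1 p + dy X2 p) = 0.
  rewrite ID ?I_dx0 ?I_dy0 ?addr0//.
    by apply: cont_intg; [exact: Leb_lfin|exact: (Ck_cont (Ck_dx X1_Ck))|exact: csupp_dx].
  by apply: cont_intg; [exact: Leb_lfin|exact: (Ck_cont (Ck_dy X2_Ck))|exact: csupp_dy].
have iX : intg L (fun p => dx X1 p + dy X2 p).
  apply: intgD.
    by apply: cont_intg; [exact: Leb_lfin|exact: (Ck_cont (Ck_dx X1_Ck))|exact: csupp_dx].
  by apply: cont_intg; [exact: Leb_lfin|exact: (Ck_cont (Ck_dy X2_Ck))|exact: csupp_dy].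
have iA : intg L (fun p => 2^-1 * (dx (dx psi) p + dy (dy psi) p) * mod2 a b p * e p).
  apply: cont_intg; first exact: Leb_lfin.
    apply: (Ck_cont (_ : Ck 0 _)); apply: CkM; last exact: Ck_le ce.
    apply: CkM; last by apply: mod2_Ck; [exact: Ck_le ca|exact: Ck_le cb].
    by apply: CkZ; apply: CkD; [exact: Ck_dx (Ck_dx cpsi)|exact: Ck_dy (Ck_dy cpsi)].
  by apply: csuppMl; apply: csuppM; exact: mod2_csupp.
have iB : intg L (fun p => dz2 a b p * e p).
  apply: cont_intg; first exact: Leb_lfin.
    apply: (Ck_cont (_ : Ck 0 _)); apply: CkM; last exact: Ck_le ce.
    have k1 := Ck_le (isT : (0 <= 1)%N) (Ck_dx ca); have k2 := Ck_le (isT : (0 <= 1)%N) (Ck_dy ca).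
    have k3 := Ck_le (isT : (0 <= 1)%N) (Ck_dx cb); have k4 := Ck_le (isT : (0 <= 1)%N) (Ck_dy cb).
    by rewrite /dz2; apply: CkZ; apply: CkD; apply: CkM; [exact: CkD|exact: CkD|exact: CkB|exact: CkB].
  apply: csuppMl; apply: csuppM; have x1 := csupp_dx sa; have x2 := csupp_dx sb; have y1 := csupp_dy sa; have y2 := csupp_dy sb.
  by apply: csuppD; apply: csuppM; apply: csuppD => //; exact: csuppN.
rewrite -[leLHS]addr0 -i0 -(ID iA iX); apply: I_le => //; first exact: intgD.
by move=> p; exact: divergence_le.
Qed.
End Fields.
End BasicInequality.

(** * Numerical inequalities for the smoothed weight *)

Section Arith.
Context {R : realType}.
Implicit Types x y n : R.

Lemma sq_scale x y : 0 < x -> 0 < y -> x <= 9 / 16 * y -> x ^+ 2 <= 10 / 16 * y ^+ 2.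
Proof. by move=> *; nra. Qed.

Lemma sq_scale2 n x y : 0 <= n -> 0 < x -> 0 < y -> n < 8^-1 * y -> 7 / 32 * y <= x -> n ^+ 2 <= x ^+ 2 / 2.
Proof. by move=> *; nra. Qed.

Lemma est1 (l c r M0 e1 e2 : R) : 0 < c -> 0 < r -> 0 <= M0 -> 0 < e1 -> e1 <= e2 ->
  c * r + - (2^-1 * c) * r <= l -> 4^-1 * c * (M0 * r * e1) <= 2^-1 * l * M0 * e2.
Proof.
move=> c0 r0 m0 e10 e12 h.
have h1 : 2^-1 * (c * r) <= l by lra.
have -> : 4^-1 * c * (M0 * r * e1) = 2^-1 * (2^-1 * (c * r)) * M0 * e1 by field.
apply: ler_pM => //; [|exact: ltW|].
  by rewrite mulr_ge0// mulr_ge0 ?invr_ge0// mulr_ge0 ?invr_ge0// mulr_ge0// ltW.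
by apply: ler_wpM2r => //; rewrite ler_pM2l ?invr_gt0.
Qed.
End Arith.

(** * A smooth weight comparable to the given one *)

Section Data.
Context {R : realType}.
Local Notation P2 := (R * R)%type.
Local Notation L := (@Leb R).
Local Notation TT := (2 * pi : R).
Implicit Types (p q w z : P2) (e r s t : R).

(** The standing hypotheses in real coordinates, with the doubling constant [cd] fixed; all later
    constants depend on [cd] alone. *)
Record fock_data (phi : P2 -> R) (mu : {measure set P2 -> \bar R}) (rho : P2 -> R) (cd : R) : Prop := {
  fd_usc : forall z e, 0 < e -> exists2 d : R, 0 < d & forall w, en (w - z) < d -> phi w < phi z + e;
  fd_smv : forall z r, 0 < r ->
    ((TT * phi z)%:E <= \int[@lebesgue_measure R]_(t in `[0%R, TT]%classic) (phi (z.1 + r * cos t, z.2 + r * sin t))%:E)%E;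
  fd_riesz : forall psi, test_fun psi ->
    Rintegral (@leb2 R) setT (fun p => phi p * lap psi p) = Rintegral mu setT psi;
  fd_fin : forall p r, (mu (D p r) < +oo)%E;
  fd_cd0 : 0 < cd;
  fd_dbl : forall p r, 0 < r -> (mu (D p (2 * r)) <= cd%:E * mu (D p r))%E;
  fd_rho0 : forall p, 0 < rho p;
  fd_mu_rho : forall p, mu (D p (rho p)) = 1%:E }.

Variables (phi : P2 -> R) (mu : {measure set P2 -> \bar R}) (rho : P2 -> R) (cd : R).
Hypothesis H : fock_data phi mu rho cd.

Lemma fd_meas : meas phi. Proof. exact: phi_meas (fd_usc H). Qed.
Lemma fd_lint : lint L phi. Proof. exact: phi_lint (fd_usc H) (fd_smv H). Qed.
Lemma fd_Av_ge r z : 0 < r -> phi z <= Av r phi z. Proof. exact: Av_ge (fd_usc H) (fd_smv H) r z. Qed.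
Lemma fd_Av_le e z : 0 < e -> e <= rho z -> Av e phi z <= phi z + Kav cd.
Proof. exact: (Av_le_rho (fd_usc H) (fd_smv H) (fd_riesz H) (fd_fin H) (fd_cd0 H) (fd_dbl H) (fd_mu_rho H)). Qed.
Lemma fd_lap_Av e : 0 < e -> (fun z => dx (dx (Av e phi)) z + dy (dy (Av e phi)) z) =
  fun z => c0^-1 * I mu (fun w => al e (w - z)).
Proof. exact: lap_Av (fd_usc H) (fd_smv H) mu (fd_riesz H) e. Qed.
Lemma fd_lbd : lbd phi.
Proof. exact: (phi_lbd (fd_usc H) (fd_smv H) (fd_riesz H) (fd_fin H) (fd_cd0 H) (fd_dbl H) (fd_rho0 H) (fd_mu_rho H)). Qed.
Lemma fd_rho_lip p q : rho p <= rho q + en (p - q).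
Proof. exact: (rho_lip (fd_fin H) (fd_cd0 H) (fd_dbl H) (fd_rho0 H) (fd_mu_rho H)). Qed.
Lemma fd_rho_cont : continuous rho.
Proof. move=> p; exact: (rho_cont (fd_fin H) (fd_cd0 H) (fd_dbl H) (fd_rho0 H) (fd_mu_rho H)). Qed.
Lemma fd_rho_low (M : R) : exists2 e : R, 0 < e & forall p, `|p| <= M -> e <= rho p.
Proof. exact: (rho_low (fd_fin H) (fd_cd0 H) (fd_dbl H) (fd_rho0 H) (fd_mu_rho H) M). Qed.
Lemma fd_Ek_mass e r z : 0 < e -> e <= r -> I mu (fun w => Ek e r (w - z)) <= KE cd * m mu z r.
Proof. exact: (Ek_mass (fd_fin H) (fd_cd0 H) (fd_dbl H) z). Qed.
Lemma fd_lfin : lfin mu. Proof. exact: mu_lfin (fd_fin H). Qed.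
Lemma fd_Kav_gt0 : 0 < Kav cd. Proof. exact: Kav_gt0 (fd_cd0 H). Qed.

Section Smoothing.
Variable e : R.
Hypothesis e0 : 0 < e.

Definition rk (k : nat) : R := 2 ^+ k * e.
(* With [rho] cut into dyadic levels, the potential [V] is a finite sum of convolutions. *)
Definition Ak (k : nat) : set P2 := [set w | rk k <= rho w / 2 < rk k.+1].

Lemma rk_gt0 k : 0 < rk k. Proof. by rewrite mulr_gt0// exprn_gt0. Qed.

Lemma rk_ge k : e <= rk k.
Proof. by rewrite /rk ler_pMl// exprn_ege1// ler1n. Qed.

Lemma rk_le j k : (j <= k)%N -> rk j <= rk k.
Proof. by move=> jk; rewrite ler_pM2r// ler_weXn2l// ler1n. Qed.

Lemma Ak_meas k : measurable (Ak k).
Proof.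
have mr : meas (fun w => rho w / 2).
  by apply: measurable_funM; [exact: cont_meas fd_rho_cont|exact: measurable_cst].
have := mr measurableT _ (measurable_itv `[rk k, rk k.+1[); rewrite setTI.
by congr measurable; apply/seteqP; split => w; rewrite /Ak /= in_itv.
Qed.

Lemma Ak_uniq w j k : Ak j w -> Ak k w -> j = k.
Proof.
rewrite /Ak /= => /andP[h1 h2] /andP[h3 h4].
have [jk|kj|//] := ltngtP j k.
  by exfalso; have h5 : rk j.+1 <= rk k := rk_le jk; lra.
by exfalso; have h5 : rk k.+1 <= rk j := rk_le kj; lra.
Qed.

Lemma Ak_exists w n : e <= rho w / 2 -> rho w / 2 < rk n -> exists2 k, (k < n)%N & Ak k w.
Proof.
move=> h; elim: n => [|n IH]; first by rewrite /rk expr0 mul1r ltNge h.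
move=> hn; have [h1|h1] := ltrP (rho w / 2) (rk n).
  by have [k kn hk] := IH h1; exists k => //; exact: ltnW.
by exists n => //; rewrite /Ak /= h1.
Qed.

Definition chi k w : R := \1_(Ak k) w.

Lemma chi1 k w : Ak k w -> chi k w = 1.
Proof. by move=> h; rewrite /chi indicE mem_set. Qed.

Lemma chi0 k w : ~ Ak k w -> chi k w = 0.
Proof. by move=> h; rewrite /chi indicE memNset. Qed.

Lemma chi_ge0 k w : 0 <= chi k w. Proof. by rewrite /chi indicE. Qed.

Lemma chi_lint k : lint mu (chi k).
Proof.
apply: lbd_lint; first exact: fd_lfin.
split; first by have mA := Ak_meas k; exact: measurable_indic.
by move=> M; exists 1 => w _; rewrite /chi indicE; case: (_ \in _); rewrite ?normr1 ?normr0.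
Qed.

(** The levels are disjoint, so the sum has at most one nonzero term. *)
Lemma chi_sum n w (x : nat -> R) : (exists k, [/\ (k < n)%N, Ak k w & \sum_(i < n) chi i w * x i = x k]) \/
  ((forall k, (k < n)%N -> ~ Ak k w) /\ \sum_(i < n) chi i w * x i = 0).
Proof.
have [[k kn hk]|h] := pselect (exists2 k, (k < n)%N & Ak k w); [left|right].
  exists k; split => //; rewrite (bigD1 (Ordinal kn))//= chi1// mul1r big1 ?addr0// => i ik.
  rewrite chi0 ?mul0r// => hi; move: ik; rewrite -val_eqE /= => /eqP; apply; exact: Ak_uniq hi hk.
split; first by move=> k kn hk; apply: h; exists k.
by rewrite big1// => i _; rewrite chi0 ?mul0r// => hi; apply: h; exists i.
Qed.

(** Adding [V] to [c0 * Av e phi] replaces, in the Laplacian, the kernel [al e] by [al (rk k)] for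
    the mass at points of level [k < n]: that mass is spread over a radius between [rho / 4] and
    [rho / 2]. *)
Definition V (n : nat) z : R := \sum_(k < n) conv mu (Ek e (rk k)) (chi k) z.

Lemma V0 : V 0 = fun=> 0.
Proof. by apply/funext => z; rewrite /V big_ord0. Qed.

Lemma VS n : V n.+1 = fun z => V n z + conv mu (Ek e (rk n)) (chi n) z.
Proof. by apply/funext => z; rewrite /V big_ord_recr. Qed.

Lemma Vk_Ck k : Ck 3 (conv mu (Ek e (rk k)) (chi k)).
Proof. by apply: conv_Ck; [exact: Ek_Ck|apply: Ek_csupp => //; exact: rk_ge|exact: chi_lint]. Qed.

Lemma V_Ck n : Ck 3 (V n).
Proof.
elim: n => [|n IH]; first by rewrite V0; exact: Ck_cst.
by rewrite VS; apply: CkD => //; exact: Vk_Ck.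
Qed.

Lemma lap_conv a f z : Ck 3 a -> csupp a -> lint mu f ->
  dx (dx (conv mu a f)) z + dy (dy (conv mu a f)) z = conv mu (fun w => dx (dx a) w + dy (dy a) w) f z.
Proof.
move=> ca sa lf.
have NN (u : P2 -> R) : (fun z => - u z) = (fun z => -1 * u z) by apply/funext => w; rewrite mulN1r.
rewrite (conv_dx ca sa lf) (conv_dy ca sa lf).
have cx := conv_Ck (Ck_dx ca) (csupp_dx sa) lf; have cy := conv_Ck (Ck_dy ca) (csupp_dy sa) lf.
rewrite (NN (conv mu (dx a) f)) (NN (conv mu (dy a) f)) (dxZ _ cx) (dyZ _ cy).
rewrite (conv_dx (Ck_dx ca) (csupp_dx sa) lf) (conv_dy (Ck_dy ca) (csupp_dy sa) lf) !mulN1r !opprK.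
have i1 := conv_intg z (Ck_cont (Ck_dx (Ck_dx ca))) (csupp_dx (csupp_dx sa)) lf.
have i2 := conv_intg z (Ck_cont (Ck_dy (Ck_dy ca))) (csupp_dy (csupp_dy sa)) lf.
have := ID i1 i2.
have -> : (fun p => f p * dx (dx a) (p - z) + f p * dy (dy a) (p - z)) =
  (fun p => f p * (dx (dx a) (p - z) + dy (dy a) (p - z))).
  by apply/funext => p; rewrite mulrDr.
exact: esym.
Qed.

Lemma lap_V n z : dx (dx (V n)) z + dy (dy (V n)) z =
  I mu (fun w => \sum_(k < n) chi k w * (al (rk k) (w - z) - al e (w - z))) /\
  intg mu (fun w => \sum_(k < n) chi k w * (al (rk k) (w - z) - al e (w - z))).
Proof.
elim: n => [|n [IH1 IH2]].
  rewrite V0 (dx_cst 0) (dy_cst 0) (dx_cst 0) (dy_cst 0) addr0.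
  have -> : (fun w => \sum_(k < 0) chi k w * (al (rk k) (w - z) - al e (w - z))) = fun=> 0.
    by apply/funext => w; rewrite big_ord0.
  by rewrite I0; split => //; exact: intg0.
have -> : (fun w => \sum_(k < n.+1) chi k w * (al (rk k) (w - z) - al e (w - z))) =
  fun w => \sum_(k < n) chi k w * (al (rk k) (w - z) - al e (w - z)) + chi n w * (al (rk n) (w - z) - al e (w - z)).
  by apply/funext => w; rewrite big_ord_recr.
have c1 := V_Ck n; have c2 := Vk_Ck n.
have cd2 : continuous (fun w => al (rk n) w - al e w).
  by move=> w; apply: cvgB; [exact: (Ck_cont (al_Ck (rk n)))|exact: (Ck_cont (al_Ck e))].
have sd2 : csupp (fun w => al (rk n) w - al e w).
  by apply: csuppD; [exact: al_csupp (rk_gt0 n)|apply: csuppN; exact: al_csupp].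
have i2 := conv_intg z cd2 sd2 (chi_lint n).
split; last exact: intgD.
rewrite (ID IH2 i2) -IH1 VS (dxD c1 c2) (dyD c1 c2) (dxD (Ck_dx c1) (Ck_dx c2)) (dyD (Ck_dy c1) (Ck_dy c2)).
rewrite addrACA; congr (_ + _); rewrite (lap_conv _ (Ek_Ck e (rk n)))//; last 2 first.
- by apply: Ek_csupp => //; exact: rk_ge.
- exact: chi_lint.
have -> : (fun w => dx (dx (Ek e (rk n))) w + dy (dy (Ek e (rk n))) w) = (fun w => al (rk n) w - al e w).
  exact: lap_Ek.
by [].
Qed.

Lemma V_I n z : V n z = I mu (fun w => \sum_(k < n) chi k w * Ek e (rk k) (w - z)) /\
  intg mu (fun w => \sum_(k < n) chi k w * Ek e (rk k) (w - z)).
Proof.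
elim: n => [|n [IH1 IH2]].
  rewrite V0.
  have -> : (fun w => \sum_(k < 0) chi k w * Ek e (rk k) (w - z)) = fun=> 0.
    by apply/funext => w; rewrite big_ord0.
  by rewrite I0; split => //; exact: intg0.
have -> : (fun w => \sum_(k < n.+1) chi k w * Ek e (rk k) (w - z)) =
  fun w => \sum_(k < n) chi k w * Ek e (rk k) (w - z) + chi n w * Ek e (rk n) (w - z).
  by apply/funext => w; rewrite big_ord_recr.
have i2 := conv_intg z (Ck_cont (Ek_Ck e (rk n))) (Ek_csupp e0 (rk_ge n)) (chi_lint n).
by split; [rewrite VS (ID IH2 i2) IH1|exact: intgD].
Qed.

Lemma V_ge0 n z : 0 <= V n z.
Proof.
have [-> _] := V_I n z; apply: I_ge0 => w; apply: sumr_ge0 => k _.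
by rewrite mulr_ge0 ?chi_ge0// Ek_ge0// rk_ge.
Qed.

(** A point [w] of level [k] contributes only if [|w - z| < rk k <= rho w / 2]. Then
    [rho w / 2 < rho z] because [rho] is 1-Lipschitz, so [V] is at most the potential truncated at
    radius [rho z], over a disc of mass 1. *)
Lemma V_le n z : e <= rho z -> c0^-1 * V n z <= Kav cd.
Proof.
move=> ez; have [-> i1] := V_I n z.
rewrite /Kav ler_pM2l ?invr_gt0 ?c0_gt0//.
have h := fd_Ek_mass z e0 ez; rewrite (m_rho (fd_mu_rho H)) mulr1 in h; apply: le_trans h.
apply: I_le => // [|w]; first exact: (Ek_shift_intg (fd_fin H)).
have [[k [_ hk ->]]|[_ ->]] := chi_sum n w (fun k => Ek e (rk k) (w - z)); last exact: Ek_ge0.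
have [h|h] := lerP (rk k) (en (w - z)); first by rewrite Ek_out ?rk_ge//; exact: Ek_ge0.
apply: Ek_le; first exact: rk_gt0.
by have := fd_rho_lip w z; move: hk; rewrite /Ak /= => /andP[]; lra.
Qed.

(** On the disc of radius [rho z / 8] the values of [rho] lie between [7/8] and [9/8] of [rho z], so
    the spreading radius lies between [7/32] and [9/16] of [rho z] and the kernel is at least
    [(rho z)^-2]. Three doublings give this disc a mass of at least [cd^-3]. *)
Lemma lap_V_low n z : e <= 7 / 16 * rho z -> 9 / 16 * rho z < rk n ->
  cd ^- 3 * (rho z) ^- 2 <= I mu (fun w => al e (w - z)) + (dx (dx (V n)) z + dy (dy (V n)) z).
Proof.
move=> ez zn; have [-> i1] := lap_V n z.
have z0 := fd_rho0 H z.
have ia : intg mu (fun w => al e (w - z)) by apply: al_shift_intg => //; exact: fd_lfin.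
rewrite -(ID ia i1).
have [iD eD] := I_D (fd_fin H) z (8^-1 * rho z).
apply: (@le_trans _ _ ((rho z) ^- 2 * m mu z (8^-1 * rho z))).
  rewrite mulrC ler_pM2l ?invr_gt0 ?exprn_gt0//.
  have h8 : 0 < 8^-1 * rho z by rewrite mulr_gt0// invr_gt0.
  have := m_dbln (fd_fin H) (fd_cd0 H) (fd_dbl H) z 3 h8.
  have -> : 2 ^+ 3 * (8^-1 * rho z) = rho z by move: (rho z) => x; field.
  by rewrite (m_rho (fd_mu_rho H)) -ler_pdivrMl ?exprn_gt0 ?(fd_cd0 H)// mulr1.
rewrite -eD -(IZ _ iD); apply: I_le => [||w]; [exact: intgZ|exact: intgD|].
have a0 := al_ge0 e (w - z).
rewrite indicE; have [/set_mem hw|_] := boolP (w \in _); last first.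
  rewrite mulr0; have [[k [_ hk ->]]|[_ ->]] := chi_sum n w (fun k => al (rk k) (w - z) - al e (w - z)).
    by rewrite subrKC al_ge0.
  by rewrite addr0.
rewrite mulr1; rewrite /D /= in hw.
have l1 := fd_rho_lip w z; have l2 := fd_rho_lip z w; rewrite -enN opprB in l2.
have [k kn hk] : exists2 k, (k < n)%N & Ak k w by apply: Ak_exists; lra.
have [[j [_ hj ->]]|[h _]] := chi_sum n w (fun k => al (rk k) (w - z) - al e (w - z)); last by case: (h k kn).
rewrite subrKC; move: hj; rewrite /Ak /= => /andP[r1 r2].
have r0 := rk_gt0 j; have re : rk j.+1 = 2 * rk j by rewrite /rk exprS mulrA.
rewrite re in r2.
have rr : rk j <= 9 / 16 * rho z by lra.
apply: (@le_trans _ _ (10 / 16 * (rk j) ^- 2)).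
  rewrite ler_pdivlMr ?exprn_gt0// mulrC ler_pdivrMr ?exprn_gt0//.
  exact: sq_scale.
apply: al_low => //; rewrite -en_sq.
have rl : 7 / 32 * rho z <= rk j by lra.
have n0 := en_ge0 (w - z).
exact: (@sq_scale2 R _ _ (rho z)).
Qed.
End Smoothing.

Definition cH : R := c0^-1 * cd ^- 3.

Lemma cH_gt0 : 0 < cH.
Proof. by rewrite mulr_gt0 ?invr_gt0 ?c0_gt0// exprn_gt0// (fd_cd0 H). Qed.

(** The function depends on [M]: [e] has to stay below [rho] on the square and [n] has to cover the
    levels needed there. The bounds do not depend on [M], so they serve for test functions of
    arbitrary compact support. *)
Lemma smooth_weight (M : R) : exists2 psi : P2 -> R, Ck 2 psi & forall z, `|z| <= M ->
  [/\ phi z <= psi z, psi z <= phi z + 2 * Kav cd & cH * (rho z) ^- 2 <= dx (dx psi) z + dy (dy psi) z].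
Proof.
have [em em0 hem] := fd_rho_low M; pose e := 7 / 16 * em.
have e0 : 0 < e by rewrite mulr_gt0// divr_gt0.
have [C hC] := cont_bounded M fd_rho_cont.
have [n [hn _]] := nat_bound (C / e) 0.
have hz z : `|z| <= M -> [/\ e <= rho z, e <= 7 / 16 * rho z & 9 / 16 * rho z < rk e n].
  move=> zM; have h1 := hem z zM; have h2 := hC z zM; have h3 := fd_rho0 H z.
  rewrite ger0_norm ?(ltW h3)// in h2.
  split; [rewrite /e; lra|rewrite /e; lra|].
  apply: (@lt_le_trans _ _ (n%:R * e)).
    by rewrite -ltr_pdivrMr//; apply: le_lt_trans (le_lt_trans (ler_norm _) hn); rewrite ler_pM2r ?invr_gt0//; lra.
  by rewrite /rk ler_pM2r// -natrX ler_nat ltnW// ltn_expl.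
have cA : Ck 2 (Av e phi) by apply: CkS; apply: Av_Ck => //; exact: fd_lint.
have cV : Ck 2 (V e n) by apply: CkS; exact: V_Ck.
exists (fun z => Av e phi z + c0^-1 * V e n z); first by apply: CkD => //; exact: CkZ.
move=> z /hz[h1 h2 h3].
have V0' : 0 <= c0^-1 * V e n z by rewrite mulr_ge0 ?invr_ge0 ?(ltW (c0_gt0))// V_ge0.
have V1 := V_le e0 n h1; have A0 := fd_Av_ge z e0; have A1 := fd_Av_le e0 h1.
split; [lra|lra|].
have cV' : Ck 2 (fun z => c0^-1 * V e n z) by exact: CkZ.
rewrite (dxD cA cV') (dyD cA cV') (dxD (Ck_dx cA) (Ck_dx cV')) (dyD (Ck_dy cA) (Ck_dy cV')).
rewrite (dxZ _ cV) (dyZ _ cV) (dxZ _ (Ck_dx cV)) (dyZ _ (Ck_dy cV)) addrACA.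
have := fd_lap_Av e0 => /(congr1 (fun f => f z)) /= ->.
by rewrite -mulrDr -mulrDr /cH -mulrA ler_pM2l ?invr_gt0 ?c0_gt0//; exact: lap_V_low.
Qed.

(** The 4 combines the factor [1/2] of [basic_inequality] with the half of [cH] conceded to [eta];
    the exponential comes from [psi <= phi + 2 Kav] in the exponent [2 psi]. *)
Definition CH : R := 4 * expR (4 * Kav cd) / cH.

Lemma ex_lbd (f : P2 -> R) : lbd f -> lbd (ex f).
Proof.
move=> [mf hf]; split; first by apply: measurableT_comp => //; apply: measurable_funM => //; exact: measurable_cst.
move=> M; have [C hC] := hf M; exists (expR (2 * C)) => p /hC h.
rewrite /ex ger0_norm ?expR_ge0// ler_expR ler_pM2l//; exact: le_trans (ler_norm _) h.
Qed.

(** The perturbation [eta] may use up half of the Laplacian of the smoothed weight; this is the room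
    for a logarithmic pole. *)
Lemma weighted_estimate (eta a b : P2 -> R) : Ck 2 eta -> Ck 2 a -> Ck 2 b -> csupp a -> csupp b ->
  (forall z, - (2^-1 * cH) * (rho z) ^- 2 <= dx (dx eta) z + dy (dy eta) z) ->
  I L (fun p => mod2 a b p * (rho p) ^- 2 * ex (fun p => phi p + eta p) p) <=
  CH * I L (fun p => dz2 a b p * ex (fun p => phi p + eta p) p).
Proof.
move=> ceta ca cb sa sb heta.
have [Ma hMa] := sa; have [Mb hMb] := sb; pose M := Num.max Ma Mb.
have [psi cpsi hpsi] := smooth_weight M.
have cpe : Ck 2 (fun p => psi p + eta p) by exact: CkD.
have BI := basic_inequality cpe ca cb sa sb.
have lw : lbd (ex (fun p => phi p + eta p)).
  by apply: ex_lbd; apply: lbdD; [exact: fd_lbd|exact: cont_lbd (Ck_cont ceta)].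
have lpe : lbd (ex (fun p => psi p + eta p)) by exact: cont_lbd (Ck_cont (ex_Ck cpe)).
have m0 : Ck 0 (mod2 a b) by apply: mod2_Ck; [exact: Ck_le ca|exact: Ck_le cb].
have sm := mod2_csupp sa sb.
have sdx := csupp_dx sa; have sdy := csupp_dy sa; have sdx' := csupp_dx sb; have sdy' := csupp_dy sb.
have sz : csupp (dz2 a b).
  by apply: csuppM; apply: csuppD; apply: csuppM; apply: csuppD => //; exact: csuppN.
have z0 : Ck 0 (dz2 a b).
  have k1 := Ck_le (isT : (0 <= 1)%N) (Ck_dx ca); have k2 := Ck_le (isT : (0 <= 1)%N) (Ck_dy ca).
  have k3 := Ck_le (isT : (0 <= 1)%N) (Ck_dx cb); have k4 := Ck_le (isT : (0 <= 1)%N) (Ck_dy cb).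
  by rewrite /dz2; apply: CkZ; apply: CkD; apply: CkM; [exact: CkD|exact: CkD|exact: CkB|exact: CkB].
have crho : continuous (fun p => (rho p) ^- 2).
  move=> p; apply: cvgV; first by rewrite lt0r_neq0// exprn_gt0// (fd_rho0 H).
  by apply: cvgM; exact: fd_rho_cont.
have i1 : intg L (fun p => mod2 a b p * (rho p) ^- 2 * ex (fun p => phi p + eta p) p).
  apply: lbd_intg; [exact: Leb_lfin| |by apply: csuppMl; exact: csuppMl].
  by apply: lbdM => //; apply: lbdM; [exact: cont_lbd (Ck_cont m0)|exact: cont_lbd].
have i2 : intg L (fun p => dz2 a b p * ex (fun p => phi p + eta p) p).
  apply: lbd_intg; [exact: Leb_lfin| |exact: csuppMl].
  by apply: lbdM => //; exact: cont_lbd (Ck_cont z0).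
have i3 : intg L (fun p => dz2 a b p * ex (fun p => psi p + eta p) p).
  apply: lbd_intg; [exact: Leb_lfin| |exact: csuppMl].
  by apply: lbdM => //; exact: cont_lbd (Ck_cont z0).
have i4 : intg L (fun p => 2^-1 * (dx (dx (fun p => psi p + eta p)) p + dy (dy (fun p => psi p + eta p)) p) * mod2 a b p * ex (fun p => psi p + eta p) p).
  apply: lbd_intg; [exact: Leb_lfin| |by apply: csuppMl; exact: csuppM].
  apply: lbdM => //; apply: lbdM; last exact: cont_lbd (Ck_cont m0).
  apply: cont_lbd; apply: (Ck_cont (_ : Ck 0 _)); apply: CkZ; apply: CkD; [exact: Ck_dx (Ck_dx cpe)|exact: Ck_dy (Ck_dy cpe)].
have out p : M < `|p| -> mod2 a b p = 0 /\ dz2 a b p = 0.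
  rewrite gt_max => /andP[h1 h2]; split; first by rewrite /mod2 hMa// hMb// expr0n addr0.
  have [e1 e1p [H1 H2]] := norm_near h1; have [e2 e2p [H3 H4]] := norm_near h2.
  rewrite /dz2 (@locdx0 _ a p e1)// ?(@locdy0 _ a p e1)// ?(@locdx0 _ b p e2)// ?(@locdy0 _ b p e2)//.
  - by rewrite addr0 subr0 expr0n /= addr0 mulr0.
  - by move=> t /H4 /hMb.
  - by move=> t /H3 /hMb.
  - by move=> t /H2 /hMa.
  - by move=> t /H1 /hMa.
have K0 := fd_Kav_gt0; have c00 := cH_gt0.
have B1 : 4^-1 * cH * I L (fun p => mod2 a b p * (rho p) ^- 2 * ex (fun p => phi p + eta p) p) <=
    I L (fun p => 2^-1 * (dx (dx (fun p => psi p + eta p)) p + dy (dy (fun p => psi p + eta p)) p) * mod2 a b p * ex (fun p => psi p + eta p) p).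
  rewrite -(IZ _ i1); apply: I_le => // [|p]; first exact: intgZ.
  have [pM|/out[-> _]] := lerP `|p| M; last by rewrite !(mul0r, mulr0).
  have [h1 h2 h3] := hpsi p pM; have h4 := heta p.
  have lapD : dx (dx (fun p => psi p + eta p)) p + dy (dy (fun p => psi p + eta p)) p =
     (dx (dx psi) p + dy (dy psi) p) + (dx (dx eta) p + dy (dy eta) p).
    rewrite (dxD cpsi ceta) (dyD cpsi ceta) (dxD (Ck_dx cpsi) (Ck_dx ceta)) (dyD (Ck_dy cpsi) (Ck_dy ceta)).
    by rewrite addrACA.
  rewrite lapD.
  have e1 : ex (fun p => phi p + eta p) p <= ex (fun p => psi p + eta p) p.
    by rewrite /ex ler_expR; lra.
  have m00 : 0 <= mod2 a b p by rewrite addr_ge0// sqr_ge0.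
  have r0 : 0 < (rho p) ^- 2 by rewrite invr_gt0 exprn_gt0// (fd_rho0 H).
  have x0 := ex_gt0 (fun p => phi p + eta p) p.
  apply: est1 => //; exact: lerD h3 h4.
have B2 : I L (fun p => dz2 a b p * ex (fun p => psi p + eta p) p) <=
    expR (4 * Kav cd) * I L (fun p => dz2 a b p * ex (fun p => phi p + eta p) p).
  rewrite -(IZ _ i2); apply: I_le => // [|p]; first exact: intgZ.
  have [pM|/out[_ ->]] := lerP `|p| M; last by rewrite !(mul0r, mulr0).
  have [h1 h2 _] := hpsi p pM.
  have dz0 : 0 <= dz2 a b p by rewrite mulr_ge0 ?invr_ge0// addr_ge0// sqr_ge0.
  rewrite mulrCA ler_wpM2l// /ex -expRD ler_expR; lra.
have := le_trans B1 (le_trans BI B2).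
rewrite -ler_pdivlMl; last by rewrite mulr_gt0// invr_gt0.
move=> h; apply: le_trans h _; rewrite /CH mulrA le_eqVlt; apply/orP; left; apply/eqP.
by move: (I _ _) => x; field; rewrite lt0r_neq0.
Qed.
End Data.

(** * The dbar-equation *)

Section GeometricCauchy.
Context {R : realType}.

Lemma geometric_cauchy (F : nat -> R) (c : R) : 0 <= c -> (forall n, `|F n.+1 - F n| <= c * 2 ^- n) ->
  cvgn F /\ forall n, `|F n - F 0%N| <= 2 * c.
Proof.
move=> c0 h.
have e n : 2 ^- n = 2 * 2 ^- n.+1 :> R by rewrite exprS; field; rewrite expf_neq0.
have b n : `|F n - F 0%N| <= 2 * c * (1 - 2 ^- n).
  elim: n => [|n IH]; first by rewrite subrr normr0 expr0 invr1 subrr mulr0.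
  have h1 := ler_distD (F n) (F n.+1) (F 0%N); apply: le_trans h1 _.
  have h2 := h n; rewrite (e n) in IH h2.
  by move: IH h2; move: (2 ^- n.+1) (`|_|) (`|_|) => x y z *; lra.
have p0 n : 0 < 2 ^- n :> R by rewrite invr_gt0 exprn_gt0.
have b2 n : `|F n - F 0%N| <= 2 * c.
  by apply: le_trans (b n) _; rewrite ler_piMr ?mulr_ge0// gerBl ltW.
split => //.
have z0 : (2 * c * 2 ^- n) @[n --> \oo] --> (0 : R).
  have -> : (fun n => 2 * c * 2 ^- n) = geometric (2 * c) (2^-1 : R).
    by apply/funext => n; rewrite /geometric /= exprVn.
  by apply: cvg_geometric; rewrite ger0_norm ?invr_ge0// invf_lt1// ltr1n.
(* Adding the bound on the remaining variation makes the sequence nonincreasing, and it is bounded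
   below. *)
have ca : cvgn (fun n => F n + 2 * c * 2 ^- n).
  apply: nonincreasing_is_cvgn.
    apply/nonincreasing_seqP => n; have := h n; rewrite ler_norml (e n) => /andP[_].
    by have := p0 n.+1; move: (2 ^- n.+1) => x *; nra.
  exists (F 0%N - 2 * c) => _ [n _ <-]; have := b2 n; rewrite ler_norml => /andP[h1 _].
  have : 0 <= 2 * c * 2 ^- n by rewrite mulr_ge0 ?mulr_ge0// ltW.
  by move: (_ * 2 ^- n) => x; lra.
have -> : F = (fun n => (F n + 2 * c * 2 ^- n) - 2 * c * 2 ^- n).
  by apply/funext => n; rewrite addrK.
by apply: is_cvgB => //; apply/cvg_ex; exists 0.
Qed.

Lemma sq_le_sqrt (d h p : R) : 0 <= h -> 0 < p -> (p * d) ^+ 2 <= h -> `|d| <= Num.sqrt h * p^-1.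
Proof.
move=> h0 p0 H; rewrite ler_pdivlMr// -[p in leLHS](gtr0_norm p0) -normrM mulrC.
by rewrite -sqrtr_sqr ler_sqrt.
Qed.

Lemma sq_le2 (x y s h : R) : 0 <= h -> s = Num.sqrt h -> `|x - y| <= 2 * s -> x ^+ 2 <= 2 * y ^+ 2 + 8 * h.
Proof.
move=> h0 -> H; have e := sqr_sqrtr h0; have s0 := sqrtr_ge0 h; rewrite -e.
move: H; rewrite ler_norml; move: (Num.sqrt h) s0 => t t0 /andP[h1 h2].
have : 0 <= (2 * t - (x - y)) * (2 * t + (x - y)) by apply: mulr_ge0; lra.
by have := sqr_ge0 (x - 2 * y); move=> *; nra.
Qed.
End GeometricCauchy.

(** * Completeness of L^2 *)

Section SquareIntegrable.
Context {R : realType} d {T : measurableType d} (nu : {measure set T -> \bar R}).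
Implicit Types f g : T -> R.

Definition sqi f := meas f /\ intg nu (fun x => f x ^+ 2).

Lemma sqi_meas_sq f : meas f -> meas (fun x => f x ^+ 2).
Proof. by move=> mf; apply: measurable_funX. Qed.

Lemma abs_mul_le (x y : R) : `|x * y| <= x ^+ 2 + y ^+ 2.
Proof.
rewrite ler_norml; have := sqr_ge0 (x + y); have := sqr_ge0 (x - y).
by have := sqr_ge0 x; have := sqr_ge0 y; move=> *; apply/andP; split; nra.
Qed.

Lemma sqiM f g : sqi f -> sqi g -> intg nu (fun x => f x * g x).
Proof.
move=> [mf i1] [mg i2]; apply: (intg_le _ _ (intgD i1 i2)); first exact: measurable_funM.
by move=> x; exact: abs_mul_le.
Qed.

Lemma sqiZ (c : R) f : sqi f -> sqi (fun x => c * f x).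
Proof.
move=> [mf i1]; split; first by apply: measurable_funM => //; exact: measurable_cst.
by have := intgZ (c ^+ 2) i1; congr (intg nu _); apply/funext => x; rewrite exprMn.
Qed.

Lemma sqiD f g : sqi f -> sqi g -> sqi (fun x => f x + g x).
Proof.
move=> sf sg; have [mf i1] := sf; have [mg i2] := sg; split; first exact: measurable_funD.
have := intgD (intgD i1 i2) (intgZ 2 (sqiM sf sg)); congr (intg nu _); apply/funext => x.
by rewrite sqrrD mulr2n mulrDl mul1r -!mulr2n; ring.
Qed.

Lemma sqiB f g : sqi f -> sqi g -> sqi (fun x => f x - g x).
Proof.
move=> sf sg; have := sqiD sf (sqiZ (-1) sg); congr sqi; apply/funext => x; by rewrite mulN1r.
Qed.

Lemma sqi_ae f g : {ae nu, forall x, f x = g x} -> meas g -> sqi f -> sqi g.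
Proof.
move=> h mg [mf i1]; split => //; apply: intg_ae_eq i1; last exact: sqi_meas_sq.
by apply: filterS h => x /= ->.
Qed.

(* Weak convergence with convergence of the norms, that is, convergence in L^2. *)
Definition L2lim (f_ : nat -> T -> R) f := [/\ sqi f,
  (forall g, sqi g -> (I nu (fun x => f_ n x * g x)) @[n --> \oo] --> I nu (fun x => f x * g x)) &
  (I nu (fun x => f_ n x ^+ 2)) @[n --> \oo] --> I nu (fun x => f x ^+ 2)].

Section Completeness.
Variable f_ : nat -> T -> R.
Hypothesis sf : forall n, sqi (f_ n).
Hypothesis fast : forall n, I nu (fun x => (f_ n.+1 x - f_ n x) ^+ 2) <= 8 ^- n.

(** The integral of [w n] is at most [4^n 8^-n = 2^-n], so the sum [h] is integrable and finite
    almost everywhere; where it is finite the steps are at most [sqrt h * 2^-n]. *)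
Let w n x : \bar R := (4 ^+ n * (f_ n.+1 x - f_ n x) ^+ 2)%:E.
Let h x : \bar R := (\sum_(n <oo) w n x)%E.

Let w0 n x : (0 <= w n x)%E.
Proof. by rewrite lee_fin mulr_ge0 ?sqr_ge0// exprn_ge0. Qed.

Let mw n : measurable_fun setT (w n).
Proof.
apply/measurable_EFinP; apply: measurable_funM; first exact: measurable_cst.
by apply: measurable_funX; apply: measurable_funB; [exact: (sf n.+1).1|exact: (sf n).1].
Qed.

Let mh : measurable_fun setT h.
Proof. exact: ge0_emeasurable_sum. Qed.

Let h0 x : (0 <= h x)%E. Proof. exact: nneseries_ge0. Qed.

Let int_h : (\int[nu]_x h x < +oo)%E.
Proof.
rewrite /h integral_nneseries//.
apply: (@le_lt_trans _ _ (\sum_(n <oo) (2 / (2 ^ (n + 0.+1))%:R)%:E)%E); last first.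
  have := @cvg_geometric_eseries_half R 2 0 => /(cvg_lim (@ereal_hausdorff R)) ->.
  by rewrite ltry.
apply: lee_nneseries => [n _ _|n _]; first by apply: integral_ge0.
have i1 : intg nu (fun x => 4 ^+ n * (f_ n.+1 x - f_ n x) ^+ 2).
  by apply: intgZ; exact: (sqiB (sf n.+1) (sf n)).2.
rewrite /w (I_fin i1) lee_fin (IZ _ (sqiB (sf n.+1) (sf n)).2).
have h4 : 0 < 4 ^+ n :> R by rewrite exprn_gt0.
apply: (@le_trans _ _ (4 ^+ n * 8 ^- n)); first by rewrite ler_pM2l.
rewrite addn1 natrX exprS.
have -> : 8 ^+ n = 4 ^+ n * 2 ^+ n :> R by rewrite -exprMn -natrM.
by rewrite le_eqVlt; apply/orP; left; apply/eqP; field; rewrite !expf_neq0.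
Qed.

Let hi : nu.-integrable setT h.
Proof.
apply/integrableP; split => //; under eq_integral do rewrite gee0_abs//.
exact: int_h.
Qed.

Let G : set T := [set x | h x \is a fin_num].

Let mG : measurable G.
Proof. by have := emeasurable_fin_num measurableT mh; rewrite setTI. Qed.

Let Gae : {ae nu, forall x, G x}.
Proof. by have := integrable_ae measurableT hi; apply: filterS => x /(_ Logic.I). Qed.

Let H x : R := fine (h x).

Let mH : meas H. Proof. exact: measurableT_comp. Qed.

Let H0 x : 0 <= H x. Proof. exact: fine_ge0. Qed.

Let iH : intg nu H.
Proof.
apply/intg_ge0P => //; apply: le_lt_trans int_h; apply: ge0_le_integral => //.
- by move=> x _; rewrite lee_fin.
- exact/measurable_EFinP.
- by move=> x _; rewrite /H; have := h0 x; case: (h x) => //= r _; rewrite leey.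
Qed.

(** Cut off to the set where [h] is finite, so that convergence holds at every point. *)
Let F n x : R := f_ n x * \1_G x.

Let mF n : meas (F n).
Proof. by apply: measurable_funM; [exact: (sf n).1|exact: measurable_indic]. Qed.

Let F_ae n : {ae nu, forall x, F n x = f_ n x}.
Proof. by apply: filterS Gae => x Gx; rewrite /F indicE mem_set// mulr1. Qed.

Let step n x : `|F n.+1 x - F n x| <= Num.sqrt (H x) * 2 ^- n.
Proof.
rewrite /F -mulrBl indicE; have [/set_mem Gx|_] := boolP (x \in G); last first.
  by rewrite mulr0 normr0 mulr_ge0 ?sqrtr_ge0// invr_ge0 exprn_ge0.
rewrite mulr1; apply: sq_le_sqrt => //.
have -> : (2 ^+ n * (f_ n.+1 x - f_ n x)) ^+ 2 = 4 ^+ n * (f_ n.+1 x - f_ n x) ^+ 2.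
  rewrite exprMn; congr (_ * _); rewrite -exprM mulnC exprM; congr (_ ^+ n); ring.
rewrite -lee_fin -[X in (_ <= X)%E]/((fine (h x))%:E) fineK//.
have := @nneseries_lim_ge R (w ^~ x) xpredT 0%N n.+1 (fun n _ _ => w0 n x).
apply: le_trans; rewrite big_nat_recr//= leeDr//.
by apply: sume_ge0 => i _; exact: w0.
Qed.

Lemma L2_complete : exists f, L2lim f_ f.
Proof.
pose f x := limn (fun n => F n x).
have cF x : (F n x) @[n --> \oo] --> f x.
  by have [] := geometric_cauchy (sqrtr_ge0 (H x)) (fun n => step n x).
have bF n x : F n x ^+ 2 <= 2 * F 0%N x ^+ 2 + 8 * H x.
  have [_ hb] := geometric_cauchy (sqrtr_ge0 (H x)) (fun n => step n x).
  exact: sq_le2 (H0 x) (erefl _) (hb n).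
have sF n : sqi (F n) by apply: sqi_ae (sf n) => //; apply: filterS (F_ae n) => x /= ->.
have iG : intg nu (fun x => 2 * F 0%N x ^+ 2 + 8 * H x).
  by apply: intgD; apply: intgZ => //; exact: (sF 0%N).2.
have mf : meas f by apply: (measurable_fun_cvg mF) => x _; exact: cF.
have [|||if2 lim2] := @I_dct _ _ _ nu (fun n x => F n x ^+ 2) (fun x => f x ^+ 2) _ _ _ iG.
- by move=> n; exact: sqi_meas_sq.
- by move=> x; rewrite expr2; under eq_fun do rewrite expr2; apply: cvgM; exact: cF.
- by move=> n x; rewrite ger0_norm ?sqr_ge0.
exists f; split => //.
  move=> g sg; have [mg ig] := sg.
  have [|||_ lim1] := @I_dct _ _ _ nu (fun n x => F n x * g x) (fun x => f x * g x) _ _ _ (intgD iG ig).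
  - by move=> n; apply: measurable_funM; [exact: mF|exact: mg].
  - by move=> x; apply: cvgM; [exact: cF|exact: cvg_cst].
  - by move=> n x; apply: le_trans (abs_mul_le _ _) _; rewrite lerD2r.
  apply: cvg_trans lim1; apply: near_eq_cvg; apply: nearW => n; apply: I_ae_eq.
  - by apply: filterS (F_ae n) => x /= ->.
  - by apply: measurable_funM; [exact: mF|exact: mg].
  - by apply: measurable_funM; [exact: (sf n).1|exact: mg].
apply: cvg_trans lim2; apply: near_eq_cvg; apply: nearW => n; apply: I_ae_eq.
- by apply: filterS (F_ae n) => x /= ->.
- exact: sqi_meas_sq.
- by apply: sqi_meas_sq; exact: (sf n).1.
Qed.
End Completeness.

(** * Riesz representation *)

Section Riesz.
(* The graph of a bounded linear functional on a space of pairs of functions. *)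
Variable Gr : (T -> R) -> (T -> R) -> R -> Prop.
Variable A : R.
Hypothesis Gr_sqi : forall f g l, Gr f g l -> sqi f /\ sqi g.
Hypothesis Gr0 : Gr (fun=> 0) (fun=> 0) 0.
Hypothesis Gr_lin : forall f g l f' g' l' (c : R), Gr f g l -> Gr f' g' l' ->
  Gr (fun x => f x + c * f' x) (fun x => g x + c * g' x) (l + c * l').
Hypothesis A0 : 0 <= A.

Let N f g := I nu (fun x => f x ^+ 2) + I nu (fun x => g x ^+ 2).
Let P f g f' g' := I nu (fun x => f x * f' x) + I nu (fun x => g x * g' x).

Hypothesis Gr_bound : forall f g l, Gr f g l -> l ^+ 2 <= A * N f g.

Let N_ge0 f g : 0 <= N f g.
Proof. by rewrite addr_ge0// I_ge0// => x; exact: sqr_ge0. Qed.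

Let N_lin f g f' g' c : sqi f -> sqi g -> sqi f' -> sqi g' ->
  N (fun x => f x + c * f' x) (fun x => g x + c * g' x) = N f g + 2 * c * P f g f' g' + c ^+ 2 * N f' g'.
Proof.
move=> s1 s2 s3 s4.
have e (u v : T -> R) : sqi u -> sqi v -> I nu (fun x => (u x + c * v x) ^+ 2) =
    I nu (fun x => u x ^+ 2) + 2 * c * I nu (fun x => u x * v x) + c ^+ 2 * I nu (fun x => v x ^+ 2).
  move=> su sv.
  have i1 := intgZ (2 * c) (sqiM su sv); have i2 := intgZ (c ^+ 2) sv.2.
  rewrite -(IZ _ (sqiM su sv)) -(IZ _ sv.2) -(ID su.2 i1) -(ID (intgD su.2 i1) i2).
  by congr I; apply/funext => x; ring.
rewrite /N /P !e//; move: (I _ _) (I _ _) (I _ _) (I _ _) (I _ _) (I _ _) => *; ring.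
Qed.

(** The concave functional [l(v) - |v|^2 / 2]; a limit of a maximizing sequence represents [l]. *)
Let J f g l := l - 2^-1 * N f g.

Let vals : set R := [set j | exists f g l, Gr f g l /\ j = J f g l].

Let vals_sup : has_sup vals.
Proof.
split; first by exists (J (fun=> 0) (fun=> 0) 0); exists (fun=> 0), (fun=> 0), 0.
exists (2^-1 * A) => _ [f [g [l [h ->]]]]; rewrite /J.
have := Gr_bound h; have := N_ge0 f g; move: (N f g) => n n0 hl.
have : (2 * l) ^+ 2 <= (A + n) ^+ 2 by have := sqr_ge0 (A - n); nra.
move=> h2; rewrite leNgt; apply/negP => h3.
have h4 : 0 < 2 * l - (A + n) by lra.
have A0' := A0; have h5 : 0 < 2 * l + (A + n) by lra.
by have := mulr_gt0 h4 h5; nra.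
Qed.

Let s := sup vals.

Let J_le f g l : Gr f g l -> J f g l <= s.
Proof. by move=> h; apply: ub_le_sup; [exact: vals_sup.2|exists f, g, l]. Qed.

(** Parallelogram law: the midpoint of two almost maximal elements has [J] at most [s], while it
    exceeds the mean of the two values by one eighth of the squared distance. *)
Let close f g l f' g' l' (e e' : R) : Gr f g l -> Gr f' g' l' -> s - e < J f g l -> s - e' < J f' g' l' ->
  N (fun x => f' x - f x) (fun x => g' x - g x) <= 4 * (e + e').
Proof.
move=> h h' he he'.
have hD := Gr_lin (-1) h' h; have hm := Gr_lin 2^-1 h hD.
have [s1 s2] := Gr_sqi h; have [s3 s4] := Gr_sqi h'; have [d1 d2] := Gr_sqi hD.
have := J_le hm; rewrite /J (N_lin _ s1 s2 d1 d2).
have eN : N f' g' = N f g + 2 * P f g (fun x => f' x + -1 * f x) (fun x => g' x + -1 * g x) +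
    N (fun x => f' x + -1 * f x) (fun x => g' x + -1 * g x).
  have := @N_lin f g _ _ 1 s1 s2 d1 d2; rewrite mulr1 expr1n mul1r => <-.
  by congr N; apply/funext => x; ring.
have -> : (fun x => f' x - f x) = (fun x => f' x + -1 * f x) by apply/funext => x; rewrite mulN1r.
have -> : (fun x => g' x - g x) = (fun x => g' x + -1 * g x) by apply/funext => x; rewrite mulN1r.
move: he he' eN; rewrite /J; move: (P _ _ _ _) (N _ _) (N _ _) (N _ _) => p n1 n2 n3; move: s => S *; lra.
Qed.

(** The space is not assumed complete, so the approximating elements of the graph are returned with
    the limit: closedness of the Fock space is derived from them in [Fock_projection]. *)
Lemma riesz_graph : exists q1 q2, exists v1 v2 : nat -> T -> R,
  [/\ (forall f g l, Gr f g l -> I nu (fun x => q1 x * f x) + I nu (fun x => q2 x * g x) = l),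
      I nu (fun x => q1 x ^+ 2) + I nu (fun x => q2 x ^+ 2) <= A,
      (forall n, exists l, Gr (v1 n) (v2 n) l), L2lim v1 q1 & L2lim v2 q2].
Proof.
(* With [close], this accuracy makes consecutive squared distances at most
   [4 (dl n + dl (n+1)) <= 8^-n], the speed used in [L2_complete]. *)
pose dl n : R := 8^-1 * 8 ^- n.
have dl0 n : 0 < dl n by rewrite mulr_gt0 ?invr_gt0// exprn_gt0.
have /choice[v hv] : forall n, exists x : (T -> R) * (T -> R) * R, Gr x.1.1 x.1.2 x.2 /\ s - dl n < J x.1.1 x.1.2 x.2.
  move=> n; have [_ [f [g [l [h ->]]]] hs] := sup_adherent (dl0 n) vals_sup.
  by exists (f, g, l).
pose v1 n := (v n).1.1; pose v2 n := (v n).1.2; pose l n := (v n).2.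
have hG n : Gr (v1 n) (v2 n) (l n) := (hv n).1.
have sv1 n : sqi (v1 n) := (Gr_sqi (hG n)).1.
have sv2 n : sqi (v2 n) := (Gr_sqi (hG n)).2.
have fast n : N (fun x => v1 n.+1 x - v1 n x) (fun x => v2 n.+1 x - v2 n x) <= 8 ^- n.
  have := close (hG n) (hG n.+1) (hv n).2 (hv n.+1).2.
  move=> h; apply: le_trans h _; rewrite /dl exprS invfM.
  have : 0 < 8 ^- n :> R by rewrite invr_gt0 exprn_gt0.
  by move: (8 ^- n) => x; lra.
have f1 n : I nu (fun x => (v1 n.+1 x - v1 n x) ^+ 2) <= 8 ^- n.
  by apply: le_trans (fast n); rewrite /N lerDl I_ge0// => x; exact: sqr_ge0.
have f2 n : I nu (fun x => (v2 n.+1 x - v2 n x) ^+ 2) <= 8 ^- n.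
  by apply: le_trans (fast n); rewrite /N lerDr I_ge0// => x; exact: sqr_ge0.
have [q1 L1] := L2_complete sv1 f1; have [q2 L2'] := L2_complete sv2 f2.
have [sq1 w1 n1] := L1; have [sq2 w2 n2] := L2'.
have dlc : dl n @[n --> \oo] --> (0 : R).
  have -> : dl = geometric (8^-1 : R) (8^-1 : R) by apply/funext => n; rewrite /dl /geometric /= exprVn.
  by apply: cvg_geometric; rewrite ger0_norm ?invr_ge0// invf_lt1// ltr1n.
have Pc f g : sqi f -> sqi g -> P (v1 n) (v2 n) f g @[n --> \oo] --> P q1 q2 f g.
  by move=> sf sg; apply: cvgD; [exact: w1|exact: w2].
have rep f g k : Gr f g k -> P q1 q2 f g = k.
  move=> hw; have [sf sg] := Gr_sqi hw.
  (* First-order optimality: [J] at [v n + t (f, g)] exceeds [J] at [v n] by at most [dl n], which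
     tends to 0. *)
  have key (t : R) : t * (k - P q1 q2 f g) <= 2^-1 * t ^+ 2 * N f g.
    have c1 : t * (k - P (v1 n) (v2 n) f g) @[n --> \oo] --> t * (k - P q1 q2 f g).
      by apply: cvgM; [exact: cvg_cst|apply: cvgB; [exact: cvg_cst|exact: Pc]].
    have c2 : dl n + 2^-1 * t ^+ 2 * N f g @[n --> \oo] --> 0 + 2^-1 * t ^+ 2 * N f g.
      by apply: cvgD => //; exact: cvg_cst.
    rewrite add0r in c2; apply: ler_cvg_to c1 c2 _; apply: nearW => n.
    have := J_le (Gr_lin t (hG n) hw); rewrite /J (N_lin _ (sv1 n) (sv2 n) sf sg).
    have := (hv n).2; rewrite /J -/(v1 n) -/(v2 n) -/(l n).
    move: (P _ _ _ _) (N _ _) (N _ _) (l n) (dl n) s => a b c d' e S *.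
    have -> : t * (k - a) = t * k - t * a by ring.
    by lra.
  set y := k - P q1 q2 f g in key.
  have n0 := N_ge0 f g; set M := N f g in n0 key.
  suff : y == 0 by rewrite subr_eq0 => /eqP ->.
  have M1 : 0 < M + 1 by lra.
  (* Up to a common denominator this reads [y^2 (M + 1) <= y^2 M / 2], hence [y = 0]; the added 1
     covers [M = 0]. *)
  have := key (y / (M + 1)).
  have -> : y / (M + 1) * y = y ^+ 2 * (M + 1) / (M + 1) ^+ 2 by field; rewrite lt0r_neq0.
  have -> : 2^-1 * (y / (M + 1)) ^+ 2 * M = (2^-1 * y ^+ 2 * M) / (M + 1) ^+ 2 by field; rewrite lt0r_neq0.
  rewrite ler_pM2r ?invr_gt0 ?exprn_gt0// => h.
  rewrite -sqrf_eq0 eq_le sqr_ge0 andbT; have := sqr_ge0 y; move: (y ^+ 2) h => z; nra.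
exists q1, q2, v1, v2; split => //; last by move=> n; exists (l n).
have ln n : l n = P (v1 n) (v2 n) q1 q2.
  rewrite -(rep _ _ _ (hG n)) /P; congr (_ + _); congr I; apply/funext => x; exact: mulrC.
have lc : l n @[n --> \oo] --> N q1 q2.
  have -> : l = (fun n => P (v1 n) (v2 n) q1 q2) by apply/funext => n; exact: ln.
  exact: (Pc _ _ sq1 sq2).
have nc : A * N (v1 n) (v2 n) @[n --> \oo] --> A * N q1 q2.
  by apply: cvgM; [exact: cvg_cst|apply: cvgD].
(* Limit of [l^2 <= A N] along the sequence, since [l n] is the pairing of [v n] with the limit and
   tends to [N q1 q2]. *)
have : N q1 q2 ^+ 2 <= A * N q1 q2.
  apply: ler_cvg_to nc _; last by apply: nearW => n; exact: Gr_bound (hG n).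
  by rewrite expr2; under eq_fun do rewrite expr2; apply: cvgM.
have := N_ge0 q1 q2; rewrite -/(N q1 q2); move: (N q1 q2) => n n0 hn.
by have [->|n1'] := eqVneq n 0; [done|rewrite -(ler_pM2r (_ : 0 < n)) -?expr2// lt0r n1'].
Qed.
End Riesz.
End SquareIntegrable.

(** * The Cauchy-Schwarz inequality for pairs *)

Section CauchySchwarz.
Context {R : realType} d {T : measurableType d} (nu : {measure set T -> \bar R}).
Implicit Types f g : T -> R.

Lemma discriminant (a b c : R) : 0 <= c -> (forall t, 0 <= a + 2 * t * b + t ^+ 2 * c) -> b ^+ 2 <= a * c.
Proof.
move=> c0 h; have [c00|cn] := eqVneq c 0.
  (* For [c = 0] the expression is affine in [t], and at this [t] it takes the value [-1] unless
     [b = 0]. *)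
  have := h (- (a + 1) / 2 * b^-1); rewrite c00 !mulr0 addr0.
  have [->|b0] := eqVneq b 0; first by rewrite expr0n.
  have -> : 2 * (- (a + 1) / 2 / b) * b = - (a + 1) by field.
  by rewrite opprD addrA subrr sub0r oppr_ge0 ler10.
have cp : 0 < c by rewrite lt0r cn.
have := h (- b / c); have -> : a + 2 * (- b / c) * b + (- b / c) ^+ 2 * c = (a * c - b ^+ 2) / c by field.
by rewrite pmulr_lge0 ?invr_gt0// subr_ge0.
Qed.

Lemma cauchy_schwarz2 f1 f2 g1 g2 : sqi nu f1 -> sqi nu f2 -> sqi nu g1 -> sqi nu g2 ->
  I nu (fun x => f1 x * g1 x + f2 x * g2 x) ^+ 2 <=
  I nu (fun x => f1 x ^+ 2 + f2 x ^+ 2) * I nu (fun x => g1 x ^+ 2 + g2 x ^+ 2).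
Proof.
move=> s1 s2 s3 s4.
have iP := intgD (sqiM s1 s3) (sqiM s2 s4).
have iF := intgD s1.2 s2.2; have iG := intgD s3.2 s4.2.
apply: discriminant; first by apply: I_ge0 => x; rewrite addr_ge0// sqr_ge0.
move=> t; rewrite -(IZ _ iP) -(IZ _ iG) -(ID iF (intgZ _ iP)) -ID; [|exact: intgD iF (intgZ _ iP)|exact: intgZ].
apply: I_ge0 => x.
have -> : f1 x ^+ 2 + f2 x ^+ 2 + 2 * t * (f1 x * g1 x + f2 x * g2 x) + t ^+ 2 * (g1 x ^+ 2 + g2 x ^+ 2) =
  (f1 x + t * g1 x) ^+ 2 + (f2 x + t * g2 x) ^+ 2 by ring.
by rewrite addr_ge0// sqr_ge0.
Qed.
End CauchySchwarz.

(** * Weak solutions by duality *)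

Section Dbar.
Context {R : realType}.
Local Notation P2 := (R * R)%type.
Local Notation L := (@Leb R).
Implicit Types (p q w z : P2) (f g a b u h theta : P2 -> R).

Lemma ex_sq theta p : ex theta p = expR (theta p) ^+ 2.
Proof. by rewrite /ex mulrDl mul1r expRD. Qed.

Lemma exN theta p : ex (fun p => - theta p) p = expR (- theta p) ^+ 2.
Proof. by rewrite ex_sq. Qed.

Lemma expRV theta p : expR (theta p) * expR (- theta p) = 1.
Proof. by rewrite -expRD subrr expR0. Qed.

Lemma meas_exp theta : meas theta -> meas (fun p => expR (theta p)).
Proof. by move=> m; apply: measurableT_comp. Qed.

Lemma meas_opp theta : meas theta -> meas (fun p => - theta p).
Proof. by move=> m; apply: measurableT_comp. Qed.

Lemma meas_ex theta : meas theta -> meas (ex theta).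
Proof. by move=> m; apply: measurableT_comp => //; apply: measurable_funM => //; exact: measurable_cst. Qed.

Lemma meas_mod2 u v : meas u -> meas v -> meas (mod2 u v).
Proof. by move=> mu mv; apply: measurable_funD; exact: measurable_funX. Qed.

(* The pair (u, v) is square integrable for the weight e^(-2 theta). *)
Definition wsq theta u v := [/\ meas u, meas v & intg L (fun p => mod2 u v p * ex (fun p => - theta p) p)].

Lemma wsq_sqi theta u v : meas theta -> wsq theta u v ->
  sqi L (fun p => u p * expR (- theta p)) /\ sqi L (fun p => v p * expR (- theta p)).
Proof.
move=> mt [mu mv i1]; have me := meas_exp (meas_opp mt).
have e2 (f : P2 -> R) p : (f p * expR (- theta p)) ^+ 2 = f p ^+ 2 * ex (fun p => - theta p) p.
  by rewrite exprMn exN.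
have x0 p := ex_gt0 (fun p => - theta p) p.
split; (split; first exact: measurable_funM); apply: (intg_le _ _ i1).
- by apply: measurable_funX; exact: measurable_funM.
- by move=> p; rewrite ger0_norm ?sqr_ge0// e2 ler_pM2r// lerDl sqr_ge0.
- by apply: measurable_funX; exact: measurable_funM.
- by move=> p; rewrite ger0_norm ?sqr_ge0// e2 ler_pM2r// lerDr sqr_ge0.
Qed.

Lemma sqi_wsq theta u v : meas theta -> meas u -> meas v ->
  sqi L (fun p => u p * expR (- theta p)) -> sqi L (fun p => v p * expR (- theta p)) -> wsq theta u v.
Proof.
move=> mt mu mv [_ i1] [_ i2]; split => //; have := intgD i1 i2; congr (intg L _); apply/funext => p.
by rewrite exN /mod2 !exprMn mulrDl.
Qed.

(** The weight is bounded below on bounded sets, and [|s| <= s^2 + 1]. *)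
Lemma lint_of_sq theta u : lbd theta -> sqi L (fun p => u p * expR (- theta p)) -> meas u -> lint L u.
Proof.
move=> [mt ht] [_ i1] mu; split => // M; have [C hC] := ht M.
have mb := bbox_meas M.
have ib : intg L (\1_(bbox M) : P2 -> R).
  apply: (@intg_indic _ _ _ L (bbox M) 1) => //; first exact: Leb_lfin.
  - exact: measurable_indic.
  - by move=> q hq; rewrite indicE mem_set// normr1.
  - by move=> q hq; rewrite indicE memNset.
apply: (intg_le _ _ (intgD (intgZ (expR C ^+ 2) i1) ib)).
  by apply: measurable_funM => //; exact: measurable_indic.
move=> p; rewrite indicE; have [/set_mem hp|_] := boolP (p \in _); last first.
  by rewrite mulr0 normr0 addr0 mulr_ge0 ?sqr_ge0// exprn_ge0// expR_ge0.
rewrite mulr1 -[true%:R]/(1 : R); set s := u p.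
have h1 : 1 <= expR C * expR (- theta p).
  rewrite -expRD -[leLHS]expR0 ler_expR subr_ge0; exact: le_trans (ler_norm _) (hC p hp).
have e : expR C ^+ 2 * (s * expR (- theta p)) ^+ 2 = s ^+ 2 * (expR C * expR (- theta p)) ^+ 2 by ring.
rewrite e; move: (expR C * _) h1 => x x1.
have : s ^+ 2 * 1 <= s ^+ 2 * x ^+ 2 by rewrite ler_wpM2l ?sqr_ge0// exprn_ege1.
have : `|s| <= s ^+ 2 + 1 by rewrite -real_normK ?num_real//; have := sqr_ge0 (`|s| - 1); have := normr_ge0 s; nra.
by rewrite mulr1 => *; lra.
Qed.

Variables (phi : P2 -> R) (mu : {measure set P2 -> \bar R}) (rho : P2 -> R) (cd : R).
Hypothesis H : fock_data phi mu rho cd.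

Section Solve.
Variables (eta h1 h2 : P2 -> R).
Hypothesis ceta : Ck 2 eta.
Hypothesis leta : forall z, - (2^-1 * cH cd) * (rho z) ^- 2 <= dx (dx eta) z + dy (dy eta) z.
Hypothesis (mh1 : meas h1) (mh2 : meas h2).
Let theta p := phi p + eta p.
Hypothesis ih : intg L (fun p => mod2 h1 h2 p * rho p ^+ 2 * ex (fun p => - theta p) p).
Let B := I L (fun p => mod2 h1 h2 p * rho p ^+ 2 * ex (fun p => - theta p) p).

Let lth : lbd theta.
Proof. by apply: lbdD; [exact: fd_lbd H|exact: cont_lbd (Ck_cont ceta)]. Qed.

Let mth : meas theta. Proof. exact: lth.1. Qed.

Let E p := expR (theta p).

Let lE : lbd E.
Proof.
split; first exact: meas_exp.
move=> M; have [C hC] := lth.2 M; exists (expR C) => p /hC h.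
by rewrite ger0_norm ?expR_ge0// ler_expR; exact: le_trans (ler_norm _) h.
Qed.

(** The pair is the [d/dz] derivative of a compactly supported [a + i b], times [e^theta]; the value
    is minus the real pairing of [h1 + i h2] with [a + i b]. Working with the relation makes it
    unnecessary to recover [a + i b] from its derivative. *)
Let Gr f g (l : R) := exists a b, [/\ [/\ Ck 2 a, Ck 2 b, csupp a & csupp b],
  f = (fun p => 2^-1 * (dx a p + dy b p) * E p), g = (fun p => 2^-1 * (dx b p - dy a p) * E p) &
  l = - I L (fun p => h1 p * a p + h2 p * b p)].

Let c2_sqi c : continuous c -> csupp c -> sqi L (fun p => c p * E p).
Proof.
move=> cc sc; have lc : lbd (fun p => c p * E p) by apply: lbdM => //; exact: cont_lbd.
split; first exact: lc.1.
by apply: lbd_intg; [exact: Leb_lfin|exact: (lbdM lc lc)|apply: csuppM; exact: csuppMl].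
Qed.

Let Y a : continuous a -> csupp a -> sqi L (fun p => a p * (rho p)^-1 * E p).
Proof.
move=> ca sa; apply: (@c2_sqi (fun p => a p * (rho p)^-1)); last exact: csuppMl.
move=> p; apply: cvgM; first exact: ca.
by apply: cvgV; [rewrite lt0r_neq0// (fd_rho0 H)|exact: (fd_rho_cont H)].
Qed.

Let X : sqi L (fun p => h1 p * rho p * expR (- theta p)) /\ sqi L (fun p => h2 p * rho p * expR (- theta p)).
Proof.
apply: wsq_sqi => //; have mr := cont_meas (fd_rho_cont H).
split; [exact: measurable_funM|exact: measurable_funM|].
by move: ih; congr (intg L _); apply/funext => p; rewrite /mod2; congr (_ * _); ring.
Qed.

Let halfx a b : Ck 2 a -> Ck 2 b -> csupp a -> csupp b ->
  [/\ continuous (fun p => 2^-1 * (dx a p + dy b p)), csupp (fun p => 2^-1 * (dx a p + dy b p)),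
      continuous (fun p => 2^-1 * (dx b p - dy a p)) & csupp (fun p => 2^-1 * (dx b p - dy a p))].
Proof.
move=> ca cb sa sb.
have k1 := Ck_dx ca; have k2 := Ck_dy ca; have k3 := Ck_dx cb; have k4 := Ck_dy cb.
have s1 := csupp_dx sa; have s2 := csupp_dy sa; have s3 := csupp_dx sb; have s4 := csupp_dy sb.
split.
- by apply: (Ck_cont (_ : Ck 1 _)); apply: CkZ; exact: CkD.
- by apply: csuppM; exact: csuppD.
- by apply: (Ck_cont (_ : Ck 1 _)); apply: CkZ; exact: CkB.
- by apply: csuppM; apply: csuppD => //; exact: csuppN.
Qed.

(** Cauchy-Schwarz with weights [rho e^-theta] on [h] and [e^theta / rho] on [a + i b];
    [weighted_estimate] bounds the second factor. *)
Let lh a b : Ck 2 a -> Ck 2 b -> csupp a -> csupp b ->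
  intg L (fun p => h1 p * a p + h2 p * b p) /\
  I L (fun p => h1 p * a p + h2 p * b p) ^+ 2 <= B * (CH cd * I L (fun p => dz2 a b p * ex theta p)).
Proof.
move=> ca cb sa sb; have [X1 X2] := X.
have Y1 := Y (Ck_cont ca) sa; have Y2 := Y (Ck_cont cb) sb.
have e (f g : P2 -> R) : (fun p => f p * rho p * expR (- theta p) * (g p * (rho p)^-1 * E p)) = (fun p => f p * g p).
  apply/funext => p; have r0 := fd_rho0 H p; have := expRV theta p; rewrite /E.
  move: (expR _) (expR _) (rho p) r0 => x y r r0 xy.
  have -> : f p * r * x * (g p * r^-1 * y) = f p * g p * (y * x) by field; exact: lt0r_neq0.
  by rewrite xy mulr1.
have i1 := sqiM X1 Y1; have i2 := sqiM X2 Y2; rewrite !e in i1 i2.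
split; first exact: intgD.
have := cauchy_schwarz2 X1 X2 Y1 Y2.
have -> : (fun p => h1 p * rho p * expR (- theta p) * (a p * (rho p)^-1 * E p) + h2 p * rho p * expR (- theta p) * (b p * (rho p)^-1 * E p)) =
  (fun p => h1 p * a p + h2 p * b p).
  by apply/funext => p; have /(congr1 (fun f => f p)) := e h1 a; have /(congr1 (fun f => f p)) := e h2 b => /= -> ->.
move=> h; apply: le_trans h _.
have -> : (fun p => (h1 p * rho p * expR (- theta p)) ^+ 2 + (h2 p * rho p * expR (- theta p)) ^+ 2) =
   (fun p => mod2 h1 h2 p * rho p ^+ 2 * ex (fun p => - theta p) p).
  by apply/funext => p; rewrite exN /mod2; ring.
rewrite -/B; apply: ler_wpM2l.
  by apply: I_ge0 => p; rewrite mulr_ge0 ?(ltW (ex_gt0 _ _))// mulr_ge0 ?sqr_ge0// addr_ge0// sqr_ge0.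
have := weighted_estimate H ceta ca cb sa sb leta; apply: le_trans.
rewrite le_eqVlt; apply/orP; left; apply/eqP; congr I; apply/funext => p.
by rewrite ex_sq -/(E p) /mod2 -exprVn; ring.
Qed.

Let Nf a b : Ck 2 a -> Ck 2 b -> csupp a -> csupp b ->
  I L (fun p => (2^-1 * (dx a p + dy b p) * E p) ^+ 2) + I L (fun p => (2^-1 * (dx b p - dy a p) * E p) ^+ 2) =
  I L (fun p => dz2 a b p * ex theta p).
Proof.
move=> ca cb sa sb; have [k1 s1 k2 s2] := halfx ca cb sa sb.
rewrite -ID; [|exact: (c2_sqi k1 s1).2|exact: (c2_sqi k2 s2).2].
congr I; apply/funext => p; rewrite ex_sq -/(E p) /dz2.
by move: (dx a p) (dy b p) (dx b p) (dy a p) (E p) => *; field.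
Qed.

Lemma dbar_solve : exists u1 u2, [/\ wsq theta u1 u2,
  I L (fun p => mod2 u1 u2 p * ex (fun p => - theta p) p) <= CH cd * B &
  forall g, Ck 2 g -> csupp g ->
    2^-1 * I L (fun p => u1 p * dx g p - u2 p * dy g p) = - I L (fun p => h1 p * g p) /\
    2^-1 * I L (fun p => u1 p * dy g p + u2 p * dx g p) = - I L (fun p => h2 p * g p)].
Proof.
have CH0 : 0 <= CH cd.
  apply: divr_ge0; last exact: ltW (cH_gt0 H).
  by apply: mulr_ge0 => //; exact: expR_ge0.
have B0 : 0 <= B.
  by apply: I_ge0 => p; rewrite mulr_ge0 ?(ltW (ex_gt0 _ _))// mulr_ge0 ?sqr_ge0// addr_ge0// sqr_ge0.
have [] := @riesz_graph _ _ _ L Gr (CH cd * B).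
- move=> f g l [a [b [[ca cb sa sb] -> -> _]]]; have [k1 s1 k2 s2] := halfx ca cb sa sb.
  by split; exact: c2_sqi.
- exists (fun=> 0), (fun=> 0); split.
  + by split; [exact: Ck_cst|exact: Ck_cst|exists 0|exists 0].
  + by apply/funext => p; rewrite (dx_cst 0) (dy_cst 0) addr0 mulr0 mul0r.
  + by apply/funext => p; rewrite (dx_cst 0) (dy_cst 0) subr0 mulr0 mul0r.
  + have -> : (fun p => h1 p * 0 + h2 p * 0) = fun=> 0 by apply/funext => p; rewrite !mulr0 addr0.
    by rewrite I0 oppr0.
- move=> f g l f' g' l' c [a [b [[ca cb sa sb] -> -> ->]]] [a' [b' [[ca' cb' sa' sb'] -> -> ->]]].
  have cza := CkZ c ca'; have czb := CkZ c cb'.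
  exists (fun p => a p + c * a' p), (fun p => b p + c * b' p); split.
  + by split; [exact: CkD|exact: CkD|apply: csuppD => //; exact: csuppM|apply: csuppD => //; exact: csuppM].
  + rewrite (dxD ca cza) (dyD cb czb) (dxZ c ca') (dyZ c cb'); apply/funext => p.
    by move: (dx a p) (dy b p) (dx a' p) (dy b' p) (E p) => *; ring.
  + rewrite (dxD cb czb) (dyD ca cza) (dxZ c cb') (dyZ c ca'); apply/funext => p.
    by move: (dx b p) (dy a p) (dx b' p) (dy a' p) (E p) => *; ring.
  + have [i1 _] := lh ca cb sa sb; have [i2 _] := lh ca' cb' sa' sb'.
    rewrite mulrN -(IZ c i2) -opprD -(ID i1 (intgZ c i2)); congr (- I L _); apply/funext => p; ring.
- exact: mulr_ge0.
- move=> f g l [a [b [[ca cb sa sb] -> -> ->]]]; rewrite (Nf ca cb sa sb) sqrrN.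
  by have [_] := lh ca cb sa sb; rewrite mulrA (mulrC B).
move=> q1 [q2 [v1 [v2 [hq hN _ [sq1 _ _] [sq2 _ _]]]]].
have mE : meas E by exact: lE.1.
have mu1 : meas (fun p => q1 p * E p) by apply: measurable_funM => //; exact: sq1.1.
have mu2 : meas (fun p => q2 p * E p) by apply: measurable_funM => //; exact: sq2.1.
have eu (q : P2 -> R) : (fun p => q p * E p * expR (- theta p)) = q.
  by apply/funext => p; rewrite -mulrA expRV mulr1.
exists (fun p => q1 p * E p), (fun p => q2 p * E p); split.
- by apply: sqi_wsq => //; rewrite eu.
- apply: le_trans hN; rewrite -(ID sq1.2 sq2.2) le_eqVlt; apply/orP; left; apply/eqP; congr I; apply/funext => p.
  have /(congr1 (fun f => f p)) /= e1 := eu q1; have /(congr1 (fun f => f p)) /= e2 := eu q2.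
  by rewrite exN /mod2 mulrDl -!exprMn e1 e2.
have s0 : csupp (fun _ : P2 => 0 : R) by exists 0.
have c0 : Ck 2 (fun _ : P2 => 0 : R) by exact: Ck_cst.
move=> g cg sg; split.
- have Gg : Gr (fun p => 2^-1 * (dx g p + dy (fun=> 0) p) * E p) (fun p => 2^-1 * (dx (fun=> 0) p - dy g p) * E p)
     (- I L (fun p => h1 p * g p + h2 p * 0)) by exists g, (fun=> 0).
  have := hq _ _ _ Gg; have -> : (fun p => h1 p * g p + h2 p * 0) = (fun p => h1 p * g p).
    by apply/funext => p; rewrite mulr0 addr0.
  move=> <-; have [k1 s1 k2 s2] := halfx cg c0 sg s0.
  have i1 := sqiM sq1 (c2_sqi k1 s1); have i2 := sqiM sq2 (c2_sqi k2 s2).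
  have e1 : (fun p => q1 p * (2^-1 * (dx g p + dy (fun=> 0) p) * E p) + q2 p * (2^-1 * (dx (fun=> 0) p - dy g p) * E p)) =
     (fun p => 2^-1 * (q1 p * E p * dx g p - q2 p * E p * dy g p)).
    by apply/funext => p; rewrite (dx_cst 0) (dy_cst 0); ring.
  rewrite -(ID i1 i2) e1 IZ//.
  have ii := intgD i1 i2; rewrite e1 in ii; have := intgZ 2 ii; congr (intg L _); apply/funext => p.
  by rewrite mulrA divff// mul1r.
have Gg : Gr (fun p => 2^-1 * (dx (fun=> 0) p + dy g p) * E p) (fun p => 2^-1 * (dx g p - dy (fun=> 0) p) * E p)
     (- I L (fun p => h1 p * 0 + h2 p * g p)) by exists (fun=> 0), g.
have := hq _ _ _ Gg; have -> : (fun p => h1 p * 0 + h2 p * g p) = (fun p => h2 p * g p).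
  by apply/funext => p; rewrite mulr0 add0r.
move=> <-; have [k1 s1 k2 s2] := halfx c0 cg s0 sg.
have i1 := sqiM sq1 (c2_sqi k1 s1); have i2 := sqiM sq2 (c2_sqi k2 s2).
have e1 : (fun p => q1 p * (2^-1 * (dx (fun=> 0) p + dy g p) * E p) + q2 p * (2^-1 * (dx g p - dy (fun=> 0) p) * E p)) =
   (fun p => 2^-1 * (q1 p * E p * dy g p + q2 p * E p * dx g p)).
  by apply/funext => p; rewrite (dx_cst 0) (dy_cst 0); ring.
rewrite -(ID i1 i2) e1 IZ//.
have ii := intgD i1 i2; rewrite e1 in ii; have := intgZ 2 ii; congr (intg L _); apply/funext => p.
  by rewrite mulrA divff// mul1r.
Qed.
End Solve.
End Dbar.

(** * Holomorphic corrections *)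

Section Correction.
Context {R : realType}.
Local Notation P2 := (R * R)%type.
Local Notation L := (@Leb R).
Implicit Types (p q w z : P2) (f g a b u h theta P Q : P2 -> R).

Lemma Ck_lint n f : Ck n f -> lint L f.
Proof. by move=> /Ck_cont c; apply: lbd_lint; [exact: Leb_lfin|exact: cont_lbd]. Qed.

Lemma wsq_ae theta u v u' v' : meas theta -> {ae L, forall p, u p = u' p} -> {ae L, forall p, v p = v' p} ->
  meas u' -> meas v' -> wsq theta u v ->
  wsq theta u' v' /\ I L (fun p => mod2 u' v' p * ex (fun p => - theta p) p) = I L (fun p => mod2 u v p * ex (fun p => - theta p) p).
Proof.
move=> mt eu ev mu' mv' [mu mv i1].
have me := meas_ex (meas_opp mt).
have E : {ae L, forall p, mod2 u v p * ex (fun p => - theta p) p = mod2 u' v' p * ex (fun p => - theta p) p}.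
  by move: eu ev; apply: filterS2 => p; rewrite /mod2 => -> ->.
have m1 : meas (fun p => mod2 u v p * ex (fun p => - theta p) p) by apply: measurable_funM => //; exact: meas_mod2.
have m2 : meas (fun p => mod2 u' v' p * ex (fun p => - theta p) p) by apply: measurable_funM => //; exact: meas_mod2.
by split; [split => //; exact: intg_ae_eq i1|apply/esym; exact: I_ae_eq].
Qed.

Lemma weyl P Q : lint L P -> lint L Q -> whol P Q ->
  [/\ CR (Av 1 P) (Av 1 Q), {ae L, forall p, P p = Av 1 P p} & {ae L, forall p, Q p = Av 1 Q p}].
Proof.
move=> lP lQ h; have [hP hQ] := whol_harm lP lQ h.
by split; [exact: whol_Av|exact: wharm_ae|exact: wharm_ae].
Qed.

Lemma CR_meas P Q : CR P Q -> meas P /\ meas Q.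
Proof. by move=> [cP cQ _]; split; apply: cont_meas; exact: (Ck_cont (_ : Ck 1 _)). Qed.

Lemma ae_sub P u v : {ae L, forall p, P p - u p = v p} -> {ae L, forall p, u p = P p - v p}.
Proof. by apply: filterS => p <-; rewrite subKr. Qed.

Variables (phi : P2 -> R) (mu : {measure set P2 -> \bar R}) (rho : P2 -> R) (cd : R).
Hypothesis H : fock_data phi mu rho cd.

(** Here [h1 + i h2] is the dbar-derivative of [P + i Q]. Subtracting the weak solution leaves a
    weakly holomorphic pair, which [weyl] replaces by a holomorphic one; the solution itself thereby
    gets a C^1 representative. *)
Lemma dbar_correct (eta h1 h2 P Q : P2 -> R) : Ck 2 eta ->
  (forall z, - (2^-1 * cH cd) * (rho z) ^- 2 <= dx (dx eta) z + dy (dy eta) z) ->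
  Ck 1 P -> Ck 1 Q -> continuous h1 -> continuous h2 ->
  (forall p, dx P p - dy Q p = 2 * h1 p /\ dy P p + dx Q p = 2 * h2 p) ->
  let theta := fun p => phi p + eta p in
  intg L (fun p => mod2 h1 h2 p * rho p ^+ 2 * ex (fun p => - theta p) p) ->
  exists v1 v2, [/\ CR v1 v2, wsq theta (fun p => P p - v1 p) (fun p => Q p - v2 p) &
    I L (fun p => mod2 (fun p => P p - v1 p) (fun p => Q p - v2 p) p * ex (fun p => - theta p) p) <=
    CH cd * I L (fun p => mod2 h1 h2 p * rho p ^+ 2 * ex (fun p => - theta p) p)].
Proof.
move=> ceta leta cP cQ ch1 ch2 hh theta ih.
have [u1 [u2 [wu hu hs]]] := dbar_solve H ceta leta (cont_meas ch1) (cont_meas ch2) ih.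
have lth : lbd theta by apply: lbdD; [exact: fd_lbd H|exact: cont_lbd (Ck_cont ceta)].
have [mu1 mu2 _] := wu; have [s1 s2] := wsq_sqi lth.1 wu.
have lu1 := lint_of_sq lth s1 mu1; have lu2 := lint_of_sq lth s2 mu2.
have lP := Ck_lint cP; have lQ := Ck_lint cQ.
have lB (f u : P2 -> R) : lint L f -> lint L u -> lint L (fun p => f p - u p).
  by move=> lf lu; apply: lintD => //; exact: lintN.
have W : whol (fun p => P p - u1 p) (fun p => Q p - u2 p).
  move=> g cg sg; have [e1 e2] := hs g cg sg; have cg1 := CkS cg.
  have sx := csupp_dx sg; have sy := csupp_dy sg.
  have i1 := test_intg lP (Ck_dx cg) sx; have i2 := test_intg lP (Ck_dy cg) sy.
  have i3 := test_intg lQ (Ck_dx cg) sx; have i4 := test_intg lQ (Ck_dy cg) sy.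
  have j1 := test_intg lu1 (Ck_dx cg) sx; have j2 := test_intg lu1 (Ck_dy cg) sy.
  have j3 := test_intg lu2 (Ck_dx cg) sx; have j4 := test_intg lu2 (Ck_dy cg) sy.
  have k1 := test_intg (Ck_lint (Ck_dx cP)) cg sg; have k2 := test_intg (Ck_lint (Ck_dy cP)) cg sg.
  have k3 := test_intg (Ck_lint (Ck_dx cQ)) cg sg; have k4 := test_intg (Ck_lint (Ck_dy cQ)) cg sg.
  have E1 : I L (fun p => P p * dx g p - Q p * dy g p) = - I L (fun p => 2 * (h1 p * g p)).
    rewrite (IB i1 i4) (ibp_x cP cg1 sg) (ibp_y cQ cg1 sg) opprK.
    have := IB k1 k4; have -> : (fun p => dx P p * g p - dy Q p * g p) = (fun p => 2 * (h1 p * g p)).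
      by apply/funext => p; rewrite -mulrBl (hh p).1 mulrA.
    by move=> ->; rewrite opprB addrC.
  have E2 : I L (fun p => P p * dy g p + Q p * dx g p) = - I L (fun p => 2 * (h2 p * g p)).
    rewrite (ID i2 i3) (ibp_y cP cg1 sg) (ibp_x cQ cg1 sg) -opprD -(ID k2 k3); congr (- I L _).
    by apply/funext => p; rewrite -mulrDl (hh p).2 mulrA.
  have l1 : intg L (fun p => h1 p * g p).
    apply: (@test_intg _ 2) => //; apply: lbd_lint; [exact: Leb_lfin|exact: cont_lbd].
  have l2 : intg L (fun p => h2 p * g p).
    apply: (@test_intg _ 2) => //; apply: lbd_lint; [exact: Leb_lfin|exact: cont_lbd].
  rewrite (IZ 2 l1) in E1; rewrite (IZ 2 l2) in E2.
  split.
    have -> : (fun p => (P p - u1 p) * dx g p - (Q p - u2 p) * dy g p) =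
      (fun p => (P p * dx g p - Q p * dy g p) - (u1 p * dx g p - u2 p * dy g p)).
      by apply/funext => p; ring.
    rewrite (IB (intgB i1 i4) (intgB j1 j4)) E1; move: e1; move: (I _ _) (I _ _) => x y e; lra.
  have -> : (fun p => (P p - u1 p) * dy g p + (Q p - u2 p) * dx g p) =
      (fun p => (P p * dy g p + Q p * dx g p) - (u1 p * dy g p + u2 p * dx g p)).
    by apply/funext => p; ring.
  rewrite (IB (intgD i2 i3) (intgD j2 j3)) E2; move: e2; move: (I _ _) (I _ _) => x y e; lra.
have [cr a1 a2] := weyl (lB _ _ lP lu1) (lB _ _ lQ lu2) W.
exists (Av 1 (fun p => P p - u1 p)), (Av 1 (fun p => Q p - u2 p)).
have [mv1 mv2] := CR_meas cr.
have mP := cont_meas (Ck_cont cP); have mQ := cont_meas (Ck_cont cQ).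
have [w' e'] := wsq_ae lth.1 (ae_sub a1) (ae_sub a2) (measurable_funB mP mv1) (measurable_funB mQ mv2) wu.
by split => //; rewrite e'.
Qed.

Section Upper.
Variables (g1 g2 f1 f2 : P2 -> R) (M : R).
Hypotheses (cg : CR g1 g2) (cf : CR f1 f2) (wf : wsq phi f1 f2).
Let P p := g1 p * f1 p + g2 p * f2 p.
Let Q p := g1 p * f2 p - g2 p * f1 p.
Hypothesis wPQ : wsq phi P Q.
Hypothesis bnd : forall p, mod2 (dx g1) (dx g2) p * rho p ^+ 2 <= M.

(** The case [eta = 0] of [dbar_correct]: [|h|^2 rho^2] factors as [|g'|^2 rho^2 |f|^2], which is at
    most [M |f|^2] pointwise. *)
Lemma hankel_upper : exists v1 v2, [/\ CR v1 v2, wsq phi v1 v2, wsq phi (fun p => P p - v1 p) (fun p => Q p - v2 p) &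
  I L (fun p => mod2 (fun p => P p - v1 p) (fun p => Q p - v2 p) p * ex (fun p => - phi p) p) <=
  CH cd * M * I L (fun p => mod2 f1 f2 p * ex (fun p => - phi p) p)].
Proof.
have [kg1 kg2 hg] := cg; have [kf1 kf2 hf] := cf.
have [cg1 cg2 _] := CR_deriv cg.
pose h1 p := dx g1 p * f1 p + dx g2 p * f2 p.
pose h2 p := dx g1 p * f2 p - dx g2 p * f1 p.
have cP : Ck 1 P by apply: CkD; exact: CkM.
have cQ : Ck 1 Q by apply: CkB; exact: CkM.
have ch1 : Ck 1 h1 by apply: CkD; exact: CkM.
have ch2 : Ck 1 h2 by apply: CkB; exact: CkM.
have dd p : dx P p - dy Q p = 2 * h1 p /\ dy P p + dx Q p = 2 * h2 p.
  have NN (u : P2 -> R) : (fun z => - u z) = (fun z => -1 * u z) by apply/funext => z; rewrite mulN1r.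
  have eQ : Q = (fun p => g1 p * f2 p + -1 * (g2 p * f1 p)) by apply/funext => z; rewrite mulN1r.
  have k1 := CkM kg1 kf1; have k2 := CkM kg2 kf2; have k3 := CkM kg1 kf2; have k4 := CkM kg2 kf1.
  rewrite eQ /P (dxD k1 k2) (dyD k1 k2) (dxD k3 (CkZ _ k4)) (dyD k3 (CkZ _ k4)) (dxZ _ k4) (dyZ _ k4).
  rewrite (dxM kg1 kf1) (dxM kg2 kf2) (dxM kg1 kf2) (dxM kg2 kf1) (dyM kg1 kf1) (dyM kg2 kf2) (dyM kg1 kf2) (dyM kg2 kf1).
  rewrite (hg p).2 -(hg p).1 (hf p).2 -(hf p).1 /h1 /h2.
  by move: (g1 p) (g2 p) (f1 p) (f2 p) (dx g1 p) (dx g2 p) (dx f1 p) (dx f2 p) => *; split; ring.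
have [mf1 mf2 iF] := wf.
have e0 p : mod2 h1 h2 p * rho p ^+ 2 * ex (fun p => - phi p) p =
   mod2 (dx g1) (dx g2) p * rho p ^+ 2 * (mod2 f1 f2 p * ex (fun p => - phi p) p).
  rewrite /mod2 /h1 /h2; move: (dx g1 p) (dx g2 p) (f1 p) (f2 p) (rho p) (ex _ p) => *; ring.
have x0 p := ltW (ex_gt0 (fun p => - phi p) p).
have m0 p : 0 <= mod2 f1 f2 p by rewrite addr_ge0// sqr_ge0.
have le p : mod2 h1 h2 p * rho p ^+ 2 * ex (fun p => - phi p) p <= M * (mod2 f1 f2 p * ex (fun p => - phi p) p).
  by rewrite e0 ler_wpM2r// mulr_ge0.
have ge p : 0 <= mod2 h1 h2 p * rho p ^+ 2 * ex (fun p => - phi p) p.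
  by rewrite mulr_ge0// mulr_ge0 ?sqr_ge0// addr_ge0// sqr_ge0.
have ih : intg L (fun p => mod2 h1 h2 p * rho p ^+ 2 * ex (fun p => - phi p) p).
  apply: (intg_le _ _ (intgZ M iF)); last by move=> p; rewrite ger0_norm.
  apply: measurable_funM; last by apply: meas_ex; apply: meas_opp; exact: fd_meas H.
  apply: measurable_funM; first by apply: meas_mod2; apply: cont_meas; exact: (Ck_cont (_ : Ck 1 _)).
  by apply: measurable_funX; exact: cont_meas (fd_rho_cont H).
have ph0 : (fun p => phi p + (fun _ : P2 => 0) p) = phi by apply/funext => p; rewrite addr0.
have ph1 : (fun p => - (phi p + 0)) = (fun p => - phi p) by apply/funext => p; rewrite addr0.
have c0 : Ck 2 (fun _ : P2 => 0 : R) by exact: Ck_cst.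
have l0 (z : P2) : - (2^-1 * cH cd) * (rho z) ^- 2 <= dx (dx (fun _ : P2 => 0 : R)) z + dy (dy (fun _ : P2 => 0 : R)) z.
  rewrite (dx_cst 0) (dy_cst 0) (dx_cst 0) (dy_cst 0) addr0 mulNr oppr_le0 mulr_ge0//.
    by rewrite mulr_ge0 ?invr_ge0// ltW// (cH_gt0 H).
  by rewrite invr_ge0 exprn_ge0// ltW// (fd_rho0 H).
have := dbar_correct c0 l0 cP cQ (Ck_cont ch1) (Ck_cont ch2) dd; rewrite /= ph0 ph1 => /(_ ih).
move=> [v1 [v2 [cv wv hv]]]; exists v1, v2.
have mphi := fd_meas H; have [mv1 mv2] := CR_meas cv.
split => //.
  have [s1 s2] := wsq_sqi mphi wPQ; have [t1 t2] := wsq_sqi mphi wv.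
  apply: sqi_wsq => //.
    by have := sqiB s1 t1; congr (sqi L _); apply/funext => p; rewrite -mulrBl subKr.
  by have := sqiB s2 t2; congr (sqi L _); apply/funext => p; rewrite -mulrBl subKr.
apply: le_trans hv _; rewrite -mulrA; apply: ler_wpM2l.
  apply: divr_ge0; last exact: ltW (cH_gt0 H).
  by apply: mulr_ge0 => //; exact: expR_ge0.
by rewrite -(IZ _ iF); apply: I_le => //; exact: intgZ.
Qed.
End Upper.
End Correction.

(** * Division by a linear factor and the local estimate *)

Section Division.
Context {R : realType}.
Local Notation P2 := (R * R)%type.
Local Notation lam := (@lebesgue_measure R).
Implicit Types (p q w z l : P2) (f g : P2 -> R) (t : R).

(** Both coordinates move at once, so the derivative along a line is taken from the first-order
    expansion [C1_rem]. *)
Lemma chain_line f z h t : Ck 1 f ->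
  is_derive t (1 : R) (fun s => f (z + (s * h.1, s * h.2)))
    (dx f (z + (t * h.1, t * h.2)) * h.1 + dy f (z + (t * h.1, t * h.2)) * h.2).
Proof.
move=> cf; apply/is_derive_epsP => e e0.
set p := z + (t * h.1, t * h.2); set N := `|h.1| + `|h.2| + 1.
have N0 : 0 < N by rewrite ltr_wpDl// addr_ge0.
have e1 : 0 < e / 2 / N by rewrite divr_gt0// divr_gt0.
have [d d0 hd] := C1_rem p cf e1.
have d1 : 0 < d / N by rewrite divr_gt0.
apply/nbhs_ballP; exists (d / N) => //= k; rewrite -ball_normE /ball_/= sub0r normrN => kd kn.
have hk : `|(k * h.1, k * h.2)| < d.
  rewrite norm_lt2 /= !normrM -!(mulrC `|h.1|) -!(mulrC `|h.2|).
  have k0 := normr_ge0 k; have a0 := normr_ge0 h.1; have b0 := normr_ge0 h.2.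
  rewrite ltr_pdivlMr// in kd; rewrite /N in kd.
  by move: kd k0 a0 b0; move: `|k| `|h.1| `|h.2| => x y v *; apply/andP; split; nra.
have := hd _ hk => /=.
have -> : p + (k * h.1, k * h.2) = z + ((k + t) * h.1, (k + t) * h.2).
  by rewrite /p -addrA; congr (z + _); rewrite /GRing.add /=; congr pair; rewrite mulrDl addrC.
move=> r; have k0 : 0 < `|k| by rewrite normr_gt0.
rewrite -(ltr_pM2l k0) -normrM mulrBr mulrA divff// mul1r.
rewrite distrC.
have -> : f (z + ((k + t) * h.1, (k + t) * h.2)) - f p - k * (dx f p * h.1 + dy f p * h.2) =
  f (z + ((k + t) * h.1, (k + t) * h.2)) - f p - (dx f p * (k * h.1) + dy f p * (k * h.2)) by ring.
apply: le_lt_trans r _; rewrite !normrM.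
have -> : e / 2 / N * (`|k| * `|h.1| + `|k| * `|h.2|) = `|k| * (e / 2 * ((`|h.1| + `|h.2|) / N)).
  by rewrite -mulrDr; move: (`|h.1| + `|h.2|) (N^-1) (e / 2) `|k| => *; ring.
rewrite ltr_pM2l//; apply: (@le_lt_trans _ _ (e / 2 * 1)); last by lra.
rewrite ler_pM2l ?divr_gt0// ler_pdivrMr// mul1r lerDl; exact: ler01.
Qed.

Variable l : P2.

Definition homo t z : P2 := (l.1 + t * (z.1 - l.1), l.2 + t * (z.2 - l.2)).

Lemma homo_line t z : homo t z = l + (t * (z - l).1, t * (z - l).2).
Proof. by []. Qed.

Lemma homo_bound t z (M : R) : 0 <= t <= 1 -> `|z| <= M -> `|homo t z| <= 2 * `|l| + M.
Proof.
move=> /andP[t0 t1] zM; rewrite homo_line; apply: le_trans (ler_normD _ _) _.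
have h : `|(t * (z - l).1, t * (z - l).2)| <= `|z - l|.
  have : `|z - l| <= `|z - l| by []. 
  rewrite [in X in X -> _]norm_le2/= => /andP[a b].
  by rewrite norm_le2 /= !normrM (ger0_norm t0); apply/andP; split;
    [exact: le_trans (ler_piMl (normr_ge0 _) t1) a|exact: le_trans (ler_piMl (normr_ge0 _) t1) b].
have := ler_normB z l; move: h; move: (`|_|) (`|_|) => a b *; lra.
Qed.

Lemma homo_dx f z t : Ck 1 f -> dx (fun z => f (homo t z)) z = t * dx f (homo t z).
Proof.
move=> cf; suff -> : dx (fun z => f (homo t z)) = fun z => t * dx f (homo t z) by [].
apply: dxE => p; have h1 : is_derive (p.1 : R) (1 : R) (fun s => l.1 + t * (s - l.1)) t.
  by apply: isd_eq; rewrite /GRing.scale/=; ring.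
by apply: (isd_eq (is_derive_comp1 h1 (derivx (homo t p) cf))); rewrite mulrC.
Qed.

Lemma homo_dy f z t : Ck 1 f -> dy (fun z => f (homo t z)) z = t * dy f (homo t z).
Proof.
move=> cf; suff -> : dy (fun z => f (homo t z)) = fun z => t * dy f (homo t z) by [].
apply: dyE => p; have h1 : is_derive (p.2 : R) (1 : R) (fun s => l.2 + t * (s - l.2)) t.
  by apply: isd_eq; rewrite /GRing.scale/=; ring.
by apply: (isd_eq (is_derive_comp1 h1 (derivy (homo t p) cf))); rewrite mulrC.
Qed.

Lemma homo_contz f t : continuous f -> continuous (fun z => f (homo t z)).
Proof.
move=> cf z; apply: (@continuous_comp _ _ _ (homo t) f); last exact: cf.
have h1 : (l.1 + t * (w.1 - l.1)) @[w --> z] --> l.1 + t * (z.1 - l.1).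
  by apply: cvgD; [exact: cvg_cst|apply: cvgM; [exact: cvg_cst|apply: cvgB; [exact: cvg_fst|exact: cvg_cst]]].
have h2 : (l.2 + t * (w.2 - l.2)) @[w --> z] --> l.2 + t * (z.2 - l.2).
  by apply: cvgD; [exact: cvg_cst|apply: cvgM; [exact: cvg_cst|apply: cvgB; [exact: cvg_snd|exact: cvg_cst]]].
exact: cvg_pair h1 h2.
Qed.

Lemma homo_contt f z : continuous f -> continuous (fun t : R => f (homo t z)).
Proof.
move=> cf t; apply: (@continuous_comp _ _ _ (fun t => homo t z) f); last exact: cf.
have h (a b : R) : (a + s * b) @[s --> t] --> a + t * b.
  by apply: cvgD; [exact: cvg_cst|apply: cvgM; [exact: cvg_id|exact: cvg_cst]].
exact: cvg_pair (h l.1 (z.1 - l.1)) (h l.2 (z.2 - l.2)).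
Qed.

Lemma homo_Ck1 f t : Ck 1 f -> Ck 1 (fun z => f (homo t z)).
Proof.
move=> cf; have h1 p : is_derive (p.1 : R) (1 : R) (fun s => l.1 + t * (s - l.1)) t.
  by apply: isd_eq; rewrite /GRing.scale/=; ring.
have h2 p : is_derive (p.2 : R) (1 : R) (fun s => l.2 + t * (s - l.2)) t.
  by apply: isd_eq; rewrite /GRing.scale/=; ring.
apply: (@CkP _ _ _ (fun z => dx f (homo t z) * t) (fun z => dy f (homo t z) * t)).
- by apply: homo_contz; exact: (Ck_cont cf).
- by move=> p; exact: (is_derive_comp1 (h1 p) (derivx (homo t p) cf)).
- by move=> p; exact: (is_derive_comp1 (h2 p) (derivy (homo t p) cf)).
- by split => // p; apply: cvgM; [apply: homo_contz; exact: (Ck_cont (Ck_dx cf))|exact: cvg_cst].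
- by split => // p; apply: cvgM; [apply: homo_contz; exact: (Ck_cont (Ck_dy cf))|exact: cvg_cst].
Qed.

Local Notation J := (`[0%R, 1%R]%classic : set R).
Local Notation T1 := (measurableTypeR R).

(** The weight [c] is 1 in the integral itself and [t] in its derivatives, by the chain rule; the
    indicator extends the integrand to the whole line. *)
Definition seg (c : R -> R) f (z : P2) (t : T1) : R := \1_J t * c t * f (homo t z).

Lemma lam_J : lam J = 1%:E.
Proof. by rewrite lebesgue_measure_itv /= lte_fin ltr01 oppr0 adde0. Qed.

Lemma seg_intg (C : R) : intg (lam : {measure set T1 -> \bar R}) (fun t => C * \1_J t).
Proof.
have mJ : measurable (J : set T1) by exact: measurable_itv.
apply: (@intg_indic _ _ T1 lam J `|C|) => //.
- by rewrite [X in (X < _)%E](_ : _ = 1%:E) ?ltry//; exact: lam_J.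
- by apply: measurable_funM; [exact: measurable_cst|exact: measurable_indic].
- by move=> t ht; rewrite indicE mem_set// mulr1.
- by move=> t ht; rewrite indicE memNset// mulr0.
Qed.

Lemma seg_Kk0 (c : R -> R) f : continuous c -> continuous f -> (forall t, 0 <= t <= 1 -> `|c t| <= 1) ->
  Kk lam 0 (seg c f).
Proof.
move=> cc cf hc; have mJ : measurable (J : set T1) by exact: measurable_itv.
split => //.
- move=> z; apply: measurable_funM; last by apply: continuous_measurable_fun; exact: homo_contt.
  by apply: measurable_funM; [exact: measurable_indic|exact: continuous_measurable_fun].
- by move=> t z; apply: cvgM; [exact: cvg_cst|exact: homo_contz].
- move=> M; have [C hC] := cont_bounded (2 * `|l| + M) cf.
  exists (fun t => C * \1_J t); first exact: seg_intg.
  move=> z t zM; rewrite /seg indicE; have [/set_mem|_] := boolP (_ \in _); last by rewrite !mul0r normr0 mulr0.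
  rewrite /= in_itv /= => ht; rewrite mul1r mulr1 normrM.
  have h1 := hC _ (homo_bound ht zM); have h2 := hc t ht.
  by apply: le_trans (_ : _ <= 1 * `|f (homo t z)|) _; rewrite ?ler_wpM2r ?mul1r.
Qed.

Lemma seg_Kk1 f : Ck 1 f -> Kk lam 1 (seg (fun=> 1) f).
Proof.
move=> cf.
have k0 : Kk lam 0 (seg (fun=> 1) f).
  by apply: seg_Kk0; [move=> ?; exact: cvg_cst|exact: (Ck_cont cf)|move=> *; rewrite normr1].
have cid : continuous (id : R -> R) by move=> ?; exact: cvg_id.
have hid (t : R) : 0 <= t <= 1 -> `|t| <= 1 by move=> /andP[t0 t1]; rewrite ger0_norm.
have cz t : Ck 1 (fun z => seg (fun=> 1) f z t) by apply: CkM; [exact: Ck_cst|exact: homo_Ck1].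
have ez t : (fun z => seg (fun=> 1) f z t) = (fun z => (\1_J t * 1) * f (homo t z)) by [].
have [a1 a2 a3 _] := k0; split => //; split => //.
  have := seg_Kk0 cid (Ck_cont (Ck_dx cf)) hid; congr (Kk lam 0 _); apply/funext => z; apply/funext => t.
  by rewrite ez (dxZ _ (homo_Ck1 t cf)) homo_dx// /seg mulr1 mulrA.
have := seg_Kk0 cid (Ck_cont (Ck_dy cf)) hid; congr (Kk lam 0 _); apply/funext => z; apply/funext => t.
by rewrite ez (dyZ _ (homo_Ck1 t cf)) homo_dy// /seg mulr1 mulrA.
Qed.

(** The mean of [f] over the segment from [l] to [z]. For [f] a derivative this is the quotient of
    Hadamard's lemma, defined and regular at [z = l] as well. *)
Definition sint f z : R := I (lam : {measure set T1 -> \bar R}) (seg (fun=> 1) f z).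

Lemma sint_Ck f : Ck 1 f -> Ck 1 (sint f).
Proof. by move=> /seg_Kk1 h; exact: Kk_Ck h. Qed.

Lemma sint_dx f z : Ck 1 f -> dx (sint f) z = I (lam : {measure set T1 -> \bar R}) (seg id (dx f) z).
Proof.
move=> cf; have := dx_I (seg_Kk1 cf) => /(congr1 (fun f => f z)) => E; apply: etrans E _; congr I; apply/funext => t.
have -> : (fun z => seg (fun=> 1) f z t) = (fun z => (\1_J t * 1) * f (homo t z)) by [].
by rewrite (dxZ _ (homo_Ck1 t cf)) homo_dx// /seg mulr1 mulrA.
Qed.

Lemma sint_dy f z : Ck 1 f -> dy (sint f) z = I (lam : {measure set T1 -> \bar R}) (seg id (dy f) z).
Proof.
move=> cf; have := dy_I (seg_Kk1 cf) => /(congr1 (fun f => f z)) => E; apply: etrans E _; congr I; apply/funext => t.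
have -> : (fun z => seg (fun=> 1) f z t) = (fun z => (\1_J t * 1) * f (homo t z)) by [].
by rewrite (dyZ _ (homo_Ck1 t cf)) homo_dy// /seg mulr1 mulrA.
Qed.

Lemma sint_CR f g : CR f g -> CR (sint f) (sint g).
Proof.
move=> [cf cg h]; split; [exact: sint_Ck|exact: sint_Ck|move=> z].
rewrite (sint_dx z cf) (sint_dy z cf) (sint_dx z cg) (sint_dy z cg).
have i1 : intg (lam : {measure set T1 -> \bar R}) (seg id (dx g) z).
  apply: (@Kk_intg _ _ _ _ 0); apply: seg_Kk0; [by move=> ?; exact: cvg_id|exact: (Ck_cont (Ck_dx cg))|].
  by move=> t /andP[t0 t1]; rewrite ger0_norm.
split.
  by congr I; apply/funext => t; rewrite /seg (h _).1.
by rewrite -(IN i1); congr I; apply/funext => t; rewrite /seg (h _).2 mulrN.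
Qed.

Lemma ftc_line f z : Ck 1 f -> f z - f l = (z.1 - l.1) * sint (dx f) z + (z.2 - l.2) * sint (dy f) z.
Proof.
move=> cf.
pose F t := f (homo t z); pose F' t := dx f (homo t z) * (z.1 - l.1) + dy f (homo t z) * (z.2 - l.2).
have dF t : is_derive (t : R) (1 : R) F (F' t) by have := chain_line l (z - l) t cf.
have cF' : continuous F'.
  move=> t; apply: cvgD; apply: cvgM; try exact: cvg_cst.
    exact: (homo_contt (Ck_cont (Ck_dx cf))).
  exact: (homo_contt (Ck_cont (Ck_dy cf))).
have cF : continuous F by exact: derive_cont dF.
have i1 : intg (lam : {measure set T1 -> \bar R}) (seg (fun=> 1) (dx f) z).
  apply: (@Kk_intg _ _ _ _ 0); apply: seg_Kk0; [by move=> ?; exact: cvg_cst|exact: (Ck_cont (Ck_dx cf))|].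
  by move=> *; rewrite normr1.
have i2 : intg (lam : {measure set T1 -> \bar R}) (seg (fun=> 1) (dy f) z).
  apply: (@Kk_intg _ _ _ _ 0); apply: seg_Kk0; [by move=> ?; exact: cvg_cst|exact: (Ck_cont (Ck_dy cf))|].
  by move=> *; rewrite normr1.
have ii := intgD (intgZ (z.1 - l.1) i1) (intgZ (z.2 - l.2) i2).
rewrite /sint -(IZ _ i1) -(IZ _ i2) -(ID (intgZ _ i1) (intgZ _ i2)).
apply: EFin_inj; rewrite -(I_fin ii).
have -> : (\int[lam]_t ((z.1 - l.1) * seg (fun=> 1) (dx f) z t + (z.2 - l.2) * seg (fun=> 1) (dy f) z t)%:E =
   \int[lam]_(t in J) (F' t)%:E)%E.
  rewrite [RHS]integral_mkcond; apply: eq_integral => t _; rewrite patchE /seg indicE /F'.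
  case: ifP => _; last by congr EFin; rewrite !mul0r !mulr0 addr0.
  by congr EFin; rewrite !mul1r; ring.
have e1 : homo 1 z = z by rewrite /homo !mul1r !subrKC; case: (z).
have e0 : homo 0 z = l by rewrite /homo !mul0r !addr0; case: (l).
rewrite (@continuous_FTC2 R F' F 0 1)//.
- by rewrite /F e1 e0 EFinB.
- exact: continuous_subspaceT.
- split.
  + by move=> t _; case: (dF t).
  + by apply: cvg_at_right_filter; exact: cF.
  + by apply: cvg_at_left_filter; exact: cF.
- by move=> t _; rewrite derive1E; case: (dF t).
Qed.

Lemma sint_at f : continuous f -> sint f l = f l.
Proof.
move=> cf; rewrite /sint.
have mJ : measurable (J : set T1) by exact: measurable_itv.
have -> : seg (fun=> 1) f l = fun t => f l * \1_J t.
  by apply/funext => t; rewrite /seg mulr1 mulrC /homo !subrr !mulr0 !addr0; case: (l).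
have i1 : intg (lam : {measure set T1 -> \bar R}) (\1_J).
  by have := seg_intg 1; congr (intg _ _); apply/funext => t; rewrite mul1r.
rewrite (IZ _ i1) (I_indic _ mJ) [X in fine X](_ : _ = 1%:E); last exact: lam_J.
by rewrite mulr1.
Qed.

(** The quotient is the mean of the complex derivative over the segment: in [ftc_line] the
    Cauchy-Riemann equations express the derivative in [y] by the one in [x]. *)
Lemma CR_divide (q1 q2 : P2 -> R) : CR q1 q2 -> exists f1 f2, [/\ CR f1 f2, f1 l = dx q1 l, f2 l = dx q2 l &
  forall z, q1 z - q1 l = (z.1 - l.1) * f1 z - (z.2 - l.2) * f2 z /\
            q2 z - q2 l = (z.1 - l.1) * f2 z + (z.2 - l.2) * f1 z].
Proof.
move=> h; have [c1 c2 hz] := h; have h' := CR_deriv h; have [d1 d2 _] := h'.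
exists (sint (dx q1)), (sint (dx q2)); split.
- exact: sint_CR.
- by apply: sint_at; exact: (Ck_cont d1).
- by apply: sint_at; exact: (Ck_cont d2).
- move=> z; rewrite (ftc_line z c1) (ftc_line z c2).
  have -> : dy q1 = fun p => - dx q2 p by apply/funext => p; rewrite (hz p).2.
  have -> : dy q2 = dx q1 by apply/funext => p; rewrite -(hz p).1.
  split => //; congr (_ + _); rewrite -mulrN; congr (_ * _); rewrite /sint.
  rewrite -IN; last first.
    apply: (@Kk_intg _ _ _ _ 0); apply: seg_Kk0; [by move=> ?; exact: cvg_cst|exact: (Ck_cont d2)|].
    by move=> *; rewrite normr1.
  by congr I; apply/funext => t; rewrite /seg mulrN.
Qed.
End Division.

(** * Cut-off functions *)

Section Plateau.
Context {R : realType}.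
Local Notation P2 := (R * R)%type.
Implicit Types (p q w z l : P2) (r t : R).

(** Two nested truncated powers: for [|w|^2 <= r^2 / 2] the inner one is 0 and the outer one is 1;
    for [|w| >= r] the inner one is at least 1 and the outer one is 0. *)
Definition plat r w : R := pw 3 (pw 3 (2 - 2 * (sq w * r^-2))).

Let arg_Ck n r : Ck n (fun w : P2 => 2 - 2 * (sq w * r^-2)).
Proof. by apply: CkB; [exact: Ck_cst|apply: CkZ; apply: CkM; [exact: sq_Ck|exact: Ck_cst]]. Qed.

Lemma plat_Ck r : Ck 2 (plat r).
Proof. by apply: (Ck_comp (pw_Dk 2)); apply: (Ck_comp (pw_Dk 2)); exact: arg_Ck. Qed.

Lemma plat1 r w : 0 < r -> sq w <= r ^+ 2 / 2 -> plat r w = 1.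
Proof.
move=> r0 h; have h1 : sq w * r^-2 <= 2^-1 by rewrite ler_pdivrMr ?exprn_gt0// mulrC.
by rewrite /plat [X in pw 3 X]pw_0; [rewrite /pw ler01 subr0 expr1n|lra].
Qed.

Lemma plat0 r w : 0 < r -> r ^+ 2 <= sq w -> plat r w = 0.
Proof.
move=> r0 h; have h1 : 1 <= sq w * r^-2 by rewrite ler_pdivlMr ?exprn_gt0// mul1r.
rewrite /plat pw_0// {1}/pw ifT; last by lra.
by apply: exprn_ege1; lra.
Qed.

Lemma plat_csupp r z : 0 < r -> csupp (fun w => plat r (w - z)).
Proof.
move=> r0; apply: (csupp_shift (- z)); exists r => w hw; apply: plat0 => //.
exact: norm_sq.
Qed.

Let pwd t : is_derive (t : R) (1 : R) (pw 3) (- (3 * pw 2 t)). Proof. exact: (pw_derive 1). Qed.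

Lemma dx_plat r w : dx (plat r) w = - 36 * (pw 2 (pw 3 (2 - 2 * (sq w * r^-2))) * pw 2 (2 - 2 * (sq w * r^-2)) * (w.1 * r^-2)).
Proof.
suff -> : dx (plat r) = fun w => - 36 * (pw 2 (pw 3 (2 - 2 * (sq w * r^-2))) * pw 2 (2 - 2 * (sq w * r^-2)) * (w.1 * r^-2)) by [].
apply: dxE => p.
have h1 := derivx p (arg_Ck 1 r).
have e1 : dx (fun w : P2 => 2 - 2 * (sq w * r^-2)) p = - 4 * (p.1 * r^-2).
  have ef : (fun w : P2 => 2 - 2 * (sq w * r^-2)) = fun w => 2 + - 2 * r^-2 * sq w.
    by apply/funext => w'; move: (sq w') (r^-2) => *; ring.
  rewrite ef (dxD (Ck_cst 1 2) (CkZ _ (sq_Ck 1))) dx_cst (dxZ _ (sq_Ck 1)) dx_sq.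
  by move: (r^-2) => *; ring.
rewrite e1 in h1.
have h2 := is_derive_comp1 h1 (pwd _); have h3 := is_derive_comp1 h2 (pwd _).
apply: (isd_eq h3); rewrite -surjective_pairing.
by move: (pw 2 _) (pw 2 _) => *; ring.
Qed.

Lemma dy_plat r w : dy (plat r) w = - 36 * (pw 2 (pw 3 (2 - 2 * (sq w * r^-2))) * pw 2 (2 - 2 * (sq w * r^-2)) * (w.2 * r^-2)).
Proof.
suff -> : dy (plat r) = fun w => - 36 * (pw 2 (pw 3 (2 - 2 * (sq w * r^-2))) * pw 2 (2 - 2 * (sq w * r^-2)) * (w.2 * r^-2)) by [].
apply: dyE => p.
have h1 := derivy p (arg_Ck 1 r).
have e1 : dy (fun w : P2 => 2 - 2 * (sq w * r^-2)) p = - 4 * (p.2 * r^-2).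
  have ef : (fun w : P2 => 2 - 2 * (sq w * r^-2)) = fun w => 2 + - 2 * r^-2 * sq w.
    by apply/funext => w'; move: (sq w') (r^-2) => *; ring.
  rewrite ef (dyD (Ck_cst 1 2) (CkZ _ (sq_Ck 1))) dy_cst (dyZ _ (sq_Ck 1)) dy_sq.
  by move: (r^-2) => *; ring.
rewrite e1 in h1.
have h2 := is_derive_comp1 h1 (pwd _); have h3 := is_derive_comp1 h2 (pwd _).
apply: (isd_eq h3); rewrite -surjective_pairing.
by move: (pw 2 _) (pw 2 _) => *; ring.
Qed.

(** The gradient lives on the annulus; [36 = 3 * 3 * 4] collects the two exponents and the
    derivative of the argument. *)
Lemma plat_d r w : 0 < r -> (dx (plat r) w = 0 /\ dy (plat r) w = 0) \/
  [/\ r ^+ 2 / 2 <= sq w, sq w <= r ^+ 2 & dx (plat r) w ^+ 2 + dy (plat r) w ^+ 2 <= 36 ^+ 2 * r^-2].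
Proof.
move=> r0; rewrite dx_plat dy_plat; have r2 : 0 < r ^+ 2 by rewrite exprn_gt0.
have [h1|h1] := ltrP (sq w) (r ^+ 2 / 2).
  left; have h2 : sq w * r^-2 <= 2^-1 by rewrite ler_pdivrMr// mulrC ltW.
  by rewrite (@pw_0 _ 1 (2 - 2 * (sq w * r^-2))); [rewrite !(mulr0, mul0r)|lra].
have [h2|h2] := ltrP (r ^+ 2) (sq w).
  left; have h3 : 1 <= sq w * r^-2 by rewrite ler_pdivlMr// mul1r ltW.
  rewrite (@pw_0 _ 1 (pw 3 (2 - 2 * (sq w * r^-2)))); first by rewrite !(mulr0, mul0r).
  by rewrite /pw ifT; [apply: exprn_ege1|]; lra.
right; split => //.
have h3 : sq w * r^-2 <= 1 by rewrite ler_pdivrMr// mul1r.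
have a1 : 0 <= pw 2 (pw 3 (2 - 2 * (sq w * r^-2))) <= 1.
  by rewrite pw_ge0/=; apply: pw_le1; exact: pw_ge0.
have a2 : 0 <= pw 2 (2 - 2 * (sq w * r^-2)) <= 1.
  by rewrite pw_ge0/=; apply: pw_le1; lra.
set A := pw 2 _ in a1 *; set B := pw 2 _ in a2 *.
have -> : (- 36 * (A * B * (w.1 * r^-2))) ^+ 2 + (- 36 * (A * B * (w.2 * r^-2))) ^+ 2 =
  36 ^+ 2 * ((A * B) ^+ 2 * (sq w * r^-2) * r^-2).
  by rewrite /sq; move: (r^-2) => x; ring.
rewrite ler_pM2l ?exprn_gt0//.
have AB : (A * B) ^+ 2 <= 1.
  move: a1 a2 => /andP[A0 A1] /andP[B0 B1]; apply: exprn_ile1; first exact: mulr_ge0.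
  by rewrite -[leRHS]mulr1; apply: ler_pM.
have ri : 0 < r^-2 by rewrite invr_gt0.
rewrite -[leRHS]mul1r ler_pM2r// -[leRHS]mulr1; apply: ler_pM => //; first exact: sqr_ge0.
by rewrite mulr_ge0 ?sq_ge0// ltW.
Qed.
End Plateau.

(** * Norm of a quotient by a linear factor *)

Section LocalEstimate.
Context {R : realType}.
Local Notation P2 := (R * R)%type.
Local Notation L := (@Leb R).
Implicit Types (p q w z : P2).
Variables (phi : P2 -> R) (mu : {measure set P2 -> \bar R}) (rho : P2 -> R) (cd : R).
Hypothesis H : fock_data phi mu rho cd.

(** Chosen so that the quadratic term of [psi], of Laplacian [2 Bq / r^2], outweighs by [2 / r^2]
    the Laplacian of [Av r phi], which is at most [10 cd / (c0 r^2)] on the disc. *)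
Definition Bq : R := 5 * cd * c0^-1 + 1.
(** [1296 = 36^2] comes from [plat_d], the exponential from comparing [e^(2 psi)] with [e^(-2 phi)]
    in both directions, and 2 from the region away from [l]. *)
Definition CN : R := 1296 * expR (Bq + 2 * (Kav cd * cd)) + 2.

Variables (l : P2) (f1 f2 q1 q2 : P2 -> R).
Hypotheses (cf : CR f1 f2) (wq : wsq phi q1 q2).
Hypothesis qf : forall z, q1 z = (z.1 - l.1) * f1 z - (z.2 - l.2) * f2 z /\
                          q2 z = (z.1 - l.1) * f2 z + (z.2 - l.2) * f1 z.

Let r := rho l.
Let r0 : 0 < r. Proof. exact: fd_rho0 H l. Qed.
Let chi z := plat r (z - l).
(** [e^(2 psi)] has to be comparable to [e^(-2 phi)], but [- Av r phi] is superharmonic; the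
    quadratic term makes [psi] strictly subharmonic on the disc of radius [rho l], at bounded
    cost. *)
Let psi z := - Av r phi z + 2^-1 * Bq * (sq (z - l) * r^-2).
Let a z := chi z * f1 z.
Let b z := - (chi z * f2 z).

Let cchi : Ck 2 chi. Proof. exact: Ck_shift (plat_Ck r). Qed.
Let schi : csupp chi. Proof. exact: plat_csupp. Qed.
Let cAv : Ck 2 (Av r phi). Proof. by apply: CkS; apply: Av_Ck => //; exact: fd_lint H. Qed.
Let csq : Ck 2 (fun z => sq (z - l)). Proof. exact: (Ck_shift (- l) (sq_Ck 2)). Qed.

Let NN (u : P2 -> R) : (fun z => - u z) = (fun z => -1 * u z).
Proof. by apply/funext => z; rewrite mulN1r. Qed.

Let cpsi : Ck 2 psi.
Proof. by apply: CkD; [exact: CkN|apply: CkZ; apply: CkM => //; exact: Ck_cst]. Qed.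

Let lap_sq z : dx (dx (fun z => sq (z - l))) z + dy (dy (fun z => sq (z - l))) z = 4.
Proof.
rewrite (dx_shift (- l) (sq_Ck 1)) (dy_shift (- l) (sq_Ck 1)) dx_sq dy_sq.
have e1 : dx (fun p : P2 => 2 * (p + - l).1) = fun=> 2.
  by apply: dxE => p; apply: isd_eq; rewrite /GRing.scale/=; ring.
have e2 : dy (fun p : P2 => 2 * (p + - l).2) = fun=> 2.
  by apply: dyE => p; apply: isd_eq; rewrite /GRing.scale/=; ring.
by rewrite e1 e2; ring.
Qed.

Let m_near z : en (z - l) <= r -> m mu z r <= cd.
Proof.
move=> h; apply: le_trans (_ : m mu l (2 * r) <= _).
  by apply: (m_le (fd_fin H)); lra.
by have := m_dbl (fd_fin H) (fd_dbl H) l r0; rewrite (m_rho (fd_mu_rho H)) mulr1.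
Qed.

Let lap_psi z : en (z - l) <= r -> 2 * r^-2 <= dx (dx psi) z + dy (dy psi) z.
Proof.
move=> hz.
have k1 : Ck 2 (fun z => -1 * Av r phi z) by exact: CkZ.
have e2 : (fun z => 2^-1 * Bq * (sq (z - l) * r^-2)) = (fun z => 2^-1 * Bq * r^-2 * sq (z - l)).
  by apply/funext => x; rewrite -!mulrA; congr (_ * (_ * _)); rewrite mulrC.
have k2 : Ck 2 (fun z => 2^-1 * Bq * r^-2 * sq (z - l)) by exact: CkZ.
have epsi : psi = (fun z => -1 * Av r phi z + 2^-1 * Bq * r^-2 * sq (z - l)).
  by apply/funext => x; rewrite /psi mulN1r; congr (_ + _); have /(congr1 (fun f => f x)) := e2.
rewrite epsi (dxD k1 k2) (dyD k1 k2) (dxD (Ck_dx k1) (Ck_dx k2)) (dyD (Ck_dy k1) (Ck_dy k2)).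
rewrite (dxZ _ cAv) (dyZ _ cAv) (dxZ _ (Ck_dx cAv)) (dyZ _ (Ck_dy cAv)).
rewrite (dxZ _ csq) (dyZ _ csq) (dxZ _ (Ck_dx csq)) (dyZ _ (Ck_dy csq)).
rewrite addrACA -!mulrDr lap_sq.
have := fd_lap_Av H r0 => /(congr1 (fun f => f z)) /= ->.
have h : I mu (fun w => al r (w - z)) <= 10 * r^-2 * cd.
  have [i1 e1] := I_D (fd_fin H) z r.
  have ia : intg mu (fun w => al r (w - z)) by apply: al_shift_intg => //; exact: fd_lfin H.
  apply: (@le_trans _ _ (10 * r^-2 * m mu z r)).
    rewrite -e1 -(IZ _ i1); apply: I_le => // [|w]; first exact: intgZ.
    rewrite indicE; have [_|/negP hw] := boolP (w \in _); first by rewrite mulr1 al_le.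
    by rewrite mulr0 al_out// leNgt; apply/negP => h; apply: hw; rewrite inE.
  by rewrite ler_pM2l ?m_near// mulr_gt0// invr_gt0 exprn_gt0.
have c00 : 0 < c0^-1 :> R by rewrite invr_gt0 c0_gt0.
have ri : 0 < r^-2 by rewrite invr_gt0 exprn_gt0.
rewrite -(ler_pM2l c00) in h; rewrite /Bq.
move: h ri; move: (c0^-1) (r^-2) (I mu _) cd => c s x d h ri; nra.
Qed.

(** The conjugate of [f] is antiholomorphic, so [d/dz] falls on the cut-off only. *)
Let dz2E z : dz2 a b z = 4^-1 * (dx chi z ^+ 2 + dy chi z ^+ 2) * mod2 f1 f2 z.
Proof.
have [k1 k2 h] := cf; have c1 := CkS cchi.
have k4 := CkM c1 k2; have k3 := CkM c1 k1.
have eb : b = (fun z => -1 * (chi z * f2 z)) by exact: NN.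
rewrite /dz2 eb /a (dxZ _ k4) (dyZ _ k4) (dxM c1 k1) (dxM c1 k2) (dyM c1 k1) (dyM c1 k2).
rewrite (h z).2 -(h z).1 /mod2.
by move: (dx chi z) (dy chi z) (chi z) (f1 z) (f2 z) (dx f1 z) (dx f2 z) => *; field.
Qed.

Let modE z : mod2 a b z = chi z ^+ 2 * mod2 f1 f2 z.
Proof. by rewrite /mod2 /a /b; move: (chi z) (f1 z) (f2 z) => *; ring. Qed.

Let fq z : sq (z - l) * mod2 f1 f2 z = mod2 q1 q2 z.
Proof.
have [e1 e2] := qf z; rewrite /mod2 e1 e2 /sq /=.
by move: (z.1 - l.1) (z.2 - l.2) (f1 z) (f2 z) => *; ring.
Qed.

Let w z := ex (fun p => - phi p) z.

Let mf0 z : 0 <= mod2 f1 f2 z. Proof. by rewrite addr_ge0// sqr_ge0. Qed.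
Let w0 z : 0 < w z. Proof. exact: ex_gt0. Qed.

Let f_far z : r ^+ 2 / 2 <= sq (z - l) -> mod2 f1 f2 z <= 2 * r^-2 * mod2 q1 q2 z.
Proof.
move=> h; rewrite -fq; have r2 : 0 < r ^+ 2 by rewrite exprn_gt0.
have m0 := mf0 z.
have h1 : 1 <= 2 * r^-2 * sq (z - l).
  by rewrite mulrAC ler_pdivlMr// mul1r; move: h; lra.
by rewrite mulrA -[leLHS]mul1r ler_wpM2r.
Qed.

(** On the disc the average of [phi] is at least [phi] and exceeds it by at most [Kav cd * cd]; this
    gives the two comparisons of [psi_le] and [psi_ge]. *)
Let psi_le z : sq (z - l) <= r ^+ 2 -> ex psi z <= expR Bq * w z.
Proof.
move=> h; rewrite /ex /w /ex -expRD ler_expR /psi.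
have h1 := fd_Av_ge H z r0.
have h2 : sq (z - l) * r^-2 <= 1 by rewrite ler_pdivrMr ?exprn_gt0// mul1r.
have B0 : 0 <= Bq.
  by rewrite /Bq addr_ge0// mulr_ge0 ?invr_ge0 ?(ltW c0_gt0)// mulr_ge0// ltW// (fd_cd0 H).
by move: h1 h2 B0; move: (Av r phi z) (phi z) (sq _ * _) Bq => *; nra.
Qed.

Let psi_ge z : en (z - l) <= r -> expR (- (2 * (Kav cd * cd))) * w z <= ex psi z.
Proof.
move=> h; rewrite /ex /w /ex -expRD ler_expR /psi.
have h1 := Av_le (fd_usc H) (fd_smv H) (fd_riesz H) (fd_fin H) (fd_cd0 H) (fd_dbl H) z r0.
have h2 : Kav cd * m mu z r <= Kav cd * cd by rewrite ler_pM2l ?(fd_Kav_gt0 H)// m_near.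
have B0 : 0 <= Bq.
  by rewrite /Bq addr_ge0// mulr_ge0 ?invr_ge0 ?(ltW c0_gt0)// mulr_ge0// ltW// (fd_cd0 H).
have h3 : 0 <= 2^-1 * Bq * (sq (z - l) * r^-2).
  by rewrite mulr_ge0// ?mulr_ge0 ?sq_ge0 ?invr_ge0 ?exprn_ge0// ltW.
by move: h1 h2 h3; move: (Av r phi z) (phi z) (_ * (_ * r^-2)) (Kav cd * _) (Kav cd * _) => *; lra.
Qed.

Let mw : meas w. Proof. by apply: meas_ex; apply: meas_opp; exact: fd_meas H. Qed.
Let lw : lbd w. Proof. by apply: (@ex_lbd _ (fun p => - phi p)); apply: lbdN; exact: fd_lbd H. Qed.

Let i_chi : intg L (fun z => mod2 a b z * w z).
Proof.
have [k1 k2 _] := cf; have c1 := CkS cchi.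
apply: lbd_intg; [exact: Leb_lfin| |].
  apply: lbdM => //; apply: cont_lbd; apply: (Ck_cont (_ : Ck 1 _)); apply: mod2_Ck; first exact: CkM.
  by apply: CkN; exact: CkM.
by apply: csuppMl; apply: mod2_csupp; [exact: csuppMl|apply: csuppN; exact: csuppMl].
Qed.

Let near_bound : I L (fun z => mod2 a b z * w z) <=
  1296 * expR (Bq + 2 * (Kav cd * cd)) * r^-2 * I L (fun z => mod2 q1 q2 z * w z).
Proof.
have [K1 K2] := CR_C3 cf.
have ca : Ck 2 a by apply: CkM => //; exact: CkS.
have cb : Ck 2 b by apply: CkN; apply: CkM => //; exact: CkS.
have sa : csupp a by exact: csuppMl.
have sb : csupp b by apply: csuppN; exact: csuppMl.
have BI := basic_inequality cpsi ca cb sa sb.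
have [mq1 mq2 iq] := wq.
have ri : 0 < r^-2 by rewrite invr_gt0 exprn_gt0.
have i4 : intg L (fun p => 2^-1 * (dx (dx psi) p + dy (dy psi) p) * mod2 a b p * ex psi p).
  apply: cont_intg; [exact: Leb_lfin| |by apply: csuppMl; apply: csuppM; exact: mod2_csupp].
  apply: (Ck_cont (_ : Ck 0 _)); apply: CkM; last by apply: Ck_le (ex_Ck cpsi).
  apply: CkM; last by apply: mod2_Ck; [exact: Ck_le ca|exact: Ck_le cb].
  by apply: CkZ; apply: CkD; [exact: Ck_dx (Ck_dx cpsi)|exact: Ck_dy (Ck_dy cpsi)].
have i3 : intg L (fun p => dz2 a b p * ex psi p).
  apply: cont_intg; first exact: Leb_lfin.
    have k1 := Ck_le (isT : (0 <= 1)%N) (Ck_dx ca); have k2 := Ck_le (isT : (0 <= 1)%N) (Ck_dy ca).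
    have k3 := Ck_le (isT : (0 <= 1)%N) (Ck_dx cb); have k4 := Ck_le (isT : (0 <= 1)%N) (Ck_dy cb).
    apply: (Ck_cont (_ : Ck 0 _)); apply: CkM; last by apply: Ck_le (ex_Ck cpsi).
    by rewrite /dz2; apply: CkZ; apply: CkD; apply: CkM; [exact: CkD|exact: CkD|exact: CkB|exact: CkB].
  apply: csuppMl; apply: csuppM; have x1 := csupp_dx sa; have x2 := csupp_dx sb; have y1 := csupp_dy sa; have y2 := csupp_dy sb.
  by apply: csuppD; apply: csuppM; apply: csuppD => //; exact: csuppN.
have B1 : r^-2 * expR (- (2 * (Kav cd * cd))) * I L (fun z => mod2 a b z * w z) <=
   I L (fun p => 2^-1 * (dx (dx psi) p + dy (dy psi) p) * mod2 a b p * ex psi p).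
  rewrite -(IZ _ i_chi); apply: I_le => // [|z]; first exact: intgZ.
  have [hz|hz] := lerP r (en (z - l)).
    have e0 : chi z = 0 by apply: plat0 => //; rewrite -en_sq ler_pXn2r// nnegrE ?en_ge0// ltW.
    by rewrite modE e0 expr0n /= !(mul0r, mulr0).
  have h1 := lap_psi (ltW hz); have h2 := psi_ge (ltW hz).
  have m0 : 0 <= mod2 a b z by rewrite addr_ge0// sqr_ge0.
  have -> : r^-2 * expR (- (2 * (Kav cd * cd))) * (mod2 a b z * w z) =
     r^-2 * mod2 a b z * (expR (- (2 * (Kav cd * cd))) * w z).
    by move: (r^-2) (expR _) (mod2 a b z) (w z) => *; ring.
  apply: ler_pM => //; [by rewrite mulr_ge0// ltW|by rewrite mulr_ge0 ?expR_ge0// ltW|].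
  by apply: ler_wpM2r => //; move: h1; move: (r^-2) (_ + _) => *; lra.
have B2 : I L (fun p => dz2 a b p * ex psi p) <= 1296 * (r^-2) ^+ 2 * expR Bq * I L (fun z => mod2 q1 q2 z * w z).
  rewrite -(IZ _ iq); apply: I_le => // [|z]; first exact: intgZ.
  have mq0 : 0 <= mod2 q1 q2 z by rewrite addr_ge0// sqr_ge0.
  have R0 : 0 <= 1296 * (r^-2) ^+ 2 * expR Bq * (mod2 q1 q2 z * ex (fun p => - phi p) z).
    apply: mulr_ge0; last by rewrite mulr_ge0// ltW// ex_gt0.
    apply: mulr_ge0; last exact: expR_ge0.
    apply: mulr_ge0; last exact: sqr_ge0.
    exact: ler0n.
  rewrite dz2E.
  have ex1 : dx chi z = dx (plat r) (z - l).
    by have := dx_shift (- l) (plat_Ck r) => /(congr1 (fun f => f z)).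
  have ex2 : dy chi z = dy (plat r) (z - l).
    by have := dy_shift (- l) (plat_Ck r) => /(congr1 (fun f => f z)).
  have [[d1 d2]|[h1 h2 h3]] := plat_d (z - l) r0.
    by rewrite ex1 ex2 d1 d2 expr0n /= addr0 mulr0 !mul0r.
  rewrite -ex1 -ex2 in h3.
  have h4 := f_far h1; have h5 := psi_le h2.
  have -> : 1296 * (r^-2) ^+ 2 * expR Bq * (mod2 q1 q2 z * ex (fun p => - phi p) z) =
     2 * 1296 * r^-2 * 4^-1 * (2 * r^-2 * mod2 q1 q2 z) * (expR Bq * ex (fun p => - phi p) z).
    by move: (r^-2) (expR Bq) (mod2 q1 q2 z) (ex _ z) => *; field.
  apply: ler_pM => //; [|exact: ltW (ex_gt0 _ _)|].
    by rewrite mulr_ge0// mulr_ge0 ?invr_ge0// addr_ge0// sqr_ge0.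
  apply: ler_pM => //; first by rewrite mulr_ge0 ?invr_ge0// addr_ge0// sqr_ge0.
  have e36 : 36 ^+ 2 = 1296 :> R by ring.
  by rewrite e36 in h3; move: h3; move: (_ + _) (r^-2) ri => *; lra.
have := le_trans B1 (le_trans BI B2).
have e0 : 0 < expR (- (2 * (Kav cd * cd))) by exact: expR_gt0.
rewrite -ler_pdivlMl ?mulr_gt0// => h; apply: le_trans h _.
rewrite le_eqVlt; apply/orP; left; apply/eqP; rewrite expRD.
have : expR (2 * (Kav cd * cd)) * expR (- (2 * (Kav cd * cd))) = 1 by rewrite -expRD subrr expR0.
move: e0; move: (I _ _) (expR Bq) (expR (2 * _)) (expR (- _)) (r^-2) ri => x y u v s s0 v0 uv.
have -> : (s * v)^-1 * (1296 * s ^+ 2 * y * x) = 1296 * y * v^-1 * s * x by field; rewrite !lt0r_neq0.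
have -> : v^-1 = u by apply: (mulIf (lt0r_neq0 v0)); rewrite uv mulVf// lt0r_neq0.
by clear s0; move: x y u s {uv} => *; ring.
Qed.

(** Where the cut-off is 1, [near_bound] applies; elsewhere [|z - l|^2 >= r^2 / 2] and dividing by
    [z - l] costs at most [2 / r^2]. *)
Lemma local_estimate : wsq phi f1 f2 /\
  I L (fun z => mod2 f1 f2 z * ex (fun p => - phi p) z) <=
  CN * (rho l) ^- 2 * I L (fun z => mod2 q1 q2 z * ex (fun p => - phi p) z).
Proof.
have [mf1 mf2] := CR_meas cf; have [mq1 mq2 iq] := wq.
have ri : 0 < r^-2 by rewrite invr_gt0 exprn_gt0.
have pt z : mod2 f1 f2 z * w z <= mod2 a b z * w z + 2 * r^-2 * (mod2 q1 q2 z * w z).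
  have mq0 : 0 <= mod2 q1 q2 z by rewrite addr_ge0// sqr_ge0.
  rewrite mulrA -mulrDl ler_pM2r//.
  have [h|h] := lerP (sq (z - l)) (r ^+ 2 / 2).
    have e1 : chi z = 1 by exact: plat1.
    by rewrite modE e1 expr1n mul1r lerDl mulr_ge0// mulr_ge0// ltW.
  by apply: le_trans (f_far (ltW h)) _; rewrite lerDr addr_ge0// sqr_ge0.
have iR := intgD i_chi (intgZ (2 * r^-2) iq).
have iF : intg L (fun z => mod2 f1 f2 z * w z).
  apply: (intg_le _ _ iR); first by apply: measurable_funM => //; exact: meas_mod2.
  by move=> z; rewrite ger0_norm// mulr_ge0// ltW.
split; first by split.
apply: (@le_trans _ _ (I L (fun z => mod2 a b z * w z + 2 * r^-2 * (mod2 q1 q2 z * w z)))); first exact: I_le.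
rewrite (ID i_chi (intgZ _ iq)) (IZ _ iq).
have := near_bound; rewrite -/r /CN; move: (I _ _) (I _ _) (expR _) (r^-2) => x y u s h; lra.
Qed.
End LocalEstimate.

(** * A Fock function not vanishing at a given point *)

Section LogPole.
Context {R : realType}.
Local Notation P2 := (R * R)%type.
Local Notation L := (@Leb R).
Implicit Types (p q w z l : P2) (e r t : R).

Lemma N0_low t : 0 <= t <= 1 -> - 2 <= N0 t <= 0.
Proof.
move=> /andP[t0 t1]; rewrite /N0 t1.
have h0 : 0 <= 1 - t by lra.
have h1 : 1 - t <= 1 by lra.
have a k : 0 <= (1 - t) ^+ k <= 1 by rewrite exprn_ge0 ?exprn_ile1.
have := a 2%N; have := a 3%N; have := a 4%N; have := a 5%N.
by move: (_ ^+ 2) (_ ^+ 3) (_ ^+ 4) (_ ^+ 5) => *; lra.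
Qed.

Transparent Ek.
Lemma Ek_low e r w : 0 < e -> e <= r -> en w <= e -> ln r - ln e - 2 <= Ek e r w.
Proof.
move=> e0 er we; have r0 := lt_le_trans e0 er.
have b x : 0 < x -> en w <= x -> 0 <= sq w * x ^- 2 <= 1.
  move=> x0 h; rewrite mulr_ge0 ?sq_ge0 ?invr_ge0 ?exprn_ge0 ?(ltW x0)//=.
  by rewrite ler_pdivrMr ?exprn_gt0// mul1r -en_le// ltW.
have /andP[h1 _] := N0_low (b r r0 (le_trans we er)).
have /andP[_ h2] := N0_low (b e e0 we).
by rewrite /Ek; lra.
Qed.
Opaque Ek.

Lemma Ek_annulus e r w : 0 < e -> e <= r / 2 -> r ^+ 2 / 2 <= sq w -> Ek e r w <= 2.
Proof.
move=> e0 er h; have r0 : 0 < r by lra.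
have r2 : 0 < r / 2 by lra.
rewrite (Ek_add e (r / 2)) (Ek_out e0 er) ?add0r.
  by apply: le_trans (Ek3_le w r2); apply: Ek_le => //; lra.
rewrite leNgt en_lt// -leNgt; apply: le_trans h.
by rewrite expr_div_n ler_pM2l ?exprn_gt0//; lra.
Qed.

Variables (phi : P2 -> R) (mu : {measure set P2 -> \bar R}) (rho : P2 -> R) (cd : R).
Hypothesis H : fock_data phi mu rho cd.

(** By reverse doubling the disc about [l] has mass at least [cd^n] for a suitable [r]. Since
    [2^n k >= 2], the disc of radius [2^n k r] about [z] contains it, so by doubling the one of
    radius [k r] has mass at least 1. Thus [rho] is small against [r] on a whole disc, which leaves
    room for a pole of scale [r]. *)
Lemma rho_small l (k : R) : 0 < k -> exists2 r, 0 < r & forall z, en (z - l) <= r -> rho z <= k * r.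
Proof.
move=> k0.
have [n hn] : exists n : nat, 2 <= 2 ^+ n * k.
  exists (Num.bound (2 / k)); rewrite -ler_pdivrMr//.
  apply: le_trans (_ : (Num.bound (2 / k))%:R <= _).
    by apply: le_trans (ltW (archi_boundP _)); rewrite // divr_ge0// ltW.
  by rewrite -natrX ler_nat ltnW// ltn_expl.
have cd0 := fd_cd0 H.
have [r r0 hr] := m_infty (fd_fin H) cd0 (fd_dbl H) (fd_rho0 H) (fd_mu_rho H) l (cd ^+ n).
have kr : 0 < k * r by rewrite mulr_gt0.
exists r => // z hz; apply: (rho_le (fd_fin H) cd0 (fd_dbl H) (fd_mu_rho H)) => //.
have h1 : m mu l r <= m mu z (2 ^+ n * (k * r)).
  apply: (m_le (fd_fin H)); rewrite -enN opprB mulrA.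
  apply: (@le_trans _ _ (2 * r)); first by lra.
  by rewrite ler_pM2r.
have h2 := m_dbln (fd_fin H) cd0 (fd_dbl H) z n kr.
have := le_trans hr (le_trans h1 h2); rewrite -[leLHS]mulr1 ler_pM2l// exprn_gt0//.
Qed.

Section AtPoint.
Variables (l : P2) (r : R).
Hypotheses (r0 : 0 < r) (hr : forall z, en (z - l) <= r -> 40 * rho z ^+ 2 <= cH cd * r ^+ 2).

Let P z := plat r (z - l).
Let h1 z := 2^-1 * dx P z.
Let h2 z := 2^-1 * dy P z.
(** A pole regularized at scale [e]: the factor [e^(-2 eta)] is of order [(r / |z - l|)^4] down to
    distance [e]. The Laplacian of [eta] is at least [-20 / r^2], which [hr] makes admissible in
    [weighted_estimate]. *)
Let eta e z := - 2 * Ek e r (z - l).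

Let cP : Ck 2 P. Proof. exact: Ck_shift (plat_Ck r). Qed.
Let sP : csupp P. Proof. exact: plat_csupp. Qed.
Let ceta e : Ck 3 (eta e). Proof. by apply: CkZ; exact: Ck_shift (Ek_Ck e r). Qed.

Let eta_le0 e z : 0 < e -> e <= r -> eta e z <= 0.
Proof. by move=> e0 er; have := Ek_ge0 (z - l) e0 er; rewrite /eta; lra. Qed.

Let lap_eta e z : 0 < e -> - (2^-1 * cH cd) * (rho z) ^- 2 <= dx (dx (eta e)) z + dy (dy (eta e)) z.
Proof.
move=> e0; have k : Ck 3 (fun z => Ek e r (z - l)) by exact: Ck_shift (Ek_Ck e r).
rewrite (dxZ _ k) (dyZ _ k) (dxZ _ (Ck_dx k)) (dyZ _ (Ck_dy k)) -mulrDr.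
rewrite (lap_shift l z (CkS (Ek_Ck e r))).
have := lap_Ek e r => /(congr1 (fun f => f (z - l))) /= ->.
have a0 := al_ge0 e (z - l).
have c0 : 0 < cH cd by exact: cH_gt0 H.
have p0 : 0 < rho z by exact: fd_rho0 H z.
have pi : 0 < rho z ^- 2 by rewrite invr_gt0 exprn_gt0.
have [h|h] := lerP r (en (z - l)).
  rewrite (al_out r0 h); have : 0 <= cH cd * rho z ^- 2 by rewrite mulr_ge0// ltW.
  by move: (cH cd) (rho z ^- 2) (al _ _) a0 => *; lra.
have a1 := al_le r (z - l).
have h3 : 20 * r ^- 2 <= 2^-1 * cH cd * rho z ^- 2.
  rewrite ler_pdivrMr ?exprn_gt0// mulrAC ler_pdivlMr ?exprn_gt0//.
  by have := hr (ltW h); move: (rho z ^+ 2) (cH cd) (r ^+ 2) => x y u; nra.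
by move: h3 a0 a1; move: (cH cd) (rho z ^- 2) (r ^- 2) (al _ _) (al _ _) => *; lra.
Qed.

Let ex_eta e p : ex (fun p => - (phi p + eta e p)) p = ex (fun p => - phi p) p * expR (4 * Ek e r (p - l)).
Proof. by rewrite /ex -expRD /eta; congr expR; ring. Qed.

Let w p := ex (fun p => - phi p) p.
Let w0 p : 0 < w p. Proof. exact: ex_gt0. Qed.
Let mw : meas w. Proof. by apply: meas_ex; apply: meas_opp; exact: fd_meas H. Qed.
Let lw : lbd w. Proof. by apply: (@ex_lbd _ (fun p => - phi p)); apply: lbdN; exact: fd_lbd H. Qed.

(** A bound independent of [e]: on the annulus carrying the gradient of the cut-off, [Ek <= 2],
    whence [expR 8]; [324 = 36^2 / 4], and [rho^2] is absorbed by [hr]. *)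
Let Y : R := expR 8 * 324 * cH cd * I L (fun p => \1_(bbox (`|l| + r)) p * w p).

Let iY : intg L (fun p => \1_(bbox (`|l| + r)) p * w p).
Proof.
have [_ h] := lbd_lint (@Leb_lfin R) lw.
by have := h (`|l| + r); congr (intg L _); apply/funext => p; rewrite mulrC.
Qed.

Let h_bound e p : 0 < e -> e <= r / 2 ->
  0 <= mod2 h1 h2 p * rho p ^+ 2 * ex (fun p => - (phi p + eta e p)) p <=
  expR 8 * 324 * cH cd * (\1_(bbox (`|l| + r)) p * w p).
Proof.
move=> e0 er.
have m0 : 0 <= mod2 h1 h2 p by rewrite addr_ge0// sqr_ge0.
have g0 : 0 <= mod2 h1 h2 p * rho p ^+ 2 * ex (fun p => - (phi p + eta e p)) p.
  by apply: mulr_ge0; [apply: mulr_ge0 => //; exact: sqr_ge0|exact: ltW (ex_gt0 _ _)].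
rewrite g0 /=.
have c0 : 0 < cH cd by exact: cH_gt0 H.
have R0 : 0 <= expR 8 * 324 * cH cd * (\1_(bbox (`|l| + r)) p * w p).
  apply: mulr_ge0; last by apply: mulr_ge0; [rewrite indicE ler0n|exact: ltW].
  by apply: mulr_ge0; [apply: mulr_ge0; [exact: expR_ge0|exact: ler0n]|exact: ltW].
have ex1 : dx P p = dx (plat r) (p - l).
  by have := dx_shift (- l) (plat_Ck r) => /(congr1 (fun f => f p)).
have ex2 : dy P p = dy (plat r) (p - l).
  by have := dy_shift (- l) (plat_Ck r) => /(congr1 (fun f => f p)).
have e4 : mod2 h1 h2 p = 4^-1 * (dx (plat r) (p - l) ^+ 2 + dy (plat r) (p - l) ^+ 2).
  by rewrite /mod2 /h1 /h2 ex1 ex2; move: (dx _ _) (dy _ _) => *; field.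
rewrite e4.
have [[d1 d2]|[k1 k2 k3]] := plat_d (p - l) r0.
  by rewrite d1 d2 expr0n /= addr0 mulr0 !mul0r.
have k4 : en (p - l) <= r by rewrite en_le// ltW.
have k5 : p \in bbox (`|l| + r).
  rewrite inE /bbox /=; have /andP[k5 _] := en_norm (p - l).
  by have := ler_normD (p - l) l; rewrite subrK; lra.
rewrite indicE k5 mul1r ex_eta.
have k6 : expR (4 * Ek e r (p - l)) <= expR 8.
  by rewrite ler_expR; have := Ek_annulus e0 er k1; lra.
have k7 := hr k4.
have k8 : 4^-1 * (dx (plat r) (p - l) ^+ 2 + dy (plat r) (p - l) ^+ 2) * rho p ^+ 2 <= 324 * cH cd.
  have e36 : 36 ^+ 2 = 1296 :> R by ring.
  have r2 : 0 < r ^+ 2 by rewrite exprn_gt0.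
  apply: (@le_trans _ _ (324 * r ^- 2 * (cH cd * r ^+ 2))).
    apply: ler_pM; [|exact: sqr_ge0| |].
    - by rewrite mulr_ge0 ?invr_ge0// addr_ge0// sqr_ge0.
    - by move: k3; rewrite e36; move: (_ + _) (r ^- 2) => *; lra.
    - by have := sqr_ge0 (rho p); move: k7; move: (rho p ^+ 2) (cH cd * _) => *; lra.
  rewrite le_eqVlt; apply/orP; left; apply/eqP.
  by move: (r ^+ 2) r2 (cH cd) => x x0 y; field; rewrite lt0r_neq0.
apply: (@le_trans _ _ (324 * cH cd * (w p * expR 8))).
  apply: ler_pM => //.
  - by rewrite mulr_ge0 ?sqr_ge0// mulr_ge0 ?invr_ge0// addr_ge0// sqr_ge0.
  - by rewrite mulr_ge0 ?expR_ge0// ltW.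
  - by rewrite ler_pM2l.
by rewrite le_eqVlt; apply/orP; left; apply/eqP; move: (cH cd) (w p) (expR 8) => *; ring.
Qed.

(** [dbar_correct] for the cut-off [P], which is constant near [l]; the bound does not depend on
    [e]. *)
Let corr e : 0 < e -> e <= r / 2 -> exists v1 v2, [/\ CR v1 v2,
  wsq (fun p => phi p + eta e p) (fun p => P p - v1 p) (fun p => 0 - v2 p) &
  I L (fun p => mod2 (fun p => P p - v1 p) (fun p => 0 - v2 p) p * ex (fun p => - (phi p + eta e p)) p) <= CH cd * Y].
Proof.
move=> e0 er.
have mh1 : Ck 1 h1 by apply: CkZ; exact: Ck_dx.
have mh2 : Ck 1 h2 by apply: CkZ; exact: Ck_dy.
have ih : intg L (fun p => mod2 h1 h2 p * rho p ^+ 2 * ex (fun p => - (phi p + eta e p)) p).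
  apply: (intg_le _ _ (intgZ (expR 8 * 324 * cH cd) iY)).
    apply: measurable_funM.
      apply: measurable_funM; first by apply: meas_mod2; apply: cont_meas; exact: (Ck_cont (_ : Ck 1 _)).
      by apply: measurable_funX; exact: cont_meas (fd_rho_cont H).
    apply: meas_ex; apply: meas_opp; apply: measurable_funD; first exact: fd_meas H.
    exact: cont_meas (Ck_cont (ceta e)).
  by move=> p; have /andP[a b] := h_bound p e0 er; rewrite ger0_norm.
have dd p : dx P p - dy (fun _ : P2 => 0 : R) p = 2 * h1 p /\ dy P p + dx (fun _ : P2 => 0 : R) p = 2 * h2 p.
  by rewrite (dx_cst 0) (dy_cst 0) /h1 /h2; move: (dx P p) (dy P p) => *; split; field.
have le z := lap_eta z e0.
have [v1 [v2 [cv wv bv]]] := dbar_correct H (CkS (ceta e)) le (CkS cP) (Ck_cst 1 0) (Ck_cont mh1) (Ck_cont mh2) dd ih.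
exists v1, v2; split => //; apply: le_trans bv _.
apply: ler_wpM2l.
  apply: divr_ge0; last exact: ltW (cH_gt0 H).
  by apply: mulr_ge0; [exact: ler0n|exact: expR_ge0].
rewrite /Y -(IZ _ iY); apply: I_le => //; first exact: intgZ.
by move=> p; have /andP[] := h_bound p e0 er.
Qed.

(* [v1 l = Av e v1 l] and the weight [e ^ (4 Ek e r)], of order [(r / e) ^ 4] on the support of [al e], forces
   [Av e] of the correction [P - v1] to be O(e). *)
Lemma log_pole_function : exists v1 v2, [/\ CR v1 v2, wsq phi v1 v2 & v1 l != 0].
Proof.
have [Phi hPhi] := (fd_lbd H).2 (`|l| + r).
(* The constant for which the final Cauchy-Schwarz inequality reads [c0^2 <= c0^2 A0 e^2], absurd
   for small [e]. *)
pose A0 : R := c0^-1 * (10 * expR 8 * expR (2 * Phi) * r ^- 4 * (CH cd * Y)).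
have Y0 : 0 <= CH cd * Y.
  have c0 : 0 < cH cd by exact: cH_gt0 H.
  apply: mulr_ge0.
    by apply: divr_ge0; [apply: mulr_ge0; [exact: ler0n|exact: expR_ge0]|exact: ltW].
  apply: mulr_ge0; last by apply: I_ge0 => p; apply: mulr_ge0; [rewrite indicE ler0n|exact: ltW].
  by apply: mulr_ge0; [apply: mulr_ge0; [exact: expR_ge0|exact: ler0n]|exact: ltW].
have c00 : 0 < c0 :> R := c0_gt0.
have A00 : 0 <= A0.
  apply: mulr_ge0; first by rewrite invr_ge0 ltW.
  apply: mulr_ge0 => //; apply: mulr_ge0; last by rewrite invr_ge0 exprn_ge0// ltW.
  by apply: mulr_ge0; [apply: mulr_ge0; [exact: ler0n|exact: expR_ge0]|exact: expR_ge0].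
have [e [e0 er eA]] : exists e : R, [/\ 0 < e, e <= r / 2 & A0 * e ^+ 2 < 1].
  have A1 : 0 < (A0 + 1)^-1 by rewrite invr_gt0; lra.
  exists (Num.min (r / 2) (Num.min 1 (A0 + 1)^-1)); split.
  - by rewrite !lt_min ltr01 A1 !andbT divr_gt0.
  - by rewrite ge_min lexx.
  set e := Num.min _ _.
  have e1 : e <= 1 by rewrite !ge_min lexx orbT.
  have e2 : e <= (A0 + 1)^-1 by rewrite !ge_min lexx !orbT.
  have e3 : 0 < e by rewrite !lt_min ltr01 A1 !andbT divr_gt0.
  have e4 : e ^+ 2 <= (A0 + 1)^-1.
    by apply: le_trans e2; rewrite expr2 -[leRHS]mul1r ler_pM2r.
  have A2 : 0 < A0 + 1 by lra.
  rewrite -(ler_pM2l A2) divff ?lt0r_neq0// in e4.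
  have e5 : 0 < e ^+ 2 by rewrite exprn_gt0.
  by move: e4 e5; move: (e ^+ 2) => x; nra.
have er' : e <= r by lra.
have [v1 [v2 [cv wv bv]]] := corr e0 er.
have mphi := fd_meas H; have [mv1 mv2] := CR_meas cv.
have meta : meas (eta e) by exact: cont_meas (Ck_cont (ceta e)).
pose theta p := phi p + eta e p.
have mth : meas theta by exact: measurable_funD.
have mP : meas P by exact: cont_meas (Ck_cont cP).
have wP : wsq phi P (fun=> 0).
  split; [exact: mP|exact: measurable_cst|apply: lbd_intg; first exact: Leb_lfin].
    by apply: lbdM => //; apply: cont_lbd; apply: (Ck_cont (_ : Ck 2 _)); apply: mod2_Ck => //; exact: Ck_cst.
  by apply: csuppMl; apply: mod2_csupp => //; exists 0.
have wu : wsq phi (fun p => P p - v1 p) (fun p => 0 - v2 p).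
  have [mu1 mu2 iu] := wv; split => //; apply: (intg_le _ _ iu).
    by apply: measurable_funM => //; exact: meas_mod2.
  move=> p; have m0 : 0 <= mod2 (fun p => P p - v1 p) (fun p => 0 - v2 p) p by rewrite addr_ge0// sqr_ge0.
  rewrite ger0_norm; last by rewrite mulr_ge0// ltW.
  apply: ler_wpM2l => //; rewrite /ex ler_expR.
  by have := eta_le0 p e0 er'; lra.
exists v1, v2; split => //.
  have [s1 s2] := wsq_sqi mphi wP; have [t1 t2] := wsq_sqi mphi wu.
  apply: sqi_wsq => //.
    by have := sqiB s1 t1; congr (sqi L _); apply/funext => p; rewrite -mulrBl subKr.
  by have := sqiB s2 t2; congr (sqi L _); apply/funext => p; rewrite -mulrBl subKr.
apply/eqP => vl.
have [s1 s2] := wsq_sqi mth wv.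
(* Paired with [G], the function [(P - v1) e^-theta] gives the integral of [P - v1] against [al e].
   It equals [c0], because [P = 1] near [l] and the mean of [v1] is [v1 l], assumed to be 0. *)
pose G p := al e (p - l) * expR (theta p).
have cal : Ck 3 (fun p => al e (p - l)) by exact: Ck_shift (al_Ck e).
have sal : csupp (fun p => al e (p - l)) by apply: (csupp_shift (- l)); exact: al_csupp.
have lth : lbd (fun p => expR (theta p)).
  have := @ex_lbd _ (fun p => 2^-1 * theta p).
  have -> : ex (fun p => 2^-1 * theta p) = fun p => expR (theta p).
    by apply/funext => p; rewrite /ex mulrA mulfV ?mul1r.
  apply; apply: lbdM; first exact: cont_lbd (Ck_cont (Ck_cst 0 _)).
  by apply: lbdD; [exact: fd_lbd H|exact: cont_lbd (Ck_cont (ceta e))].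
have lG : lbd G by apply: lbdM => //; exact: cont_lbd (Ck_cont cal).
have sG : csupp G by exact: csuppMl.
have mG : meas G by have [] := lG.
have iG2 : intg L (fun p => G p ^+ 2).
  apply: lbd_intg; [exact: Leb_lfin| |].
    by have := lbdM lG lG; congr lbd; apply/funext => p; rewrite expr2.
  by have := csuppM G sG; congr csupp; apply/funext => p; rewrite expr2.
have CS := cauchy_schwarz2 s1 s2 (conj mG iG2 : sqi L G) (_ : sqi L (fun=> 0)).
have z0 : sqi L (fun _ : P2 => 0 : R).
  split; first exact: measurable_cst.
  by have := @intg0 _ _ _ L; congr (intg L _); apply/funext => p; rewrite expr0n.
move: (CS z0) => {CS z0}.
have -> : (fun x => (P x - v1 x) * expR (- theta x) * G x + (0 - v2 x) * expR (- theta x) * 0) =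
   (fun x => P x * al e (x - l) - v1 x * al e (x - l)).
  apply/funext => x; rewrite mulr0 addr0 /G; have := expRV theta x.
  move: (expR (theta x)) (expR (- theta x)) (P x) (v1 x) (al e _) => a b c d f h.
  by transitivity ((c - d) * f * (a * b)); [ring|rewrite h; ring].
have i1 : intg L (fun x => P x * al e (x - l)).
  by apply: (lint_mul (Ck_lint cP)) => //; exact: cont_lbd (Ck_cont cal).
have [cv1 cv2 _] := cv.
have i2 : intg L (fun x => v1 x * al e (x - l)).
  by apply: (lint_mul (Ck_lint cv1)) => //; exact: cont_lbd (Ck_cont cal).
rewrite (IB i1 i2).
have -> : I L (fun x => v1 x * al e (x - l)) = 0.
  have [fx _] := CR_fix e0 cv.
  have : Av e v1 l = 0 by rewrite fx.
  by rewrite /Av /conv => /eqP; rewrite mulf_eq0 invr_eq0 (negPf (lt0r_neq0 c00)) => /eqP.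
have -> : I L (fun x => P x * al e (x - l)) = c0.
  rewrite -(al_shift_mass l e0); congr (I L _); apply/funext => x.
  have [h|h] := lerP e (en (x - l)); first by rewrite al_out// mulr0.
  rewrite /P plat1 ?mul1r// -en_sq; have := en_ge0 (x - l); nra.
rewrite subr0.
have -> : (fun x => ((P x - v1 x) * expR (- theta x)) ^+ 2 + ((0 - v2 x) * expR (- theta x)) ^+ 2) =
   (fun p => mod2 (fun p => P p - v1 p) (fun p => 0 - v2 p) p * ex (fun p => - (phi p + eta e p)) p).
  apply/funext => x; rewrite (exN theta) /mod2.
  by move: (P x) (v1 x) (v2 x) (expR _) => *; ring.
have -> : (fun x => G x ^+ 2 + 0 ^+ 2) = (fun x => G x ^+ 2) by apply/funext => x; rewrite expr0n addr0.
have ia : intg L (fun p => al e (p - l)) by apply: al_shift_intg => //; exact: Leb_lfin.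
(* On the support of [al e] the pole makes [e^(2 theta)] of order [(e / r)^4], which beats the bound
   [10 / e^2] of the kernel. *)
have GB : I L (fun x => G x ^+ 2) <= 10 * expR 8 * expR (2 * Phi) * r ^- 4 * e ^+ 2 * c0.
  rewrite -(al_shift_mass l e0) -(IZ _ ia); apply: I_le => // [|p]; first exact: intgZ.
  have [h|h] := lerP e (en (p - l)); first by rewrite /G al_out// mul0r expr0n/= mulr0.
  have a0 := al_ge0 e (p - l); have a1 := al_le e (p - l).
  have -> : G p ^+ 2 = al e (p - l) * ex theta p * al e (p - l).
    by rewrite ex_sq /G; move: (al _ _) (expR _) => *; ring.
  apply: ler_wpM2r => //.
  have E : ex theta p <= expR 8 * expR (2 * Phi) * (e ^+ 4 * r ^- 4).
    have -> : e ^+ 4 * r ^- 4 = expR (4 * (ln e - ln r)).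
      have re : expR (ln e - ln r) = e / r by rewrite expRD expRN !lnK// posrE.
      by rewrite expRM_natl re expr_div_n.
    rewrite -!expRD /ex ler_expR /theta /eta.
    have := Ek_low e0 er' (ltW h).
    have : phi p <= Phi.
      apply: le_trans (ler_norm _) _; apply: hPhi; have /andP[k5 _] := en_norm (p - l).
      by have := ler_normD (p - l) l; rewrite subrK; lra.
    by move: (phi p) (Ek _ _ _) (ln e) (ln r) => *; lra.
  apply: (@le_trans _ _ (10 * e ^- 2 * (expR 8 * expR (2 * Phi) * (e ^+ 4 * r ^- 4)))).
    by apply: ler_pM => //; exact: ltW (ex_gt0 _ _).
  rewrite le_eqVlt; apply/orP; left; apply/eqP.
  by field; rewrite !lt0r_neq0.
have I0 : 0 <= I L (fun x => G x ^+ 2) by apply: I_ge0 => x; exact: sqr_ge0.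
have J0 : 0 <= I L (fun p => mod2 (fun p => P p - v1 p) (fun p => 0 - v2 p) p * ex (fun p => - (phi p + eta e p)) p).
  by apply: I_ge0 => x; rewrite mulr_ge0 ?(ltW (ex_gt0 _ _))// addr_ge0// sqr_ge0.
move=> CS; have := le_trans CS (ler_pM J0 I0 bv GB).
apply/negP; rewrite -ltNge.
have -> : CH cd * Y * (10 * expR 8 * expR (2 * Phi) * r ^- 4 * e ^+ 2 * c0) = c0 ^+ 2 * (A0 * e ^+ 2).
  by rewrite /A0; move: (CH cd * Y) => Z; field; rewrite !lt0r_neq0.
by rewrite -[ltRHS]mulr1 ltr_pM2l// exprn_gt0.
Qed.
End AtPoint.

Lemma nonvanishing l : exists v1 v2, [/\ CR v1 v2, wsq phi v1 v2 & v1 l != 0].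
Proof.
have c0 : 0 < cH cd by exact: cH_gt0 H.
(* The ratio for which [rho z <= k r] becomes [40 rho^2 <= cH r^2]. *)
have k0 : 0 < Num.sqrt (cH cd / 40) by rewrite sqrtr_gt0 divr_gt0// ltr0n.
have [r r0 hr] := rho_small l k0.
apply: (@log_pole_function l r) => // z hz.
have h := hr z hz; have p0 : 0 < rho z by exact: fd_rho0 H z.
have : rho z ^+ 2 <= (Num.sqrt (cH cd / 40) * r) ^+ 2.
  by rewrite ler_pXn2r// nnegrE ltW// mulr_gt0.
rewrite exprMn sqr_sqrtr; last by rewrite divr_ge0 ?ler0n// ltW.
by move: (rho z ^+ 2) (r ^+ 2) (cH cd) => x y u; lra.
Qed.
End LogPole.

(** * The Hankel operator *)

Section Products.
Context {R : realType}.
Local Notation P2 := (R * R)%type.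
Implicit Types (u v f g : P2 -> R).

Lemma CRD u1 u2 v1 v2 : CR u1 u2 -> CR v1 v2 -> CR (fun p => u1 p + v1 p) (fun p => u2 p + v2 p).
Proof.
move=> [a1 a2 a] [b1 b2 b]; split; [exact: CkD|exact: CkD|] => z.
rewrite (dxD a1 b1) (dyD a1 b1) (dxD a2 b2) (dyD a2 b2).
by rewrite (a z).1 (a z).2 (b z).1 (b z).2 opprD.
Qed.

Lemma CR_cst (a b : R) : CR (fun _ : P2 => a) (fun=> b).
Proof.
split; [exact: Ck_cst|exact: Ck_cst|] => z.
by rewrite (dx_cst a) (dy_cst b) (dy_cst a) (dx_cst b) oppr0.
Qed.

Lemma CR_mul u1 u2 v1 v2 : CR u1 u2 -> CR v1 v2 ->
  CR (fun p => u1 p * v1 p - u2 p * v2 p) (fun p => u1 p * v2 p + u2 p * v1 p).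
Proof.
move=> [a1 a2 a] [b1 b2 b].
have k1 := CkM a1 b1; have k2 := CkM a2 b2; have k3 := CkM a1 b2; have k4 := CkM a2 b1.
split; [exact: CkB|exact: CkD|] => z.
have e1 : (fun p => u1 p * v1 p - u2 p * v2 p) = (fun p => u1 p * v1 p + -1 * (u2 p * v2 p)).
  by apply/funext => p; rewrite mulN1r.
rewrite e1 (dxD k1 (CkZ _ k2)) (dyD k1 (CkZ _ k2)) (dxD k3 k4) (dyD k3 k4) (dxZ _ k2) (dyZ _ k2).
rewrite (dxM a1 b1) (dxM a2 b2) (dxM a1 b2) (dxM a2 b1) (dyM a1 b1) (dyM a2 b2) (dyM a1 b2) (dyM a2 b1).
rewrite (a z).1 (a z).2 (b z).1 (b z).2.
by move: (u1 z) (u2 z) (v1 z) (v2 z) (dy u1 z) (dy u2 z) (dy v1 z) (dy v2 z) => *; split; ring.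
Qed.
End Products.

(** * Inner product and norm for pairs *)

Section FockSpace.
Context {R : realType}.
Local Notation P2 := (R * R)%type.
Local Notation L := (@Leb R).
Implicit Types (p z l : P2) (u v f g : P2 -> R).
Variables (phi : P2 -> R).
Hypothesis mphi : meas phi.

Let E p := expR (- phi p).
Local Notation w := (ex (fun p => - phi p)).

(** The real part of the Hermitian inner product. The imaginary part is [ip] against [(- v2, v1)],
    that is, against [i v]. *)
Definition ip u1 u2 v1 v2 : R := I L (fun p => (u1 p * v1 p + u2 p * v2 p) * w p).
Definition nrm u1 u2 : R := I L (fun p => mod2 u1 u2 p * w p).
Definition Fk u1 u2 := CR u1 u2 /\ wsq phi u1 u2.

Lemma nrm_ge0 u1 u2 : 0 <= nrm u1 u2.
Proof. by apply: I_ge0 => p; rewrite mulr_ge0 ?(ltW (ex_gt0 _ _))// addr_ge0// sqr_ge0. Qed.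

Lemma ip_self u1 u2 : ip u1 u2 u1 u2 = nrm u1 u2.
Proof. by rewrite /ip /nrm /mod2; congr (I L _); apply/funext => p; rewrite !expr2. Qed.

Let ipE u1 u2 v1 v2 p : (u1 p * v1 p + u2 p * v2 p) * w p = u1 p * E p * (v1 p * E p) + u2 p * E p * (v2 p * E p).
Proof. by rewrite exN /E; move: (u1 p) (v1 p) (u2 p) (v2 p) (expR _) => *; ring. Qed.

Lemma ip_intg u1 u2 v1 v2 : wsq phi u1 u2 -> wsq phi v1 v2 ->
  intg L (fun p => (u1 p * v1 p + u2 p * v2 p) * w p).
Proof.
move=> /(wsq_sqi mphi) [a1 a2] /(wsq_sqi mphi) [b1 b2].
by have := intgD (sqiM a1 b1) (sqiM a2 b2); congr (intg L _); apply/funext => p; rewrite ipE.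
Qed.

Lemma ip_sym u1 u2 v1 v2 : ip u1 u2 v1 v2 = ip v1 v2 u1 u2.
Proof. by congr (I L _); apply/funext => p; rewrite (mulrC (u1 p)) (mulrC (u2 p)). Qed.

Lemma wsqDZ u1 u2 v1 v2 (c : R) : wsq phi u1 u2 -> wsq phi v1 v2 ->
  wsq phi (fun p => u1 p + c * v1 p) (fun p => u2 p + c * v2 p).
Proof.
move=> wu wv; have [mu1 mu2 _] := wu; have [mv1 mv2 _] := wv.
have [a1 a2] := wsq_sqi mphi wu; have [b1 b2] := wsq_sqi mphi wv.
apply: sqi_wsq => //.
- by apply: measurable_funD => //; apply: measurable_funM => //; exact: measurable_cst.
- by apply: measurable_funD => //; apply: measurable_funM => //; exact: measurable_cst.
- by have := sqiD a1 (sqiZ c b1); congr (sqi L _); apply/funext => p; rewrite mulrDl mulrA.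
- by have := sqiD a2 (sqiZ c b2); congr (sqi L _); apply/funext => p; rewrite mulrDl mulrA.
Qed.

Lemma wsqB u1 u2 v1 v2 : wsq phi u1 u2 -> wsq phi v1 v2 ->
  wsq phi (fun p => u1 p - v1 p) (fun p => u2 p - v2 p).
Proof.
move=> wu wv; have := wsqDZ (- 1) wu wv.
by congr (wsq phi _ _); apply/funext => p; rewrite mulN1r.
Qed.

Lemma ipDZ u1 u2 v1 v2 (c : R) t1 t2 : wsq phi u1 u2 -> wsq phi v1 v2 -> wsq phi t1 t2 ->
  ip (fun p => u1 p + c * v1 p) (fun p => u2 p + c * v2 p) t1 t2 = ip u1 u2 t1 t2 + c * ip v1 v2 t1 t2.
Proof.
move=> wu wv wt; have a := ip_intg wu wt; have b := ip_intg wv wt.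
rewrite /ip -(IZ c b) -(ID a (intgZ c b)); congr (I L _); apply/funext => p.
by move: (w p) (u1 p) (v1 p) (u2 p) (v2 p) => *; ring.
Qed.

Lemma ipB u1 u2 v1 v2 t1 t2 : wsq phi u1 u2 -> wsq phi v1 v2 -> wsq phi t1 t2 ->
  ip (fun p => u1 p - v1 p) (fun p => u2 p - v2 p) t1 t2 = ip u1 u2 t1 t2 - ip v1 v2 t1 t2.
Proof.
move=> wu wv wt; rewrite -mulN1r -(ipDZ (- 1) wu wv wt).
by congr (ip _ _ _ _); apply/funext => p; rewrite mulN1r.
Qed.

Lemma ip_CS u1 u2 v1 v2 : wsq phi u1 u2 -> wsq phi v1 v2 ->
  ip u1 u2 v1 v2 ^+ 2 <= nrm u1 u2 * nrm v1 v2.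
Proof.
move=> wu wv; have [a1 a2] := wsq_sqi mphi wu; have [b1 b2] := wsq_sqi mphi wv.
have NE t1 t2 : nrm t1 t2 = I L (fun p => (t1 p * E p) ^+ 2 + (t2 p * E p) ^+ 2).
  congr (I L _); apply/funext => p.
  by rewrite exN /E /mod2; move: (t1 p) (t2 p) (expR _) => *; ring.
rewrite !NE; apply: le_trans (cauchy_schwarz2 a1 a2 b1 b2).
by rewrite /ip le_eqVlt; apply/orP; left; apply/eqP; congr (I L _ ^+ 2); apply/funext => p; rewrite ipE.
Qed.

(** Multiplication by [i]. *)
Lemma wsq_rot u1 u2 : wsq phi u1 u2 -> wsq phi (fun p => - u2 p) u1.
Proof.
move=> [m1 m2 i]; split; [exact: meas_opp|by []|].
by have := i; congr (intg L _); apply/funext => p; rewrite /mod2 sqrrN addrC.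
Qed.

Lemma nrm_rot u1 u2 : nrm (fun p => - u2 p) u1 = nrm u1 u2.
Proof. by congr (I L _); apply/funext => p; rewrite /mod2 sqrrN addrC. Qed.

Lemma CR_rot u1 u2 : CR u1 u2 -> CR (fun p => - u2 p) u1.
Proof.
move=> h; have := CR_mul (CR_cst 0 1) h.
by congr CR; apply/funext => p; rewrite !mul0r ?add0r ?sub0r !mul1r.
Qed.

Lemma FkB u1 u2 v1 v2 : Fk u1 u2 -> Fk v1 v2 -> Fk (fun p => u1 p - v1 p) (fun p => u2 p - v2 p).
Proof.
move=> [cu wu] [cv wv]; split; last exact: wsqB.
have := CRD cu (CRZ (- 1) cv).
by congr CR; apply/funext => p; rewrite mulN1r.
Qed.

Lemma orthogonal_le u1 u2 v1 v2 : wsq phi u1 u2 -> wsq phi v1 v2 -> ip u1 u2 v1 v2 = 0 ->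
  nrm u1 u2 <= nrm (fun p => u1 p + v1 p) (fun p => u2 p + v2 p).
Proof.
move=> wu wv h.
have eD : (fun p => u1 p + v1 p) = (fun p => u1 p + 1 * v1 p) by apply/funext => p; rewrite mul1r.
have eD2 : (fun p => u2 p + v2 p) = (fun p => u2 p + 1 * v2 p) by apply/funext => p; rewrite mul1r.
rewrite eD eD2 -(ip_self (fun _ => _ + _)).
have ws := wsqDZ 1 wu wv.
rewrite (ipDZ 1 wu wv ws) ip_sym (ip_sym v1) (ipDZ 1 wu wv wu) (ipDZ 1 wu wv wv) h (ip_sym v1) h !ip_self.
by rewrite mulr0 addr0 add0r !mul1r lerDl nrm_ge0.
Qed.
End FockSpace.

(** * Orthogonal projection onto the Fock space *)

Section Projection.
Context {R : realType}.
Local Notation P2 := (R * R)%type.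
Local Notation L := (@Leb R).
Implicit Types (p z : P2) (u v f g : P2 -> R).
Variables (phi : P2 -> R).
Hypothesis lphi : lbd phi.
Variables (a1 a2 : P2 -> R).
Hypothesis wa : wsq phi a1 a2.

Let mphi : meas phi. Proof. by have [] := lphi. Qed.
Let E p := expR (- phi p).
Let F p := expR (phi p).
Let FE p : F p * E p = 1. Proof. exact: expRV. Qed.
Let Gr f g (l : R) := exists v1 v2, [/\ Fk phi v1 v2, f = (fun p => v1 p * E p), g = (fun p => v2 p * E p) & l = ip phi v1 v2 a1 a2].

Let lF : lbd F.
Proof.
have := @ex_lbd _ (fun p => 2^-1 * phi p).
have -> : ex (fun p => 2^-1 * phi p) = F by apply/funext => p; rewrite /ex mulrA mulfV ?mul1r.
by apply; apply: lbdM => //; exact: cont_lbd (Ck_cont (Ck_cst 0 _)).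
Qed.

(** A test function times [e^phi] is square integrable, [phi] being locally bounded, so convergence
    in the weighted space passes to pairings with tests. *)
Let weak_limit (v_ : nat -> P2 -> R) q g : L2lim L (fun n p => v_ n p * E p) q -> continuous g -> csupp g ->
  (I L (fun p => v_ n p * g p)) @[n --> \oo] --> I L (fun p => q p * F p * g p).
Proof.
move=> [_ h _] cg sg.
have sF : sqi L (fun p => F p * g p).
  have lFg : lbd (fun p => F p * g p) by apply: lbdM => //; exact: cont_lbd.
  split; first by have [] := lFg.
  apply: lbd_intg; [exact: Leb_lfin| |].
    by have := lbdM lFg lFg; congr lbd; apply/funext => p; rewrite expr2.
  by have := csuppM (fun p => F p * g p) (csuppM F sg); congr csupp; apply/funext => p; rewrite expr2.
have := h _ sF.
have -> : (fun n => I L (fun p => v_ n p * E p * (F p * g p))) = (fun n => I L (fun p => v_ n p * g p)).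
  apply/funext => n; congr (I L _); apply/funext => p; have := FE p.
  by move: (F p) (E p) (v_ n p) (g p) => b c d e h1; transitivity (d * e * (b * c)); [ring|rewrite h1 mulr1].
have -> : (fun p => q p * F p * g p) = (fun p => q p * (F p * g p)) by apply/funext => p; rewrite mulrA.
by [].
Qed.

(** The pairing with [a] is represented by a limit of Fock functions. That limit is weakly
    holomorphic, hence almost everywhere equal to a holomorphic pair. Boundedness of the Hankel
    operator is stated for any projection [u], so existence of one is what makes it usable. *)
Lemma Fock_projection : exists u1 u2, Fk phi u1 u2 /\
  forall v1 v2, Fk phi v1 v2 -> ip phi (fun p => a1 p - u1 p) (fun p => a2 p - u2 p) v1 v2 = 0.
Proof.
have Gr_sqi f g l : Gr f g l -> sqi L f /\ sqi L g.
  by move=> [v1 [v2 [[_ wv] -> -> _]]]; exact: wsq_sqi.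
have w0 : wsq phi (fun=> 0) (fun=> 0).
  split; [exact: measurable_cst|exact: measurable_cst|].
  by have := @intg0 _ _ _ L; congr (intg L _); apply/funext => p; rewrite /mod2 expr0n addr0 mul0r.
have Gr0 : Gr (fun=> 0) (fun=> 0) 0.
  exists (fun=> 0), (fun=> 0); split.
  - by split => //; exact: CR_cst.
  - by apply/funext => p; rewrite mul0r.
  - by apply/funext => p; rewrite mul0r.
  - by rewrite /ip -[LHS](@I0 _ _ _ L); congr (I L _); apply/funext => p; rewrite !mul0r addr0 mul0r.
have Gr_lin f g l f' g' l' (c : R) : Gr f g l -> Gr f' g' l' ->
    Gr (fun x => f x + c * f' x) (fun x => g x + c * g' x) (l + c * l').
  move=> [v1 [v2 [[cv wv] -> -> ->]]] [t1 [t2 [[ct wt] -> -> ->]]].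
  exists (fun p => v1 p + c * t1 p), (fun p => v2 p + c * t2 p); split.
  - by split; [exact: CRD cv (CRZ c ct)|exact: wsqDZ].
  - by apply/funext => p; rewrite mulrDl mulrA.
  - by apply/funext => p; rewrite mulrDl mulrA.
  - by rewrite ipDZ.
have Gr_bound f g l : Gr f g l -> l ^+ 2 <= nrm phi a1 a2 * (I L (fun x => f x ^+ 2) + I L (fun x => g x ^+ 2)).
  move=> [v1 [v2 [[cv wv] -> -> ->]]]; rewrite mulrC.
  have [s1 s2] := wsq_sqi mphi wv.
  rewrite -(ID s1.2 s2.2); apply: le_trans (ip_CS mphi wv wa) _.
  rewrite le_eqVlt; apply/orP; left; apply/eqP; congr (_ * _); congr (I L _); apply/funext => p.
  by rewrite exN /E /mod2 !exprMn mulrDl.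
have [q1 [q2 [v1 [v2 [rep _ hv l1 l2]]]]] := riesz_graph Gr_sqi Gr0 Gr_lin (nrm_ge0 phi a1 a2) Gr_bound.
pose t1 n p := v1 n p * F p; pose t2 n p := v2 n p * F p.
have ht n : Fk phi (t1 n) (t2 n).
  have [l [x [y [h1 h2 h3 _]]]] := hv n.
  have tE c : (fun p => c p * E p * F p) = c by apply/funext => p; rewrite -mulrA (mulrC (E p)) FE mulr1.
  by rewrite /t1 /t2 h2 h3 !tE.
have tE (c : nat -> P2 -> R) : c = (fun n p => c n p * F p * E p).
  by apply/funext => n; apply/funext => p; rewrite -mulrA FE mulr1.
rewrite (tE v1) in l1; rewrite (tE v2) in l2.
have mF : meas F by have [] := lF.
pose u1 p := q1 p * F p; pose u2 p := q2 p * F p.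
have [sq1 _ _] := l1; have [sq2 _ _] := l2.
have mu1 : meas u1 by apply: measurable_funM => //; have [] := sq1.
have mu2 : meas u2 by apply: measurable_funM => //; have [] := sq2.
have uE q : (fun p => q p * F p * expR (- phi p)) = q by apply/funext => p; rewrite -mulrA FE mulr1.
have su1 : sqi L (fun p => u1 p * expR (- phi p)) by rewrite uE.
have su2 : sqi L (fun p => u2 p * expR (- phi p)) by rewrite uE.
have wu : wsq phi u1 u2 by exact: sqi_wsq.
have lu1 : lint L u1 by exact: lint_of_sq lphi su1 mu1.
have lu2 : lint L u2 by exact: lint_of_sq lphi su2 mu2.
have wh : whol u1 u2.
  move=> g cg sg; have cx := Ck_dx cg; have cy := Ck_dy cg.
  have tst u c : lint L u -> Ck 1 c -> csupp c -> intg L (fun p => u p * c p) by exact: test_intg.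
  have sx := csupp_dx sg; have sy := csupp_dy sg.
  have T1 n : lint L (t1 n) by have [[c _ _] _] := ht n; exact: Ck_lint c.
  have T2 n : lint L (t2 n) by have [[_ c _] _] := ht n; exact: Ck_lint c.
  have an n : annih (t1 n) (t2 n) g by have [c _] := ht n; exact: CR_annih c (CkS cg) sg.
  have cg1 := Ck_cont cx; have cg2 := Ck_cont cy.
  split.
    rewrite (IB (tst _ _ lu1 cx sx) (tst _ _ lu2 cy sy)).
    have A := weak_limit l1 cg1 sx; have B := weak_limit l2 cg2 sy.
    have C : (I L (fun p => t1 n p * dx g p) - I L (fun p => t2 n p * dy g p)) @[n --> \oo] --> I L (fun p => u1 p * dx g p) - I L (fun p => u2 p * dy g p) by exact: cvgB A B.
    have Z : (fun n => I L (fun p => t1 n p * dx g p) - I L (fun p => t2 n p * dy g p)) = (fun=> 0).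
      by apply/funext => n; rewrite -(IB (tst _ _ (T1 n) cx sx) (tst _ _ (T2 n) cy sy)); have [] := an n.
    by rewrite Z in C; exact: (@cvg_unique _ _ _ _ _ _ C (cvg_cst _)).
  rewrite (ID (tst _ _ lu1 cy sy) (tst _ _ lu2 cx sx)).
  have A := weak_limit l1 cg2 sy; have B := weak_limit l2 cg1 sx.
  have C : (I L (fun p => t1 n p * dy g p) + I L (fun p => t2 n p * dx g p)) @[n --> \oo] --> I L (fun p => u1 p * dy g p) + I L (fun p => u2 p * dx g p) by exact: cvgD A B.
  have Z : (fun n => I L (fun p => t1 n p * dy g p) + I L (fun p => t2 n p * dx g p)) = (fun=> 0).
    by apply/funext => n; rewrite -(ID (tst _ _ (T1 n) cy sy) (tst _ _ (T2 n) cx sx)); have [] := an n.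
  by rewrite Z in C; exact: (@cvg_unique _ _ _ _ _ _ C (cvg_cst _)).
have [cA ae1 ae2] := weyl lu1 lu2 wh.
have [mA1 mA2] := CR_meas cA.
have [wA _] := wsq_ae mphi ae1 ae2 mA1 mA2 wu.
exists (Av 1 u1), (Av 1 u2); split => // x1 x2 Fx; have [cx wx] := Fx.
have [mx1 mx2] := CR_meas cx.
rewrite (ipB mphi wa wA wx); apply/eqP; rewrite subr_eq0; apply/eqP.
have -> : ip phi (Av 1 u1) (Av 1 u2) x1 x2 = ip phi u1 u2 x1 x2.
  symmetry; apply: I_ae_eq.
  - by apply: filterS2 ae1 ae2 => p -> ->.
  - exact: (@intg_meas _ _ _ L _ (ip_intg mphi wu wx)).
  - exact: (@intg_meas _ _ _ L _ (ip_intg mphi wA wx)).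
have g0 : Gr (fun p => x1 p * E p) (fun p => x2 p * E p) (ip phi x1 x2 a1 a2) by exists x1, x2.
rewrite ip_sym -(rep _ _ _ g0).
have [y1 y2] := wsq_sqi mphi wx.
rewrite -(ID (sqiM sq1 y1) (sqiM sq2 y2)); congr (I L _); apply/funext => p.
rewrite exN /u1 /u2 -/(E p); have := FE p; move: (F p) (E p) (q1 p) (q2 p) (x1 p) (x2 p) => b c d e f g h1.
by transitivity ((d * f + e * g) * c * (b * c)); [rewrite h1; ring|ring].
Qed.
End Projection.

(** * The two implications for pairs *)

Section Hankel.
Context {R : realType}.
Local Notation P2 := (R * R)%type.
Local Notation L := (@Leb R).
Implicit Types (p z l : P2) (u v f g : P2 -> R).
Variables (phi : P2 -> R) (mu : {measure set P2 -> \bar R}) (rho : P2 -> R) (cd : R).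
Hypothesis H : fock_data phi mu rho cd.
Variables (g1 g2 : P2 -> R).
Hypothesis cg : CR g1 g2.

(* conj(g) f = (cm1 f, cm2 f) *)
Definition cm1 f1 f2 p := g1 p * f1 p + g2 p * f2 p.
Definition cm2 f1 f2 p := g1 p * f2 p - g2 p * f1 p.

Let mphi : meas phi. Proof. exact: fd_meas H. Qed.

Lemma hankel_sufficient f1 f2 u1 u2 (M : R) : Fk phi f1 f2 -> wsq phi (cm1 f1 f2) (cm2 f1 f2) ->
  (forall p, mod2 (dx g1) (dx g2) p * rho p ^+ 2 <= M) -> Fk phi u1 u2 ->
  (forall v1 v2, Fk phi v1 v2 -> ip phi (fun p => cm1 f1 f2 p - u1 p) (fun p => cm2 f1 f2 p - u2 p) v1 v2 = 0) ->
  nrm phi (fun p => cm1 f1 f2 p - u1 p) (fun p => cm2 f1 f2 p - u2 p) <= CH cd * M * nrm phi f1 f2.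
Proof.
move=> [cf wf] wc bnd Fu orth; have [cu wu] := Fu.
have [v1 [v2 [cv wv wr bv]]] := hankel_upper H cg cf wf wc bnd.
apply: le_trans bv; have Fv : Fk phi v1 v2 by [].
have Fuv := FkB mphi Fu Fv.
have := orthogonal_le mphi (wsqB mphi wc wu) Fuv.2 (orth _ _ Fuv).
by congr (_ <= _); congr (nrm _ _ _); apply/funext => p; rewrite addrA subrK.
Qed.

Variables (K1 K2 : P2 -> P2 -> R).
Hypothesis FK : forall z, Fk phi (K1 z) (K2 z).
Hypothesis rep : forall z f1 f2, Fk phi f1 f2 ->
  f1 z = ip phi f1 f2 (K1 z) (K2 z) /\ f2 z = ip phi f1 f2 (fun p => - K2 z p) (K1 z).
Hypothesis wgK : forall z, wsq phi (cm1 (K1 z) (K2 z)) (cm2 (K1 z) (K2 z)).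
Variable M : R.
Hypothesis bnd : forall z u1 u2, Fk phi u1 u2 ->
  (forall v1 v2, Fk phi v1 v2 ->
    ip phi (fun p => cm1 (K1 z) (K2 z) p - u1 p) (fun p => cm2 (K1 z) (K2 z) p - u2 p) v1 v2 = 0) ->
  nrm phi (fun p => cm1 (K1 z) (K2 z) p - u1 p) (fun p => cm2 (K1 z) (K2 z) p - u2 p) <= M * nrm phi (K1 z) (K2 z).

(** [g K_z] has the same modulus as [conj(g) K_z], so it is a Fock function and the reproducing
    property applies to it. *)
Let FgK z : Fk phi (fun p => g1 p * K1 z p - g2 p * K2 z p) (fun p => g1 p * K2 z p + g2 p * K1 z p).
Proof.
have [cK wK] := FK z; have cm := CR_mul cg cK; split => //.
have [m1 m2] := CR_meas cm; have [_ _ i] := wgK z; split => //.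
have := i; congr (intg L _); apply/funext => p; rewrite /mod2 /cm1 /cm2.
by move: (g1 p) (g2 p) (K1 z p) (K2 z p) (ex _ p) => *; ring.
Qed.

Let FkRot u1 u2 : Fk phi u1 u2 -> Fk phi (fun p => - u2 p) u1.
Proof. by move=> [cu wu]; split; [exact: CR_rot|exact: wsq_rot]. Qed.

Lemma kernel_sym l z : K1 l z = K1 z l /\ K2 l z = - K2 z l.
Proof.
have [-> ->] := rep z (FK l); split; first by rewrite ip_sym -(rep l (FK z)).1.
by rewrite ip_sym -(rep l (FkRot (FK z))).1.
Qed.

(* <conj g k_l, k_z> is the conjugate of <g k_z, k_l> = g(l) k_z(l). *)
Lemma projection_of_kernel l u1 u2 : Fk phi u1 u2 ->
  (forall v1 v2, Fk phi v1 v2 ->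
    ip phi (fun p => cm1 (K1 l) (K2 l) p - u1 p) (fun p => cm2 (K1 l) (K2 l) p - u2 p) v1 v2 = 0) ->
  u1 = (fun z => g1 l * K1 l z + g2 l * K2 l z) /\ u2 = (fun z => g1 l * K2 l z - g2 l * K1 l z).
Proof.
move=> Fu orth; have [cu wu] := Fu.
have eqip v1 v2 : Fk phi v1 v2 -> ip phi u1 u2 v1 v2 = ip phi (cm1 (K1 l) (K2 l)) (cm2 (K1 l) (K2 l)) v1 v2.
  move=> Fv; have := orth _ _ Fv; rewrite (ipB mphi (wgK l) wu Fv.2) => /eqP.
  by rewrite subr_eq0 => /eqP.
split; apply/funext => z.
  have [-> _] := rep z Fu; rewrite (eqip _ _ (FK z)).
  have -> : ip phi (cm1 (K1 l) (K2 l)) (cm2 (K1 l) (K2 l)) (K1 z) (K2 z) =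
    ip phi (fun p => g1 p * K1 z p - g2 p * K2 z p) (fun p => g1 p * K2 z p + g2 p * K1 z p) (K1 l) (K2 l).
    congr (I L _); apply/funext => p; rewrite /cm1 /cm2.
    by move: (g1 p) (g2 p) (K1 z p) (K2 z p) (K1 l p) (K2 l p) (ex _ p) => *; ring.
  rewrite -(rep l (FgK z)).1; have [-> ->] := kernel_sym l z.
  by move: (g1 l) (g2 l) (K1 z l) (K2 z l) => *; ring.
have [_ ->] := rep z Fu; rewrite (eqip _ _ (FkRot (FK z))).
have -> : ip phi (cm1 (K1 l) (K2 l)) (cm2 (K1 l) (K2 l)) (fun p => - K2 z p) (K1 z) =
  ip phi (fun p => - (g1 p * K2 z p + g2 p * K1 z p)) (fun p => g1 p * K1 z p - g2 p * K2 z p) (K1 l) (K2 l).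
  congr (I L _); apply/funext => p; rewrite /cm1 /cm2.
  by move: (g1 p) (g2 p) (K1 z p) (K2 z p) (K1 l p) (K2 l p) (ex _ p) => *; ring.
rewrite -(rep l (FkRot (FgK z))).1; have [-> ->] := kernel_sym l z.
by move: (g1 l) (g2 l) (K1 z l) (K2 z l) => *; ring.
Qed.

(** [K(l, l)] is the squared norm of [K_l]. Were it 0, every Fock function would vanish at [l] by
    Cauchy-Schwarz, against [nonvanishing]. *)
Lemma kernel_diag l : [/\ K2 l l = 0, K1 l l = nrm phi (K1 l) (K2 l) & 0 < K1 l l].
Proof.
have e1 : K1 l l = nrm phi (K1 l) (K2 l) by rewrite (rep l (FK l)).1 ip_self.
have [_ h2] := kernel_sym l l; split => //; first by move: h2; move: (K2 l l) => x; lra.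
rewrite lt0r e1 nrm_ge0 andbT; apply/eqP => n0.
have [v1 [v2 [cv wv vl]]] := nonvanishing H l.
have [e2 _] := rep l (conj cv wv : Fk phi v1 v2).
have := ip_CS mphi wv (FK l).2; rewrite n0 mulr0 -e2 => h.
by move: vl; rewrite -sqrf_eq0 eq_le h sqr_ge0.
Qed.

(** The factor 2 appears because the real and imaginary parts of [f(l)] are estimated separately. *)
Lemma hankel_necessary l : mod2 (dx g1) (dx g2) l * rho l ^+ 2 <= 2 * CN cd * M.
Proof.
have [u1 [u2 [Fu orth]]] := Fock_projection (fd_lbd H) (wgK l).
have := bnd Fu orth; have [-> ->] := projection_of_kernel Fu orth => hM.
pose q1 z := (g1 z - g1 l) * K1 l z - (g2 z - g2 l) * K2 l z.
pose q2 z := (g1 z - g1 l) * K2 l z + (g2 z - g2 l) * K1 l z.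
have [cK wK] := FK l; have [k1 k2 _] := cK; have [c1 c2 hg] := cg.
have cg' : CR (fun z => g1 z - g1 l) (fun z => g2 z - g2 l) by exact: CRD cg (CR_cst _ _).
have cq : CR q1 q2 by exact: CR_mul cg' cK.
have [mq1 mq2] := CR_meas cq.
have Nq : nrm phi q1 q2 <= M * nrm phi (K1 l) (K2 l).
  apply: le_trans hM; rewrite le_eqVlt; apply/orP; left; apply/eqP; congr (I L _); apply/funext => p.
  rewrite /mod2 /q1 /q2 /cm1 /cm2.
  by move: (g1 p) (g2 p) (K1 l p) (K2 l p) (g1 l) (g2 l) (ex _ p) => *; ring.
have wq : wsq phi q1 q2.
  (* [g(l) K_l] is written as [K_l + (g1 l - 1) K_l + g2 l (i K_l)]. *)
  have := wsqB mphi (FgK l).2 (wsqDZ mphi (g2 l) (wsqDZ mphi (g1 l - 1) wK wK) (wsq_rot wK)).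
  by congr (wsq phi _ _); apply/funext => p; rewrite /q1 /q2; move: (g1 p) (g2 p) (K1 l p) (K2 l p) (g1 l) (g2 l) => *; ring.
have [f1 [f2 [cf f1l f2l qf]]] := CR_divide l cq.
have ql1 : q1 l = 0 by rewrite /q1 !subrr !mul0r subrr.
have ql2 : q2 l = 0 by rewrite /q2 !subrr !mul0r addr0.
have qf' z : q1 z = (z.1 - l.1) * f1 z - (z.2 - l.2) * f2 z /\ q2 z = (z.1 - l.1) * f2 z + (z.2 - l.2) * f1 z.
  by have := qf z; rewrite ql1 ql2 !subr0.
have [wf Nf] := local_estimate H cf wq qf'.
have Ff : Fk phi f1 f2 by [].
have [K20 K1n K10] := kernel_diag l.
have d1 : f1 l = dx g1 l * K1 l l.
  rewrite f1l; have s1 := cg'; have [a1 a2 _] := s1.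
  have e1 : q1 = (fun z => (g1 z - g1 l) * K1 l z + -1 * ((g2 z - g2 l) * K2 l z)) by apply/funext => z; rewrite mulN1r.
  rewrite e1 (dxD (CkM a1 k1) (CkZ _ (CkM a2 k2))) (dxZ _ (CkM a2 k2)) (dxM a1 k1) (dxM a2 k2).
  rewrite (dxD c1 (Ck_cst 1 _)) dx_cst K20.
  by move: (g1 l) (g2 l) (dx (K1 l) l) (dx (K2 l) l) (dx g1 l) (dx _ l) (K1 l l) => *; ring.
have d2 : f2 l = dx g2 l * K1 l l.
  rewrite f2l; have s1 := cg'; have [a1 a2 _] := s1.
  rewrite (dxD (CkM a1 k2) (CkM a2 k1)) (dxM a1 k2) (dxM a2 k1).
  rewrite (dxD c2 (Ck_cst 1 _)) dx_cst K20.
  by move: (g1 l) (g2 l) (dx (K1 l) l) (dx (K2 l) l) (dx g2 l) (dx _ l) (K1 l l) => *; ring.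
have b1 : f1 l ^+ 2 <= nrm phi f1 f2 * K1 l l.
  by rewrite {1}(rep l Ff).1 K1n; exact: ip_CS.
have b2 : f2 l ^+ 2 <= nrm phi f1 f2 * K1 l l.
  rewrite {1}(rep l Ff).2 K1n -(nrm_rot phi (K1 l)).
  by apply: ip_CS => //; exact: wsq_rot.
have sqk (x k : R) : (x * k) ^+ 2 = x ^+ 2 * k * k by ring.
rewrite d1 sqk ler_pM2r// in b1; rewrite d2 sqk ler_pM2r// in b2.
have r2 : 0 < rho l ^+ 2 by rewrite exprn_gt0// (fd_rho0 H).
have CN0 : 0 <= CN cd.
  apply: addr_ge0; last exact: ler0n.
  by apply: mulr_ge0; [exact: ler0n|exact: expR_ge0].
have CNr : 0 <= CN cd / rho l ^+ 2 by rewrite divr_ge0// ltW.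
have Nf' : nrm phi f1 f2 <= CN cd / rho l ^+ 2 * (M * K1 l l).
  by apply: le_trans Nf _; apply: ler_wpM2l => //; rewrite K1n.
rewrite -(ler_pM2r K10).
have e1 : CN cd / rho l ^+ 2 * (M * K1 l l) * rho l ^+ 2 = CN cd * M * K1 l l.
  by move: (rho l ^+ 2) r2 (K1 l l) (CN cd) => x x0 *; field; rewrite lt0r_neq0.
rewrite -(ler_pM2r r2) e1 in Nf'; rewrite -(ler_pM2r r2) in b1; rewrite -(ler_pM2r r2) in b2.
move: Nf' b1 b2; rewrite /mod2.
move: (rho l ^+ 2) (K1 l l) (CN cd) (nrm _ _ _) (dx g1 l) (dx g2 l) => *; lra.
Qed.
End Hankel.

(** * Complex functions as pairs *)

Section Complex.
Context {R : realType}.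
Local Notation C := R[i].
Local Notation P2 := (R * R)%type.
Local Notation L := (@Leb R).
Implicit Types (p q : P2) (z h : C) (F G : C -> C).

Definition toP z : P2 := (complex.Re z, complex.Im z).
Definition re F p : R := complex.Re (F (toC p)).
Definition im F p : R := complex.Im (F (toC p)).
Definition pairC (u v : P2 -> R) z : C := (u (toP z) +i* v (toP z))%C.

Lemma toCK p : toP (toC p) = p. Proof. by case: p. Qed.
Lemma toPK z : toC (toP z) = z. Proof. by case: z. Qed.

Lemma re_pairC u v : re (pairC u v) = u.
Proof. by apply/funext => p; rewrite /re /= toCK. Qed.

Lemma im_pairC u v : im (pairC u v) = v.
Proof. by apply/funext => p; rewrite /im /= toCK. Qed.

Lemma ReD z h : complex.Re (z + h) = complex.Re z + complex.Re h. Proof. by case: z; case: h. Qed.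
Lemma ImD z h : complex.Im (z + h) = complex.Im z + complex.Im h. Proof. by case: z; case: h. Qed.
Lemma ReN z : complex.Re (- z) = - complex.Re z. Proof. by case: z. Qed.
Lemma ImN z : complex.Im (- z) = - complex.Im z. Proof. by case: z. Qed.
Lemma ReM z h : complex.Re (z * h) = complex.Re z * complex.Re h - complex.Im z * complex.Im h.
Proof. by case: z; case: h. Qed.
Lemma ImM z h : complex.Im (z * h) = complex.Re z * complex.Im h + complex.Im z * complex.Re h.
Proof. by case: z; case: h. Qed.
Lemma ReJ z : complex.Re (z^*)%C = complex.Re z. Proof. by case: z. Qed.
Lemma ImJ z : complex.Im (z^*)%C = - complex.Im z. Proof. by case: z. Qed.
Definition ReImE := (ReD, ImD, ReN, ImN, ReM, ImM, ReJ, ImJ).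

Lemma toP_sub z h : toP (z - h) = toP z - toP h.
Proof. by rewrite /toP !ReImE. Qed.

Lemma toP_add z h : toP (z + h) = toP z + toP h.
Proof. by rewrite /toP !ReImE. Qed.

Lemma cabsE z : cabs z = en (toP z). Proof. by []. Qed.

Lemma cabs_sq z : cabs z ^+ 2 = complex.Re z ^+ 2 + complex.Im z ^+ 2.
Proof. by rewrite cabsE en_sq. Qed.

Lemma cabsM z h : cabs (z * h) = cabs z * cabs h.
Proof.
rewrite /cabs -sqrtrM ?addr_ge0 ?sqr_ge0// !ReImE; congr Num.sqrt.
by move: (complex.Re z) (complex.Im z) (complex.Re h) (complex.Im h) => *; ring.
Qed.

Lemma cabs_ge0 z : 0 <= cabs z. Proof. exact: sqrtr_ge0. Qed.

Lemma cabs_eq0 z : (cabs z == 0) = (z == 0).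
Proof.
apply/idP/idP => [/eqP h|/eqP ->]; last by rewrite cabsE /toP/= en0.
have := cabs_sq z; rewrite h expr0n /= => /esym/eqP; rewrite paddr_eq0 ?sqr_ge0// !sqrf_eq0.
by case: z h => a b _ /andP[/eqP /= -> /eqP /= ->].
Qed.

Lemma cabs_gt0 z : (0 < cabs z) = (z != 0).
Proof. by rewrite lt0r cabs_eq0 cabs_ge0 andbT. Qed.

Lemma discE p r : disc (toC p) r = D p r.
Proof. by apply/seteqP; split => q; rewrite /disc /D /= cabsE toP_sub !toCK. Qed.

(** The complex derivative is measured with the modulus, the expansion with the maximum norm; the
    factor 2 between these norms accounts for [e / 2] and [r / 2]. *)
Lemma has_cderiv_cdiff F z d : has_cderiv F z d -> forall e : R, 0 < e -> exists2 r : R, 0 < r &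
  forall q, `|q - toP z| < r ->
  `|re F q - (re F (toP z) + (complex.Re d * (q.1 - (toP z).1) - complex.Im d * (q.2 - (toP z).2)))| <= e * `|q - toP z| /\
  `|im F q - (im F (toP z) + (complex.Im d * (q.1 - (toP z).1) + complex.Re d * (q.2 - (toP z).2)))| <= e * `|q - toP z|.
Proof.
move=> hd e e0; have e2 : 0 < e / 2 by rewrite divr_gt0.
have [r [r0 hr]] := hd _ e2; exists (r / 2); first by rewrite divr_gt0.
move=> q hq; pose h := toC (q - toP z).
have qE : toC q = z + h by rewrite -(toPK (z + h)) toP_add /h toCK addrC subrK.
pose X := F (z + h) - F z - d * h.
have hX : cabs X <= e * `|q - toP z|.
  have [h0|h0] := eqVneq h 0.
    by rewrite /X h0 addr0 subrr mulr0 subr0 cabsE /toP/= en0 mulr_ge0// ltW.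
  have hp : 0 < cabs h by rewrite cabs_gt0.
  have /andP[_ n2] := en_norm (q - toP z).
  have hl : 0 < cabs h < r by rewrite hp cabsE toCK; lra.
  have := hr h hl; have -> : (F (z + h) - F z) / h - d = X / h by rewrite /X [RHS]mulrBl mulfK.
  have XE : cabs X = cabs (X / h) * cabs h by rewrite -cabsM divfK.
  rewrite XE => hx; apply: (@le_trans _ _ (e / 2 * (2 * `|q - toP z|))); last by rewrite mulrA divfK.
  by apply: ler_pM; [exact: cabs_ge0|exact: cabs_ge0|exact: hx|rewrite cabsE toCK].
have /andP[nX _] := en_norm (toP X); move: nX; rewrite norm_le2 -cabsE => /andP[x1 x2].
have hr1 : complex.Re h = q.1 - (toP z).1 by [].
have hi1 : complex.Im h = q.2 - (toP z).2 by [].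
have a1 : (toP X).1 = re F q - (re F (toP z) + (complex.Re d * (q.1 - (toP z).1) - complex.Im d * (q.2 - (toP z).2))).
  rewrite -[LHS]/(complex.Re X) -hr1 -hi1.
  have -> : re F q = complex.Re (F (z + h)) by rewrite /re qE.
  have -> : re F (toP z) = complex.Re (F z) by rewrite /re toPK.
  rewrite /X !ReImE; move: (complex.Re d) (complex.Im d) (complex.Re h) (complex.Im h) => *; ring.
have a2 : (toP X).2 = im F q - (im F (toP z) + (complex.Im d * (q.1 - (toP z).1) + complex.Re d * (q.2 - (toP z).2))).
  rewrite -[LHS]/(complex.Im X) -hr1 -hi1.
  have -> : im F q = complex.Im (F (z + h)) by rewrite /im qE.
  have -> : im F (toP z) = complex.Im (F z) by rewrite /im toPK.
  rewrite /X !ReImE; move: (complex.Re d) (complex.Im d) (complex.Re h) (complex.Im h) => *; ring.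
by rewrite -a1 -a2; split; exact: le_trans hX.
Qed.

Lemma cdiff_cont (f1 f2 : P2 -> R) p : cdiff f1 f2 p -> {for p, continuous f1} /\ {for p, continuous f2}.
Proof.
move=> [a [b h]].
have [d d0 hd] := h 1 ltr01; pose N := `|a| + `|b| + 1.
have N0 : 0 < N by rewrite /N ltr_wpDl.
have bd q : `|q - p| < d -> `|f1 q - f1 p| <= N * `|q - p| /\ `|f2 q - f2 p| <= N * `|q - p|.
  move=> hq; have [x y] := hd q hq.
  have := lexx `|q - p|; rewrite {1}norm_le2 => /andP[q1 q2].
  have A (s t : R) : `|s| <= `|q - p| -> `|t| <= `|q - p| -> `|a * s| + `|b * t| <= (`|a| + `|b|) * `|q - p|.
    by move=> hs ht; rewrite !normrM mulrDl lerD// ler_wpM2l.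
  split; rewrite ler_norml.
    move: x (A _ _ q1 q2); rewrite /N ler_norml => /andP[x1 x2].
    have := ler_norm (a * (q - p).1); have := ler_norm (- (a * (q - p).1)); rewrite normrN.
    have := ler_norm (b * (q - p).2); have := ler_norm (- (b * (q - p).2)); rewrite normrN.
    by move: x1 x2 => /=; move: `|_ * _| `|_ * _| `|_| => *; lra.
  move: y (A _ _ q2 q1); rewrite /N ler_norml => /andP[x1 x2].
  have := ler_norm (a * (q - p).2); have := ler_norm (- (a * (q - p).2)); rewrite normrN.
  have := ler_norm (b * (q - p).1); have := ler_norm (- (b * (q - p).1)); rewrite normrN.
  by move: x1 x2 => /=; move: `|_ * _| `|_ * _| `|_| => *; lra.
have key (f : P2 -> R) : (forall q, `|q - p| < d -> `|f q - f p| <= N * `|q - p|) -> {for p, continuous f}.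
  move=> hf; apply: eps_cont => e e0; exists (Num.min d (e / N)); first by rewrite lt_min d0 divr_gt0.
  move=> q; rewrite lt_min ltr_pdivlMr// => /andP[q1 q2].
  by apply: le_lt_trans (hf q q1) _; rewrite mulrC.
by split; apply: key => q /bd[].
Qed.

(** Both expansions are compared at a horizontal displacement [t]; dividing by [t] leaves [2 e].
    This identifies the given derivative [dg] with [dx]. *)
Lemma cdiff_unique (f1 f2 : P2 -> R) p (a b a' b' : R) :
  (forall e : R, 0 < e -> exists2 d : R, 0 < d & forall q, `|q - p| < d ->
    `|f1 q - (f1 p + (a * (q.1 - p.1) - b * (q.2 - p.2)))| <= e * `|q - p| /\
    `|f2 q - (f2 p + (b * (q.1 - p.1) + a * (q.2 - p.2)))| <= e * `|q - p|) ->
  (forall e : R, 0 < e -> exists2 d : R, 0 < d & forall q, `|q - p| < d ->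
    `|f1 q - (f1 p + (a' * (q.1 - p.1) - b' * (q.2 - p.2)))| <= e * `|q - p| /\
    `|f2 q - (f2 p + (b' * (q.1 - p.1) + a' * (q.2 - p.2)))| <= e * `|q - p|) ->
  a = a' /\ b = b'.
Proof.
move=> h h'.
have key (e : R) : 0 < e -> `|a - a'| <= 2 * e /\ `|b - b'| <= 2 * e.
  move=> e0; have [d d0 hd] := h e e0; have [d' d0' hd'] := h' e e0.
  pose t := Num.min d d' / 2.
  have t0 : 0 < t by rewrite divr_gt0// lt_min d0.
  have td : t < d /\ t < d'.
    have : Num.min d d' <= d by rewrite ge_min lexx.
    have : Num.min d d' <= d' by rewrite ge_min lexx orbT.
    by rewrite /t; move: (Num.min d d') t0 => x; rewrite /t; lra.
  pose q : P2 := (p.1 + t, p.2).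
  have qp : `|q - p| = t.
    apply/eqP; rewrite eq_le norm_le2 /= addrC addKr subrr normr0 gtr0_norm// lexx ltW//=.
    have := lexx `|q - p|; rewrite {1}norm_le2 => /andP[+ _]; rewrite /= addrC addKr gtr0_norm//.
  have [x1 x2] := hd q (eq_ind_r (fun x => x < d) td.1 qp).
  have [y1 y2] := hd' q (eq_ind_r (fun x => x < d') td.2 qp).
  move: x1 x2 y1 y2; rewrite qp /= (addrC p.1) addrK subrr !mulr0 !subr0 !addr0.
  move: (f1 q) (f2 q) (f1 p) (f2 p) => u v x y x1 x2 y1 y2.
  have A (s s' k l : R) : `|k - (l + s * t)| <= e * t -> `|k - (l + s' * t)| <= e * t -> `|s - s'| <= 2 * e.
    move=> k1 k2; rewrite -(ler_pM2r t0) -{1}(gtr0_norm t0) -normrM.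
    have -> : (s - s') * t = (k - (l + s' * t)) - (k - (l + s * t)) by ring.
    by apply: le_trans (ler_normB _ _) _; lra.
  by split; [exact: A x1 y1|exact: A x2 y2].
have eq (x y : R) : (forall e : R, 0 < e -> `|x - y| <= 2 * e) -> x = y.
  move=> hx; apply/eqP; rewrite -subr_eq0 -normr_le0 leNgt; apply/negP => n0.
  have := hx (`|x - y| / 4); rewrite divr_gt0// => /(_ isT); lra.
by split; apply: eq => e /key[].
Qed.

Definition hol F := CR (re F) (im F).

Lemma entire_hol F : entire F -> hol F.
Proof.
move=> h.
have cd p : cdiff (re F) (im F) p.
  have [d hd] := h (toC p); exists (complex.Re d), (complex.Im d).
  by have := has_cderiv_cdiff hd; rewrite toCK.
by apply: goursat => // p; have [] := cdiff_cont (cd p).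
Qed.

Lemma cderiv_dx F z d : hol F -> has_cderiv F z d -> complex.Re d = dx (re F) (toP z) /\ complex.Im d = dx (im F) (toP z).
Proof. by move=> hF hd; apply: cdiff_unique (has_cderiv_cdiff hd) (CR_cdiff _ hF). Qed.

Lemma hol_entire F : hol F -> entire F.
Proof.
move=> hF z; have hd := CR_cdiff (toP z) hF.
exists (dx (re F) (toP z) +i* dx (im F) (toP z))%C => e e0.
have e2 : 0 < e / 2 by rewrite divr_gt0.
have [r r0 hr] := hd _ e2; exists r; split => // h /andP[h0 hl].
set d := (_ +i* _)%C; pose X := F (z + h) - F z - d * h.
have dr : complex.Re d = dx (re F) (toP z) by [].
have di : complex.Im d = dx (im F) (toP z) by [].
have hn : h != 0 by rewrite -cabs_gt0.
have -> : (F (z + h) - F z) / h - d = X / h by rewrite /X [RHS]mulrBl mulfK.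
have XE : cabs X = cabs (X / h) * cabs h by rewrite -cabsM divfK.
rewrite -(ler_pM2r h0) -XE.
pose q := toP (z + h).
have qz : q - toP z = toP h by rewrite -toP_sub addrC addKr.
have /andP[n1 _] := en_norm (toP h); rewrite -cabsE in n1.
have [|x1 x2] := hr q; first by rewrite qz; exact: le_lt_trans hl.
have q1 : q.1 - (toP z).1 = complex.Re h by have := congr1 fst qz.
have q2 : q.2 - (toP z).2 = complex.Im h by have := congr1 snd qz.
have a1 : (toP X).1 = re F q - (re F (toP z) + (dx (re F) (toP z) * (q.1 - (toP z).1) - dx (im F) (toP z) * (q.2 - (toP z).2))).
  have -> : re F q = complex.Re (F (z + h)) by rewrite /re toPK.
  have -> : re F (toP z) = complex.Re (F z) by rewrite /re toPK.
  rewrite q1 q2 -[LHS]/(complex.Re X) /X !ReImE -dr -di.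
  by move: (complex.Re d) (complex.Im d) (complex.Re h) (complex.Im h) => *; ring.
have a2 : (toP X).2 = im F q - (im F (toP z) + (dx (im F) (toP z) * (q.1 - (toP z).1) + dx (re F) (toP z) * (q.2 - (toP z).2))).
  have -> : im F q = complex.Im (F (z + h)) by rewrite /im toPK.
  have -> : im F (toP z) = complex.Im (F z) by rewrite /im toPK.
  rewrite q1 q2 -[LHS]/(complex.Im X) /X !ReImE -dr -di.
  by move: (complex.Re d) (complex.Im d) (complex.Re h) (complex.Im h) => *; ring.
rewrite -a1 qz in x1; rewrite -a2 qz in x2.
have /andP[_ n2] := en_norm (toP X); rewrite cabsE; apply: le_trans n2 _.
have : `|toP X| <= e / 2 * `|toP h| by rewrite norm_le2 x1 x2.
have : e / 2 * `|toP h| <= e / 2 * cabs h by rewrite ler_pM2l.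
move: `|toP X| `|toP h| (cabs h) => *; lra.
Qed.
End Complex.

(** * The Fock space in real coordinates *)

Section Translation.
Context {R : realType}.
Local Notation C := R[i].
Local Notation P2 := (R * R)%type.
Local Notation L := (@Leb R).
Implicit Types (p q : P2) (z h : C) (F G : C -> C).
Variable phi : C -> R.

Let w p := ex (fun p => - phi (toC p)) p.

Lemma weightE p : weight phi p = w p.
Proof. by rewrite /weight /w /ex mulrN. Qed.

Hypothesis mphi : meas (phi \o toC).

Let mw : meas w. Proof. by apply: meas_ex; exact: meas_opp. Qed.

Let mF F : meas (re F) -> meas (im F) -> meas (fun p => mod2 (re F) (im F) p * w p).
Proof. by move=> m1 m2; apply: measurable_funM; [exact: meas_mod2|exact: mw]. Qed.

Let F_ge0 F p : 0 <= mod2 (re F) (im F) p * w p.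
Proof. by rewrite mulr_ge0 ?(ltW (ex_gt0 _ _))// addr_ge0// sqr_ge0. Qed.

Lemma L2_int F : meas (re F) -> meas (im F) ->
  (\int[@leb2 R]_p ((cabs (F (toC p))) ^+ 2 * weight phi p)%:E = \int[L]_p (mod2 (re F) (im F) p * w p)%:E)%E.
Proof.
move=> m1 m2; have mm : measurable_fun setT (fun p : P2 => (mod2 (re F) (im F) p * w p)%:E).
  by apply/measurable_EFinP; exact: mF.
by rewrite (int_Leb mm); apply: eq_integral => p _; rewrite cabs_sq weightE.
Qed.

Lemma L2_wsq F : L2 phi F <-> wsq (phi \o toC) (re F) (im F).
Proof.
have E m1 m2 := @intg_ge0P _ _ _ L _ (@mF F m1 m2) (F_ge0 F).
split=> [[m1 m2 i]|[m1 m2 i]]; split => //.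
  by apply: (E m1 m2).2; rewrite -L2_int.
by rewrite L2_int//; apply: (E m1 m2).1.
Qed.

Lemma Fock_Fk F : Fock phi F <-> Fk (phi \o toC) (re F) (im F).
Proof.
by split=> [[hF /L2_wsq lF]|[hF wF]]; split => //; [exact: entire_hol|exact: hol_entire|exact/L2_wsq].
Qed.

Lemma L2normE F : wsq (phi \o toC) (re F) (im F) -> L2norm phi F = Num.sqrt (nrm (phi \o toC) (re F) (im F)).
Proof.
move=> [m1 m2 i]; rewrite /L2norm; congr Num.sqrt.
rewrite /nrm -(Leb_I (mF m1 m2)); congr (Rintegral _ _ _); apply/funext => p.
by rewrite cabs_sq weightE.
Qed.

Lemma innerE F G : wsq (phi \o toC) (re F) (im F) -> wsq (phi \o toC) (re G) (im G) ->
  inner phi F G = (ip (phi \o toC) (re F) (im F) (re G) (im G)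
    +i* ip (phi \o toC) (re F) (im F) (fun p => (- im G p)%R) (re G))%C.
Proof.
move=> wF wG; rewrite /inner /cintegral; congr (_ +i* _)%C.
  rewrite /ip -(Leb_I (@intg_meas _ _ _ L _ (ip_intg mphi wF wG))); congr (Rintegral _ _ _); apply/funext => p.
  rewrite weightE !ReImE /re /im /= /w.
  by move: (complex.Re _) (complex.Im _) (complex.Re _) (complex.Im _) (ex _ p) => *; ring.
rewrite /ip -(Leb_I (@intg_meas _ _ _ L _ (ip_intg mphi wF (wsq_rot wG)))); congr (Rintegral _ _ _); apply/funext => p.
rewrite weightE !ReImE /re /im /= /w.
by move: (complex.Re _) (complex.Im _) (complex.Re _) (complex.Im _) (ex _ p) => *; ring.
Qed.
End Translation.

Section Data.
Context {R : realType}.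
Local Notation C := R[i].
Local Notation P2 := (R * R)%type.
Variables (phi : C -> R) (mu : {measure set P2 -> \bar R}) (rho : C -> R).

Lemma fock_data_of (cd : R) : subharmonic phi -> riesz_measure phi mu ->
  (forall z, 0 < rho z /\ mu (disc z (rho z)) = 1%:E) -> 0 < cd ->
  (forall (z : C) (r : R), 0 < r -> (mu (disc z (2 * r)) <= cd%:E * mu (disc z r))%E) ->
  fock_data (phi \o toC) mu (rho \o toC) cd.
Proof.
move=> [usc smv] [fin rz] hrho cd0 dbl; split => //.
- move=> z e e0; have [d [d0 hd]] := usc (toC z) e e0; exists d => // w hw.
  by apply: hd; rewrite cabsE toP_sub !toCK.
- move=> z r r0; have := smv (toC z) r r0; congr (_ <= _)%E; apply: eq_integral => t _.
  by congr (phi _)%:E; rewrite /toC /=; simpc.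
- by move=> p r; rewrite -discE; exact: fin.
- by move=> p r r0; rewrite -!discE; exact: dbl.
- by move=> p; have [] := hrho (toC p).
- by move=> p; rewrite -discE; have [] := hrho (toC p).
Qed.
End Data.

(** * The Hankel operator on the span of the kernels *)

Section Operator.
Context {R : realType}.
Local Notation C := R[i].
Local Notation P2 := (R * R)%type.
Implicit Types (p q : P2) (z h l : C) (F G u : C -> C) (v f : P2 -> R).
Variables (phi : C -> R) (mu : {measure set P2 -> \bar R}) (rho : C -> R) (cd : R).
Hypothesis H : fock_data (phi \o toC) mu (rho \o toC) cd.
Variables (g dg : C -> C).
Hypothesis hg : forall z, has_cderiv g z (dg z).

Let ph := phi \o toC.
Let mphi : meas ph. Proof. exact: fd_meas H. Qed.

Local Notation sqw F := (wsq ph (re F) (im F)).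
Local Notation FF F := (Fk ph (re F) (im F)).
Local Notation N F := (nrm ph (re F) (im F)).

Let cg : hol g. Proof. by apply: entire_hol => z; exists (dg z); exact: hg. Qed.

Lemma dgE z : mod2 (dx (re g)) (dx (im g)) (toP z) = cabs (dg z) ^+ 2.
Proof. by have [e1 e2] := cderiv_dx cg (hg z); rewrite cabs_sq e1 e2. Qed.

Lemma sqw_scale (c : C) F : sqw F -> sqw (fun z => c * F z).
Proof.
(* [c F] as [F + (Re c - 1) F + Im c (i F)], the leading term of [wsqDZ] having coefficient 1. *)
move=> wF; have := wsqDZ mphi (complex.Im c) (wsqDZ mphi (complex.Re c - 1) wF wF) (wsq_rot wF).
congr (wsq _ _ _); apply/funext => p; rewrite /re /im !ReImE.
  by move: (complex.Re c) (complex.Im c) (complex.Re _) (complex.Im _) => *; ring.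
by move: (complex.Re c) (complex.Im c) (complex.Re _) (complex.Im _) => *; ring.
Qed.

Lemma sqw_add F G : sqw F -> sqw G -> sqw (fun z => F z + G z).
Proof.
move=> wF wG; have := wsqDZ mphi 1 wF wG.
by congr (wsq _ _ _); apply/funext => p; rewrite /re /im !ReImE mul1r.
Qed.

Lemma sqw0 : sqw (fun=> 0).
Proof.
split; [exact: measurable_cst|exact: measurable_cst|].
by have := @intg0 _ _ _ (@Leb R); congr (intg _ _); apply/funext => p; rewrite /mod2 expr0n addr0 mul0r.
Qed.

Lemma FF_scale (c : C) F : FF F -> FF (fun z => c * F z).
Proof.
move=> [cF wF]; split; last exact: sqw_scale.
have := CR_mul (CR_cst (complex.Re c) (complex.Im c)) cF.
by congr CR; apply/funext => p; rewrite /re /im !ReImE.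
Qed.

Lemma FF_add F G : FF F -> FF G -> FF (fun z => F z + G z).
Proof.
move=> [cF wF] [cG wG]; split; last exact: sqw_add.
by have := CRD cF cG; congr CR; apply/funext => p; rewrite /re /im !ReImE.
Qed.

Lemma FF0 : FF (fun=> 0).
Proof. by split; [exact: CR_cst|exact: sqw0]. Qed.

Lemma sum_ind (Q : (C -> C) -> Prop) n (F : 'I_n -> C -> C) : Q (fun=> 0) ->
  (forall F G, Q F -> Q G -> Q (fun z => F z + G z)) -> (forall i, Q (F i)) ->
  Q (fun z => \sum_(i < n) F i z).
Proof.
move=> Q0 QD; elim: n F => [|n IH] F QF.
  by have -> : (fun z => \sum_(i < 0) F i z) = (fun=> 0) by apply/funext => z; rewrite big_ord0.
have -> : (fun z => \sum_(i < n.+1) F i z) = (fun z => \sum_(i < n) F (widen_ord (leqnSn n) i) z + F ord_max z).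
  by apply/funext => z; rewrite big_ord_recr.
by apply: QD => //; apply: IH.
Qed.

Lemma conj_re F : re (fun z => (g z)^*%C * F z) = cm1 (re g) (im g) (re F) (im F).
Proof. by apply/funext => p; rewrite /re /im /cm1 !ReImE; move: (complex.Im _) => x; rewrite mulNr opprK. Qed.

Lemma conj_im F : im (fun z => (g z)^*%C * F z) = cm2 (re g) (im g) (re F) (im F).
Proof. by apply/funext => p; rewrite /re /im /cm2 !ReImE mulNr. Qed.

(** Vanishing of the real part for all [v] suffices, since [i v] is also in the Fock space. *)
Lemma projectionP F u : sqw F -> is_Fock_projection phi F u <-> FF u /\
  forall v1 v2, Fk ph v1 v2 -> ip ph (fun p => re F p - re u p) (fun p => im F p - im u p) v1 v2 = 0.
Proof.
move=> wF; have reB : FF u -> [/\ sqw (fun z => F z - u z), re (fun z => F z - u z) = (fun p => re F p - re u p) &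
    im (fun z => F z - u z) = (fun p => im F p - im u p)].
  move=> [_ wu]; have e1 : re (fun z => F z - u z) = (fun p => re F p - re u p).
    by apply/funext => p; rewrite /re !ReImE.
  have e2 : im (fun z => F z - u z) = (fun p => im F p - im u p).
    by apply/funext => p; rewrite /im !ReImE.
  by split => //; rewrite e1 e2; exact: wsqB.
split=> [[/(Fock_Fk mphi) Fu orth]|[Fu orth]]; have [wB e1 e2] := reB Fu.
  split => // v1 v2 Fv.
  have := orth (pairC v1 v2); rewrite (Fock_Fk mphi) re_pairC im_pairC => /(_ Fv).
  rewrite (innerE mphi wB) ?re_pairC ?im_pairC; last by have [] := Fv.
  by rewrite e1 e2 => /(congr1 (@complex.Re _)).
split; first exact/(Fock_Fk mphi).
move=> v /(Fock_Fk mphi) Fv; have [cv wv] := Fv.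
rewrite (innerE mphi wB wv) e1 e2 (orth _ _ Fv) orth//.
by split; [exact: CR_rot|exact: wsq_rot].
Qed.

Variable K : C -> C -> C.
Hypothesis hK : reproducing_kernel phi K.

Let K1 p := re (K^~ (toC p)).
Let K2 p := im (K^~ (toC p)).

Let FK p : Fk ph (K1 p) (K2 p).
Proof. by have [/(Fock_Fk mphi)] := hK (toC p). Qed.

Let rep p f1 f2 : Fk ph f1 f2 -> f1 p = ip ph f1 f2 (K1 p) (K2 p) /\ f2 p = ip ph f1 f2 (fun q => - K2 p q) (K1 p).
Proof.
move=> Ff; have [_ wf] := Ff; have [_ h] := hK (toC p).
have Fp : Fock phi (pairC f1 f2) by apply/(Fock_Fk mphi); rewrite re_pairC im_pairC.
have := h _ Fp; rewrite innerE ?re_pairC ?im_pairC//; last by have [] := FK p.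
by rewrite /pairC toCK => -[].
Qed.

(** Makes the normalization invertible, so that [K_l] itself lies in the span on which
    [hankel_bounded] is tested. *)
Lemma K_diag_neq0 l : K l l != 0.
Proof.
have [_ _ h] := kernel_diag H FK rep (toP l).
apply/eqP => h0; move: h; rewrite /K1 /re toPK h0 /= ltxx//.
Qed.

Lemma kernel_scale l : exists2 c : C, c != 0 & K^~ l = (fun z => c * nkernel K l z).
Proof.
have s0 : sqrtC (K l l) != 0 by rewrite sqrtC_eq0 K_diag_neq0.
by exists (sqrtC (K l l)) => //; apply/funext => z; rewrite mulrC divfK.
Qed.

Hypothesis hL2 : forall l, L2 phi (fun z => (g z)^*%C * nkernel K l z).

Lemma span_FF F : in_kernel_span K F -> FF F /\ sqw (fun z => (g z)^*%C * F z).
Proof.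
move=> [n [c [l ->]]]; split.
  apply: (@sum_ind (fun F => FF F)); [exact: FF0|exact: FF_add|] => i.
  apply: FF_scale; have -> : nkernel K (l i) = (fun z => (sqrtC (K (l i) (l i)))^-1 * K z (l i)).
    by apply/funext => z; rewrite mulrC.
  by apply: FF_scale; have := FK (toP (l i)); rewrite /K1 /K2 toPK.
have -> : (fun z => (g z)^*%C * \sum_(i < n) c i * nkernel K (l i) z) =
    (fun z => \sum_(i < n) c i * ((g z)^*%C * nkernel K (l i) z)).
  by apply/funext => z; rewrite mulr_sumr; apply: eq_bigr => i _; rewrite mulrCA.
apply: (@sum_ind (fun F => sqw F)); [exact: sqw0|exact: sqw_add|] => i.
by apply: sqw_scale; exact/(L2_wsq mphi).
Qed.

Lemma kernel_in_span l : in_kernel_span K (K^~ l).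
Proof.
have [c _ ->] := kernel_scale l; exists 1%N, (fun=> c), (fun=> l).
by apply/funext => z; rewrite big_ord1.
Qed.

Lemma bounded_of_derivative (M : R) : (forall z, cabs (dg z) * rho z <= M) -> hankel_bounded phi K g.
Proof.
move=> hM; have CH0 : 0 <= CH cd.
  apply: divr_ge0; last exact: ltW (cH_gt0 H).
  by apply: mulr_ge0; [exact: ler0n|exact: expR_ge0].
have A0 : 0 <= CH cd * M ^+ 2 by rewrite mulr_ge0// sqr_ge0.
exists (Num.sqrt (CH cd * M ^+ 2)) => F hF u hu.
have [Ff wgF] := span_FF hF.
have [Fu orth] := (projectionP u wgF).1 hu.
have e1 : re (fun z => (g z)^*%C * F z - u z) = (fun p => re (fun z => (g z)^*%C * F z) p - re u p).
  by apply/funext => p; rewrite /re [LHS]ReD ReN.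
have e2 : im (fun z => (g z)^*%C * F z - u z) = (fun p => im (fun z => (g z)^*%C * F z) p - im u p).
  by apply/funext => p; rewrite /im [LHS]ImD ImN.
have wB : sqw (fun z => (g z)^*%C * F z - u z) by rewrite e1 e2; apply: wsqB => //; have [] := Fu.
rewrite (L2normE mphi wB) (L2normE mphi Ff.2) -sqrtrM// ler_wsqrtr// e1 e2.
rewrite conj_re conj_im in orth wgF *.
apply: (hankel_sufficient H cg Ff wgF _ Fu orth) => p.
have p0 : 0 < rho (toC p) by exact: fd_rho0 H p.
rewrite -{1}(toCK p) dgE -exprMn ler_pXn2r ?nnegrE//; first by rewrite mulr_ge0 ?cabs_ge0// ltW.
by apply: le_trans (hM (toC p)); rewrite mulr_ge0 ?cabs_ge0// ltW.
Qed.

Lemma derivative_of_bounded : hankel_bounded phi K g -> exists M : R, forall z, cabs (dg z) * rho z <= M.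
Proof.
(* From [x^2 <= y] follows [x <= y + 1], so no square root has to be taken. *)
move=> [M hM]; exists (2 * CN cd * M ^+ 2 + 1) => z.
have wgK p : wsq ph (cm1 (re g) (im g) (K1 p) (K2 p)) (cm2 (re g) (im g) (K1 p) (K2 p)).
  by have [_] := span_FF (kernel_in_span (toC p)); rewrite conj_re conj_im.
have bnd p (u1 u2 : P2 -> R) : Fk ph u1 u2 ->
  (forall v1 v2, Fk ph v1 v2 -> ip ph (fun q => cm1 (re g) (im g) (K1 p) (K2 p) q - u1 q)
     (fun q => cm2 (re g) (im g) (K1 p) (K2 p) q - u2 q) v1 v2 = 0) ->
  nrm ph (fun q => cm1 (re g) (im g) (K1 p) (K2 p) q - u1 q) (fun q => cm2 (re g) (im g) (K1 p) (K2 p) q - u2 q)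
    <= M ^+ 2 * nrm ph (K1 p) (K2 p).
  move=> Fu orth; pose u := pairC u1 u2; pose F := K^~ (toC p).
  have hF : in_kernel_span K F by exact: kernel_in_span.
  have [Ff wgF] := span_FF hF.
  have hu : is_Fock_projection phi (fun z => (g z)^*%C * F z) u.
    by apply: (projectionP u wgF).2; rewrite conj_re conj_im /u re_pairC im_pairC.
  have e1 : re (fun z => (g z)^*%C * F z - u z) = (fun q => cm1 (re g) (im g) (K1 p) (K2 p) q - u1 q).
    by rewrite -(conj_re F) -[u1](re_pairC u1 u2); apply/funext => q; rewrite /re [LHS]ReD ReN.
  have e2 : im (fun z => (g z)^*%C * F z - u z) = (fun q => cm2 (re g) (im g) (K1 p) (K2 p) q - u2 q).
    by rewrite -(conj_im F) -[u2](im_pairC u1 u2); apply/funext => q; rewrite /im [LHS]ImD ImN.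
  have wB : sqw (fun z => (g z)^*%C * F z - u z) by rewrite e1 e2; apply: wsqB => //; have [] := Fu.
  have := hM F hF u hu; rewrite (L2normE mphi wB) (L2normE mphi Ff.2) e1 e2 => h.
  have s0 := sqrtr_ge0 (nrm ph (fun q => cm1 (re g) (im g) (K1 p) (K2 p) q - u1 q) (fun q => cm2 (re g) (im g) (K1 p) (K2 p) q - u2 q)).
  have : (Num.sqrt (nrm ph (fun q => cm1 (re g) (im g) (K1 p) (K2 p) q - u1 q) (fun q => cm2 (re g) (im g) (K1 p) (K2 p) q - u2 q))) ^+ 2
     <= (M * Num.sqrt (N F)) ^+ 2 by rewrite ler_pXn2r// nnegrE//; exact: le_trans h.
  by rewrite exprMn !sqr_sqrtr ?nrm_ge0.
have := hankel_necessary H cg FK rep wgK bnd (toP z).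
rewrite dgE /= toPK -exprMn.
move: (cabs _ * _) (_ * M ^+ 2) => x y h; have h1 := sqr_ge0 (x - 1).
nra.
Qed.
End Operator.

Theorem theorem3 (R : realType) (phi : R[i] -> R)
  (mu : {measure set (R * R) -> \bar R}) (rho : R[i] -> R)
  (K : R[i] -> R[i] -> R[i]) (g dg : R[i] -> R[i]) :
  subharmonic phi -> ~ is_harmonic phi ->
  riesz_measure phi mu -> doubling mu ->
  (forall z, 0 < rho z /\ mu (disc z (rho z)) = 1%:E) ->
  reproducing_kernel phi K ->
  (forall z, has_cderiv g z (dg z)) ->
  (forall lam, L2 phi (fun z => (g z)^*%C * nkernel K lam z)) ->
  (hankel_bounded phi K g <->
   exists M : R, forall z, cabs (dg z) * rho z <= M).
Proof.
move=> sh _ rz [cd [cd0 dbl]] hrho hK hg hL2.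
have H := fock_data_of sh rz hrho cd0 dbl.
split; last move=> [M hM].
  have necessity := derivative_of_bounded H hg hK hL2; exact: necessity.
have sufficiency := bounded_of_derivative H hg hK hL2 hM; exact: sufficiency.
Qed.
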